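(* Let $\tilde\nu$ be a positive regular Borel measure on $[0,\infty)$ with $\sup_{t>0}\frac{\tilde\nu[0,2t)}{\tilde\nu[0,t)}<\infty$, let $\nu=\tilde\nu\otimes\lambda$, and let $A^2_\nu$ be the corresponding Zen space. Let $b:\mathbb C_+\to\mathbb C$ be analytic, $b\in H^2(\mathbb C_+)$. If the measure $$|b'(z)|^2\,\operatorname{Re}z\;\tilde\nu([0,\operatorname{Re}z))\,dA(z)$$ is a $\nu$-Carleson measure on $\mathbb C_+$, then the little Hankel operator $$A^2_\nu\to\overline{A^2_\nu},\qquad f\mapsto Q_\nu(\bar b f),$$ is bounded, where $Q_\nu$ denotes the orthogonal projection $Q_\nu:L^2(\overline{\mathbb C_+},d\nu)\to\overline{A^2_\nu}$.
   Context: $\mathbb C_+=\{\operatorname{Re}z>0\}$, $dA$ is area measure, $\lambda$ is Lebesgue measure on $\mathbb R$, and $\nu$ is regarded as a measure on $\overline{\mathbb C_+}=[0,\infty)\times\mathbb R$. $H^2(\mathbb C_+)$ is the Hardy space. The Zen space is $$A^2_\nu=\Big\{f:\mathbb C_+\to\mathbb C\text{ analytic}:\ \sup_{\varepsilon>0}\int_{\overline{\mathbb C_+}}|f(z+\varepsilon)|^2\,d\nu(z)<\infty\Big\},\qquad\|f\|_{A^2_\nu}^2=\int_{\overline{\mathbb C_+}}|f|^2\,d\nu,$$ a Hilbert space, regarded as a closed subspace of $L^2(\nu)$ (if $\tilde\nu(\{0\})>0$, values on $i\mathbb R$ are boundary values), and $\overline{A^2_\nu}=\{\bar f:f\in A^2_\nu\}$.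 A positive Borel measure $\mu$ on $\mathbb C_+$ is $\nu$-Carleson if there is $C>0$ with $\int_{\mathbb C_+}|f|^2d\mu\le C\|f\|_{A^2_\nu}^2$ for all $f\in A^2_\nu$; equivalently, $\mu(Q_I)\le C'|I|\,\tilde\nu([0,|I|))$ for all bounded intervals $I\subset i\mathbb R$, where $Q_I=\{x+iy:iy\in I,\ 0<x<|I|\}$. The Hankel operator is understood as a densely defined operator, given by the formula for those $f\in A^2_\nu$ with $\bar b f\in L^2(\nu)$; bounded means $\|Q_\nu(\bar bf)\|\le C\|f\|_{A^2_\nu}$ for all such $f$. *)

(* Defs.v *)
From HB Require Import structures.
From mathcomp Require Import all_boot all_order all_algebra.
From mathcomp Require Import complex.
From mathcomp Require Import all_classical all_reals all_analysis.
Set Implicit Arguments.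
Unset Strict Implicit.
Unset Printing Implicit Defensive.
Import Order.TTheory GRing.Theory Num.Theory.
Import numFieldNormedType.Exports.
Local Open Scope classical_set_scope.
Local Open Scope ring_scope.

(* Measures live on the real plane; the point z = x + iy of C is read off the
   pair (x, y). Functions on C_+ are total functions R[i] -> R[i] of which only
   the values on {Re z > 0} are ever used. *)
Notation plane R := (measurableTypeR R * measurableTypeR R)%type.

Definition cplx (R : realType) (p : plane R) : R[i] := Complex p.1 p.2.

Definition rhp (R : realType) : set (plane R) := [set p | 0 < p.1].

Definition crhp (R : realType) : set (plane R) := [set p | 0 <= p.1].

Definition sqmod (R : realType) (z : R[i]) : R :=
  complex.Re z ^+ 2 + complex.Im z ^+ 2.

(* [R[i]^o] carries the normed topology of the field R[i], so this is complex
   differentiability. *)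
Definition analytic_rhp (R : realType) (f : R[i] -> R[i]) : Prop :=
  forall z : R[i], 0 < complex.Re z -> derivable (f : R[i]^o -> R[i]^o) z 1.

Definition cderive (R : realType) (f : R[i] -> R[i]) (z : R[i]) : R[i] :=
  derive1 (f : R[i]^o -> R[i]^o) z.

Definition hardy2 (R : realType) (f : R[i] -> R[i]) : Prop :=
  analytic_rhp f /\
  (ereal_sup [set \int[@lebesgue_measure R]_y (sqmod (f (Complex x y)))%:E
             | x in [set x : R | (0 < x)%R]] < +oo)%E.

(* Boundary value at iy: the limit of f(x + iy) as x -> 0+. *)
Definition boundary_value (R : realType) (f : R[i] -> R[i]) (y : R) : R[i] :=
  lim ((f (Complex x y) : R[i]^o) @[x --> (0 : R)^'+]).

Definition ext (R : realType) (f : R[i] -> R[i]) (p : plane R) : R[i] :=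
  if 0 < p.1 then f (cplx p) else boundary_value f p.2.

Definition borel_regular (R : realType)
    (m : {measure set (measurableTypeR R) -> \bar R}) : Prop :=
  [/\ forall K : set R, compact K -> (m K < +oo)%E,
      forall A : set (measurableTypeR R), measurable A ->
        m A = ereal_inf [set m U | U in [set U : set R | open U /\ A `<=` U]] &
      forall A : set (measurableTypeR R), measurable A ->
        m A = ereal_sup [set m K | K in [set K : set R | compact K /\ K `<=` A]]].

(* The first clause is what makes the ratios meaningful. *)
Definition doubling (R : realType)
    (m : {measure set (measurableTypeR R) -> \bar R}) : Prop :=
  (forall t : R, 0 < t -> (0 < m `[0%R, t[%classic < +oo)%E) /\
  (ereal_sup [set (fine (m `[0%R, 2 * t[%classic) /
                   fine (m `[0%R, t[%classic))%:E
             | t in [set t : R | (0 < t)%R]] < +oo)%E.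

(* A Borel measure on [0, +oo[ is a Borel measure on R that does not charge
   the negative half-line. *)
Definition zen_weight (R : realType)
    (m : {measure set (measurableTypeR R) -> \bar R}) : Prop :=
  [/\ m `]-oo, 0%R[%classic = 0%E, borel_regular m & doubling m].

Section Zen.
Variables (R : realType) (m : {measure set (measurableTypeR R) -> \bar R}).

Local Notation nu := (m \x @lebesgue_measure R)%E.

Definition sqnorm (g : plane R -> R[i]) : \bar R :=
  \int[nu]_(p in @crhp R) (sqmod (g p))%:E.

(* \bar R-valued, so that an infinite norm is never read as 0. *)
Definition L2norm (g : plane R -> R[i]) : \bar R := (sqnorm g `^ 2^-1)%E.

Definition L2 (g : plane R -> R[i]) : Prop :=
  [/\ measurable_fun (@crhp R) (fun p => complex.Re (g p) : measurableTypeR R),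
      measurable_fun (@crhp R) (fun p => complex.Im (g p) : measurableTypeR R) &
      (sqnorm g < +oo)%E].

Definition inner (g h : plane R -> R[i]) : R[i] :=
  Complex (\int[nu]_(p in @crhp R) complex.Re (g p * conjc (h p)))%R
          (\int[nu]_(p in @crhp R) complex.Im (g p * conjc (h p)))%R.

Definition zen (f : R[i] -> R[i]) : Prop :=
  analytic_rhp f /\
  (ereal_sup [set \int[nu]_(p in @crhp R) (sqmod (f (cplx p + (Complex e 0))))%:E
             | e in [set e : R | (0 < e)%R]] < +oo)%E.

Definition conj_zen : set (plane R -> R[i]) :=
  [set h | exists2 f, zen f & h = (fun p => conjc (ext f p))].

(* h represents the orthogonal projection of g : L2 onto the subspace M; it is
   unique up to nu-a.e. equality. *)
Definition is_orth_proj (M : set (plane R -> R[i])) (g h : plane R -> R[i]) :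
    Prop :=
  M h /\ forall k, M k -> inner (fun p => g p - h p) k = 0.

Definition carleson (mu : {measure set (plane R) -> \bar R}) : Prop :=
  exists2 C : R, 0 < C & forall f, zen f ->
    (\int[mu]_(p in @rhp R) (sqmod (f (cplx p)))%:E <= C%:E * sqnorm (ext f))%E.

Definition conj_symbol_mul (b f : R[i] -> R[i]) (p : plane R) : R[i] :=
  conjc (ext b p) * ext f p.

(* Boundedness of f |-> Q_nu (conj b * f), Q_nu the orthogonal projection onto
   conj_zen; existence of the projection is part of the assertion. *)
Definition little_hankel_bounded (b : R[i] -> R[i]) : Prop :=
  exists2 C : R, 0 < C & forall f, zen f -> L2 (conj_symbol_mul b f) ->
    exists2 h, is_orth_proj conj_zen (conj_symbol_mul b f) h &
      (L2norm h <= C%:E * L2norm (ext f))%E.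

(* mu is the measure |b'(z)|^2 Re z m([0, Re z)) dA(z) on C_+. *)
Definition has_hankel_density (b : R[i] -> R[i])
    (mu : {measure set (plane R) -> \bar R}) : Prop :=
  forall A : set (plane R), measurable A ->
    mu A = (\int[@lebesgue_measure R \x @lebesgue_measure R]_(p in A `&` @rhp R)
              ((sqmod (cderive b (cplx p)) * p.1)%:E * m `[0%R, p.1[%classic))%E.

End Zen.

(* Main.v *)
(** The pairing of f on the line Re z = x with g on the line Re z = x' depends
    only on x + x', by Cauchy's theorem applied to f(z) conj(g(c - conj z)). Hence
    phi(x) = Re of the integral of f conj g over Re z = x satisfies phi'' = 4 psi,
    where psi is the same expression for f' and g', and Taylor's formula from
    infinity expresses phi(x) as the integral of 4 (s - x) psi(s) over s > x; for
    g = f it yields a Littlewood-Paley inequality. Integrating in x against the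
    weight turns (s - x) into a factor that is at most s m[0,s) and, by doubling,
    at least a multiple of it.

    For the pair (f g, b) this bounds the Hankel form, the integral of
    conj(b) f g, by the integral of 4 |b'| |(f g)'| s m[0,s). The product rule,
    |uv| <= (t |u|^2 + |v|^2 / t) / 2, the Carleson hypothesis and the
    Littlewood-Paley inequality bound it by K (t |f|^2 + |g|^2 / t). The projection
    exists because the Zen space is complete, and its norm is estimated by taking
    for g the projection itself.

    When m has an atom at 0, Zen functions lie in H^2 and their radial limits are
    needed. Vertical energies are nonincreasing; applied to f(z) / (z + x0 - i y0)
    this dominates |f(x0 + i y0)|^2 by a Poisson average of |f|^2 on a line close
    to the axis, and the Hardy-Littlewood maximal inequality gives convergence
    almost everywhere. *)

Require Import Defs.
From HB Require Import structures.
From mathcomp Require Import all_boot all_order all_algebra.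
From mathcomp Require Import complex.
From mathcomp Require Import all_classical all_reals all_analysis.
From mathcomp Require Import measurable_realfun.
From mathcomp Require Import ring lra.
Import Order.TTheory GRing.Theory Num.Theory.
Import numFieldNormedType.Exports.
Import Normc.
Set Implicit Arguments.
Unset Strict Implicit.
Unset Printing Implicit Defensive.
Local Open Scope classical_set_scope.
Local Open Scope ring_scope.

(** * Complex differentiation *)

Section ComplexCalculus.
Variable R : realType.
Implicit Types (f g : R[i] -> R[i]) (z w c h : R[i]).
Local Notation C := (R[i]).

(** A Zen function is controlled at first only on average: no vertical line is known to carry finite
    energy, so Cauchy's theorem cannot be used on whole lines. The way in is that m[0,d) > 0 for
    every d. Integrating the defining bound over the shifts and exchanging integrals bounds the
    energy over windows of abscissas; two good lines symmetric about a given one then bound it by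
    midpoint convexity, and a convex function bounded on [d, +oo[ is nonincreasing. The later
    estimates rest on this. The factor 4 is 2 squared: moving both lines by h amounts to moving one
    of them by 2 h. For f paired with itself the terms at infinity have a favourable sign. For f g
    against b they must tend to 0: one factor is square-integrable on lines and the squared modulus
    of the other is O(1/x), which suffices. The parameter t stands in for the Cauchy-Schwarz
    inequality because a bound linear in the energies can be integrated in s term by term. It is
    fixed only at the end, where it gives the squared norm of the projection the coefficient 1/2, so
    that this term is absorbed. *)

Lemma normcE_sqmod z : normc z = Num.sqrt (sqmod z).
Proof. by case: z. Qed.

Lemma sqmodE z : sqmod z = normc z ^+ 2.
Proof. by rewrite normcE_sqmod sqr_sqrtr// addr_ge0 ?sqr_ge0. Qed.

Lemma normc_ge0 z : 0 <= normc z.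
Proof. by rewrite normcE_sqmod sqrtr_ge0. Qed.

Lemma sqmod_ge0 z : 0 <= sqmod z.
Proof. by rewrite addr_ge0 ?sqr_ge0. Qed.

Lemma normcC z : `|z| = (normc z)%:C%C.
Proof. by case: z. Qed.

Lemma normc_Re z : `|complex.Re z| <= normc z.
Proof.
rewrite normcE_sqmod -sqrtr_sqr ler_sqrt ?addr_ge0 ?sqr_ge0//.
by rewrite lerDl sqr_ge0.
Qed.

Lemma normc_Im z : `|complex.Im z| <= normc z.
Proof.
rewrite normcE_sqmod -sqrtr_sqr ler_sqrt ?addr_ge0 ?sqr_ge0//.
by rewrite lerDr sqr_ge0.
Qed.

Lemma normc_le_ReIm z : normc z <= `|complex.Re z| + `|complex.Im z|.
Proof.
rewrite -(@ler_pXn2r _ 2)// ?nnegrE ?normc_ge0 ?addr_ge0// -sqmodE /sqmod.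
rewrite sqrrD !real_normK ?num_real//.
have := mulr_ge0 (normr_ge0 (complex.Re z)) (normr_ge0 (complex.Im z)).
by nra.
Qed.

Lemma normc_eq0 z : (normc z == 0) = (z == 0).
Proof. by apply/eqP/eqP => [/eq0_normc //|->]; rewrite normc0. Qed.

Lemma normc_gt0 z : (0 < normc z) = (z != 0).
Proof. by rewrite lt_neqAle normc_ge0 andbT eq_sym normc_eq0. Qed.

Lemma normcB z w : normc (z - w) = normc (w - z).
Proof. by rewrite -normcN opprB. Qed.

Lemma normc_real (x : R) : normc (Complex x 0) = `|x|.
Proof. by rewrite /normc/= expr0n addr0 sqrtr_sqr. Qed.

Lemma normc_imag (x : R) : normc (Complex 0 x) = `|x|.
Proof. by rewrite /normc/= expr0n add0r sqrtr_sqr. Qed.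

Lemma conjc_normc z : normc (conjc z) = normc z.
Proof. by case: z => a b; rewrite /= sqrrN. Qed.

Lemma sqmodM z w : sqmod (z * w) = sqmod z * sqmod w.
Proof. by rewrite !sqmodE normcM exprMn. Qed.

Lemma cReD z w : complex.Re (z + w) = complex.Re z + complex.Re w.
Proof. by case: z; case: w. Qed.
Lemma cImD z w : complex.Im (z + w) = complex.Im z + complex.Im w.
Proof. by case: z; case: w. Qed.
Lemma cReN z : complex.Re (- z) = - complex.Re z.
Proof. by case: z. Qed.
Lemma cImN z : complex.Im (- z) = - complex.Im z.
Proof. by case: z. Qed.
Lemma cReM z w : complex.Re (z * w) =
  complex.Re z * complex.Re w - complex.Im z * complex.Im w.
Proof. by case: z; case: w. Qed.
Lemma cImM z w : complex.Im (z * w) =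
  complex.Re z * complex.Im w + complex.Im z * complex.Re w.
Proof. by case: z; case: w. Qed.
Lemma cReJ z : complex.Re (conjc z) = complex.Re z.
Proof. by case: z. Qed.
Lemma cImJ z : complex.Im (conjc z) = - complex.Im z.
Proof. by case: z. Qed.

Definition reimE := (cReD, cImD, cReN, cImN, cReM, cImM, cReJ, cImJ).

Lemma complex_ext z w :
  complex.Re z = complex.Re w -> complex.Im z = complex.Im w -> z = w.
Proof. by case: z; case: w => a b c d /= -> ->. Qed.

Lemma difference_quotientE f z c h : h != 0 ->
  c - (h^-1 *: (f (h + z) - f z) : C^o) = - (h^-1 * (f (z + h) - f z - c * h)).
Proof.
move=> h0; have -> : (h^-1 *: (f (h + z) - f z) : C^o) =
  h^-1 * (f (z + h) - f z) by rewrite [h + z]addrC.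
by rewrite [in RHS]mulrBr [h^-1 * (c * h)]mulrCA mulVf// mulr1 opprB.
Qed.

(** Frechet form with real constants: nothing is divided by [h] and [h = 0] is allowed, so the rules
    of calculus become inequalities between real numbers without case distinctions. *)
Definition has_cderiv f z c := forall e : R, 0 < e -> exists2 d : R, 0 < d &
  forall h, normc h < d -> normc (f (z + h) - f z - c * h) <= e * normc h.

Lemma has_cderiv_cvg f z c : has_cderiv f z c ->
  (h^-1 *: ((f : C^o -> C^o) (h%:A + z) - (f : C^o -> C^o) z))
    @[h --> (0 : (C : numFieldType))^'] --> (c : C^o).
Proof.
(* In the partially ordered field [R[i]], [0 < e] says that [e] is real and positive, which turns
   the complex radii of the filter into real ones. *)
move=> fc; apply/cvgrPdist_le => e; rewrite ltcE => /andP[/eqP/= e0 er].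
have [d d0 H] := fc _ er.
have dC : (0 : C) < d%:C%C by rewrite ltcR.
exists (d%:C%C) => //= h; rewrite /ball/= sub0r normrN normcC ltcR => hd h0.
have := H _ hd.
have hA : h%:A = h by exact: mulr1.
rewrite hA.
rewrite (difference_quotientE _ _ _ h0).
have -> : e = (complex.Re e)%:C%C by apply: complex_ext.
rewrite normrN normcC lecR normcM normcV ler_pdivrMl ?normc_gt0// [normc h * _]mulrC.
by []. Qed.

Lemma derivable_has_cderiv f z : derivable (f : C^o -> C^o) z 1 ->
  has_cderiv f z (cderive f z).
Proof.
rewrite /cderive derive1E /derivable /derive.
set c := lim _ => fc e e0.
have eC : (0 : C) < e%:C%C by rewrite ltcR.
move/cvgrPdist_le : (fc) => /(_ _ eC)[/= d d0 H].
have dr : complex.Im d = 0 /\ 0 < complex.Re d.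
  by move: d0; rewrite /= ltcE => /andP[/eqP ->].
exists (complex.Re d); first by case: dr.
move=> h hd; have [->|h0] := eqVneq h 0.
  by rewrite mulr0 subr0 addr0 subrr normc0 mulr0.
have := H h; rewrite /ball/= sub0r normrN.
have -> : d = (complex.Re d)%:C%C by apply: complex_ext; case: dr.
rewrite normcC ltcR => /(_ hd h0).
have hA : h%:A = h by exact: mulr1.
rewrite hA.
rewrite (difference_quotientE _ _ _ h0).
by rewrite normrN normcC lecR normcM normcV ler_pdivrMl ?normc_gt0// [normc h * _]mulrC.
Qed.

Lemma has_cderiv_unique f z c c' :
  has_cderiv f z c -> has_cderiv f z c' -> c = c'.
Proof.
move=> fc fc'; apply/eqP; rewrite -subr_eq0 -normc_eq0 eq_le normc_ge0 andbT.
apply/ler_addgt0Pr => e e0; rewrite add0r.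
have e20 : 0 < e / 2 by rewrite divr_gt0.
have [d d0 H] := fc _ e20; have [d' d'0 H'] := fc' _ e20.
pose t := Num.min d d' / 2; have t0 : 0 < t by rewrite divr_gt0// lt_min d0.
pose h : C := Complex t 0.
have hE : normc h = t by rewrite normc_real gtr0_norm.
have := H h; have := H' h.
have /andP[td td'] : (t < d) && (t < d').
  by rewrite -lt_min /t ltr_pdivrMr// ltr_pMr ?lt_min ?d0// ltr1n.
rewrite hE => /(_ td') h1 /(_ td) h2.
have := le_normcD (f (z + h) - f z - c' * h) (- (f (z + h) - f z - c * h)).
rewrite normcN.
have -> : f (z + h) - f z - c' * h - (f (z + h) - f z - c * h) = (c - c') * h.
  by ring.
rewrite normcM hE => h3.
rewrite -(ler_pM2r t0); lra.
Qed.

Lemma has_cderiv_derivable f z c : has_cderiv f z c ->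
  derivable (f : C^o -> C^o) z 1 /\ cderive f z = c.
Proof.
move=> fc; have D : derivable (f : C^o -> C^o) z 1.
  by apply/cvg_ex; exists c; exact: has_cderiv_cvg.
by split=> //; apply: has_cderiv_unique fc; exact: derivable_has_cderiv.
Qed.

Lemma analytic_has_cderiv f : analytic_rhp f <->
  forall z, 0 < complex.Re z -> has_cderiv f z (cderive f z).
Proof.
split=> H z z0; first exact/derivable_has_cderiv/H.
by have [] := has_cderiv_derivable (H _ z0).
Qed.

Lemma cderiveP f z c : has_cderiv f z c -> cderive f z = c.
Proof. by move=> /has_cderiv_derivable[]. Qed.

Lemma cvg_ray f (y : R) (l : C) : (forall e : R, 0 < e -> exists2 d : R, 0 < d &
    forall x, 0 < x < d -> normc (f (Complex x y) - l) <= e) <->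
  (f (Complex x y) : C^o) @[x --> (0 : R)^'+] --> (l : C^o).
Proof.
split=> [H|/cvgrPdist_le H e e0].
  apply/cvgrPdist_le => e; rewrite ltcE => /andP[/eqP/= e0 er].
  have [d d0 {}H] := H _ er.
  near=> x.
  rewrite distrC.
  have -> : e = (complex.Re e)%:C%C by apply: complex_ext.
  rewrite normcC lecR; apply: H; apply/andP; split => //.
have eC : (0 : C) < e%:C%C by rewrite ltcR.
have [d /= d0 {}H] := H _ eC.
exists d => // x /andP[x0 xd].
have := H x; rewrite /ball/= sub0r normrN gtr0_norm// => /(_ xd x0).
by rewrite distrC normcC lecR.
Unshelve. all: by end_near. Qed.

Lemma boundary_valueP f (y : R) (l : C) : (forall e : R, 0 < e -> exists2 d : R, 0 < d &
    forall x, 0 < x < d -> normc (f (Complex x y) - l) <= e) ->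
  boundary_value f y = l.
Proof. by move=> /cvg_ray H; exact: (cvg_lim (@norm_hausdorff _ (C^o)) H). Qed.

End ComplexCalculus.

(** * Rules of complex differentiation *)

Section ComplexRules.
Variable R : realType.
Local Notation C := (R[i]).
Implicit Types (f g p q : C -> C) (z w a b c h : C).

(** As [h = 0] is not excluded, [p 0 = a] is forced: this is continuity at 0 with a prescribed
    value. *)
Definition tends p a := forall e : R, 0 < e -> exists2 d : R, 0 < d &
  forall h, normc h < d -> normc (p h - a) <= e.

Lemma tends_cst a : tends (fun=> a) a.
Proof. by move=> e e0; exists 1 => // h _; rewrite subrr normc0 ltW. Qed.

Lemma tends_shift a : tends (fun h => a + h) a.
Proof.
by move=> e e0; exists e => // h he; rewrite [a + h]addrC addrK ltW.
Qed.

Lemma tendsD p q a b : tends p a -> tends q b ->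
  tends (fun h => p h + q h) (a + b).
Proof.
move=> pa qb e e0; have e20 : 0 < e / 2 by rewrite divr_gt0.
have [d d0 H] := pa _ e20; have [d' d'0 H'] := qb _ e20.
exists (Num.min d d'); first by rewrite lt_min d0.
move=> h; rewrite lt_min => /andP[/H h1 /H' h2].
rewrite opprD addrACA; apply: le_trans (le_normcD _ _) _.
by rewrite [e]splitr lerD.
Qed.

Lemma tendsM p q a b : tends p a -> tends q b ->
  tends (fun h => p h * q h) (a * b).
Proof.
move=> pa qb e e0.
pose k := normc a + normc b + 1.
have k0 : 0 < k by rewrite ltr_wpDl// addr_ge0 ?normc_ge0.
pose e' := Num.min 1 (e / (2 * k)).
have e'0 : 0 < e' by rewrite lt_min ltr01/= divr_gt0// mulr_gt0.
have [d d0 H] := pa _ e'0; have [d' d'0 H'] := qb _ e'0.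
exists (Num.min d d'); first by rewrite lt_min d0.
move=> h; rewrite lt_min => /andP[/H h1 /H' h2].
have -> : p h * q h - a * b = (p h - a) * q h + a * (q h - b) by ring.
apply: le_trans (le_normcD _ _) _; rewrite !normcM.
have h3 : normc (q h) <= normc b + 1.
  rewrite -[q h](subrK b); apply: le_trans (le_normcD _ _) _.
  rewrite addrC lerD2l; apply: le_trans h2 _.
  by rewrite ge_min lexx.
have h4 : e' * k <= e / 2.
  rewrite -ler_pdivlMr//; apply: (@le_trans _ _ (e / (2 * k))).
    by rewrite ge_min lexx orbT.
  by rewrite invfM mulrA.
have h5 : normc (p h - a) * normc (q h) <= e' * (normc b + 1).
  by rewrite ler_pM ?normc_ge0.
have h6 : normc a * normc (q h - b) <= normc a * e'.
  by rewrite ler_wpM2l ?normc_ge0.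
have : e' * k = e' * (normc b + 1) + normc a * e' by rewrite /k; ring.
lra.
Qed.

Lemma tendsV p a : a != 0 -> tends p a -> tends (fun h => (p h)^-1) a^-1.
Proof.
move=> a0 pa e e0.
have na : 0 < normc a by rewrite normc_gt0.
pose e' := Num.min (normc a / 2) (e * normc a ^+ 2 / 2).
have e'0 : 0 < e' by rewrite lt_min !divr_gt0// mulr_gt0// exprn_gt0.
have [d d0 H] := pa _ e'0; exists d => // h /H h1.
have h2 : normc (p h - a) <= normc a / 2.
  by apply: le_trans h1 _; rewrite ge_min lexx.
have h3 : normc (p h - a) <= e * normc a ^+ 2 / 2.
  by apply: le_trans h1 _; rewrite ge_min lexx orbT.
have h4 : normc a / 2 <= normc (p h).
  have := le_normcD (p h) (a - p h); rewrite addrC subrK normcB; lra.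
have p0 : p h != 0.
  by rewrite -normc_gt0; apply: lt_le_trans h4; rewrite divr_gt0.
have -> : (p h)^-1 - a^-1 = (a - p h) * (p h)^-1 * a^-1.
  by field; rewrite ?p0 ?a0.
rewrite !normcM !normcV normcB -mulrA -invfM ler_pdivrMr; last first.
  by rewrite mulr_gt0// normc_gt0.
apply: le_trans h3 _; have := mulr_gt0 e0 na; nra.
Qed.

Lemma tends_comp p q a : q 0 = 0 -> tends q 0 -> tends p a ->
  tends (fun h => p (q h)) a.
Proof.
move=> q0 tq tp e e0; have [d d0 H] := tp _ e0.
have d20 : 0 < d / 2 by rewrite divr_gt0.
have [d' d'0 H'] := tq _ d20; exists d' => // h /H'; rewrite subr0 => h1.
by apply: H; apply: le_lt_trans h1 _; rewrite ltr_pdivrMr// ltr_pMr// ltr1n.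
Qed.

(** Caratheodory's slope: the difference quotient, completed by the value [c] at 0, is continuous
    there. The product and chain rules then reduce to identities between slopes. *)
Lemma has_cderivP f z c : has_cderiv f z c <->
  exists2 p, forall h, f (z + h) = f z + p h * h & tends p c.
Proof.
split=> [fc|[p fE tp] e e0]; last first.
  have [d d0 H] := tp _ e0; exists d => // h /H h1.
  by rewrite fE [_ + _ * _]addrC addrK -mulrBl normcM ler_wpM2r ?normc_ge0.
exists (fun h => if h == 0 then c else (f (z + h) - f z) / h) => [h|e e0].
  case: eqVneq => [->|h0]; first by rewrite mulr0 !addr0.
  by rewrite divfK// addrCA subrr addr0.
have [d d0 H] := fc _ e0; exists d => // h hd.
case: eqVneq => [_|h0]; first by rewrite subrr normc0 ltW.
rewrite -[X in _ - X](mulfK h0) -mulrBl normcM normcV ler_pdivrMr ?normc_gt0//.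
exact: H.
Qed.

Lemma has_cderiv_tends f z c : has_cderiv f z c ->
  tends (fun h => f (z + h)) (f z).
Proof.
move=> /has_cderivP[p fE tp].
have -> : (fun h => f (z + h)) = (fun h => f z + p h * (0 + h)).
  by apply/funext => h; rewrite add0r fE.
rewrite -[X in tends _ X](addr0 (f z)) -[X in _ + X](mulr0 c).
apply: tendsD (tends_cst _) _; apply: tendsM tp _; exact: tends_shift.
Qed.

Lemma has_cderiv_cst a z : has_cderiv (fun=> a) z 0.
Proof.
apply/has_cderivP; exists (fun=> 0); last exact: tends_cst.
by move=> h; rewrite mul0r addr0.
Qed.

Lemma has_cderiv_id z : has_cderiv id z 1.
Proof.
apply/has_cderivP; exists (fun=> 1); last exact: tends_cst.
by move=> h; rewrite mul1r.
Qed.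

Lemma has_cderivD f g z a b : has_cderiv f z a -> has_cderiv g z b ->
  has_cderiv (fun w => f w + g w) z (a + b).
Proof.
move=> /has_cderivP[p fE tp] /has_cderivP[q gE tq]; apply/has_cderivP.
exists (fun h => p h + q h); last exact: tendsD.
by move=> h; rewrite fE gE; ring.
Qed.

Lemma has_cderivM f g z a b : has_cderiv f z a -> has_cderiv g z b ->
  has_cderiv (fun w => f w * g w) z (a * g z + f z * b).
Proof.
move=> /has_cderivP[p fE tp] dg; have tg := has_cderiv_tends dg.
move/has_cderivP : dg => [q gE tq]; apply/has_cderivP.
exists (fun h => p h * g (z + h) + f z * q h).
  by move=> h; rewrite fE gE; ring.
apply: tendsD; first exact: tendsM.
by apply: tendsM => //; exact: tends_cst.
Qed.

Lemma has_cderivZ f z a b : has_cderiv f z a ->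
  has_cderiv (fun w => b * f w) z (b * a).
Proof.
move=> fa; rewrite -[b * a]add0r -(mul0r (f z)).
by apply: has_cderivM => //; exact: has_cderiv_cst.
Qed.

Lemma has_cderivN f z a : has_cderiv f z a -> has_cderiv (fun w => - f w) z (- a).
Proof.
move=> fa; rewrite -mulN1r.
rewrite (_ : (fun w => - f w) = (fun w => -1 * f w)); first exact: has_cderivZ.
by apply/funext => w; rewrite mulN1r.
Qed.

Lemma has_cderivB f g z a b : has_cderiv f z a -> has_cderiv g z b ->
  has_cderiv (fun w => f w - g w) z (a - b).
Proof. by move=> fa gb; apply: has_cderivD => //; exact: has_cderivN. Qed.

Lemma has_cderiv_comp f g z a b : has_cderiv g z b -> has_cderiv f (g z) a ->
  has_cderiv (fun w => f (g w)) z (a * b).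
Proof.
move=> /has_cderivP[q gE tq] /has_cderivP[p fE tp]; apply/has_cderivP.
exists (fun h => p (q h * h) * q h).
  by move=> h; rewrite gE fE mulrA.
apply: tendsM => //; apply: (@tends_comp p (fun h => q h * h)) => //.
  by rewrite mulr0.
rewrite -(mulr0 b); apply: tendsM => //.
have := @tends_shift 0; rewrite (_ : (fun h => 0 + h) = id)//.
by apply/funext => h; rewrite add0r.
Qed.

Lemma has_cderivV z : z != 0 -> has_cderiv (fun w => w^-1) z (- z ^- 2).
Proof.
move=> z0; move=> e e0.
have : tends (fun h => (z + h)^-1) z^-1 by apply: tendsV => //; exact: tends_shift.
move=> tV; have tM : tends (fun h => - z^-1 * (z + h)^-1) (- z^-1 * z^-1).
  by apply: tendsM => //; exact: tends_cst.
have [d d0 H] := tM _ e0.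
exists (Num.min d (normc z)); first by rewrite lt_min d0 normc_gt0.
move=> h; rewrite lt_min => /andP[hd hz].
have zh : z + h != 0.
  apply/eqP => /eqP; rewrite addr_eq0 => /eqP zE.
  by move: hz; rewrite zE normcN ltxx.
have -> : (z + h)^-1 - z^-1 - - z ^- 2 * h =
    (- z^-1 * (z + h)^-1 - - z^-1 * z^-1) * h.
  by field; rewrite ?zh ?z0.
by rewrite normcM ler_wpM2r ?normc_ge0// H.
Qed.

(** The two conjugations cancel, so the result is holomorphic again. For real [b] its value at x + i
    y is the conjugate of [f] at (b - x) + i y; this is how a conjugated factor enters Cauchy's
    theorem. *)
Lemma has_cderiv_reflect f z a b : has_cderiv f (b - conjc z) a ->
  has_cderiv (fun w => conjc (f (b - conjc w))) z (- conjc a).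
Proof.
move=> fa e e0; have [d d0 H] := fa _ e0; exists d => // h hd.
have := H (- conjc h); rewrite normcN conjc_normc => /(_ hd).
rewrite -conjc_normc.
have -> : b - conjc (z + h) = b - conjc z - conjc h.
  by apply: complex_ext; rewrite !reimE; ring.
congr (_ <= _); congr normc.
by apply: complex_ext; rewrite !reimE; ring.
Qed.

End ComplexRules.

(** * Integrals of continuous functions over segments *)

Section IntervalIntegral.
Variable R : realType.
Implicit Types (f g : R -> R) (a b c : R).
Local Notation mu := (@lebesgue_measure R).

(** Two-sided continuity, also at the end points: it restricts to subsegments at once, and the
    functions considered are defined beyond the segment. *)
Definition ictn f a b := forall x, a <= x <= b -> {for x, continuous f}.

Definition rint f a b : R := \int[mu]_(x in `[a, b]) f x.

Lemma ictn_within f a b : ictn f a b -> {within `[a, b], continuous f}.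
Proof.
move=> cf; apply: continuous_in_subspaceT => x; rewrite inE/= in_itv/=.
exact: cf.
Qed.

Lemma ictn_integrable f a b : ictn f a b ->
  mu.-integrable `[a, b] (EFin \o f).
Proof.
move=> cf; apply: continuous_compact_integrable; first exact: segment_compact.
exact: ictn_within.
Qed.

Lemma ictnS f a b c d : a <= c -> d <= b -> ictn f a b -> ictn f c d.
Proof.
by move=> ac db cf x /andP[cx xd]; apply: cf; rewrite (le_trans ac)// (le_trans xd).
Qed.

Lemma ictnB f g a b : ictn f a b -> ictn g a b -> ictn (fun x => f x - g x) a b.
Proof. by move=> cf cg x xab; apply: continuousB; [exact: cf|exact: cg]. Qed.

Lemma ictnD f g a b : ictn f a b -> ictn g a b -> ictn (fun x => f x + g x) a b.
Proof. by move=> cf cg x xab; apply: continuousD; [exact: cf|exact: cg]. Qed.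

Lemma ictnM f g a b : ictn f a b -> ictn g a b -> ictn (fun x => f x * g x) a b.
Proof. by move=> cf cg x xab; apply: continuousM; [exact: cf|exact: cg]. Qed.

Lemma ictn_cst k a b : ictn (fun=> k) a b.
Proof. by move=> x _; exact: cst_continuous. Qed.

Lemma ictnP f a b : ictn f a b <-> forall x, a <= x <= b ->
  forall e, 0 < e -> exists2 d, 0 < d & forall y, `|y - x| < d -> `|f y - f x| <= e.
Proof.
split=> [cf x xab e e0|H x /H{}H].
  have := cf _ xab; move=> /cvgrPdist_le /(_ _ e0)[d /= d0 {}H].
  exists d => // y yx; rewrite distrC; apply: H.
  by rewrite /ball/= distrC.
apply/cvgrPdist_le => e /H[d d0 {}H]; exists d => // y; rewrite /ball/= => yx.
by rewrite distrC H// distrC.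
Qed.

Lemma rintB f g a b : ictn f a b -> ictn g a b ->
  rint (fun x => f x - g x) a b = rint f a b - rint g a b.
Proof.
by move=> cf cg; rewrite /rint RintegralB//; exact: ictn_integrable.
Qed.

Lemma rintD f g a b : ictn f a b -> ictn g a b ->
  rint (fun x => f x + g x) a b = rint f a b + rint g a b.
Proof.
by move=> cf cg; rewrite /rint RintegralD//; exact: ictn_integrable.
Qed.

Lemma rintZ f k a b : ictn f a b -> rint (fun x => k * f x) a b = k * rint f a b.
Proof. by move=> cf; rewrite /rint RintegralZl//; exact: ictn_integrable. Qed.

Lemma rint_cst k a b : a <= b -> rint (fun=> k) a b = k * (b - a).
Proof.
move=> ab; rewrite /rint Rintegral_cst//= lebesgue_measure_itv/= lte_fin.
have [//|ba] := ltP a b.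
have -> : a = b by apply/le_anti; rewrite ab ba.
by rewrite subrr.
Qed.

Lemma eq_rint f g a b : (forall x, a <= x <= b -> f x = g x) ->
  rint f a b = rint g a b.
Proof.
by move=> fg; apply: eq_Rintegral => x; rewrite inE/= in_itv/=; exact: fg.
Qed.

Lemma rint_le f g a b : ictn f a b -> ictn g a b ->
  (forall x, a <= x <= b -> f x <= g x) -> rint f a b <= rint g a b.
Proof.
move=> cf cg fg; apply: (le_Rintegral _ (ictn_integrable cf) (ictn_integrable cg)) => //.
Qed.

Lemma rint_bound f k a b : a <= b -> ictn f a b ->
  (forall x, a <= x <= b -> `|f x| <= k) -> `|rint f a b| <= k * (b - a).
Proof.
move=> ab cf fk; rewrite ler_norml -mulNr -!rint_cst//.
apply/andP; split; apply: rint_le => //; try exact: ictn_cst;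
  by move=> x /fk; rewrite ler_norml => /andP[].
Qed.

Lemma rint_split f a b c : a <= c -> c <= b -> ictn f a b ->
  rint f a b = rint f a c + rint f c b.
Proof.
move=> ac cb cf; have fi := ictn_integrable cf.
have := @Rintegral_itvB _ f (BLeft a) (BRight b) c fi.
rewrite !bnd_simp => /(_ ac cb).
rewrite Rintegral_itv_obnd_cbnd; last first.
  apply: integrableS fi => //; apply: subset_itvr; rewrite bnd_simp//.
by rewrite /rint => <-; rewrite addrC subrK.
Qed.

End IntervalIntegral.

(** * Cauchy's theorem on rectangles *)

Section Goursat.
Variable R : realType.
Local Notation C := (R[i]).

(** The supremum of the left ends lies below every right end. No hypothesis makes the widths tend to
    0; only the common point of the nested sides is wanted. *)
Lemma sup_squeeze (x : nat -> R) (w : nat -> R) :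
  (forall n, x n <= x n.+1) -> (forall n, x n.+1 + w n.+1 <= x n + w n) ->
  (forall n, 0 <= w n) -> exists p, forall n, x n <= p <= x n + w n.
Proof.
move=> ndx niw w0.
have ndx' m n : (m <= n)%N -> x m <= x n by move/(homo_leq (@lexx _ _) (@le_trans _ _)): ndx; exact.
have niw' m n : (m <= n)%N -> x n + w n <= x m + w m.
  move: m n; apply: (@homo_leq _ (fun n => x n + w n) (fun a b => b <= a)) => //.
  by move=> b a c ab bc; exact: le_trans bc ab.
have H m n : x m <= x n + w n.
  have [mn|/ltnW nm] := leqP m n; first by rewrite (le_trans (ndx' _ _ mn))// lerDl.
  by apply: le_trans (niw' _ _ nm); rewrite lerDl.
exists (sup (range x)) => n; apply/andP; split.
  apply: ub_le_sup; last by exists n.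
  by exists (x 0%N + w 0%N) => _ [m _ <-].
apply: ge_sup; first by exists (x 0%N), 0%N.
by move=> _ [m _ <-].
Qed.

Lemma has_cderiv_ctn_x (H : C -> C) x y c : has_cderiv H (Complex x y) c ->
  {for x, continuous (fun s => complex.Re (H (Complex s y)))} /\
  {for x, continuous (fun s => complex.Im (H (Complex s y)))}.
Proof.
move=> /has_cderiv_tends tH.
have E (s : R) : H (Complex s y) = H (Complex x y + Complex (s - x) 0).
  by congr H; apply: complex_ext => /=; ring.
split; apply/cvgrPdist_le => e e0; have [d d0 {}tH] := tH _ e0;
  exists d => //= s; rewrite /ball/= distrC => sx;
  rewrite distrC (E s).
- apply: le_trans (tH (Complex (s - x) 0) _); last by rewrite normc_real.
  by rewrite -cReN -cReD normc_Re.
- apply: le_trans (tH (Complex (s - x) 0) _); last by rewrite normc_real.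
  by rewrite -cImN -cImD normc_Im.
Qed.

Lemma has_cderiv_ctn_y (H : C -> C) x y c : has_cderiv H (Complex x y) c ->
  {for y, continuous (fun s => complex.Re (H (Complex x s)))} /\
  {for y, continuous (fun s => complex.Im (H (Complex x s)))}.
Proof.
move=> /has_cderiv_tends tH.
have E (s : R) : H (Complex x s) = H (Complex x y + Complex 0 (s - y)).
  by congr H; apply: complex_ext => /=; ring.
split; apply/cvgrPdist_le => e e0; have [d d0 {}tH] := tH _ e0;
  exists d => //= s; rewrite /ball/= distrC => sx;
  rewrite distrC (E s).
- apply: le_trans (tH (Complex 0 (s - y)) _); last by rewrite normc_imag.
  by rewrite -cReN -cReD normc_Re.
- apply: le_trans (tH (Complex 0 (s - y)) _); last by rewrite normc_imag.
  by rewrite -cImN -cImD normc_Im.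
Qed.

Variable H : C -> C.
Let u x y := complex.Re (H (Complex x y)).
Let v x y := complex.Im (H (Complex x y)).

Definition holo_rect a b c d := forall x y, a <= x <= b -> c <= y <= d ->
  exists k, has_cderiv H (Complex x y) k.

(* The imaginary part of the integral of H dz along the boundary of the
   rectangle [a,b] x [c,d]. *)
Definition im_circ a b c d : R :=
  rint (fun y => u b y - u a y) c d - rint (fun x => v x d - v x c) a b.

Let ictn_u x a b c d : holo_rect a b c d -> a <= x <= b -> ictn (u x) c d.
Proof. by move=> hH xab y ycd; have [k /has_cderiv_ctn_y[]] := hH _ _ xab ycd. Qed.

Let ictn_v y a b c d : holo_rect a b c d -> c <= y <= d ->
  ictn (fun x => v x y) a b.
Proof. by move=> hH ycd x xab; have [k /has_cderiv_ctn_x[]] := hH _ _ xab ycd. Qed.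

Lemma holo_rectS a b c d a' b' c' d' : a <= a' -> b' <= b -> c <= c' -> d' <= d ->
  holo_rect a b c d -> holo_rect a' b' c' d'.
Proof.
move=> aa bb cc dd hH x y /andP[ax xb] /andP[cy yd]; apply: hH.
  by rewrite (le_trans aa)// (le_trans xb).
by rewrite (le_trans cc)// (le_trans yd).
Qed.

Lemma im_circ_splitx a b c d e : a <= e <= b -> c <= d -> holo_rect a b c d ->
  im_circ a b c d = im_circ a e c d + im_circ e b c d.
Proof.
move=> /andP[ae eb] cd hH; have ab := le_trans ae eb.
have cI x : a <= x <= b -> ictn (u x) c d := ictn_u hH.
have dI y : c <= y <= d -> ictn (fun x => v x y) a b := ictn_v hH.
have xa : a <= a <= b by rewrite lexx.
have xb : a <= b <= b by rewrite lexx andbT.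
have xe : a <= e <= b by rewrite ae.
have yc : c <= c <= d by rewrite lexx.
have yd : c <= d <= d by rewrite lexx andbT.
rewrite /im_circ (@rint_split _ (fun x => v x d - v x c) a b e)//; last first.
  by apply: ictnB; exact: dI.
rewrite !rintB//; try exact: cI.
- ring.
- by apply: ictnS (dI _ yd).
- by apply: ictnS (dI _ yc).
- by apply: ictnS (dI _ yd).
- by apply: ictnS (dI _ yc).
Qed.

Lemma im_circ_splity a b c d e : a <= b -> c <= e <= d -> holo_rect a b c d ->
  im_circ a b c d = im_circ a b c e + im_circ a b e d.
Proof.
move=> ab /andP[ce ed] hH; have cd := le_trans ce ed.
have cI x : a <= x <= b -> ictn (u x) c d := ictn_u hH.
have dI y : c <= y <= d -> ictn (fun x => v x y) a b := ictn_v hH.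
have xa : a <= a <= b by rewrite lexx.
have xb : a <= b <= b by rewrite lexx andbT.
have ye : c <= e <= d by rewrite ce.
have yc : c <= c <= d by rewrite lexx.
have yd : c <= d <= d by rewrite lexx andbT.
rewrite /im_circ (@rint_split _ (fun y => u b y - u a y) c d e)//; last first.
  by apply: ictnB; exact: cI.
rewrite !rintB//; try exact: dI.
- ring.
- by apply: ictnS (cI _ xb).
- by apply: ictnS (cI _ xa).
- by apply: ictnS (cI _ xb).
- by apply: ictnS (cI _ xa).
Qed.

(* On an affine function the two integrals cancel exactly. *)
Lemma im_circ_small (p q : R) k e a b c d : a <= p <= b -> c <= q <= d ->
  holo_rect a b c d -> 0 <= e ->
  (forall x y, a <= x <= b -> c <= y <= d ->
    normc (H (Complex x y) - H (Complex p q) - k * Complex (x - p) (y - q)) <= e) ->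
  `|im_circ a b c d| <= 2 * e * (b - a + (d - c)).
Proof.
move=> /andP[ap pb] /andP[cq qd] hH e0 HE.
have ab := le_trans ap pb; have cd := le_trans cq qd.
have xa : a <= a <= b by rewrite lexx.
have xb : a <= b <= b by rewrite lexx andbT.
have yc : c <= c <= d by rewrite lexx.
have yd : c <= d <= d by rewrite lexx andbT.
pose al := complex.Re k; pose be := complex.Im k.
have hu y : c <= y <= d -> `|u b y - u a y - al * (b - a)| <= 2 * e.
  move=> ycd; have h1 := HE _ _ xb ycd; have h2 := HE _ _ xa ycd.
  have := le_trans (normc_Re _) h1; have := le_trans (normc_Re _) h2.
  rewrite !reimE/= -/al -/be -/(u _ _) -/(u _ _) -/(u _ _) => h3 h4.
  have := ler_normB (u b y - u p q - (al * (b - p) - be * (y - q)))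
    (u a y - u p q - (al * (a - p) - be * (y - q))).
  rewrite (_ : u b y - _ - _ - _ = u b y - u a y - al * (b - a)); last by ring.
  move=> h5; apply: le_trans h5 _.
  by rewrite mulr_natl mulr2n lerD.
have hv x : a <= x <= b -> `|v x d - v x c - al * (d - c)| <= 2 * e.
  move=> xab; have h1 := HE _ _ xab yd; have h2 := HE _ _ xab yc.
  have := le_trans (normc_Im _) h1; have := le_trans (normc_Im _) h2.
  rewrite !reimE/= -/al -/be -/(v _ _) -/(v _ _) -/(v _ _) => h3 h4.
  have := ler_normB (v x d - v p q - (al * (d - q) + be * (x - p)))
    (v x c - v p q - (al * (c - q) + be * (x - p))).
  rewrite (_ : v x d - _ - _ - _ = v x d - v x c - al * (d - c)); last by ring.
  move=> h5; apply: le_trans h5 _.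
  by rewrite mulr_natl mulr2n lerD.
have cu : ictn (fun y => u b y - u a y) c d by apply: ictnB; exact: ictn_u hH _.
have cv : ictn (fun x => v x d - v x c) a b by apply: ictnB; exact: ictn_v hH _.
have h1 : `|rint (fun y => u b y - u a y - al * (b - a)) c d| <= 2 * e * (d - c).
  by apply: rint_bound => //; apply: ictnB => //; exact: ictn_cst.
have h2 : `|rint (fun x => v x d - v x c - al * (d - c)) a b| <= 2 * e * (b - a).
  by apply: rint_bound => //; apply: ictnB => //; exact: ictn_cst.
move: h1 h2; rewrite rintB//; last exact: ictn_cst.
rewrite (@rintB _ (fun x => v x d - v x c))//; last exact: ictn_cst.
rewrite !rint_cst// => h1 h2; rewrite /im_circ.
have := ler_normB (rint (fun y => u b y - u a y) c d - al * (b - a) * (d - c))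
  (rint (fun x => v x d - v x c) a b - al * (d - c) * (b - a)).
rewrite (_ : rint _ _ _ - _ - (_ - _) = rint (fun y => u b y - u a y) c d -
  rint (fun x => v x d - v x c) a b); last by ring.
by move=> h3; apply: (le_trans h3); rewrite [leRHS]mulrDr [leRHS]addrC lerD.
Qed.

(** Bisection: one of the four quarters carries at least a quarter of the circulation, so after n
    steps the loss is 4^n, while differentiability at the limit point bounds the circulation of the
    nth rectangle by a small multiple of (L / 2^n)^2. The imaginary part is chosen because dz = i dy
    on vertical sides, so that it sees the real part of [H] there. *)
Lemma goursat a b c d : a <= b -> c <= d -> holo_rect a b c d ->
  im_circ a b c d = 0.
Proof.
move=> ab cd hH.
have p2 n : 0 < (2 : R) ^+ n by rewrite exprn_gt0.
have halves (t : R) : 0 <= t -> exists w : nat -> R, [/\ forall n, 0 <= w n,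
    forall n, w n = w n.+1 + w n.+1 & forall n, w n = t / 2 ^+ n].
  move=> t0; exists (fun n => t / 2 ^+ n); split=> // n.
    by rewrite divr_ge0// ltW.
  by rewrite exprS; field; rewrite gt_eqF.
have [w [w0 wS wE]] : exists w : nat -> R, _ := halves (b - a) ltac:(by rewrite subr_ge0).
have [k [k0 kS kE]] : exists w : nat -> R, _ := halves (d - c) ltac:(by rewrite subr_ge0).
pose G n (s : R * R) := `|im_circ s.1 (s.1 + w n) s.2 (s.2 + k n)|.
pose inr n (s : R * R) := [/\ a <= s.1, s.1 + w n <= b, c <= s.2 & s.2 + k n <= d].
pose P (ns : nat * (R * R)) (t : R * R) := inr ns.1 ns.2 ->
  [/\ inr ns.1.+1 t, ns.2.1 <= t.1, t.1 + w ns.1.+1 <= ns.2.1 + w ns.1,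
    ns.2.2 <= t.2 /\ t.2 + k ns.1.+1 <= ns.2.2 + k ns.1 &
    G ns.1 ns.2 <= 4 * G ns.1.+1 t].
(* The choice function must be total, so the property [P] is guarded by inclusion in the original
   rectangle; an argument violating the guard is returned unchanged. *)
have [step stepP] : {F : nat * (R * R) -> R * R & forall ns, P ns (F ns)}.
  apply: boolp.choice => -[n [x y]].
  have [hr|hr] := pselect (inr n (x, y)); last by exists (x, y) => /hr.
  have [/= h1 h2 h3 h4] := hr.
  have wn := w0 n.+1; have kn := k0 n.+1; have wSn := wS n; have kSn := kS n.
  have hr' : holo_rect x (x + w n) y (y + k n) by apply: holo_rectS hH.
  pose g i j := G n.+1 (x + i * w n.+1, y + j * k n.+1).
  have split4 : G n (x, y) <= g 0 0 + g 0 1 + (g 1 0 + g 1 1).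
    rewrite /g /G/= !mul0r !addr0 !mul1r.
    have hx : x <= x + w n.+1 <= x + w n by apply/andP; split; lra.
    have hy : y <= y + k n.+1 <= y + k n by apply/andP; split; lra.
    have [/andP[hx1 hx2] /andP[hy1 hy2]] := (hx, hy).
    have hyy := le_trans hy1 hy2.
    rewrite (im_circ_splitx hx hyy hr').
    rewrite (im_circ_splity hx1 hy (holo_rectS _ _ _ _ hr'))//.
    rewrite (im_circ_splity hx2 hy (holo_rectS _ _ _ _ hr'))//.
    rewrite wSn kSn [x + (_ + _)]addrA [y + (_ + _)]addrA.
    by apply: le_trans (ler_normD _ _) _; apply: lerD; exact: ler_normD.
  have [i [j [i01 j01 hij]]] : exists i j : R, [/\ i = 0 \/ i = 1, j = 0 \/ j = 1 &
      G n (x, y) <= 4 * g i j].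
    apply: contrapT => hardy_away.
    have hn' i j : i = 0 \/ i = 1 -> j = 0 \/ j = 1 -> 4 * g i j < G n (x, y).
      by move=> i01 j01; rewrite ltNge; apply/negP => ?; apply: hardy_away; exists i, j.
    have := hn' 0 0 (or_introl erefl) (or_introl erefl).
    have := hn' 0 1 (or_introl erefl) (or_intror erefl).
    have := hn' 1 0 (or_intror erefl) (or_introl erefl).
    have := hn' 1 1 (or_intror erefl) (or_intror erefl).
    lra.
  exists (x + i * w n.+1, y + j * k n.+1) => _ /=.
  have hij' := hij.
  have hi : 0 <= i * w n.+1 /\ i * w n.+1 <= w n.+1.
    by case: i01 => ->; rewrite ?mul0r ?mul1r.
  have hj : 0 <= j * k n.+1 /\ j * k n.+1 <= k n.+1.
    by case: j01 => ->; rewrite ?mul0r ?mul1r.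
  clear - h1 h2 h3 h4 wn kn wSn kSn hi hj hij'.
  by split; [split; rewrite /=; lra|lra|lra|split; lra|exact: hij'].

pose s := fix s n := if n is m.+1 then step (m, s m) else (a, c).
have inr_s n : inr n (s n).
  elim: n => [|n ih]; last by have [] := stepP (n, s n) ih.
  by rewrite /s/=; split => //=; rewrite ?wE ?kE expr0 divr1 addrC subrK.
have sP n := stepP (n, s n) (inr_s n).
have Gs n : G 0%N (a, c) <= 4 ^+ n * G n (s n).
  elim: n => [|n ih]; first by rewrite expr0 mul1r.
  apply: le_trans ih _; rewrite exprSr -mulrA ler_pM2l ?exprn_gt0//.
  by have [] := sP n.
have [p pP] : exists p, forall n, (s n).1 <= p <= (s n).1 + w n.
  by apply: sup_squeeze => // n; have [] := sP n.
have [q qP] : exists q, forall n, (s n).2 <= q <= (s n).2 + k n.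
  by apply: sup_squeeze => // n; have [_ _ _ []] := sP n.
have G0 : G 0%N (a, c) = `|im_circ a b c d|.
  by rewrite /G/= wE kE expr0 !divr1 ![_ + (_ - _)]addrC !subrK.
have pab : a <= p <= b.
  by have := pP 0%N; rewrite /= wE expr0 divr1 [a + _]addrC subrK.
have qcd : c <= q <= d.
  by have := qP 0%N; rewrite /= kE expr0 divr1 [c + _]addrC subrK.
have [m hm] := hH _ _ pab qcd.
pose L := b - a + (d - c); have L0 : 0 <= L by rewrite addr_ge0 ?subr_ge0.
apply/eqP; rewrite -normr_eq0 eq_le normr_ge0 andbT -G0.
apply/ler_addgt0Pr => e e0; rewrite add0r.
(* The final bound is 2 e' L^2; the added 1 covers a rectangle reduced to a point. *)
pose e' := e / (2 * (L ^+ 2 + 1)).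
have L2 : 0 < L ^+ 2 + 1 by rewrite ltr_wpDl// sqr_ge0.
have e'0 : 0 < e' by rewrite divr_gt0// mulr_gt0.
have [dl dl0 hd] := hm _ e'0.
have [n nP] : exists n, L / 2 ^+ n < dl.
  have nP := archi_boundP (divr_ge0 L0 (ltW dl0)).
  exists (Num.bound (L / dl)); rewrite ltr_pdivrMr// mulrC -ltr_pdivrMr//.
  by apply: lt_trans nP _; rewrite -natrX ltr_nat ltn_expl.
apply: le_trans (Gs n) _.
have [/= i1 i2 i3 i4] := inr_s n.
have Ln0 : 0 <= L / 2 ^+ n by rewrite divr_ge0// ltW.
have wkL : w n + k n = L / 2 ^+ n by rewrite wE kE -mulrDl.
have : G n (s n) <= 2 * (e' * (L / 2 ^+ n)) *
    ((s n).1 + w n - (s n).1 + ((s n).2 + k n - (s n).2)).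
  apply: (@im_circ_small p q m _ _ _ _ _ (pP n) (qP n)).
  - by apply: holo_rectS hH.
  - by rewrite mulr_ge0// ltW.
  move=> x y /andP[x1 x2] /andP[y1 y2].
  have xyn : normc (Complex (x - p) (y - q)) <= L / 2 ^+ n.
    apply: le_trans (normc_le_ReIm _) _ => /=.
    have /andP[p1 p3] := pP n; have /andP[q1 q2] := qP n.
    by rewrite -wkL lerD// ler_norml; apply/andP; split; lra.
  have := hd (Complex (x - p) (y - q)) (le_lt_trans xyn nP).
  rewrite (_ : Complex p q + _ = Complex x y); last first.
    by apply: complex_ext => /=; ring.
  by move=> h; apply: le_trans h _; rewrite ler_pM2l.
rewrite (_ : (s n).1 + w n - _ + _ = L / 2 ^+ n); last by rewrite -wkL; ring.
move=> h; apply: (@le_trans _ _ (2 * e' * L ^+ 2)).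
  rewrite (_ : 2 * e' * L ^+ 2 = 4 ^+ n * (2 * (e' * (L / 2 ^+ n)) * (L / 2 ^+ n))).
    by rewrite ler_pM2l// exprn_gt0.
  rewrite (_ : 4 = 2 * 2 :> R); last by rewrite -natrM.
  rewrite exprMn; field; by rewrite gt_eqF.
rewrite /e'; rewrite (_ : 2 * _ * _ = e * (L ^+ 2 / (L ^+ 2 + 1))); last first.
  by field; rewrite gt_eqF.
rewrite ger_pMr// ler_pdivrMr// mul1r lerDl.
exact: ler01.
Qed.

End Goursat.

(** * Derivatives along segments and the complex exponential *)

Section RealDerivative.
Variable R : realType.
Implicit Types f : R -> R.
Local Notation C := (R[i]).

Lemma is_deriveP f (x c : R) : is_derive x 1 f c <->
  forall e : R, 0 < e -> exists2 d : R, 0 < d & forall h : R, `|h| < d ->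
    `|f (x + h) - f x - c * h| <= e * `|h|.
Proof.
split=> [[dfx dfE] e e0|H].
  have : (h^-1 *: (f (h%:A + x) - f x)) @[h --> (0 : R)^'] --> c.
    by move: dfE; rewrite /derive => <-.
  move=> /cvgrPdist_le /(_ _ e0)[d /= d0 {}H].
  exists d => // h hd; have [->|h0] := eqVneq h 0.
    by rewrite addr0 mulr0 subrr subr0 normr0 mulr0.
  have := H h; rewrite /ball/= sub0r normrN => /(_ hd h0).
  have hA : h%:A = h by exact: mulr1.
  rewrite hA [h + x]addrC.
  have -> : c - h^-1 *: (f (x + h) - f x) = - (h^-1 * (f (x + h) - f x - c * h)).
    by rewrite /GRing.scale/=; field.
  by rewrite normrN normrM normfV ler_pdivrMl ?normr_gt0// [`|h| * _]mulrC.
have cf : (h^-1 *: (f (h%:A + x) - f x)) @[h --> (0 : R)^'] --> c.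
  apply/cvgrPdist_le => e /H[d d0 {}H].
  exists d => // h; rewrite /ball/= sub0r normrN => hd h0.
  have hA : h%:A = h by exact: mulr1.
  rewrite hA [h + x]addrC.
  have -> : c - h^-1 *: (f (x + h) - f x) = - (h^-1 * (f (x + h) - f x - c * h)).
    by rewrite /GRing.scale/=; field.
  rewrite normrN normrM normfV ler_pdivrMl ?normr_gt0// [`|h| * _]mulrC.
  exact: H.
split; first by apply/cvg_ex; exists c.
by rewrite /derive; apply/cvg_lim => //; exact: Rhausdorff.
Qed.

Lemma is_derive_line (f : C -> C) (a h : C) (t : R) c :
  has_cderiv f (a + Complex t 0 * h) c ->
  is_derive t 1 (fun s => complex.Re (f (a + Complex s 0 * h))) (complex.Re (c * h)) /\
  is_derive t 1 (fun s => complex.Im (f (a + Complex s 0 * h))) (complex.Im (c * h)).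
Proof.
move=> fc.
have H (e : R) : 0 < e -> exists2 d : R, 0 < d & forall s : R, `|s| < d ->
  normc (f (a + Complex (t + s) 0 * h) - f (a + Complex t 0 * h) -
     c * h * Complex s 0) <= e * `|s|.
  move=> e0; have k0 : 0 < normc h + 1 by rewrite ltr_wpDl ?normc_ge0.
  have [d d0 H] := fc _ (divr_gt0 e0 k0).
  exists (d / (normc h + 1)); first by rewrite divr_gt0.
  move=> s; rewrite ltr_pdivlMr// => sd.
  have sh : normc (Complex s 0 * h) <= `|s| * (normc h + 1).
    by rewrite normcM normc_real ler_wpM2l// lerDl.
  have := H (Complex s 0 * h) (le_lt_trans sh sd).
  have -> : a + Complex t 0 * h + Complex s 0 * h = a + Complex (t + s) 0 * h.
    by rewrite -addrA -mulrDl; congr (_ + _ * _); apply: complex_ext => /=; ring.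
  rewrite (_ : c * (_ * h) = c * h * Complex s 0); last by ring.
  move=> h1; apply: le_trans h1 _.
  apply: le_trans (ler_wpM2l _ sh) _; first by rewrite divr_ge0 ?ltW.
  by rewrite mulrCA divfK ?gt_eqF// mulrC.
split; apply/is_deriveP => e /H[d d0 {}H]; exists d => // s /H; apply: le_trans.
- apply: le_trans (normc_Re _); rewrite !reimE /=.
  by rewrite le_eqVlt; apply/orP; left; apply/eqP; congr `|_|; ring.
- apply: le_trans (normc_Im _); rewrite !reimE /=.
  by rewrite le_eqVlt; apply/orP; left; apply/eqP; congr `|_|; ring.
Qed.

Lemma is_derive_ctn f (x c : R) : is_derive x 1 f c -> {for x, continuous f}.
Proof.
by move=> [df _]; apply/differentiable_continuous/derivable1_diffP.
Qed.

(** The mean value theorem holds for real functions only, so real and imaginary parts are estimated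
    separately, at two unrelated intermediate points; hence the factor 2. *)
Lemma mvt_segment (f : C -> C) (a h : C) (K : R) :
  (forall t : R, 0 <= t <= 1 -> exists2 c, has_cderiv f (a + Complex t 0 * h) c &
    normc (c * h) <= K) ->
  normc (f (a + h) - f a) <= 2 * K.
Proof.
move=> H.
have E1 : a + h = a + Complex 1 0 * h by rewrite (_ : Complex 1 0 = 1)// mul1r.
have E0 : a = a + Complex 0 0 * h by rewrite (_ : Complex 0 0 = 0)// mul0r addr0.
have aux (p : C -> R) : (forall z, `|p z| <= normc z) ->
   (forall t c, has_cderiv f (a + Complex t 0 * h) c ->
     is_derive t 1 (fun s => p (f (a + Complex s 0 * h))) (p (c * h))) ->
   `|p (f (a + h)) - p (f a)| <= K.
  move=> pn pd.
  have H' (t : R) : exists c, 0 <= t <= 1 ->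
    has_cderiv f (a + Complex t 0 * h) c /\ normc (c * h) <= K.
    have [/H[c h1 h2]|nt] := pselect (0 <= t <= 1); first by exists c.
    by exists 0.
  have [F FP] := boolp.choice H'.
  have [] := @MVT_segment _ (fun s => p (f (a + Complex s 0 * h)))
     (fun s => p (F s * h)) 0 1 ler01.
  - move=> t; rewrite in_itv/= => /andP[t0 t1].
    by apply: pd; apply: (FP t _).1; rewrite !ltW.
  - apply: ictn_within => t t01; have [c h1 _] := H _ t01.
    exact: is_derive_ctn (pd _ _ h1).
  move=> t; rewrite in_itv/= => t01; rewrite -E1 -E0 subr0 mulr1 => ->.
  by apply: le_trans (pn _) _; exact: (FP t t01).2.
rewrite mulr_natl mulr2n; apply: le_trans (normc_le_ReIm _) _.
rewrite !reimE; apply: lerD.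
- by apply: aux; [exact: normc_Re|move=> t c /is_derive_line[]].
- by apply: aux; [exact: normc_Im|move=> t c /is_derive_line[]].
Qed.

(** It maps the rectangle [ln r', ln r] x [0, 2 pi] onto an annulus, which carries Cauchy's theorem
    on rectangles over to circles. *)
Definition cexp (w : C) : C :=
  Complex (expR (complex.Re w) * cos (complex.Im w))
          (expR (complex.Re w) * sin (complex.Im w)).

Lemma cexpD z w : cexp (z + w) = cexp z * cexp w.
Proof.
by apply: complex_ext; rewrite !reimE/= !reimE expRD ?cosD ?sinD; ring.
Qed.

Lemma normc_cexp z : normc (cexp z) = expR (complex.Re z).
Proof.
rewrite normcE_sqmod /sqmod/= !exprMn -mulrDr cos2Dsin2 mulr1 sqrtr_sqr.
by rewrite gtr0_norm// expR_gt0.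
Qed.

Lemma has_cderiv_cexp z : has_cderiv cexp z (cexp z).
Proof.
have c0 : has_cderiv cexp 0 1.
  (* The real and the imaginary part each leave an error of 3 e' |h|. The radius [d4] below ensures
     |exp s| <= 2 and |exp s - 1| <= e'; the addition law later moves the result from 0 to [z]. *)
  move=> e e0; pose e' := Num.min 1 (e / 6).
  have e'0 : 0 < e' by rewrite lt_min ltr01 divr_gt0.
  have e'1 : e' <= 1 by rewrite ge_min lexx.
  have e'e : 6 * e' <= e.
    by rewrite mulrC -ler_pdivlMr// ge_min lexx orbT.
  have /is_deriveP/(_ _ e'0)[d1 d10 H1] := is_derive_expR (0 : R).
  have /is_deriveP/(_ _ e'0)[d2 d20 H2] := is_derive_cos (0 : R).
  have /is_deriveP/(_ _ e'0)[d3 d30 H3] := is_derive_sin (0 : R).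
  pose d4 := Num.min (1 / 2) (e' / 2).
  have d40 : 0 < d4 by rewrite lt_min !divr_gt0.
  exists (Num.min (Num.min d1 d2) (Num.min d3 d4)).
    by rewrite !lt_min d10 d20 d30 !divr_gt0.
  move=> h; rewrite !lt_min => /andP[/andP[hd1 hd2] /and3P[hd3 hd4 hd5]].
  have nr := normc_Re h; have ni := normc_Im h.
  have := H1 (complex.Re h) (le_lt_trans nr hd1).
  have := H2 (complex.Im h) (le_lt_trans ni hd2).
  have := H3 (complex.Im h) (le_lt_trans ni hd3).
  rewrite !add0r cos0 sin0 expR0 oppr0 !mul1r !mul0r !subr0 ?addr0.
  set s := complex.Re h in nr *; set t := complex.Im h in ni *.
  set E := expR s; set c := cos t; set S := sin t => h3 h2 h1.
  have hs : `|s| <= 1 / 2 by apply: le_trans nr (ltW hd4).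
  have hs2 : `|s| <= e' / 2 by apply: le_trans nr (ltW hd5).
  have hE1 : `|E - 1| <= 2 * `|s|.
    have -> : E - 1 = (E - 1 - s) + s by ring.
    apply: le_trans (ler_normD _ _) _; have := normr_ge0 s; nra.
  have hE : `|E| <= 2.
    have -> : E = (E - 1) + 1 by ring.
    apply: le_trans (ler_normD _ _) _; rewrite normr1; lra.
  have n0 := normc_ge0 h.
  apply: le_trans (normc_le_ReIm _) _; rewrite !reimE/= -/s -/t -/E -/c -/S.
  rewrite expR0 cos0 sin0 mulr1 mulr0 subr0.
  have k1 : `|E * c - 1 - s| <= e' * normc h + 2 * (e' * normc h).
    have -> : E * c - 1 - s = (E - 1 - s) + E * (c - 1) by ring.
    apply: le_trans (ler_normD _ _) _; rewrite normrM; apply: lerD.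
      by apply: le_trans h1 _; rewrite ler_pM2l.
    apply: ler_pM => //; apply: le_trans h2 _; by rewrite ler_pM2l.
  have k2 : `|E * S - t| <= 2 * (e' * normc h) + e' * normc h.
    have -> : E * S - t = E * (S - t) + (E - 1) * t by ring.
    apply: le_trans (ler_normD _ _) _; rewrite !normrM; apply: lerD.
      by apply: ler_pM => //; apply: le_trans h3 _; rewrite ler_pM2l.
    by apply: ler_pM => //; lra.
  have : 6 * e' * normc h <= e * normc h by rewrite ler_wpM2r.
  lra.
move=> e e0; have nz : 0 < normc (cexp z) by rewrite normc_cexp expR_gt0.
have [d d0 H] := c0 _ (divr_gt0 e0 nz); exists d => // h /H.
rewrite add0r cexpD.
have -> : cexp z * cexp h - cexp z - cexp z * h = cexp z * (cexp h - cexp 0 - 1 * h).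
  have -> : cexp 0 = 1.
    by apply: complex_ext; rewrite /= expR0 ?cos0 ?sin0 ?mulr1 ?mulr0.
  ring.
move=> h1; rewrite normcM; apply: le_trans (ler_wpM2l (ltW nz) h1) _.
by rewrite mulrA mulrC [normc (cexp z) * _]mulrC divfK ?gt_eqF// mulrC.
Qed.

Definition circ (r t : R) : C := Complex (r * cos t) (r * sin t).

Lemma normc_circ r t : 0 <= r -> normc (circ r t) = r.
Proof.
move=> r0; rewrite normcE_sqmod /sqmod/= !exprMn -mulrDr cos2Dsin2 mulr1.
by rewrite sqrtr_sqr ger0_norm.
Qed.

Lemma cexp_circ s t : cexp (Complex s t) = circ (expR s) t.
Proof. by []. Qed.

End RealDerivative.

(** * Circle means, Cauchy estimates and Weierstrass' theorem *)

Section CircleMean.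
Variable R : realType.
Local Notation C := (R[i]).
Implicit Types (f g q : C -> C) (w z h : C) (r t : R).

Definition cctn (p : R -> C) (a b : R) :=
  ictn (fun t => complex.Re (p t)) a b /\ ictn (fun t => complex.Im (p t)) a b.

Lemma cctnP p a b : cctn p a b <-> forall t, a <= t <= b ->
  forall e : R, 0 < e -> exists2 d : R, 0 < d &
    forall s, `|s - t| < d -> normc (p s - p t) <= e.
Proof.
split=> [[/ictnP hr /ictnP hi] t tab e e0|H]; last first.
  split; apply/ictnP => t /H{}H e /H[d d0 {}H]; exists d => // s /H; apply: le_trans.
    by rewrite -cReN -cReD normc_Re.
  by rewrite -cImN -cImD normc_Im.
have [d d0 H] := hr _ tab _ (divr_gt0 e0 (ltr0n _ 2)).
have [d' d'0 H'] := hi _ tab _ (divr_gt0 e0 (ltr0n _ 2)).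
exists (Num.min d d'); first by rewrite lt_min d0.
move=> s; rewrite lt_min => /andP[/H h1 /H' h2].
apply: le_trans (normc_le_ReIm _) _.
by rewrite !reimE [e]splitr lerD.
Qed.

Lemma cctn_comp (p : R -> C) f (a b : R) : cctn p a b ->
  (forall t, a <= t <= b -> exists c, has_cderiv f (p t) c) ->
  cctn (fun t => f (p t)) a b.
Proof.
move=> /cctnP cp fp; apply/cctnP => t tab e e0.
have [c /has_cderiv_tends tf] := fp _ tab.
have [d d0 H] := tf _ e0.
have [d' d'0 H'] := cp _ tab _ (divr_gt0 d0 (ltr0n _ 2)).
exists d' => // s /H' h1.
have := H (p s - p t); rewrite addrCA subrr addr0; apply.
by apply: le_lt_trans h1 _; rewrite ltr_pdivrMr// ltr_pMr// ltr1n.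
Qed.

Lemma cctnD (p q : R -> C) (a b : R) : cctn p a b -> cctn q a b -> cctn (fun t => p t + q t) a b.
Proof.
move=> [p1 p2] [q1 q2]; split.
- by under eq_fun do rewrite cReD; exact: ictnD.
- by under eq_fun do rewrite cImD; exact: ictnD.
Qed.

Lemma cctnM (p q : R -> C) (a b : R) : cctn p a b -> cctn q a b -> cctn (fun t => p t * q t) a b.
Proof.
move=> [p1 p2] [q1 q2]; split.
- by under eq_fun do rewrite cReM; apply: ictnB; exact: ictnM.
- by under eq_fun do rewrite cImM; apply: ictnD; exact: ictnM.
Qed.

Lemma cctn_cst (c : C) (a b : R) : cctn (fun=> c) a b.
Proof. by split; exact: ictn_cst. Qed.

Lemma cctnB (p q : R -> C) (a b : R) : cctn p a b -> cctn q a b -> cctn (fun t => p t - q t) a b.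
Proof.
move=> cp cq; apply: cctnD => //.
have -> : (fun t => - q t) = (fun t => -1 * q t) by apply/funext => t; rewrite mulN1r.
by apply: cctnM => //; exact: cctn_cst.
Qed.

Lemma cctn_circ r a b : cctn (circ r) a b.
Proof.
split=> t _ /=; apply: continuousM; try exact: cst_continuous.
  exact: continuous_cos.
exact: continuous_sin.
Qed.

Lemma cctn_circV r a b : 0 < r -> cctn (fun t => (circ r t)^-1) a b.
Proof.
move=> r0; apply: cctn_comp; first exact: cctn_circ.
move=> t _; eexists; apply: has_cderivV.
by rewrite -normc_gt0 normc_circ// ltW.
Qed.

Local Notation T := (pi *+ 2 : R).

Lemma T_gt0 : 0 < T. Proof. by rewrite mulrn_wgt0// pi_gt0. Qed.

Definition cmean (p : R -> C) : C :=
  Complex (rint (fun t => complex.Re (p t)) 0 T / T)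
          (rint (fun t => complex.Im (p t)) 0 T / T).

Lemma cmeanB (p q : R -> C) : cctn p 0 T -> cctn q 0 T ->
  cmean (fun t => p t - q t) = cmean p - cmean q.
Proof.
move=> [p1 p2] [q1 q2]; apply: complex_ext; rewrite !reimE /=.
- by rewrite -mulrBl -rintB//; congr (_ / _); apply: eq_rint => t _; rewrite !reimE.
- by rewrite -mulrBl -rintB//; congr (_ / _); apply: eq_rint => t _; rewrite !reimE.
Qed.

Lemma cmeanZ (c : C) (p : R -> C) : cctn p 0 T -> cmean (fun t => c * p t) = c * cmean p.
Proof.
move=> [p1 p2]; apply: complex_ext; rewrite !reimE /= !mulrA.
- rewrite -mulrBl -!rintZ// -rintB//; first last.
  + by apply: ictnM => //; exact: ictn_cst.
  + by apply: ictnM => //; exact: ictn_cst.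
  by congr (_ / _); apply: eq_rint => t _; rewrite !reimE.
- rewrite -mulrDl -!rintZ// -rintD//; first last.
  + by apply: ictnM => //; exact: ictn_cst.
  + by apply: ictnM => //; exact: ictn_cst.
  by congr (_ / _); apply: eq_rint => t _; rewrite !reimE.
Qed.

Lemma cmean_bound (p : R -> C) (K : R) : cctn p 0 T -> (forall t, normc (p t) <= K) ->
  normc (cmean p) <= 2 * K.
Proof.
move=> [p1 p2] pK; apply: le_trans (normc_le_ReIm _) _ => /=.
rewrite mulr_natl mulr2n !normrM !normfV (gtr0_norm T_gt0).
apply: lerD; rewrite ler_pdivrMr ?T_gt0//; rewrite -[X in _ * X]subr0;
  apply: rint_bound => //; rewrite ?ltW ?T_gt0// => t _.
- exact: le_trans (normc_Re _) (pK t).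
- exact: le_trans (normc_Im _) (pK t).
Qed.

(** Cauchy's theorem for q(exp w) on [ln r', ln r] x [0, 2 pi]: the horizontal sides cancel by
    periodicity, so the integral does not depend on the radius, and r' tends to 0. At the centre
    only a limit is assumed, which admits removable singularities. *)
Let re_mean q (q0 : C) (rho : R) :
  (forall z, 0 < normc z < rho -> exists k, has_cderiv q z k) ->
  (forall e : R, 0 < e -> exists2 d : R, 0 < d & forall z, 0 < normc z < d ->
     normc (q z - q0) <= e) ->
  forall r, 0 < r < rho ->
  rint (fun t => complex.Re (q (circ r t))) 0 T = complex.Re q0 * T.
Proof.
move=> hq tq r /andP[r0 rr].
pose H (w : C) := q (cexp w).
have hH (s t : R) : expR s < rho -> exists k, has_cderiv H (Complex s t) k.
  move=> sr; have [|k qk] := hq (cexp (Complex s t)).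
    by rewrite normc_cexp/= expR_gt0.
  by eexists; apply: has_cderiv_comp (has_cderiv_cexp _) qk.
have step r' : 0 < r' <= r -> rint (fun t => complex.Re (q (circ r t))) 0 T =
    rint (fun t => complex.Re (q (circ r' t))) 0 T.
  move=> /andP[r'0 r'r].
  have lr : ln r' <= ln r by rewrite ler_ln ?posrE.
  have hR : holo_rect H (ln r') (ln r) 0 T.
    move=> x y /andP[_ xr] _; apply: hH; apply: le_lt_trans rr.
    by rewrite -[leRHS]lnK ?posrE// ler_expR.
  have := goursat lr (ltW T_gt0) hR; rewrite /im_circ.
  rewrite [X in _ - X](_ : _ = rint (fun=> 0) (ln r') (ln r)); last first.
    apply: eq_rint => x _; rewrite /H !cexp_circ.
    rewrite (_ : circ _ T = circ (expR x) 0) ?subrr//.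
    by apply: complex_ext; rewrite /= ?cos2pi ?cos0 ?sin2pi ?sin0.
  rewrite rint_cst// mul0r subr0 rintB.
  - have EH r1 : 0 < r1 -> rint (fun t => complex.Re (H (Complex (ln r1) t))) 0 T =
        rint (fun t => complex.Re (q (circ r1 t))) 0 T.
      by move=> r10; apply: eq_rint => t _; rewrite /H cexp_circ lnK ?posrE.
    by move/eqP; rewrite subr_eq0 !EH// => /eqP.
  - have xr : ln r' <= ln r <= ln r by rewrite lr lexx.
    by move=> t tT; have [k /has_cderiv_ctn_y[]] := hR _ _ xr tT.
  - have xr : ln r' <= ln r' <= ln r by rewrite lr lexx.
    by move=> t tT; have [k /has_cderiv_ctn_y[]] := hR _ _ xr tT.
apply/eqP; rewrite -subr_eq0 -normr_eq0 eq_le normr_ge0 andbT.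
apply/ler_addgt0Pr => e e0; rewrite add0r.
have [d d0 H'] := tq _ (divr_gt0 e0 T_gt0).
pose r' := Num.min r (d / 2).
have r'0 : 0 < r' by rewrite lt_min r0 divr_gt0.
have r'r : r' <= r by rewrite ge_min lexx.
have r'd : r' < d.
  by rewrite (@le_lt_trans _ _ (d / 2)) ?ge_min ?lexx ?orbT// ltr_pdivrMr// ltr_pMr// ltr1n.
rewrite (step r') ?r'0//.
have cI : ictn (fun t => complex.Re (q (circ r' t))) 0 T.
  apply: (@cctn_comp (circ r') q 0 T _ _).1; first exact: cctn_circ.
  move=> t _; apply: hq; rewrite normc_circ ?ltW//.
  by rewrite r'0 (le_lt_trans r'r).
have nT : T != 0 by rewrite gt_eqF ?T_gt0.
have : `|rint (fun t => complex.Re (q (circ r' t)) - complex.Re q0) 0 T| <=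
    e / T * (T - 0).
  apply: rint_bound; first by rewrite ltW ?T_gt0.
    by apply: ictnB => //; exact: ictn_cst.
  move=> t _; rewrite -cReN -cReD; apply: le_trans (normc_Re _) _; apply: H'.
  by rewrite normc_circ ?r'0// ltW.
rewrite (rintB cI (@ictn_cst _ _ _ _)) rint_cst; last by rewrite ltW ?T_gt0.
by rewrite subr0 divfK.
Qed.

Lemma circle_mean q (q0 : C) (rho : R) :
  (forall z, 0 < normc z < rho -> exists k, has_cderiv q z k) ->
  (forall e : R, 0 < e -> exists2 d : R, 0 < d & forall z, 0 < normc z < d ->
     normc (q z - q0) <= e) ->
  forall r, 0 < r < rho -> cmean (fun t => q (circ r t)) = q0.
Proof.
move=> hq tq r rr; have nT : T != 0 by rewrite gt_eqF ?T_gt0.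
apply: complex_ext => /=; first by rewrite (re_mean hq tq rr) mulfK.
rewrite -[RHS](mulfK nT); congr (_ / _).
rewrite (_ : complex.Im q0 = complex.Re (- 'i%C * q0)); last first.
  by rewrite !reimE /=; ring.
rewrite -(@re_mean (fun z => - 'i%C * q z) (- 'i%C * q0) rho _ _ r rr).
- by apply: eq_rint => t _; rewrite !reimE /=; ring.
- by move=> z /hq[k qk]; eexists; exact: has_cderivZ qk.
- move=> e /tq[d d0 H]; exists d => // z /H.
  by rewrite -mulrBr normcM normcN (_ : normc 'i%C = 1) ?mul1r// normc_imag normr1.
Qed.

End CircleMean.

Section CauchyEstimates.
Variable R : realType.
Local Notation C := (R[i]).
Implicit Types (f g : C -> C) (w z h : C) (r t rho K : R).
Local Notation T := (pi *+ 2 : R).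

Definition holo_disc f w rho :=
  forall h, normc h < rho -> has_cderiv f (w + h) (cderive f (w + h)).

Lemma holo_discS f w rho h rho' : normc h + rho' <= rho ->
  holo_disc f w rho -> holo_disc f (w + h) rho'.
Proof.
move=> hr fw h' h'r; rewrite -addrA; apply: fw.
apply: le_lt_trans (le_normcD _ _) _; apply: lt_le_trans hr.
by rewrite ltrD2l.
Qed.

Lemma cctn_translate_circ w r a b : cctn (fun t => w + circ r t) a b.
Proof. by apply: cctnD; [exact: cctn_cst|exact: cctn_circ]. Qed.

Lemma holo_disc_circ f w rho r : holo_disc f w rho -> 0 < r < rho ->
  cctn (fun t => f (w + circ r t)) 0 T.
Proof.
move=> fw /andP[r0 rr]; apply: cctn_comp; first exact: cctn_translate_circ.
by move=> t _; eexists; apply: fw; rewrite normc_circ ?ltW.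
Qed.

Lemma has_cderiv_translate f w z c : has_cderiv f (w + z) c ->
  has_cderiv (fun u => f (w + u)) z c.
Proof. by move=> H e /H[d d0 {}H]; exists d => // h /H; rewrite addrA. Qed.

(** Cauchy's formula for the derivative read as a mean value property: the difference quotient has a
    removable singularity at the centre, with value f'(w). *)
Lemma mean_derive f w rho r : holo_disc f w rho -> 0 < r < rho ->
  cmean (fun t => (f (w + circ r t) - f w) / circ r t) = cderive f w.
Proof.
move=> fw rr.
apply: (@circle_mean _ (fun z => (f (w + z) - f w) / z) (cderive f w) rho) => //.
  move=> z /andP[z0 zr]; eexists; apply: has_cderivM.
    by apply: has_cderivB; [exact/has_cderiv_translate/fw|exact: has_cderiv_cst].
  by apply: has_cderivV; rewrite -normc_gt0.
have rho0 : 0 < rho by case/andP: rr => r0 /(lt_trans r0).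
have := fw 0; rewrite normc0 addr0 => /(_ rho0) fd e /fd[d d0 H].
exists d => // z /andP[z0 /H H'].
have zn0 : z != 0 by rewrite -normc_gt0.
rewrite -[X in _ - X](mulfK zn0) -mulrBl normcM normcV ler_pdivrMr//.
Qed.

Lemma quot_circ_cctn (p : R -> C) r : 0 < r -> cctn p 0 T ->
  cctn (fun t => p t / circ r t) 0 T.
Proof. by move=> r0 cp; apply: cctnM => //; exact: cctn_circV. Qed.

Lemma quot_circ_bound (p : R -> C) r K : 0 < r -> cctn p 0 T ->
  (forall t, normc (p t) <= K) -> normc (cmean (fun t => p t / circ r t)) <= 2 * (K / r).
Proof.
move=> r0 cp pK; apply: cmean_bound; first exact: quot_circ_cctn.
by move=> t; rewrite normcM normcV (normc_circ _ (ltW r0)) ler_pM2r ?invr_gt0.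
Qed.

Section Local.
Variables (f : C -> C) (w : C) (rho K : R).
Hypotheses (rho0 : 0 < rho) (fw : holo_disc f w rho).
Hypothesis (fK : forall h, normc h < rho -> normc (f (w + h)) <= K).

Let K0 : 0 <= K.
Proof. by apply: le_trans (normc_ge0 _) (fK (h := 0) _); rewrite normc0. Qed.

Lemma derive_bound h : normc h < rho / 2 -> normc (cderive f (w + h)) <= 16 * K / rho.
Proof.
have rho0' := rho0; move=> hr; have hd : holo_disc f (w + h) (rho / 2).
  by apply: holo_discS fw; lra.
have r0 : 0 < rho / 4 by lra.
have rr : 0 < rho / 4 < rho / 2 by apply/andP; split; lra.
rewrite -(mean_derive hd rr).
(* The circle has radius rho / 4, increments of [f] are at most 2 K, and the outer 2 is that of
   [cmean_bound]. *)
apply: (@le_trans _ _ (2 * (2 * K / (rho / 4)))); last first.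
  by rewrite le_eqVlt; apply/orP; left; apply/eqP; field; rewrite gt_eqF.
apply: quot_circ_bound => //.
  by apply: cctnB; [exact: holo_disc_circ rr|exact: cctn_cst].
move=> t; apply: le_trans (le_normcD _ _) _; rewrite normcN -addrA mulr_natl mulr2n.
apply: lerD; apply: fK; last by lra.
by apply: le_lt_trans (le_normcD _ _) _; rewrite normc_circ; lra.
Qed.

Lemma lipschitz h1 h2 : normc h1 < rho / 2 -> normc h2 < rho / 2 ->
  normc (f (w + h1) - f (w + h2)) <= 32 * K / rho * normc (h1 - h2).
Proof.
have rho0' := rho0; move=> hr1 hr2.
have -> : w + h1 = (w + h2) + (h1 - h2) by ring.
apply: (@le_trans _ _ (2 * (16 * K / rho * normc (h1 - h2)))); last first.
  by rewrite le_eqVlt; apply/orP; left; apply/eqP; ring.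
apply: mvt_segment => t /andP[t0 t1].
have ht : normc (h2 + Complex t 0 * (h1 - h2)) < rho / 2.
  have -> : h2 + Complex t 0 * (h1 - h2) = Complex (1 - t) 0 * h2 + Complex t 0 * h1.
    have -> : Complex (1 - t) 0 = 1 - Complex t 0 :> C.
      by apply: complex_ext => /=; ring.
    ring.
  apply: le_lt_trans (le_normcD _ _) _; rewrite !normcM !normc_real.
  rewrite (ger0_norm t0) ger0_norm ?subr_ge0//.
  have := normc_ge0 h1; have := normc_ge0 h2 => h20 h10.
  pose m := Num.max (normc h1) (normc h2).
  have m1 : normc h1 <= m by rewrite le_max lexx.
  have m2 : normc h2 <= m by rewrite le_max lexx orbT.
  have mr : m < rho / 2 by rewrite gt_max hr1.
  apply: le_lt_trans mr.
  have : (1 - t) * normc h2 <= (1 - t) * m by rewrite ler_wpM2l// subr_ge0.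
  have : t * normc h1 <= t * m by rewrite ler_wpM2l.
  lra.
rewrite -addrA; exists (cderive f (w + (h2 + Complex t 0 * (h1 - h2)))).
  by apply: fw; lra.
by rewrite normcM ler_wpM2r ?normc_ge0// derive_bound.
Qed.

Lemma derive_lipschitz h1 h2 : normc h1 < rho / 4 -> normc h2 < rho / 4 ->
  normc (cderive f (w + h1) - cderive f (w + h2)) <=
    1024 * K / rho ^+ 2 * normc (h1 - h2).
Proof.
have rho0' := rho0; move=> hr1 hr2.
have hd1 : holo_disc f (w + h1) (rho / 2) by apply: holo_discS fw; lra.
have hd2 : holo_disc f (w + h2) (rho / 2) by apply: holo_discS fw; lra.
have r0 : 0 < rho / 8 by lra.
have rr : 0 < rho / 8 < rho / 2 by apply/andP; split; lra.
have c1 := holo_disc_circ hd1 rr; have c2 := holo_disc_circ hd2 rr.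
have c1' : cctn (fun t => f (w + h1 + circ (rho / 8) t) - f (w + h1)) 0 T.
  by apply: cctnB => //; exact: cctn_cst.
have c2' : cctn (fun t => f (w + h2 + circ (rho / 8) t) - f (w + h2)) 0 T.
  by apply: cctnB => //; exact: cctn_cst.
rewrite -(mean_derive hd1 rr) -(mean_derive hd2 rr) -cmeanB; [|exact: quot_circ_cctn..].
under eq_fun do rewrite -mulrBl.
set L := 32 * K / rho * normc (h1 - h2).
apply: (@le_trans _ _ (2 * (2 * L / (rho / 8)))); last first.
  by rewrite le_eqVlt; apply/orP; left; apply/eqP; rewrite /L; field; rewrite gt_eqF.
apply: quot_circ_bound => //; first exact: cctnB.
move=> t; rewrite opprD addrACA -opprD.
apply: le_trans (le_normcD _ _) _; rewrite normcN mulr_natl mulr2n.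
apply: lerD; last by apply: lipschitz; lra.
rewrite -!addrA; set z := circ _ _.
have hz : normc z = rho / 8 by rewrite normc_circ// ltW.
rewrite /L (_ : h1 - h2 = (h1 + z) - (h2 + z)); last by ring.
by apply: lipschitz; apply: le_lt_trans (le_normcD _ _) _; lra.
Qed.

(** The mean value inequality for f(z) - f'(w) z, whose derivative on the segment is small by the
    Lipschitz bound for f'. The constant depends only on [K] and [rho], so the estimate is uniform
    over bounded families. *)
Lemma quadratic_estimate h : normc h < rho / 4 ->
  normc (f (w + h) - f w - cderive f w * h) <= 2048 * K / rho ^+ 2 * normc h ^+ 2.
Proof.
have rho0' := rho0; move=> hr.
have A0 : 0 <= 1024 * K / rho ^+ 2.
  by apply: divr_ge0; [apply: mulr_ge0 (ler0n _ _) K0|exact: sqr_ge0].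
have := @mvt_segment _ (fun z => f z - cderive f w * z) w h
  (1024 * K / rho ^+ 2 * normc h ^+ 2).
rewrite (_ : f (w + h) - _ - _ = f (w + h) - f w - cderive f w * h); last by ring.
move=> H; apply: (@le_trans _ _ (2 * (1024 * K / rho ^+ 2 * normc h ^+ 2))); last first.
  by rewrite le_eqVlt; apply/orP; left; apply/eqP; ring.
apply: H => t /andP[t0 t1].
have ht : normc (Complex t 0 * h) <= normc h.
  by rewrite normcM normc_real ger0_norm// ler_piMl// normc_ge0.
exists (cderive f (w + Complex t 0 * h) - cderive f w * 1).
  apply: has_cderivB; first by apply: fw; lra.
  by apply: has_cderivZ; exact: has_cderiv_id.
rewrite mulr1 normcM expr2 mulrA ler_wpM2r ?normc_ge0//.
have := @derive_lipschitz (Complex t 0 * h) 0.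
rewrite addr0 subr0 normc0 => H; apply: le_trans (H _ _) _; [lra|lra|].
exact: ler_wpM2l.
Qed.

End Local.

Let quot_regroup (a b c d p q h k : C) :
  (a - b) / k - (c - d) / k - h * ((p - q) / k) =
  (a - c - p * h - (b - d - q * h)) / k.
Proof. by ring. Qed.

(** Differentiation of [mean_derive] under the mean. The candidate for f''(w) is the circle mean of
    the difference quotient of f'; the error is the mean of (E(z) - E(0)) / z, where [E] is the
    second-order remainder of [f], of size |h|^2 uniformly near [w]. *)
Lemma derive_has_cderiv_bounded f w rho K : 0 < rho -> holo_disc f w rho ->
  (forall h, normc h < rho -> normc (f (w + h)) <= K) ->
  exists c, has_cderiv (cderive f) w c.
Proof.
move=> rho0 fw fK; have r0 : 0 < rho / 8 by lra.
have K0 : 0 <= K by apply: le_trans (normc_ge0 _) (fK 0 _); rewrite normc0.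
pose r := rho / 8; pose z t := circ r t.
have nz t : normc (z t) = r by rewrite normc_circ// ltW.
have cz : cctn z 0 T by exact: cctn_circ.
have cdz : cctn (fun t => cderive f (w + z t)) 0 T.
  apply/cctnP => t tT e e0.
  pose A := 1024 * K / rho ^+ 2 + 1.
  have A0 : 0 < A.
    apply: ltr_wpDl; last exact: ltr01.
    by apply: divr_ge0; [apply: mulr_ge0 (ler0n _ _) K0|exact: sqr_ge0].
  move/cctnP : cz => /(_ _ tT _ (divr_gt0 e0 A0))[d d0 H]; exists d => // s /H.
  rewrite ler_pdivlMr// => H'; apply: le_trans (derive_lipschitz rho0 fw fK _ _) _.
  - by rewrite nz /r; lra.
  - by rewrite nz /r; lra.
  apply: le_trans H'; rewrite mulrC ler_wpM2l ?normc_ge0// lerDl; exact: ler01.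
exists (cmean (fun t => (cderive f (w + z t) - cderive f w) / z t)).
have [B B0 HB] : exists2 B : R, 0 <= B & forall h u, normc u < rho / 4 ->
    normc h < rho / 8 -> normc (f (w + u + h) - f (w + u) - cderive f (w + u) * h) <=
    B * normc h ^+ 2.
  exists (2048 * K / (rho / 2) ^+ 2).
    by apply: divr_ge0; [apply: mulr_ge0 (ler0n _ _) K0|exact: sqr_ge0].
  move=> h u ur hr; apply: quadratic_estimate; [lra| | |lra].
    by apply: holo_discS fw; lra.
  move=> h' h'r; rewrite -addrA; apply: fK.
  by apply: le_lt_trans (le_normcD _ _) _; lra.
pose A := 4 * B / r + 1.
have A0 : 0 < A.
  apply: ltr_wpDl; last exact: ltr01.
  by apply: divr_ge0; [exact: mulr_ge0|exact: ltW].
have rr : 0 < r < rho / 2 by apply/andP; split; rewrite /r; lra.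
move=> e e0; exists (Num.min (rho / 8) (e / A)); first by rewrite lt_min r0 divr_gt0.
move=> h; rewrite lt_min => /andP[hr]; rewrite ltr_pdivlMr// => hA.
have hd1 : holo_disc f (w + h) (rho / 2) by apply: holo_discS fw; lra.
have hd2 : holo_disc f w (rho / 2).
  by have := @holo_discS f w rho 0 (rho / 2); rewrite addr0 normc0; apply => //; lra.
have c1 := holo_disc_circ hd1 rr; have c2 := holo_disc_circ hd2 rr.
pose E u := f (w + u + h) - f (w + u) - cderive f (w + u) * h.
have EB u : normc u < rho / 4 -> normc (E u) <= B * normc h ^+ 2.
  by move=> ur; exact: (HB _ _ ur hr).
have q3 : cctn (fun t => (cderive f (w + z t) - cderive f w) / z t) 0 T.
  by apply: (quot_circ_cctn r0); apply: (cctnB cdz); exact: cctn_cst.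
set M := cmean _; rewrite -(mean_derive hd1 rr) -(mean_derive hd2 rr).
rewrite [M * h]mulrC /M -(cmeanZ _ q3).
have k1 : cctn (fun t => (f (w + h + circ r t) - f (w + h)) / circ r t) 0 T.
  by apply: (quot_circ_cctn r0); apply: (cctnB c1); exact: cctn_cst.
have k2 : cctn (fun t => (f (w + circ r t) - f w) / circ r t) 0 T.
  by apply: (quot_circ_cctn r0); apply: (cctnB c2); exact: cctn_cst.
have k3 : cctn (fun t => h * ((cderive f (w + z t) - cderive f w) / z t)) 0 T.
  by apply: cctnM q3; exact: cctn_cst.
rewrite -(cmeanB k1 k2) -(cmeanB (cctnB k1 k2) k3).
rewrite (_ : (fun t => _) = fun t => (E (z t) - E 0) / circ r t); last first.
  apply/funext => t; rewrite /E /z addr0 [w + circ r t + h]addrAC.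
  exact: quot_regroup.
have cE : cctn (fun t => E (z t) - E 0) 0 T.
  apply: cctnB; last exact: cctn_cst.
  apply: cctnB; last by apply: (cctnM cdz); exact: cctn_cst.
  apply: (cctnB _ c2).
  by under eq_fun do rewrite [w + _ + h]addrAC.
apply: le_trans (quot_circ_bound (K := 2 * (B * normc h ^+ 2)) r0 cE _) _.
  move=> t; apply: le_trans (le_normcD _ _) _; rewrite normcN mulr_natl mulr2n.
  by apply: lerD; apply: EB; rewrite ?nz ?normc0 /r; lra.
have n0 := normc_ge0 h.
rewrite (_ : 2 * _ = (4 * B / r) * normc h * normc h); last first.
  by rewrite /r; field; rewrite gt_eqF.
rewrite ler_wpM2r//; apply: le_trans (ltW hA).
by rewrite mulrC ler_wpM2l// lerDl.
Qed.

Lemma derive_has_cderiv f w rho : 0 < rho -> holo_disc f w rho ->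
  exists c, has_cderiv (cderive f) w c.
Proof.
move=> rho0 fw; have := fw 0; rewrite normc0 addr0 => /(_ rho0) /has_cderiv_tends tf.
have [d d0 H] := tf _ ltr01.
apply: (@derive_has_cderiv_bounded f w (Num.min d rho) (normc (f w) + 1)).
- by rewrite lt_min d0.
- by move=> h; rewrite lt_min => /andP[_]; exact: fw.
- move=> h; rewrite lt_min => /andP[/H hd _].
  have -> : f (w + h) = f w + (f (w + h) - f w) by ring.
  by apply: le_trans (le_normcD _ _) _; rewrite lerD2l.
Qed.

Lemma analytic_holo_disc f z rho : analytic_rhp f -> rho <= complex.Re z ->
  holo_disc f z rho.
Proof.
move=> /analytic_has_cderiv fa zr h hr; apply: fa.
rewrite cReD; have := normc_Re h; rewrite ler_norml => /andP[h1 _]; lra.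
Qed.

Lemma analytic_cderive f : analytic_rhp f -> analytic_rhp (cderive f).
Proof.
move=> fa; apply/analytic_has_cderiv => z z0.
have [c fc] := derive_has_cderiv z0 (analytic_holo_disc fa (lexx _)).
by rewrite (cderiveP fc).
Qed.

End CauchyEstimates.

(** * Limits and combinations of analytic functions *)

Section AnalyticClosure.
Variable R : realType.
Local Notation C := (R[i]).
Implicit Types (f g : C -> C) (w z h : C).

Lemma real_cauchy_limit (u : nat -> R) :
  (forall e : R, 0 < e -> exists N, forall n m, (N <= n)%N -> (N <= m)%N ->
    `|u n - u m| <= e) ->
  exists l, forall e : R, 0 < e -> exists N, forall n, (N <= n)%N -> `|u n - l| <= e.
Proof.
move=> H; have : cvg (u @ \oo).
  apply/cauchy_cvgP/cauchy_exP => e e0.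
  have [N HN] := H _ (divr_gt0 e0 (ltr0n _ 2)).
  exists (u N); exists N => // n /= Nn; rewrite /ball/=.
  apply: le_lt_trans (HN _ _ (leqnn N) Nn) _.
  by rewrite ltr_pdivrMr// ltr_pMr// ltr1n.
move=> /cvg_ex[l /cvgrPdist_le ul]; exists l => e /ul[N _ HN]; exists N => n Nn.
by rewrite distrC; exact: HN.
Qed.

Lemma complex_cauchy_limit (u : nat -> C) :
  (forall e : R, 0 < e -> exists N, forall n m, (N <= n)%N -> (N <= m)%N ->
    normc (u n - u m) <= e) ->
  exists l, forall e : R, 0 < e -> exists N, forall n, (N <= n)%N -> normc (u n - l) <= e.
Proof.
move=> H.
have [a Ha] : exists l, forall e : R, 0 < e -> exists N, forall n, (N <= n)%N ->
    `|complex.Re (u n) - l| <= e.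
  apply: real_cauchy_limit => e /H[N HN]; exists N => n m Nn Nm.
  by apply: le_trans (HN _ _ Nn Nm); rewrite -cReN -cReD normc_Re.
have [b Hb] : exists l, forall e : R, 0 < e -> exists N, forall n, (N <= n)%N ->
    `|complex.Im (u n) - l| <= e.
  apply: real_cauchy_limit => e /H[N HN]; exists N => n m Nn Nm.
  by apply: le_trans (HN _ _ Nn Nm); rewrite -cImN -cImD normc_Im.
exists (Complex a b) => e e0.
have [N HN] := Ha _ (divr_gt0 e0 (ltr0n _ 2)).
have [N' HN'] := Hb _ (divr_gt0 e0 (ltr0n _ 2)).
exists (maxn N N') => n; rewrite geq_max => /andP[/HN h1 /HN' h2].
by apply: le_trans (normc_le_ReIm _) _; rewrite !reimE/= [e]splitr lerD.
Qed.

(** Pointwise convergence with a common bound is enough: the uniform quadratic estimate compares the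
    derivatives at [w] with difference quotients of one fixed step, which makes them a Cauchy
    sequence, and then passes to the limit. *)
Lemma weierstrass (F : nat -> C -> C) f w (rho K : R) : 0 < rho ->
  (forall n, holo_disc (F n) w rho) ->
  (forall n h, normc h < rho -> normc (F n (w + h)) <= K) ->
  (forall h, normc h < rho -> forall e : R, 0 < e -> exists N, forall n, (N <= n)%N ->
    normc (F n (w + h) - f (w + h)) <= e) ->
  exists c, has_cderiv f w c.
Proof.
move=> rho0 hF FK Ff.
have [A A0 HA] : exists2 A : R, 0 < A & forall n h, normc h < rho / 4 ->
    normc (F n (w + h) - F n w - cderive (F n) w * h) <= A * normc h ^+ 2.
  exists (2048 * K / rho ^+ 2 + 1).
    apply: ltr_wpDl; last exact: ltr01.
    have K0 : 0 <= K by apply: le_trans (normc_ge0 _) (FK 0%N 0 _); rewrite normc0.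
    by apply: divr_ge0; [apply: mulr_ge0 (ler0n _ _) K0|exact: sqr_ge0].
  move=> n h hr; apply: le_trans (quadratic_estimate rho0 (hF n) (FK n) hr) _.
  apply: ler_wpM2r; first exact: sqr_ge0.
  by rewrite lerDl; exact: ler01.
have Ff0 e : 0 < e -> exists N, forall n, (N <= n)%N -> normc (F n w - f w) <= e.
  by move=> e0; have := Ff 0; rewrite normc0 addr0; apply.
have [c Hc] : exists l, forall e : R, 0 < e -> exists N, forall n, (N <= n)%N ->
    normc (cderive (F n) w - l) <= e.
  apply: complex_cauchy_limit => e e0.
  (* The two quadratic errors take 2 A s^2 <= e s / 2 and the four values of [F] the remaining e s /
     2, each of them e s / 8. *)
  pose s := Num.min (rho / 8) (e / (4 * A)).
  have s0 : 0 < s by rewrite lt_min !divr_gt0// mulr_gt0.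
  have s1 : s < rho / 4 by apply: (@le_lt_trans _ _ (rho / 8)); [rewrite ge_min lexx|lra].
  have s2 : A * s <= e / 4.
    rewrite mulrC -ler_pdivlMr// -mulrA -invfM ge_min; apply/orP; right.
    by rewrite mulrC.
  pose h : C := Complex s 0.
  have hs : normc h = s by rewrite normc_real gtr0_norm.
  have es0 : 0 < e * s / 8 by rewrite divr_gt0// mulr_gt0.
  have [|N HN] := Ff h _ _ es0; first by rewrite hs; lra.
  have [N' HN'] := Ff0 _ es0.
  exists (maxn N N') => n m; rewrite !geq_max => /andP[n1 n2] /andP[m1 m2].
  have k1 := HA n h; have k2 := HA m h; rewrite hs in k1 k2.
  have {}k1 := k1 s1; have {}k2 := k2 s1.
  have a1 := HN _ n1; have a2 := HN _ m1; have a3 := HN' _ n2; have a4 := HN' _ m2.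
  rewrite -(ler_pM2r s0) -{1}hs -normcM.
  set a := F n (w + h) in k1 a1; set b := F m (w + h) in k2 a2.
  set p := F n w in k1 a3; set q := F m w in k2 a4.
  set x := cderive (F n) w in k1 *; set y := cderive (F m) w in k2 *.
  have -> : (x - y) * h = (a - f (w + h)) - (b - f (w + h)) - (p - f w) + (q - f w)
      - (a - p - x * h) + (b - q - y * h) by ring.
  have tri u v (k l : R) : normc u <= k -> normc v <= l -> normc (u + v) <= k + l.
    by move=> uk vl; apply: le_trans (le_normcD _ _) _; exact: lerD.
  have triN u v (k l : R) : normc u <= k -> normc v <= l -> normc (u - v) <= k + l.
    by move=> uk vl; apply: tri; rewrite ?normcN.
  apply: le_trans (tri _ _ _ _ (triN _ _ _ _ (tri _ _ _ _ (triN _ _ _ _ (triN _ _ _ _ a1 a2) a3) a4) k1) k2) _.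
  have As : A * s ^+ 2 <= e / 4 * s by rewrite expr2 mulrA ler_pM2r.
  by clearbody s; clear - As; lra.
exists c => e e0.
exists (Num.min (rho / 8) (e / A)); first by rewrite lt_min !divr_gt0.
move=> h; rewrite lt_min => /andP[hr]; rewrite ltr_pdivlMr// => hA.
have hr4 : normc h < rho / 4 by lra.
have hr1 : normc h < rho by lra.
have n0 := normc_ge0 h.
apply: (@le_trans _ _ (A * normc h ^+ 2)); last first.
  by rewrite expr2 mulrA ler_wpM2r// mulrC ltW.
apply/ler_addgt0Pr => d d0.
have d30 : 0 < d / 3 by lra.
have dh0 : 0 < d / 3 / (normc h + 1) by rewrite divr_gt0// ltr_wpDl.
have [N HN] := Ff h hr1 _ d30; have [N' HN'] := Ff0 _ d30.
have [N'' HN''] := Hc _ dh0.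
pose n := maxn N (maxn N' N'').
have a1 : normc (F n (w + h) - f (w + h)) <= d / 3 by apply: HN; rewrite leq_maxl.
have a2 : normc (F n w - f w) <= d / 3.
  by apply: HN'; rewrite leq_max leq_maxl orbT.
have a3 : normc ((cderive (F n) w - c) * h) <= d / 3.
  rewrite normcM; apply: (@le_trans _ _ (d / 3 / (normc h + 1) * normc h)).
    by rewrite ler_wpM2r// HN''// leq_max leq_maxr orbT.
  rewrite mulrAC ler_pdivrMr ?ltr_wpDl// ler_pM2l//.
  by rewrite lerDl; exact: ler01.
have a4 := HA n h hr4.
set a := F n (w + h) in a1 a4; set p := F n w in a2 a4.
set x := cderive (F n) w in a3 a4.
have -> : f (w + h) - f w - c * h = (a - p - x * h) - (a - f (w + h)) + (p - f w)
   + (x - c) * h by ring.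
have tri u v (k l : R) : normc u <= k -> normc v <= l -> normc (u + v) <= k + l.
  by move=> uk vl; apply: le_trans (le_normcD _ _) _; exact: lerD.
have triN u v (k l : R) : normc u <= k -> normc v <= l -> normc (u - v) <= k + l.
  by move=> uk vl; apply: tri; rewrite ?normcN.
apply: le_trans (tri _ _ _ _ (tri _ _ _ _ (triN _ _ _ _ a4 a1) a2) a3) _.
lra.
Qed.

Lemma analyticD f g : analytic_rhp f -> analytic_rhp g ->
  analytic_rhp (fun z => f z + g z).
Proof.
move=> /analytic_has_cderiv fa /analytic_has_cderiv ga z z0.
by have [] := has_cderiv_derivable (has_cderivD (fa _ z0) (ga _ z0)).
Qed.

Lemma analyticM f g : analytic_rhp f -> analytic_rhp g ->
  analytic_rhp (fun z => f z * g z).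
Proof.
move=> /analytic_has_cderiv fa /analytic_has_cderiv ga z z0.
by have [] := has_cderiv_derivable (has_cderivM (fa _ z0) (ga _ z0)).
Qed.

Lemma cderiveM f g z : analytic_rhp f -> analytic_rhp g -> 0 < complex.Re z ->
  cderive (fun z => f z * g z) z = cderive f z * g z + f z * cderive g z.
Proof.
move=> /analytic_has_cderiv fa /analytic_has_cderiv ga z0.
exact: cderiveP (has_cderivM (fa _ z0) (ga _ z0)).
Qed.

Lemma analyticZ f c : analytic_rhp f -> analytic_rhp (fun z => c * f z).
Proof.
move=> /analytic_has_cderiv fa z z0.
by have [] := has_cderiv_derivable (has_cderivZ c (fa _ z0)).
Qed.

Lemma has_cderiv_shift f z (a : R) c : has_cderiv f (z + Complex a 0) c ->
  has_cderiv (fun u => f (u + Complex a 0)) z c.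
Proof. by move=> H e /H[d d0 {}H]; exists d => // h /H; rewrite [z + h + _]addrAC. Qed.

Lemma analytic_shift f (a : R) : 0 <= a -> analytic_rhp f ->
  analytic_rhp (fun z => f (z + Complex a 0)).
Proof.
move=> a0 /analytic_has_cderiv fa z z0.
have za0 : 0 < complex.Re (z + Complex a 0) by rewrite cReD/= ltr_pwDl.
by have [] := has_cderiv_derivable (has_cderiv_shift (fa _ za0)).
Qed.

End AnalyticClosure.

(** * Square-integrable functions and strips *)

Section L2Theory.
Context d (T : measurableType d) (R : realType).
Variables (mu : {measure set T -> \bar R}) (D : set T).
Local Notation C := (R[i]).
Implicit Types (p q s : T -> C).

Definition cmeas p := measurable_fun D (fun x => complex.Re (p x)) /\
  measurable_fun D (fun x => complex.Im (p x)).

Definition energy p : \bar R := \int[mu]_(x in D) (sqmod (p x))%:E.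

Definition sqint p := cmeas p /\ (energy p < +oo)%E.

(** The real part of z times the conjugate of w, so [ip] is a real inner product. Complex
    orthogonality is recovered at the end by testing also with -i times a Zen function. *)
Definition cdot (z w : C) : R :=
  complex.Re z * complex.Re w + complex.Im z * complex.Im w.

Definition ip p q : R := \int[mu]_(x in D) cdot (p x) (q x).

Hypothesis mD : measurable D.

Lemma cmeasD p q : cmeas p -> cmeas q -> cmeas (fun x => p x + q x).
Proof.
move=> [p1 p2] [q1 q2]; split.
  by under eq_fun do rewrite cReD; exact: measurable_funD.
by under eq_fun do rewrite cImD; exact: measurable_funD.
Qed.

Lemma cmeasM p q : cmeas p -> cmeas q -> cmeas (fun x => p x * q x).
Proof.
move=> [p1 p2] [q1 q2]; split.
  by under eq_fun do rewrite cReM; apply: measurable_funB; exact: measurable_funM.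
by under eq_fun do rewrite cImM; apply: measurable_funD; exact: measurable_funM.
Qed.

Lemma cmeas_cst (c : C) : cmeas (fun=> c).
Proof. by split; exact: measurable_cst. Qed.

Lemma cmeasZ c p : cmeas p -> cmeas (fun x => c * p x).
Proof. by apply: cmeasM; exact: cmeas_cst. Qed.

Lemma cmeasJ p : cmeas p -> cmeas (fun x => conjc (p x)).
Proof.
move=> [p1 p2]; split; first by under eq_fun do rewrite cReJ.
by under eq_fun do rewrite cImJ; exact: measurableT_comp.
Qed.

Lemma cmeas_cdot p q : cmeas p -> cmeas q ->
  measurable_fun D (fun x => cdot (p x) (q x)).
Proof.
by move=> [p1 p2] [q1 q2]; apply: measurable_funD; exact: measurable_funM.
Qed.

Lemma cdotzz (z : C) : cdot z z = sqmod z.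
Proof. by rewrite /cdot /sqmod !expr2. Qed.

Lemma cmeas_sqmod p : cmeas p -> measurable_fun D (fun x => sqmod (p x)).
Proof.
by move=> mp; under eq_fun do rewrite -cdotzz; exact: cmeas_cdot.
Qed.

Lemma cmeas_esqmod p : cmeas p -> measurable_fun D (fun x => (sqmod (p x))%:E).
Proof. by move=> mp; apply/measurable_EFinP; exact: cmeas_sqmod. Qed.

Lemma energy_ge0 p : (0 <= energy p)%E.
Proof. by apply: integral_ge0 => x _; rewrite lee_fin sqmod_ge0. Qed.

Lemma cdotC (z w : C) : cdot z w = cdot w z.
Proof. by rewrite /cdot mulrC [X in _ + X]mulrC. Qed.

Lemma cdotDl (z w u : C) : cdot (z + w) u = cdot z u + cdot w u.
Proof. by rewrite /cdot !reimE; ring. Qed.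

Lemma cdotZl (t : R) (w u : C) : cdot (Complex t 0 * w) u = t * cdot w u.
Proof. by rewrite /cdot !reimE/=; ring. Qed.

Lemma sqmodD_le (z w : C) : sqmod (z + w) <= 2 * sqmod z + 2 * sqmod w.
Proof.
rewrite -subr_ge0 (_ : _ - _ = sqmod (z - w)) ?sqmod_ge0//.
by rewrite /sqmod !reimE; ring.
Qed.

Lemma cdot_le (z w : C) : `|cdot z w| <= sqmod z + sqmod w.
Proof.
have h1 := sqmod_ge0 (z - w); have h2 := sqmod_ge0 (z + w).
have h3 := sqmod_ge0 z; have h4 := sqmod_ge0 w.
have e1 : sqmod (z - w) = sqmod z + sqmod w - 2 * cdot z w.
  by rewrite /sqmod /cdot !reimE; ring.
have e2 : sqmod (z + w) = sqmod z + sqmod w + 2 * cdot z w.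
  by rewrite /sqmod /cdot !reimE; ring.
by rewrite ler_norml; apply/andP; split; lra.
Qed.

Lemma sqint_sqmod p : sqint p -> mu.-integrable D (EFin \o (fun x => sqmod (p x))).
Proof.
move=> [mp Ep]; apply/integrableP; split; first exact: cmeas_esqmod.
by under eq_integral do rewrite /= ger0_norm ?sqmod_ge0//.
Qed.

Lemma sqint_cdot p q : sqint p -> sqint q ->
  mu.-integrable D (EFin \o (fun x => cdot (p x) (q x))).
Proof.
move=> hp hq.
apply: (@le_integrable _ _ _ mu D mD _ ((EFin \o (fun x => sqmod (p x))) \+
   (EFin \o (fun x => sqmod (q x))))).
- by apply/measurable_EFinP; apply: cmeas_cdot; [case: hp|case: hq].
- move=> x _; rewrite /= lee_fin; apply: le_trans (cdot_le _ _) _.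
  by rewrite ger0_norm// addr_ge0// sqmod_ge0.
- by apply: integrableD => //; exact: sqint_sqmod.
Qed.

Lemma energy_fin p : sqint p -> energy p = (fine (energy p))%:E.
Proof. by move=> [_ Ep]; rewrite fineK// ge0_fin_numE// energy_ge0. Qed.

Lemma ipE p : ip p p = fine (energy p).
Proof. by rewrite /ip /Rintegral; under eq_integral do rewrite cdotzz. Qed.

Lemma energyE p : sqint p -> energy p = (ip p p)%:E.
Proof. by move=> hp; rewrite ipE -energy_fin. Qed.

Lemma energyZ c p : cmeas p -> energy (fun x => c * p x) = ((sqmod c)%:E * energy p)%E.
Proof.
move=> mp; rewrite /energy -ge0_integralZl_EFin ?sqmod_ge0//.
- by under eq_integral do rewrite sqmodM EFinM.
- by move=> x _; rewrite lee_fin sqmod_ge0.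
- exact: cmeas_esqmod.
Qed.

Lemma sqintZ c p : sqint p -> sqint (fun x => c * p x).
Proof.
move=> [mp Ep]; split; first exact: cmeasZ.
by rewrite energyZ// lte_mul_pinfty// ?lee_fin ?sqmod_ge0.
Qed.

Lemma energyD_le p q : cmeas p -> cmeas q ->
  (energy (fun x => (p x + q x)%R) <= 2%:E * energy p + 2%:E * energy q)%E.
Proof.
move=> mp mq.
have m1 := cmeas_esqmod mp; have m2 := cmeas_esqmod mq.
have g1 x : D x -> (0 <= (sqmod (p x))%:E)%E by rewrite lee_fin sqmod_ge0.
have g2 x : D x -> (0 <= (sqmod (q x))%:E)%E by rewrite lee_fin sqmod_ge0.
rewrite /energy -!ge0_integralZl_EFin// -ge0_integralD//.
- apply: ge0_le_integral => //.
  + by move=> x _; rewrite lee_fin sqmod_ge0.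
  + by apply: cmeas_esqmod; exact: cmeasD.
  + by apply: emeasurable_funD; exact: measurable_funeM.
  + by move=> x _; rewrite -!EFinM -EFinD lee_fin sqmodD_le.
- by move=> x Dx; rewrite mule_ge0// g1.
- exact: measurable_funeM.
- by move=> x Dx; rewrite mule_ge0// g2.
- exact: measurable_funeM.
Qed.

Lemma sqintD p q : sqint p -> sqint q -> sqint (fun x => p x + q x).
Proof.
move=> [mp Ep] [mq Eq]; split; first exact: cmeasD.
apply: le_lt_trans (energyD_le mp mq) _.
by rewrite lte_add_pinfty// lte_mul_pinfty.
Qed.

Lemma sqintB p q : sqint p -> sqint q -> sqint (fun x => p x - q x).
Proof.
move=> hp hq; under eq_fun do rewrite -[- q _]mulN1r.
by apply: sqintD => //; exact: sqintZ.
Qed.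

Lemma ipC p q : ip p q = ip q p.
Proof. by rewrite /ip; under eq_Rintegral do rewrite cdotC. Qed.

Lemma ipDl p q s : sqint p -> sqint q -> sqint s ->
  ip (fun x => p x + q x) s = ip p s + ip q s.
Proof.
move=> hp hq hs; rewrite /ip; under eq_Rintegral do rewrite cdotDl.
by rewrite RintegralD//; exact: sqint_cdot.
Qed.

Lemma ipZl (t : R) p s : sqint p -> sqint s ->
  ip (fun x => Complex t 0 * p x) s = t * ip p s.
Proof.
move=> hp hs; rewrite /ip; under eq_Rintegral do rewrite cdotZl.
by rewrite RintegralZl//; exact: sqint_cdot.
Qed.

Lemma ipDr p q s : sqint p -> sqint q -> sqint s ->
  ip s (fun x => p x + q x) = ip s p + ip s q.
Proof. by move=> hp hq hs; rewrite ipC ipDl// ipC [ip q s]ipC. Qed.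

Lemma ipZr (t : R) p s : sqint p -> sqint s ->
  ip s (fun x => Complex t 0 * p x) = t * ip s p.
Proof. by move=> hp hs; rewrite ipC ipZl// ipC. Qed.

Lemma ipBl p q s : sqint p -> sqint q -> sqint s ->
  ip (fun x => p x - q x) s = ip p s - ip q s.
Proof.
move=> hp hq hs; rewrite -mulN1r -ipZl// -ipDl//; last exact: sqintZ.
congr ip; apply/funext => x; rewrite (_ : Complex (-1) 0 = -1 :> C) ?mulN1r//.
by apply: complex_ext; rewrite /= ?oppr0.
Qed.

Lemma ipBr p q s : sqint p -> sqint q -> sqint s ->
  ip s (fun x => p x - q x) = ip s p - ip s q.
Proof. by move=> hp hq hs; rewrite ipC ipBl// ipC [ip q s]ipC. Qed.

Lemma ip_ge0 p : 0 <= ip p p.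
Proof. by rewrite ipE fine_ge0// energy_ge0. Qed.

Lemma ip_quad (t : R) p q : sqint p -> sqint q ->
  ip (fun x => p x + Complex t 0 * q x) (fun x => p x + Complex t 0 * q x) =
  ip p p + 2 * t * ip p q + t ^+ 2 * ip q q.
Proof.
move=> hp hq; have hz := sqintZ (Complex t 0) hq.
have hs := sqintD hp hz.
by rewrite ipDl// !ipDr// !ipZl// !ipZr// (ipC q p); ring.
Qed.

Lemma quad_discr (a b c : R) : 0 <= a -> 0 <= c ->
  (forall t, 0 <= a + 2 * t * b + t ^+ 2 * c) -> b ^+ 2 <= a * c.
Proof.
move=> a0 c0 H; have [c0'|c0'] := eqVneq c 0.
  subst c; have [->|b0] := eqVneq b 0; first by rewrite expr0n/= mulr0.
  (* With c = 0 the polynomial is affine, and it equals -1 at this point. *)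
  have := H (- (a + 1) / (2 * b)); rewrite mulr0 addr0.
  rewrite (_ : 2 * _ * b = - (a + 1)); last by field.
  by lra.
have cp : 0 < c by rewrite lt_neqAle eq_sym c0'.
have := H (- b / c).
rewrite (_ : a + _ + _ = (a * c - b ^+ 2) / c); last by field.
by rewrite pmulr_lge0 ?invr_gt0// subr_ge0.
Qed.

Lemma ip_CS p q : sqint p -> sqint q -> ip p q ^+ 2 <= ip p p * ip q q.
Proof.
move=> hp hq; apply: quad_discr; rewrite ?ip_ge0// => t.
by rewrite -ip_quad// ip_ge0.
Qed.

Lemma ip_CS_sqrt p q : sqint p -> sqint q ->
  `|ip p q| <= Num.sqrt (ip p p) * Num.sqrt (ip q q).
Proof.
move=> hp hq; rewrite -sqrtrM ?ip_ge0// -sqrtr_sqr ler_sqrt ?ip_CS//.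
by rewrite mulr_ge0// ip_ge0.
Qed.

Lemma energy_fatou (F : nat -> T -> C) p (M : \bar R) :
  (forall n, cmeas (F n)) -> cmeas p ->
  (forall x, D x -> (fun n => (sqmod (F n x))%:E) @ \oo --> (sqmod (p x))%:E) ->
  (exists N, forall n, (N <= n)%N -> (energy (F n) <= M)%E) -> (energy p <= M)%E.
Proof.
move=> mF mp Fp [N HN].
have := @fatou _ _ _ mu D mD (fun n x => (sqmod (F n x))%:E) (fun n => cmeas_esqmod (mF n)).
have g0 n x : D x -> (0 <= (sqmod (F n x))%:E)%E by rewrite lee_fin sqmod_ge0.
move=> /(_ g0); rewrite (@eq_integral _ _ _ mu D (fun x => (sqmod (p x))%:E)); last first.
  by move=> x; rewrite inE => Dx; apply: (cvg_limn_einf_sup (Fp x Dx)).1.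
move=> H; apply: (le_trans H).
rewrite limn_einf_lim; apply: lime_le.
  by apply: ereal_nondecreasing_is_cvgn; exact: nondecreasing_einfs.
near=> n; apply: (@le_trans _ _ (energy (F n))); last first.
  by apply: HN; near: n; exists N.
by apply: ereal_inf_lbound; exists n => /=.
Unshelve. all: by end_near. Qed.

End L2Theory.

(** * Tonelli's theorem and measurability on strips *)

Section Strips.
Variable R : realType.
Local Notation leb := (@lebesgue_measure R).
Local Notation RT := (measurableTypeR R).

Section Tonelli.
Variable m1 : {sigma_finite_measure set RT -> \bar R}.
Variables (A : set RT) (F : plane R -> \bar R).
Hypotheses (mA : measurable A) (mF : measurable_fun (A `*` setT) F).
Hypothesis F0 : forall p, A p.1 -> (0 <= F p)%E.

Let D : set (plane R) := A `*` setT.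
Let mD : measurable D. Proof. exact: measurableX. Qed.
Let G := F \_ D.
Let G0 p : (0 <= G p)%E.
Proof. by apply: erestrict_ge0 => q [/= Aq _]; exact: F0. Qed.
Let mG : measurable_fun setT G.
Proof. exact/(measurable_restrictT _ _).1. Qed.
Let GE x y : A x -> G (x, y) = F (x, y).
Proof. by move=> Ax; rewrite /G patchE mem_set. Qed.
Let GN x y : ~ A x -> G (x, y) = 0%E.
Proof. by move=> Ax; rewrite /G patchE memNset// => -[]. Qed.

Lemma tonelli_strip :
  (\int[(m1 \x leb)%E]_(p in A `*` setT) F p = \int[m1]_(x in A) \int[leb]_y F (x, y))%E.
Proof.
rewrite integral_mkcond (fubini_tonelli1 _ mG G0) [RHS]integral_mkcond.
apply: eq_integral => x _; rewrite /fubini_F patchE; case: ifPn => [|].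
  by rewrite inE => Ax; apply: eq_integral => y _; rewrite -/(G _) GE.
by rewrite notin_setE => Ax; apply: integral0_eq => y _; rewrite -/(G _) GN.
Qed.

Lemma measurable_strip_inner : measurable_fun A (fun x => \int[leb]_y F (x, y))%E.
Proof.
have := measurable_fun_fubini_tonelli_F (m2 := leb) G mG G0.
move=> /(measurable_funS measurableT (@subsetT _ A)); apply: eq_measurable_fun.
by move=> x; rewrite inE => Ax; apply: eq_integral => y _; rewrite GE.
Qed.

Lemma measurable_strip_outer :
  measurable_fun setT (fun y => \int[m1]_(x in A) F (x, y))%E.
Proof.
have := measurable_fun_fubini_tonelli_G (m1 := m1) G mG G0.
apply: eq_measurable_fun => y _; rewrite /fubini_G [RHS]integral_mkcond.
apply: eq_integral => x _; rewrite patchE; case: ifPn => [|].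
  by rewrite inE => /GE.
by rewrite notin_setE => /GN.
Qed.

Lemma tonelli_strip_swap :
  (\int[m1]_(x in A) \int[leb]_y F (x, y) = \int[leb]_y \int[m1]_(x in A) F (x, y))%E.
Proof.
have := fubini_tonelli (m1 := m1) (m2 := leb) G mG G0.
rewrite [LHS](_ : _ = \int[m1]_(x in A) \int[leb]_y F (x, y))%E; last first.
  rewrite [RHS]integral_mkcond; apply: eq_integral => x _.
  rewrite patchE; case: ifPn => [|].
    by rewrite inE => Ax; apply: eq_integral => y _; rewrite GE.
  by rewrite notin_setE => Ax; apply: integral0_eq => y _; rewrite GN.
move=> ->; apply: eq_integral => y _.
rewrite [RHS]integral_mkcond; apply: eq_integral => x _.
rewrite patchE; case: ifPn => [|]; first by rewrite inE => /GE.
by rewrite notin_setE => /GN.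
Qed.

End Tonelli.

Lemma rhpE : @rhp R = (`]0%R, +oo[%classic : set RT) `*` setT.
Proof.
apply/seteqP; split=> -[x y]; rewrite /rhp/= in_itv/= andbT; first by split.
by case.
Qed.

Lemma crhpE : @crhp R = (`[0%R, +oo[%classic : set RT) `*` setT.
Proof.
apply/seteqP; split=> -[x y]; rewrite /crhp/= in_itv/= andbT; first by split.
by case.
Qed.

Lemma measurable_rhp : measurable (@rhp R).
Proof. by rewrite rhpE; exact: measurableX. Qed.

Lemma measurable_crhp : measurable (@crhp R).
Proof. by rewrite crhpE; exact: measurableX. Qed.

(* The value at (x, y) is the limit of the values at (x_n, y), where x_n is the
   right end of the interval of length 1/(n+1) containing x. *)
Lemma caratheodory (phi : R -> R -> R) :
  (forall x y, 0 < x -> {for x, continuous (phi^~ y)}) ->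
  (forall x, 0 < x -> measurable_fun setT (phi x)) ->
  measurable_fun (@rhp R) (fun p : plane R => phi p.1 p.2).
Proof.
move=> cphi mphi.
pose st (n : nat) (x : R) : R := (Num.truncn (x * n.+1%:R)).+1%:R / n.+1%:R.
pose h n (p : plane R) := phi (st n p.1) p.2.
apply: (@measurable_fun_cvg _ _ _ _ h) => [n|[x y]]; last first.
  rewrite /rhp/= => x0; apply/cvgrPdist_le => e e0.
  have := cphi _ y x0; move=> /cvgrPdist_le /(_ _ e0)[d /= d0 H].
  near=> n; apply: H; rewrite /ball/=.
  have n0 : (0 : R) < n.+1%:R by rewrite ltr0n.
  have xn0 : 0 <= x * n.+1%:R by rewrite mulr_ge0// ltW.
  have /andP[h1 h2] := truncn_itv xn0.
  have k1 : x < st n x by rewrite /st ltr_pdivlMr.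
  have k2 : st n x <= x + n.+1%:R^-1.
    rewrite /st -(ler_pM2r n0) divfK ?gt_eqF// mulrDl mulVf ?gt_eqF//.
    by rewrite -natr1 lerD2r.
  have k3 : n.+1%:R^-1 < d :> R.
    near: n; have [N _ HN] := near_infty_natSinv_lt (PosNum d0); exists N => //.
  rewrite ltr0_norm ?subr_lt0// opprB ltrBlDl; apply: le_lt_trans k2 _.
  by rewrite ltrD2l.
pose E k : set (plane R) := ((`]0%R, +oo[%classic `&`
  `[(k%:R / n.+1%:R)%R, (k.+1%:R / n.+1%:R)[%classic) : set RT) `*` setT.
have -> : @rhp R = \bigcup_k E k.
  apply/seteqP; split=> [[x y]|[x y] [k _ [[]]]]; rewrite /rhp/= ?in_itv/= ?andbT//.
  move=> x0; exists (Num.truncn (x * n.+1%:R)) => //; split=> //; split => /=.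
    by rewrite in_itv/= x0.
  rewrite in_itv/=; have n0 : (0 : R) < n.+1%:R by rewrite ltr0n.
  have xn0 : 0 <= x * n.+1%:R by rewrite mulr_ge0// ltW.
  have /andP[h1 h2] := truncn_itv xn0.
  by rewrite ler_pdivrMr// ltr_pdivlMr// h1 h2.
have mE k : measurable (E k) by apply: measurableX => //; exact: measurableI.
have [_ ] := measurable_fun_bigcup (h n) mE; apply => k.
apply: (@eq_measurable_fun _ _ _ _ _ (phi (k.+1%:R / n.+1%:R) \o snd)).
  move=> [x y]; rewrite inE/= => -[[/=]]; rewrite !in_itv/= andbT => x0 /andP[h1 h2] _.
  have n0 : (0 : R) < n.+1%:R by rewrite ltr0n.
  rewrite /h /st/= (@truncn_def _ _ k)//.
  by move: h1 h2; rewrite ler_pdivrMr// ltr_pdivlMr// => -> ->.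
apply: (@measurable_funS _ _ _ _ setT) => //.
apply: measurableT_comp => //; apply: mphi; by rewrite divr_gt0// ltr0n.
Unshelve. all: by end_near. Qed.

Definition line (f : R[i] -> R[i]) (x y : R) : R[i] := f (Complex x y).

Lemma line_ctn_y f x y : analytic_rhp f -> 0 < x ->
  {for y, continuous (fun t => complex.Re (line f x t))} /\
  {for y, continuous (fun t => complex.Im (line f x t))}.
Proof.
move=> /analytic_has_cderiv fa x0; have := fa (Complex x y) x0.
exact: has_cderiv_ctn_y.
Qed.

Lemma line_ctn_x f x y : analytic_rhp f -> 0 < x ->
  {for x, continuous (fun t => complex.Re (line f t y))} /\
  {for x, continuous (fun t => complex.Im (line f t y))}.
Proof.
move=> /analytic_has_cderiv fa x0; have := fa (Complex x y) x0.
exact: has_cderiv_ctn_x.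
Qed.

Lemma line_cmeas f x : analytic_rhp f -> 0 < x -> cmeas setT (line f x : RT -> R[i]).
Proof.
by move=> fa x0; split; apply: continuous_measurable_fun => y;
  have [] := line_ctn_y y fa x0.
Qed.

Lemma analytic_cmeas f : analytic_rhp f ->
  cmeas (@rhp R) (fun p : plane R => f (cplx p)).
Proof.
move=> fa; split.
- apply: (@caratheodory (fun x y => complex.Re (line f x y))) => [x y x0|x x0].
    by have [] := line_ctn_x y fa x0.
  by have [] := line_cmeas fa x0.
- apply: (@caratheodory (fun x y => complex.Im (line f x y))) => [x y x0|x x0].
    by have [] := line_ctn_x y fa x0.
  by have [] := line_cmeas fa x0.
Qed.

End Strips.

(** * Energies on vertical lines *)

Section Shift.
Variable R : realType.
Local Notation leb := (@lebesgue_measure R).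
Local Notation RT := (measurableTypeR R).
Local Notation C := (R[i]).
Implicit Types (f g : C -> C).

Lemma leb_pushforward_integral (phi : RT -> RT) (F : R -> \bar R) :
  measurable_fun setT phi ->
  (forall A : set RT, measurable A -> pushforward leb phi A = leb A) ->
  measurable_fun setT F -> (forall x, (0 <= F x)%E) ->
  (\int[leb]_x F (phi x) = \int[leb]_x F x)%E.
Proof.
move=> mphi hphi mF F0.
transitivity (\int[pushforward leb phi]_(x in setT) F x)%E.
  by rewrite ge0_integral_pushforward.
by apply: eq_measure_integral => //= A mA _; exact: hphi.
Qed.

Lemma leb_translate (c : R) (F : R -> \bar R) : measurable_fun setT F ->
  (forall x, (0 <= F x)%E) -> (\int[leb]_x F (c + x)%R = \int[leb]_x F x)%E.
Proof.
move=> mF F0; have mphi : measurable_fun setT ((fun x => c + x) : RT -> RT).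
  by apply: measurable_funD => //; exact: measurable_cst.
apply: (@leb_pushforward_integral (fun x => c + x)) => // A mA.
pose phi : {mfun RT >-> RT} := HB.pack ((fun x => c + x) : RT -> RT)
  (isMeasurableFun.Build _ _ _ _ _ mphi).
apply/esym/(@lebesgue_measure_unique _ (pushforward leb phi)) => //= _ [[a b]] _ <-.
rewrite /pushforward /= (_ : _ @^-1` _ = `](a - c), (b - c)]%classic); last first.
  by apply/seteqP; split=> x /=; rewrite !in_itv/= ltrBlDl lerBrDl.
rewrite !lebesgue_measure_itv/= !lte_fin ltrD2r; case: ifPn => // _.
by rewrite -!EFinB; congr (_%:E); ring.
Qed.

Lemma leb_reflect (c : R) (F : R -> \bar R) : measurable_fun setT F ->
  (forall x, (0 <= F x)%E) -> (\int[leb]_x F (c - x)%R = \int[leb]_x F x)%E.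
Proof.
move=> mF F0; have mphi : measurable_fun setT ((fun x => c - x) : RT -> RT).
  by apply: measurable_funB => //; exact: measurable_cst.
apply: (@leb_pushforward_integral (fun x => c - x)) => // A mA.
pose phi : {mfun RT >-> RT} := HB.pack ((fun x => c - x) : RT -> RT)
  (isMeasurableFun.Build _ _ _ _ _ mphi).
apply/esym/(@lebesgue_measure_unique _ (pushforward leb phi)) => //= _ [[a b]] _ <-.
(* The reflection exchanges the open and the closed end of the generating interval, which does not
   change its length. *)
rewrite /pushforward /= (_ : _ @^-1` _ = `[(c - b), (c - a)[%classic); last first.
  apply/seteqP; split=> x /=; rewrite !in_itv/= => /andP[h1 h2];
  by apply/andP; split; lra.
rewrite !lebesgue_measure_itv/= !lte_fin ltrD2l ltrN2; case: ifPn => // _.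
by rewrite -!EFinB; congr (_%:E); ring.
Qed.

(** An integrable nonnegative function cannot stay above [e] on a whole half-line. It supplies
    heights beyond [k] at which the horizontal sides of a Cauchy rectangle are negligible. *)
Lemma tail_small (P : R -> \bar R) (e k : R) : measurable_fun setT P ->
  (forall y, (0 <= P y)%E) -> (\int[leb]_y P y < +oo)%E -> 0 < e ->
  exists2 N, k <= N & (P N <= e%:E)%E.
Proof.
move=> mP P0 iP e0; apply: contrapT => H.
have H' y : k <= y -> (e%:E <= P y)%E.
  by move=> ky; rewrite leNgt; apply/negP => Py; apply: H; exists y => //; exact: ltW.
have : (\int[leb]_(y in `[k, +oo[) e%:E <= \int[leb]_y P y)%E.
  apply: (@le_trans _ _ (\int[leb]_(y in `[k, +oo[) P y)%E).
    apply: ge0_le_integral => //.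
    - by move=> y _; rewrite lee_fin ltW.
    - exact: measurable_funTS.
    - by move=> y; rewrite /= in_itv/= andbT => /H'.
  by apply: ge0_subset_integral.
rewrite integral_cst//= lebesgue_measure_itv/= ltry mulry gtr0_sg// mul1e.
by rewrite leNgt iP.
Qed.

Lemma tail_small_neg (P : R -> \bar R) (e k : R) : measurable_fun setT P ->
  (forall y, (0 <= P y)%E) -> (\int[leb]_y P y < +oo)%E -> 0 < e ->
  exists2 N, k <= N & (P (- N)%R <= e%:E)%E.
Proof.
move=> mP P0 iP e0; apply: (@tail_small (fun y => P (- y)%R)) => //.
  by apply: measurableT_comp => //; exact: measurable_funN.
have := @leb_reflect 0 P mP P0; under eq_integral do rewrite sub0r.
by move=> ->.
Qed.

Definition en f (x : R) : \bar R := energy leb setT (line f x : RT -> C).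

Lemma en_ge0 f x : (0 <= en f x)%E.
Proof. exact: energy_ge0. Qed.

Let msq f : analytic_rhp f -> measurable_fun (`]0%R, +oo[%classic `*` setT : set (plane R))
   (fun p : plane R => (sqmod (f (cplx p)))%:E).
Proof. by move=> fa; rewrite -rhpE; apply: cmeas_esqmod; exact: analytic_cmeas. Qed.

Lemma measurable_en f : analytic_rhp f -> measurable_fun (`]0%R, +oo[%classic : set RT) (en f).
Proof.
move=> fa; apply: (@measurable_strip_inner _ `]0%R, +oo[%classic
   (fun p : plane R => (sqmod (f (cplx p)))%:E)) => //; first exact: msq.
by move=> p _; rewrite lee_fin sqmod_ge0.
Qed.

Definition hseg f (a b y : R) : \bar R :=
  \int[leb]_(x in `[a, b]) (sqmod (line f x y))%:E.

Let mAB (a b : R) : 0 < a -> (`[a, b]%classic : set RT) `<=` `]0%R, +oo[%classic.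
Proof.
by move=> a0 x/=; rewrite !in_itv/= andbT => /andP[ax _]; exact: lt_le_trans ax.
Qed.

Lemma hseg_integral f a b : analytic_rhp f -> 0 < a ->
  (\int[leb]_y hseg f a b y = \int[leb]_(x in `[a, b]) en f x)%E.
Proof.
move=> fa a0; have m1 := msq fa.
apply/esym; apply: (@tonelli_strip_swap _ leb `[a, b]%classic
  (fun p : plane R => (sqmod (f (cplx p)))%:E)) => //.
  apply: measurable_funS m1; first exact: measurableX.
  by move=> [x y] /= [h1 _]; split => //; exact: mAB h1.
by move=> p _; rewrite lee_fin sqmod_ge0.
Qed.

Lemma measurable_hseg f a b : analytic_rhp f -> 0 < a ->
  measurable_fun setT (hseg f a b).
Proof.
move=> fa a0; have m1 := msq fa.
apply: (@measurable_strip_outer _ leb `[a, b]%classic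
  (fun p : plane R => (sqmod (f (cplx p)))%:E)) => //.
  apply: measurable_funS m1; first exact: measurableX.
  by move=> [x y] /= [h1 _]; split => //; exact: mAB h1.
by move=> p _; rewrite lee_fin sqmod_ge0.
Qed.

Lemma hsegE f a b y : analytic_rhp f -> 0 < a ->
  hseg f a b y = (rint (fun x => sqmod (line f x y)) a b)%:E.
Proof.
move=> fa a0; rewrite /rint /Rintegral fineK//; apply: integrable_fin_num => //.
apply: ictn_integrable => x /andP[ax _].
have [h1 h2] := line_ctn_x y fa (lt_le_trans a0 ax).
by apply: continuousD; apply: continuousM.
Qed.

End Shift.

Section ShiftInvariance.
Variable R : realType.
Local Notation leb := (@lebesgue_measure R).
Local Notation RT := (measurableTypeR R).
Local Notation C := (R[i]).
Implicit Types (f g : C -> C) (x y h : R).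

(** Just enough to find good heights: single lines may still have infinite energy. *)
Definition slab f := analytic_rhp f /\
  forall a b : R, 0 < a -> (\int[leb]_(x in `[a, b]) en f x < +oo)%E.

Lemma sqmod_line_ictn_y f x a b : analytic_rhp f -> 0 < x ->
  ictn (fun y => sqmod (line f x y)) a b.
Proof.
move=> fa x0 y _; have [h1 h2] := line_ctn_y y fa x0.
by apply: continuousD; apply: continuousM.
Qed.

Lemma cdot_line_ictn_y f g x x' a b : analytic_rhp f -> analytic_rhp g ->
  0 < x -> 0 < x' -> ictn (fun y => cdot (line f x y) (line g x' y)) a b.
Proof.
move=> fa ga x0 x'0 y _; have [h1 h2] := line_ctn_y y fa x0.
have [h3 h4] := line_ctn_y y ga x'0.
by apply: continuousD; apply: continuousM.
Qed.

Lemma hseg_reflect g (c a b y : R) : analytic_rhp g -> b < c ->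
  (\int[leb]_(x in `[a, b]) (sqmod (line g (c - x) y))%:E = hseg g (c - b) (c - a) y)%E.
Proof.
move=> ga bc; rewrite /hseg.
pose F : R -> \bar R := (fun x => (sqmod (line g x y))%:E) \_ (`[c - b, c - a]%classic).
have mF : measurable_fun setT F.
  apply/(measurable_restrictT _ _).1 => //.
  have : {within `[c - b, c - a], continuous (fun x => sqmod (line g x y))}.
    apply: ictn_within => x /andP[xb _].
    have x0 : 0 < x by apply: lt_le_trans xb; rewrite subr_gt0.
    have [h1 h2] := line_ctn_x y ga x0.
    by apply: continuousD; apply: continuousM.
  move=> cg; apply/measurable_EFinP.
  exact: (subspace_continuous_measurable_fun _ cg).
have F0 x : (0 <= F x)%E by apply: erestrict_ge0 => t _; rewrite lee_fin sqmod_ge0.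
rewrite [RHS]integral_mkcond -/F -(leb_reflect c mF F0) [LHS]integral_mkcond.
apply: eq_integral => x _; rewrite /F !patchE.
rewrite (_ : (c - x \in `[c - b, c - a]%classic) = (x \in `[a, b]%classic)) //.
by apply/idP/idP; rewrite !inE/= !in_itv/= => /andP[h1 h2]; apply/andP; split; lra.
Qed.

(** Cauchy's theorem for f(z) conj(g(c - conj z)), c = x1 + x2, on [x1, x1 + h] x [lo, hi]. The
    vertical sides are the two truncated pairings, the horizontal ones are dominated by |f|^2 +
    |g|^2; [h < x2] keeps the reflected abscissas positive. *)
Lemma trunc_shift f g x1 x2 h lo hi : analytic_rhp f -> analytic_rhp g ->
  0 < x1 -> 0 <= h -> h < x2 -> lo <= hi ->
  (`|rint (fun y => cdot (line f (x1 + h) y) (line g (x2 - h) y)) lo hi -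
     rint (fun y => cdot (line f x1 y) (line g x2 y)) lo hi|%:E <=
   (hseg f x1 (x1 + h) lo + hseg g (x2 - h) x2 lo) +
   (hseg f x1 (x1 + h) hi + hseg g (x2 - h) x2 hi))%E.
Proof.
move=> fa ga x10 h0 hx2 lohi; pose c := x1 + x2.
pose W (z : C) : C := f z * conjc (g (Complex c 0 - conjc z)).
have WE x y : W (Complex x y) = line f x y * conjc (line g (c - x) y).
  rewrite /W /line; congr (_ * conjc (g _)).
  by apply: complex_ext => /=; ring.
have x1h : x1 <= x1 + h by rewrite lerDl.
have x12 : x1 + h < c by rewrite /c ltrD2l.
have hW : holo_rect W x1 (x1 + h) lo hi.
  move=> x y /andP[xl xr] _; eexists; apply: has_cderivM.
    by move/analytic_has_cderiv : fa; apply => /=; exact: lt_le_trans xl.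
  apply: has_cderiv_reflect; move/analytic_has_cderiv : ga; apply => /=.
  by rewrite subr_gt0; apply: le_lt_trans x12.
have := goursat x1h lohi hW; rewrite /im_circ.
have cu x : x1 <= x <= x1 + h -> ictn (fun y => complex.Re (W (Complex x y))) lo hi.
  by move=> xx y yy; have [k /has_cderiv_ctn_y[]] := hW _ _ xx yy.
have cv y : lo <= y <= hi -> ictn (fun x => complex.Im (W (Complex x y))) x1 (x1 + h).
  by move=> yy x xx; have [k /has_cderiv_ctn_x[]] := hW _ _ xx yy.
have xl : x1 <= x1 <= x1 + h by rewrite lexx.
have xr : x1 <= x1 + h <= x1 + h by rewrite lexx andbT.
have yl : lo <= lo <= hi by rewrite lexx.
have yr : lo <= hi <= hi by rewrite lexx andbT.
rewrite (rintB (cu _ xr) (cu _ xl)) (rintB (cv _ yr) (cv _ yl)).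
have ReW x y : complex.Re (W (Complex x y)) = cdot (line f x y) (line g (c - x) y).
  by rewrite WE /cdot !reimE; ring.
have -> : rint (fun y => complex.Re (W (Complex (x1 + h) y))) lo hi =
    rint (fun y => cdot (line f (x1 + h) y) (line g (x2 - h) y)) lo hi.
  by apply: eq_rint => y _; rewrite ReW (_ : c - (x1 + h) = x2 - h)// /c; ring.
have -> : rint (fun y => complex.Re (W (Complex x1 y))) lo hi =
    rint (fun y => cdot (line f x1 y) (line g x2 y)) lo hi.
  by apply: eq_rint => y _; rewrite ReW (_ : c - x1 = x2)// /c; ring.
move=> /eqP; rewrite subr_eq0 => /eqP ->.
have cf y : ictn (fun x => sqmod (line f x y)) x1 (x1 + h).
  move=> x /andP[xx _]; have [h1 h2] := line_ctn_x y fa (lt_le_trans x10 xx).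
  by apply: continuousD; apply: continuousM.
have cg y : ictn (fun x => sqmod (line g (c - x) y)) x1 (x1 + h).
  move=> x /andP[_ xx]; have x0 : 0 < c - x by rewrite subr_gt0; apply: le_lt_trans x12.
  have [h1 h2] := line_ctn_x y ga x0.
  have cs : {for x, continuous (fun t : R => c - t)}.
    by apply: continuousB; [exact: cst_continuous|exact: id].
  have k1 := @continuous_comp _ _ _ (fun t : R => c - t)
    (fun t => complex.Re (line g t y)) x cs h1.
  have k2 := @continuous_comp _ _ _ (fun t : R => c - t)
    (fun t => complex.Im (line g t y)) x cs h2.
  by apply: continuousD; apply: continuousM.
have bnd y : lo <= y <= hi ->
  (`|rint (fun x => complex.Im (W (Complex x y))) x1 (x1 + h)|%:E <=
    hseg f x1 (x1 + h) y + hseg g (x2 - h) x2 y)%E.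
  move=> yy.
  have -> : hseg g (x2 - h) x2 y = (rint (fun x => sqmod (line g (c - x) y)) x1 (x1 + h))%:E.
    have -> : x2 - h = c - (x1 + h) by rewrite /c; ring.
    have -> : x2 = c - x1 by rewrite /c; ring.
    rewrite -hseg_reflect// /rint /Rintegral fineK//.
    by apply: integrable_fin_num => //; exact: ictn_integrable.
  rewrite hsegE// -EFinD lee_fin -rintD//.
  have cI := cv _ yy.
  have Wb x : `|complex.Im (W (Complex x y))| <= sqmod (line f x y) + sqmod (line g (c - x) y).
    rewrite WE; apply: le_trans (normc_Im _) _; rewrite normcM conjc_normc !sqmodE.
    have := normc_ge0 (line f x y); have := normc_ge0 (line g (c - x) y).
    by move: (normc _) (normc _) => u v; nra.
  rewrite ler_norml; apply/andP; split.
    rewrite -[X in - X]mul1r -mulNr -rintZ; last exact: ictnD.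
    apply: rint_le => //; first by apply: ictnM; [exact: ictn_cst|exact: ictnD].
    by move=> x _; have := Wb x; rewrite ler_norml mulN1r => /andP[].
  apply: rint_le => //; first exact: ictnD.
  by move=> x _; have := Wb x; rewrite ler_norml => /andP[].
apply: (@le_trans _ _ (`|rint (fun x => complex.Im (W (Complex x hi))) x1 (x1 + h)| +
  `|rint (fun x => complex.Im (W (Complex x lo))) x1 (x1 + h)|)%:E).
  by rewrite lee_fin; exact: ler_normB.
by rewrite addeC EFinD; apply: leeD; exact: bnd.
Qed.

Lemma hseg_ge0 f a b y : (0 <= hseg f a b y)%E.
Proof. by apply: integral_ge0 => x _; rewrite lee_fin sqmod_ge0. Qed.

Lemma slab_heights f g a b a' b' (e k : R) : slab f -> slab g -> 0 < a -> 0 < a' ->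
  0 < e -> exists M N, [/\ k <= M, k <= N,
    (hseg f a b (- M)%R + hseg g a' b' (- M)%R <= e%:E)%E &
    (hseg f a b N + hseg g a' b' N <= e%:E)%E].
Proof.
move=> [fa fs] [ga gs] a0 a'0 e0.
pose P y := (hseg f a b y + hseg g a' b' y)%E.
have mf := measurable_hseg b fa a0; have mg := measurable_hseg b' ga a'0.
have mP : measurable_fun setT P by exact: emeasurable_funD.
have P0 y : (0 <= P y)%E by rewrite adde_ge0// hseg_ge0.
have iP : (\int[leb]_y P y < +oo)%E.
  rewrite ge0_integralD//; [|by move=> y _; exact: hseg_ge0..].
  rewrite (hseg_integral b fa a0) (hseg_integral b' ga a'0).
  by apply: lte_add_pinfty; [exact: fs|exact: gs].
have [N kN PN] := tail_small k mP P0 iP e0.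
have [M kM PM] := tail_small_neg k mP P0 iP e0.
by exists M, N.
Qed.

Lemma exhaust_le (F : R -> \bar R) (A : \bar R) : measurable_fun setT F ->
  (forall y, (0 <= F y)%E) ->
  (forall k : nat, (\int[leb]_(y in `[(- k%:R)%R, k%:R]) F y <= A)%E) ->
  (\int[leb]_y F y <= A)%E.
Proof.
move=> mF F0 H.
pose S (k : nat) : set RT := `[(- k%:R)%R, k%:R]%classic.
have SE : \bigcup_k S k = setT.
  apply/seteqP; split=> // y _; exists (Num.bound `|y|) => //.
  rewrite /S/= in_itv/= -ler_norml ltW//; exact: archi_boundP.
rewrite -SE; have ndS : nondecreasing_seq S.
  move=> m n mn; rewrite subsetEset => y; rewrite /S/= !in_itv/= => /andP[h1 h2].
  have mnR : m%:R <= n%:R :> R by rewrite ler_nat.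
  by apply/andP; split; lra.
have := ge0_nondecreasing_set_cvg_integral (mu := leb) (F := S) (f := F) ndS (fun=> measurable_itv _)
   (fun=> measurable_funTS mF) (fun _ y _ => F0 y).
move=> c; rewrite -(cvg_lim _ c)//; apply: lime_le; first by apply/cvg_ex; eexists; exact: c.
by apply: nearW => k; exact: H.
Qed.

Lemma cdot_le_half (z w : C) : cdot z w <= (sqmod z + sqmod w) / 2.
Proof.
have := sqmod_ge0 (z - w).
have -> : sqmod (z - w) = sqmod z + sqmod w - 2 * cdot z w.
  by rewrite /sqmod /cdot !reimE; ring.
lra.
Qed.

Lemma en_trunc f x lo hi (A : R) : analytic_rhp f -> 0 < x -> (en f x <= A%:E)%E ->
  rint (fun y => sqmod (line f x y)) lo hi <= A.
Proof.
move=> fa x0 fA; rewrite -lee_fin; apply: le_trans fA.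
rewrite /rint /Rintegral fineK; last first.
  apply: integrable_fin_num => //; apply: ictn_integrable; exact: sqmod_line_ictn_y.
apply: ge0_subset_integral => //.
- by apply: cmeas_esqmod; exact: line_cmeas.
- by move=> y _; rewrite lee_fin sqmod_ge0.
Qed.

(** The truncated energy of the middle line is, up to the horizontal sides, the pairing of the two
    outer lines, which is at most half the sum of their energies. Finiteness on the middle line is a
    conclusion, so truncations are kept until the end. *)
Lemma en_midpoint f x h (A B : R) : slab f -> 0 <= h -> h < x ->
  (en f (x - h) <= A%:E)%E -> (en f (x + h) <= B%:E)%E ->
  (en f x <= ((A + B) / 2)%:E)%E.
Proof.
move=> sf h0 hx fA fB; have [fa fs] := sf.
have x0 : 0 < x by exact: le_lt_trans hx.
have xh0 : 0 < x - h by rewrite subr_gt0.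
have xh1 : 0 < x + h by rewrite ltr_pwDl.
apply/lee_addgt0Pr => e e0; rewrite -EFinD.
have msq : measurable_fun setT (fun y => (sqmod (line f x y))%:E).
  by apply: cmeas_esqmod; exact: line_cmeas.
apply: exhaust_le => // [y|k]; first by rewrite lee_fin sqmod_ge0.
have e20 : 0 < e / 2 by rewrite divr_gt0.
have [M [N [kM kN hM hN]]] := slab_heights (x + h) x k%:R sf sf x0 xh0 e20.
have k0 : (0 : R) <= k%:R by rewrite ler0n.
have MN : - M <= N by lra.
apply: (@le_trans _ _ (\int[leb]_(y in `[(- M)%R, N]) (sqmod (line f x y))%:E)%E).
  apply: ge0_subset_integral => //.
  - exact: measurable_funTS.
  - by move=> y _; rewrite lee_fin sqmod_ge0.
  - by move=> y; rewrite /= !in_itv/= => /andP[h1 h2]; apply/andP; split; lra.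
have -> : (\int[leb]_(y in `[(- M)%R, N]) (sqmod (line f x y))%:E =
    (rint (fun y => cdot (line f x y) (line f x y)) (- M) N)%:E)%E.
  under eq_integral do rewrite -cdotzz.
  rewrite /rint /Rintegral fineK//; apply: integrable_fin_num => //.
  by apply: ictn_integrable; exact: cdot_line_ictn_y.
rewrite lee_fin.
have := trunc_shift fa fa x0 h0 hx MN.
move/le_trans => /(_ _ (leeD hM hN)); rewrite -EFinD lee_fin -splitr.
rewrite ler_norml => /andP[+ _].
have r1 := en_trunc (- M) N fa xh0 fA; have r2 := en_trunc (- M) N fa xh1 fB.
have : rint (fun y => cdot (line f (x + h) y) (line f (x - h) y)) (- M) N <=
   rint (fun y => 2^-1 * (sqmod (line f (x + h) y) + sqmod (line f (x - h) y))) (- M) N.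
  apply: rint_le.
  - exact: cdot_line_ictn_y.
  - apply: ictnM; first exact: ictn_cst.
    by apply: ictnD; exact: sqmod_line_ictn_y.
  - by move=> y _; rewrite mulrC; exact: cdot_le_half.
rewrite rintZ; last by apply: ictnD; exact: sqmod_line_ictn_y.
rewrite rintD; [|exact: sqmod_line_ictn_y..].
lra.
Qed.

End ShiftInvariance.

Section HardyLines.
Variable R : realType.
Local Notation leb := (@lebesgue_measure R).
Local Notation RT := (measurableTypeR R).
Local Notation C := (R[i]).
Implicit Types (f g : C -> C) (x y h : R).

(* What a Zen function keeps of H^2 when the weight does not charge the axis: the
   energies may blow up as the line approaches Re z = 0. *)
Definition hardy_away f := analytic_rhp f /\
  forall d : R, 0 < d -> exists M : R, forall x, d <= x -> (en f x <= M%:E)%E.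

Definition B f g x x' : R := ip leb setT (line f x : RT -> C) (line g x').

Lemma hn_sqint f x : hardy_away f -> 0 < x -> sqint leb setT (line f x : RT -> C).
Proof.
move=> [fa fb] x0; split; first exact: line_cmeas.
by have [M /(_ x (lexx _)) H] := fb _ x0; exact: le_lt_trans H (ltry _).
Qed.

Lemma enE f x : hardy_away f -> 0 < x -> en f x = (B f f x x)%:E.
Proof. by move=> hf x0; rewrite /en energyE//; exact: hn_sqint. Qed.

Lemma hn_slab f : hardy_away f -> slab f.
Proof.
move=> [fa fb]; split => // a b a0.
have [M HM] := fb _ a0.
have mab : (`[a, b]%classic : set RT) `<=` `]0%R, +oo[%classic.
  by move=> x/=; rewrite !in_itv/= andbT => /andP[ax _]; exact: lt_le_trans ax.
apply: (@le_lt_trans _ _ (\int[leb]_(x in `[a, b]) M%:E)%E).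
  apply: ge0_le_integral => //.
  - by move=> x _; exact: en_ge0.
  - by apply: measurable_funS mab (measurable_en fa).
  - by move=> x; rewrite /= in_itv/= => /andP[ax _]; exact: HM.
rewrite integral_cst//= lebesgue_measure_itv/=; case: ifPn => _.
  by rewrite -EFinB -EFinM ltry.
by rewrite mule0 ltry.
Qed.

(** The two truncation points vary independently, because [slab_heights] provides unrelated heights
    below and above. *)
Lemma trunc_integral (u : R -> R) (e : R) : leb.-integrable setT (EFin \o u) -> 0 < e ->
  exists k : R, forall M N, k <= M -> k <= N ->
    `|\int[leb]_y u y - rint u (- M) N| <= e.
Proof.
move=> iu e0; have iv := integrable_abse iu.
pose v y := `|u y|.
have iv' : leb.-integrable setT (EFin \o v).
  by apply: eq_integrable iv.
pose S (k : nat) : set RT := `[(- k%:R)%R, k%:R]%classic.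
have SE : \bigcup_k S k = setT.
  apply/seteqP; split=> // y _; exists (Num.bound `|y|) => //.
  rewrite /S/= in_itv/= -ler_norml ltW//; exact: archi_boundP.
have ndS : nondecreasing_seq S.
  move=> m n mn; rewrite subsetEset => y; rewrite /S/= !in_itv/= => /andP[h1 h2].
  have mnR : m%:R <= n%:R :> R by rewrite ler_nat.
  by apply/andP; split; lra.
have mv : measurable_fun setT (EFin \o v) := measurable_int leb iv'.
have := ge0_nondecreasing_set_cvg_integral (mu := leb) (F := S) (f := EFin \o v) ndS
  (fun=> measurable_itv _) (fun=> measurable_funTS mv)
  (fun _ y _ => (normr_ge0 (u y) : (0 <= (EFin \o v) y)%E)).
rewrite SE => cS.
have finv : (\int[leb]_y (EFin \o v) y)%E \is a fin_num by exact: integrable_fin_num.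
have [k Hk] : exists k : nat,
    (\int[leb]_y (EFin \o v) y - e%:E <= \int[leb]_(y in S k) (EFin \o v) y)%E.
  apply: contrapT => H.
  have H' k : (\int[leb]_(y in S k) (EFin \o v) y <= \int[leb]_y (EFin \o v) y - e%:E)%E.
    by rewrite leNgt; apply/negP => /ltW Hk; apply: H; exists k.
  have : (\int[leb]_y (EFin \o v) y <= \int[leb]_y (EFin \o v) y - e%:E)%E.
    rewrite -{1}(cvg_lim _ cS)//; apply: lime_le; first by apply/cvg_ex; eexists; exact: cS.
    by apply: nearW => k; exact: H'.
  rewrite -(fineK finv) -EFinB lee_fin; lra.
exists k%:R => M N kM kN.
pose K : set RT := `[- M, N]%classic.
have mK : measurable K by exact: measurable_itv.
have sSK : S k `<=` K.
  by move=> y; rewrite /S /K/= !in_itv/= => /andP[h1 h2]; apply/andP; split; lra.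
have KC : setT = K `|` ~` K :> set RT by rewrite setUv.
have dK : [disjoint K & ~` K] by apply/disj_setPS; rewrite setICr.
have split w : leb.-integrable setT (EFin \o w) ->
    \int[leb]_y w y = \int[leb]_(y in K) w y + \int[leb]_(y in ~` K) w y.
  by move=> iw; rewrite {1}KC Rintegral_setU// -?KC//; exact: measurableC.
rewrite (split u iu) /rint [X in X - _]addrC addrK.
have iuC : leb.-integrable (~` K) (EFin \o u).
  by apply: integrableS iu => //; exact: measurableC.
apply: (le_trans (le_normr_Rintegral _ iuC)); first exact: measurableC.
have -> : \int[leb]_(y in ~` K) `|u y| = \int[leb]_y v y - \int[leb]_(y in K) v y.
  by rewrite (split v iv') addrC addKr.
have : \int[leb]_y v y - e <= \int[leb]_(y in K) v y; last by lra.
rewrite -lee_fin EFinB /Rintegral !fineK//; first last.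
  by apply: integrable_fin_num => //; apply: integrableS iv'.
apply: (le_trans Hk); apply: ge0_subset_integral => //.
  exact: measurable_itv.
  exact: (measurable_funTS mv).
by move=> y _; rewrite lee_fin normr_ge0.
Qed.

Let B_shift_pos f g x1 x2 h : hardy_away f -> hardy_away g -> 0 < x1 -> 0 <= h -> h < x2 ->
  B f g (x1 + h) (x2 - h) = B f g x1 x2.
Proof.
move=> hf hg x10 h0 hx2.
have x1h : 0 < x1 + h by rewrite ltr_pwDl.
have x2h : 0 < x2 - h by rewrite subr_gt0.
have x20 : 0 < x2 by exact: le_lt_trans hx2.
apply/eqP; rewrite -subr_eq0 -normr_eq0 eq_le normr_ge0 andbT.
apply/ler_addgt0Pr => e e0; rewrite add0r.
have e40 : 0 < e / 4 by rewrite divr_gt0.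
pose u y := cdot (line f (x1 + h) y) (line g (x2 - h) y).
pose v y := cdot (line f x1 y) (line g x2 y).
have iu : leb.-integrable setT (EFin \o u).
  by apply: sqint_cdot => //; exact: hn_sqint.
have iv : leb.-integrable setT (EFin \o v).
  by apply: sqint_cdot => //; exact: hn_sqint.
have [k Hk] := trunc_integral iu e40; have [k' Hk'] := trunc_integral iv e40.
pose K := Num.max 0 (Num.max k k').
have [M [N [KM KN hM hN]]] := slab_heights (x1 + h) x2 K (hn_slab hf) (hn_slab hg) x10 x2h e40.
move: KM KN; rewrite !ge_max => /and3P[M0 kM k'M] /and3P[N0 kN k'N].
have MN : - M <= N by lra.
have := trunc_shift hf.1 hg.1 x10 h0 hx2 MN.
move/le_trans => /(_ _ (leeD hM hN)); rewrite -EFinD lee_fin.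
move=> h3; have {}h3 : `|rint u (- M) N - rint v (- M) N| <= e / 4 + e / 4 by exact: h3.
have h1 := Hk _ _ kM kN; have h2 := Hk' _ _ k'M k'N.
have E1 : B f g (x1 + h) (x2 - h) = \int[leb]_y u y by [].
have E2 : B f g x1 x2 = \int[leb]_y v y by [].
rewrite E1 E2.
move: (\int[leb]_y u y) (\int[leb]_y v y) (rint u (- M) N) (rint v (- M) N) h1 h2 h3.
move=> bu bv ru rv h1 h2 h3.
rewrite (_ : bu - bv = (bu - ru) + (ru - rv) - (bv - rv)); last by ring.
apply: le_trans (ler_normB _ _) _.
have := ler_normD (bu - ru) (ru - rv); lra.
Qed.

(* Cauchy's theorem for z |-> f z * conj (g (x1 + x2 - conj z)). *)
Lemma B_shift f g x1 x2 h : hardy_away f -> hardy_away g -> 0 < x1 -> 0 < x2 -> 0 < x1 + h -> 0 < x2 - h ->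
  B f g (x1 + h) (x2 - h) = B f g x1 x2.
Proof.
move=> hf hg x10 x20 x1h x2h; have [h0|h0] := leP 0 h.
  by apply: B_shift_pos => //; rewrite -subr_gt0.
have := @B_shift_pos f g (x1 + h) (x2 - h) (- h) hf hg x1h.
rewrite (_ : x1 + h + - h = x1); last by ring.
rewrite (_ : x2 - h - - h = x2); last by ring.
by move=> <-//; lra.
Qed.

(** By midpoint convexity an increase by [d] over a step [h] recurs over every following step, and n
    d would exceed the bound that holds to the right of [x]. *)
Lemma en_nonincreasing f x y : hardy_away f -> 0 < x -> x <= y -> (en f y <= en f x)%E.
Proof.
move=> hf x0; rewrite le_eqVlt => /predU1P[->//|xy].
rewrite leNgt; apply/negP.
have y0 := lt_trans x0 xy.
rewrite (enE hf x0) (enE hf y0) lte_fin => Bxy.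
pose I t := B f f t t.
have mid t h : 0 <= h -> h < t -> 2 * I t <= I (t - h) + I (t + h).
  move=> h0 ht; have t0 := le_lt_trans h0 ht.
  have th0 : 0 < t - h by rewrite subr_gt0.
  have th1 : 0 < t + h by rewrite ltr_pwDl.
  have := en_midpoint (hn_slab hf) h0 ht (A := I (t - h)) (B := I (t + h)).
  rewrite !enE// => /(_ (lexx _) (lexx _)); rewrite lee_fin -/(I t); lra.
pose h := y - x; have h0 : 0 < h by rewrite subr_gt0.
pose d := I y - I x; have d0 : 0 < d by rewrite subr_gt0.
have incr n : d <= I (x + n.+1%:R * h) - I (x + n%:R * h).
  elim: n => [|n ih].
    by rewrite mul0r mul1r addr0 (_ : x + h = y) // /h; ring.
  have n0 : (0 : R) <= n%:R by rewrite ler0n.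
  have nh : 0 <= n%:R * h by rewrite mulr_ge0// ltW.
  have := mid (x + n.+1%:R * h) h (ltW h0).
  rewrite -[n.+2%:R]natr1 -[n.+1%:R]natr1.
  rewrite (_ : x + (n%:R + 1) * h - h = x + n%:R * h); last by ring.
  rewrite (_ : x + (n%:R + 1) * h + h = x + (n%:R + 1 + 1) * h); last by ring.
  move: ih; rewrite -[n.+1%:R]natr1 => ih H.
  have := H ltac:(rewrite mulrDl mul1r; lra); lra.
have grow n : I x + n%:R * d <= I (x + n%:R * h).
  elim: n => [|n ih]; first by rewrite !mul0r !addr0.
  have := incr n; rewrite -[in X in X * d]natr1 mulrDl mul1r; lra.
have [M HM] := hf.2 _ x0.
have HM' n : I (x + n%:R * h) <= M.
  have xn : x <= x + n%:R * h by rewrite lerDl mulr_ge0 ?ler0n// ltW.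
  have := HM _ xn; rewrite enE// ?lee_fin//; exact: lt_le_trans xn.
have I0 : 0 <= I x by exact: ip_ge0.
have M0 : 0 <= M by apply: le_trans (HM' 0%N); rewrite mul0r addr0.
have := archi_boundP (divr_ge0 M0 (ltW d0)).
set n := Num.bound _; rewrite ltr_pdivrMr//.
have := le_trans (grow n) (HM' n); lra.
Qed.

End HardyLines.

(** * Cauchy-Schwarz, Sobolev and Cauchy inequalities on lines *)

Section DerivativeEstimates.
Variable R : realType.
Local Notation leb := (@lebesgue_measure R).
Local Notation RT := (measurableTypeR R).
Local Notation C := (R[i]).
Local Notation T := (pi *+ 2 : R).
Implicit Types (f g : C -> C) (u v : R -> R) (a b x y h : R).

Lemma rint_CS u a b : a <= b -> ictn u a b ->
  rint u a b ^+ 2 <= (b - a) * rint (fun t => u t * u t) a b.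
Proof.
move=> ab cu; rewrite mulrC; have cuu := ictnM cu cu.
have uu0 : 0 <= rint (fun t => u t * u t) a b.
  by apply: Rintegral_ge0 => t _; rewrite -expr2 sqr_ge0.
apply: quad_discr => //; first by rewrite subr_ge0.
move=> t; have ct : ictn (fun s => 2 * t * u s) a b by apply: ictnM => //; exact: ictn_cst.
have <- : rint (fun s => u s * u s + 2 * t * u s + t ^+ 2) a b =
    rint (fun s => u s * u s) a b + 2 * t * rint u a b + t ^+ 2 * (b - a).
  rewrite rintD; [|exact: ictnD|exact: ictn_cst].
  by rewrite rintD// rintZ// rint_cst.
apply: Rintegral_ge0 => s _.
by rewrite (_ : _ + _ = (u s + t) ^+ 2) ?sqr_ge0//; ring.
Qed.

Lemma rint_ftc u u' a b : a <= b ->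
  (forall t, a <= t <= b -> is_derive t 1 u (u' t)) -> ictn u' a b ->
  rint u' a b = u b - u a.
Proof.
rewrite le_eqVlt => /predU1P[->|ab] du cu'.
  by rewrite /rint set_itv1 Rintegral_set1 subrr.
have cu t : a <= t <= b -> {for t, continuous u} by move=> /du/is_derive_ctn.
have al : a <= a <= b by rewrite lexx ltW.
have bl : a <= b <= b by rewrite lexx ltW.
rewrite /rint /Rintegral (@continuous_FTC2 _ u' u)//.
- exact: ictn_within.
- split.
  + move=> t; rewrite in_itv/= => /andP[at_ tb].
    by have [] := du t; rewrite ?ltW.
  + by apply: cvg_at_right_filter; exact: cu.
  + by apply: cvg_at_left_filter; exact: cu.
- move=> t; rewrite in_itv/= => /andP[at_ tb].
  have dt : is_derive t 1 u (u' t) by apply: du; rewrite !ltW.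
  by rewrite derive1E; exact: derive_val.
Qed.

Lemma increment_CS u u' a b : a <= b ->
  (forall t, a <= t <= b -> is_derive t 1 u (u' t)) -> ictn u' a b ->
  (u b - u a) ^+ 2 <= (b - a) * rint (fun t => u' t * u' t) a b.
Proof. by move=> ab du cu'; rewrite -(rint_ftc ab du cu') rint_CS. Qed.

Lemma is_derive_line_x f x y : analytic_rhp f -> 0 < x ->
  is_derive x 1 (fun s => complex.Re (line f s y)) (complex.Re (line (cderive f) x y)) /\
  is_derive x 1 (fun s => complex.Im (line f s y)) (complex.Im (line (cderive f) x y)).
Proof.
move=> /analytic_has_cderiv fa x0; have H := fa (Complex x y) x0.
have E (s : R) : Complex 0 y + Complex s 0 * 1 = Complex s y :> C.
  by rewrite mulr1; apply: complex_ext => /=; ring.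
have := @is_derive_line _ f (Complex 0 y) 1 x (cderive f (Complex x y)).
rewrite E mulr1 => /(_ H)[h1 h2]; rewrite /line.
by split; [move: h1|move: h2]; under eq_fun do rewrite E.
Qed.

Lemma is_derive_line_y f x y : analytic_rhp f -> 0 < x ->
  is_derive y 1 (fun s => complex.Re (line f x s)) (- complex.Im (line (cderive f) x y)) /\
  is_derive y 1 (fun s => complex.Im (line f x s)) (complex.Re (line (cderive f) x y)).
Proof.
move=> /analytic_has_cderiv fa x0; have H := fa (Complex x y) x0.
have E (s : R) : Complex x 0 + Complex s 0 * 'i%C = Complex x s :> C.
  by apply: complex_ext; rewrite /=; ring.
have := @is_derive_line _ f (Complex x 0) 'i%C y (cderive f (Complex x y)).
rewrite E => /(_ H)[]; rewrite !reimE /= !mulr0 !mulr1 sub0r addr0 => h1 h2.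
by rewrite /line; split; [move: h1|move: h2]; under eq_fun do rewrite E.
Qed.

Lemma sqmodE_mul (z : C) :
  sqmod z = complex.Re z * complex.Re z + complex.Im z * complex.Im z.
Proof. by rewrite /sqmod !expr2. Qed.

Lemma increment_x f a b y : analytic_rhp f -> 0 < a -> a <= b ->
  sqmod (line f b y - line f a y) <=
  (b - a) * rint (fun x => sqmod (line (cderive f) x y)) a b.
Proof.
move=> fa a0 ab; have fa' := analytic_cderive fa.
have pos t : a <= t <= b -> 0 < t by case/andP => /(lt_le_trans a0).
have c1 : ictn (fun x => complex.Re (line (cderive f) x y)) a b.
  by move=> t /pos t0; have [] := line_ctn_x y fa' t0.
have c2 : ictn (fun x => complex.Im (line (cderive f) x y)) a b.
  by move=> t /pos t0; have [] := line_ctn_x y fa' t0.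
under eq_rint do rewrite sqmodE_mul.
rewrite rintD; [|exact: ictnM..]; rewrite mulrDr /sqmod !reimE; apply: lerD.
- apply: (@increment_CS (fun s => complex.Re (line f s y))) => // t /pos t0.
  by have [] := is_derive_line_x y fa t0.
- apply: (@increment_CS (fun s => complex.Im (line f s y))) => // t /pos t0.
  by have [] := is_derive_line_x y fa t0.
Qed.

Lemma increment_y f x a b : analytic_rhp f -> 0 < x -> a <= b ->
  sqmod (line f x b - line f x a) <=
  (b - a) * rint (fun y => sqmod (line (cderive f) x y)) a b.
Proof.
move=> fa x0 ab; have fa' := analytic_cderive fa.
have c1 : ictn (fun y => complex.Re (line (cderive f) x y)) a b.
  by move=> t _; have [] := line_ctn_y t fa' x0.
have c2 : ictn (fun y => complex.Im (line (cderive f) x y)) a b.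
  by move=> t _; have [] := line_ctn_y t fa' x0.
have c2' : ictn (fun y => - complex.Im (line (cderive f) x y)) a b.
  by move=> t tab; apply: continuousN; exact: c2.
under eq_rint do rewrite sqmodE_mul.
rewrite rintD; [|exact: ictnM..].
rewrite mulrDr [leRHS]addrC /sqmod !reimE; apply: lerD.
- under eq_rint do rewrite -mulrNN.
  apply: (@increment_CS (fun s => complex.Re (line f x s))) => // t _.
  by have [] := is_derive_line_y t fa x0.
- apply: (@increment_CS (fun s => complex.Im (line f x s))) => // t _.
  by have [] := is_derive_line_y t fa x0.
Qed.

(** The bound |f(y)|^2 <= 2 |f(t)|^2 + 2 |f(t) - f(y)|^2 is integrated over t in [y, y + l], the
    increment being controlled by the energy of f' through Cauchy-Schwarz. *)
Lemma sobolev f x y l : analytic_rhp f -> 0 < x -> 0 < l ->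
  l * sqmod (line f x y) <= 2 * rint (fun t => sqmod (line f x t)) y (y + l) +
    2 * l ^+ 2 * rint (fun t => sqmod (line (cderive f) x t)) y (y + l).
Proof.
move=> fa x0 l0; have fa' := analytic_cderive fa.
have yl : y <= y + l by rewrite lerDl ltW.
pose E := rint (fun t => sqmod (line (cderive f) x t)) y (y + l).
have cI a b : ictn (fun t => sqmod (line (cderive f) x t)) a b by exact: sqmod_line_ictn_y.
have cf a b : ictn (fun t => sqmod (line f x t)) a b by exact: sqmod_line_ictn_y.
have nn a b : 0 <= rint (fun t => sqmod (line (cderive f) x t)) a b.
  by apply: Rintegral_ge0 => s _; exact: sqmod_ge0.
have bnd t : y <= t <= y + l -> sqmod (line f x y) <= 2 * sqmod (line f x t) + 2 * (l * E).
  move=> /andP[yt tl].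
  have -> : line f x y = line f x t - (line f x t - line f x y) by ring.
  apply: (le_trans (sqmodD_le _ _)); rewrite lerD2l ler_pM2l//.
  have -> : sqmod (- (line f x t - line f x y)) = sqmod (line f x t - line f x y).
    by rewrite !sqmodE normcN.
  apply: (le_trans (increment_y fa x0 yt)).
  have h1 : t - y <= l by lra.
  have h2 : rint (fun t => sqmod (line (cderive f) x t)) y t <= E.
    by rewrite /E (rint_split yt tl (cI _ _)) lerDl.
  by apply: ler_pM => //; rewrite subr_ge0.
have := @rint_le _ (fun=> sqmod (line f x y))
  (fun t => 2 * sqmod (line f x t) + 2 * (l * E)) y (y + l).
have -> : rint (fun t => 2 * sqmod (line f x t) + 2 * (l * E)) y (y + l) =
    2 * rint (fun t => sqmod (line f x t)) y (y + l) + 2 * (l * E) * l.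
  rewrite (@rintD _ (fun t => 2 * sqmod (line f x t)) (fun=> 2 * (l * E))); first last.
  - exact: ictn_cst.
  - by apply: ictnM => //; exact: ictn_cst.
  rewrite (rintZ _ (cf _ _)) (rint_cst _ yl); congr (_ + _ * _); ring.
rewrite (rint_cst _ yl) (_ : y + l - y = l); last by ring.
move=> H; rewrite [l * _]mulrC; apply: (le_trans (H _ _ bnd)).
- exact: ictn_cst.
- by apply: ictnD; [apply: ictnM => //; exact: ictn_cst|exact: ictn_cst].
by rewrite lerD2l le_eqVlt; apply/orP; left; apply/eqP; rewrite /E; ring.
Qed.

Lemma cmean_sqmod (p : R -> C) : cctn p 0 T ->
  sqmod (cmean p) <= T^-1 * rint (fun t => sqmod (p t)) 0 T.
Proof.
move=> [c1 c2]; have T0 : 0 < T := T_gt0 R.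
under eq_rint do rewrite sqmodE_mul.
rewrite rintD; [|exact: ictnM..].
have h1 := rint_CS (ltW T0) c1; have h2 := rint_CS (ltW T0) c2.
rewrite subr0 in h1 h2.
rewrite mulrDr /sqmod/= !exprMn; apply: lerD.
- rewrite mulrC expr2 -mulrA ler_pM2l ?invr_gt0// ler_pdivrMl//.
- rewrite mulrC expr2 -mulrA ler_pM2l ?invr_gt0// ler_pdivrMl//.
Qed.

(** Cauchy's formula on the circle of radius r = x / 2, squared under the mean: 8 / x^2 is 1 / r^2
    times the factor 2 of |a - b|^2 <= 2 |a|^2 + 2 |b|^2. *)
Lemma cderive_sqmod f x y : analytic_rhp f -> 0 < x ->
  sqmod (line (cderive f) x y) <= (8 / x ^+ 2) * (T^-1 *
    rint (fun t => sqmod (line f (x + x / 2 * cos t) (y + x / 2 * sin t))) 0 T +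
    sqmod (line f x y)).
Proof.
move=> fa x0; pose w : C := Complex x y; pose r := x / 2.
have T0 : 0 < T := T_gt0 R.
have hd : holo_disc f w x by apply: analytic_holo_disc.
have rr : 0 < r < x by apply/andP; split; rewrite /r; lra.
have r0 : 0 < r by case/andP: rr.
have cc := holo_disc_circ hd rr.
have cd : cctn (fun t => f (w + circ r t) - f w) 0 T.
  by apply: cctnB => //; exact: cctn_cst.
rewrite -[line (cderive f) x y]/(cderive f w) -(mean_derive hd rr).
apply: (le_trans (cmean_sqmod (quot_circ_cctn r0 cd))).
have E t : f (w + circ r t) = line f (x + x / 2 * cos t) (y + x / 2 * sin t) by [].
have cI : ictn (fun t => sqmod (line f (x + x / 2 * cos t) (y + x / 2 * sin t))) 0 T.
  by apply: ictnD; apply: ictnM; [exact: cc.1|exact: cc.1|exact: cc.2|exact: cc.2].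
have pt t : sqmod ((f (w + circ r t) - f w) / circ r t) <=
    8 / x ^+ 2 * (sqmod (line f (x + x / 2 * cos t) (y + x / 2 * sin t)) + sqmod (line f x y)).
  rewrite sqmodM (sqmodE (_^-1)) normcV (normc_circ _ (ltW r0)).
  have -> : r^-1 ^+ 2 = 4 / x ^+ 2 by rewrite /r; field; rewrite gt_eqF.
  rewrite [8 / _](_ : _ = 2 * (4 / x ^+ 2)); last by field; rewrite gt_eqF.
  rewrite [leLHS]mulrC [2 * (4 / _)]mulrC -[leRHS]mulrA ler_pM2l; last by rewrite divr_gt0// exprn_gt0.
  apply: (le_trans (sqmodD_le _ _)); rewrite E [leRHS]mulrDr.
  have -> : sqmod (- f w) = sqmod (line f x y) by rewrite !sqmodE normcN.
  exact: lexx.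
have := @rint_le _ (fun t => sqmod ((f (w + circ r t) - f w) / circ r t))
  (fun t => 8 / x ^+ 2 * (sqmod (line f (x + x / 2 * cos t) (y + x / 2 * sin t)) +
     sqmod (line f x y))) 0 T.
have [q1 q2] := quot_circ_cctn r0 cd.
pose S t := sqmod (line f (x + x / 2 * cos t) (y + x / 2 * sin t)).
have cS : ictn (fun t => S t + sqmod (line f x y)) 0 T.
  by apply: ictnD => //; exact: ictn_cst.
rewrite (rintZ (8 / x ^+ 2) cS) (rintD cI (@ictn_cst _ (sqmod (line f x y)) 0 T)).
rewrite (rint_cst _ (ltW T0)) subr0 => H.
apply: (@le_trans _ _ (T^-1 * (8 / x ^+ 2 *
  (rint (fun t => sqmod (line f (x + x / 2 * cos t) (y + x / 2 * sin t))) 0 T +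
    sqmod (line f x y) * T)))).
  rewrite ler_pM2l ?invr_gt0//; apply: H => //.
  - by apply: ictnD; exact: ictnM.
  - apply: ictnM; first exact: ictn_cst.
    by apply: ictnD => //; exact: ictn_cst.
rewrite le_eqVlt; apply/orP; left; apply/eqP.
move: (rint _ _ _) (sqmod _) T0 => p q; move: (T) => U U0.
by field; rewrite !gt_eqF.
Qed.

End DerivativeEstimates.

Section HardyCalculus.
Variable R : realType.
Local Notation leb := (@lebesgue_measure R).
Local Notation RT := (measurableTypeR R).
Local Notation C := (R[i]).
Local Notation T := (pi *+ 2 : R).
Implicit Types (f g : C -> C) (a b x y h : R).

(** Integrating [cderive_sqmod] along the line, each angle contributes the energy of a translated
    line of abscissa at least x / 2. The mean and the centre contribute [M] each, whence 16 = 8 +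
    8. *)
Lemma en_derive f x (M : R) : analytic_rhp f -> 0 < x ->
  (forall t, x / 2 <= t -> (en f t <= M%:E)%E) ->
  (en (cderive f) x <= (16 * M / x ^+ 2)%:E)%E.
Proof.
move=> fa x0 HM; have T0 : 0 < T := T_gt0 R.
pose S (t y : R) := sqmod (line f (x + x / 2 * cos t) (y + x / 2 * sin t)).
have S0 t y : 0 <= S t y by exact: sqmod_ge0.
have xc t : x / 2 <= x + x / 2 * cos t.
  by have := cos_geN1 t; nra.
have xc0 t : 0 < x + x / 2 * cos t by apply: lt_le_trans (xc t); rewrite divr_gt0.
have cS t y : {for t, continuous (S^~ y)}.
  have cc : cctn (fun u => f (Complex x y + circ (x / 2) u)) t t.
    apply: cctn_comp; first exact: cctn_translate_circ.
    move=> u _; move/analytic_has_cderiv : fa => fd; eexists; apply: fd.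
    exact: xc0.
  have tt : t <= t <= t by rewrite lexx.
  have [h1 h2] := (cc.1 t tt, cc.2 t tt).
  by apply: continuousD; apply: continuousM.
have mS t : measurable_fun setT (S t).
  apply: continuous_measurable_fun => y.
  have [h1 h2] := line_ctn_y (y + x / 2 * sin t) fa (xc0 t).
  have cs : {for y, continuous (fun u : R => u + x / 2 * sin t)}.
    by apply: continuousD; [exact: id|exact: cst_continuous].
  have k1 := @continuous_comp _ _ _ (fun u : R => u + x / 2 * sin t)
    (fun u => complex.Re (line f (x + x / 2 * cos t) u)) y cs h1.
  have k2 := @continuous_comp _ _ _ (fun u : R => u + x / 2 * sin t)
    (fun u => complex.Im (line f (x + x / 2 * cos t) u)) y cs h2.
  have : {for y, continuous (fun u =>
      sqmod (line f (x + x / 2 * cos t) (u + x / 2 * sin t)))}.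
    by apply: continuousD; apply: continuousM.
  exact.
(* The angle plays the part of the first coordinate in [caratheodory], which lives on positive
   abscissas; this is why 0 is left out of the interval. *)
have mF : measurable_fun ((`]0%R, T]%classic : set RT) `*` setT)
    (fun p : plane R => (S p.1 p.2)%:E).
  apply/measurable_EFinP.
  have := @caratheodory R S (fun t y _ => cS t y) (fun t _ => mS t).
  apply: measurable_funS; first exact: measurable_rhp.
  by move=> [t y] [/=]; rewrite in_itv/= => /andP[t0 _] _.
have F0 (p : plane R) : (`]0%R, T]%classic : set RT) p.1 -> (0 <= (S p.1 p.2)%:E)%E.
  by move=> _; rewrite lee_fin.
have mA : measurable (`]0%R, T]%classic : set RT) by exact: measurable_itv.
pose G y := (\int[leb]_(t in `]0%R, T]) (S t y)%:E)%E.
have mG : measurable_fun setT G := @measurable_strip_outer R leb _ _ mA mF F0.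
have G0 y : (0 <= G y)%E by apply: integral_ge0 => t _; rewrite lee_fin.
have iS t : (\int[leb]_y (S t y)%:E = en f (x + x / 2 * cos t)%R)%E.
  rewrite /en /energy.
  have := @leb_translate R (x / 2 * sin t)
    (fun y => (sqmod (line f (x + x / 2 * cos t) y))%:E).
  move=> <-.
  - by apply: eq_integral => y _; rewrite /S [y + _]addrC.
  - by apply: cmeas_esqmod; exact: line_cmeas.
  - by move=> y; rewrite lee_fin sqmod_ge0.
have M0 : 0 <= M.
  by rewrite -lee_fin; apply: le_trans (HM x _); [exact: en_ge0|lra].
have iG : (\int[leb]_y G y <= (T * M)%:E)%E.
  have := @tonelli_strip_swap R leb _ _ mA mF F0; rewrite -/(G _) => <-.
  apply: (@le_trans _ _ (\int[leb]_(t in `]0%R, T]) M%:E)%E).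
    apply: ge0_le_integral => //.
    - by move=> t _; apply: integral_ge0 => y _; rewrite lee_fin.
    - exact: (@measurable_strip_inner R _ _ mA mF F0).
    - by move=> t _; rewrite /= iS; exact: HM.
  by rewrite integral_cst//= lebesgue_measure_itv/= lte_fin T0 -EFinB -EFinM subr0 mulrC.
have GE y : G y = (rint (S^~ y) 0 T)%:E.
  have cI : ictn (S^~ y) 0 T by move=> t _; exact: cS.
  rewrite /G integral_itv_obnd_cbnd; last first.
    by apply/measurable_EFinP; apply: measurable_funS (@subsetT _ _) (continuous_measurable_fun (fun t => cS t y)).
  by rewrite /rint /Rintegral fineK//; apply: integrable_fin_num => //; exact: ictn_integrable.
have me := cmeas_esqmod (line_cmeas fa x0).
have g1 y : (0 <= (T^-1)%:E * G y)%E by rewrite mule_ge0// lee_fin invr_ge0 ltW.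
have g2 y : (0 <= (sqmod (line f x y))%:E)%E by rewrite lee_fin sqmod_ge0.
apply: (@le_trans _ _ (\int[leb]_y ((8 / x ^+ 2)%:E * ((T^-1)%:E * G y + (sqmod (line f x y))%:E)))%E).
  have fa' := analytic_cderive fa.
  have m1 := cmeas_esqmod (line_cmeas fa' x0).
  have m2 : measurable_fun setT (fun y => (8 / x ^+ 2)%:E * ((T^-1)%:E * G y +
      (sqmod (line f x y))%:E))%E.
    apply: measurable_funeM; apply: emeasurable_funD => //; exact: measurable_funeM.
  apply: (ge0_le_integral leb measurableT _ m1 m2) => y _.
    by rewrite lee_fin; exact: sqmod_ge0.
  rewrite GE -EFinM lee_fin; exact: cderive_sqmod.
have x2 : 0 <= 8 / x ^+ 2 by rewrite divr_ge0// exprn_ge0// ltW.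
rewrite ge0_integralZl_EFin//; first last.
- by apply: emeasurable_funD => //; exact: measurable_funeM.
- by move=> y _; rewrite adde_ge0.
rewrite ge0_integralD//; last exact: measurable_funeM.
rewrite ge0_integralZl_EFin//; last by rewrite invr_ge0 ltW.
rewrite (_ : (16 * M / x ^+ 2)%:E = (8 / x ^+ 2)%:E * ((T^-1)%:E * (T * M)%:E + M%:E))%E; last first.
  rewrite -!EFinM; congr (_%:E).
  by move: (T) T0 => U U0; field; rewrite !gt_eqF.
apply: lee_wpmul2l; first by rewrite lee_fin.
apply: leeD; last by apply: HM; lra.
by apply: lee_wpmul2l => //; rewrite lee_fin invr_ge0 ltW.
Qed.

Lemma hn_bound f d : hardy_away f -> 0 < d -> exists2 M : R, 0 <= M &
  forall t, d <= t -> (en f t <= M%:E)%E.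
Proof.
move=> hf d0; have [M HM] := hf.2 _ d0; exists M => //.
by rewrite -lee_fin; apply: le_trans (HM _ (lexx d)); exact: en_ge0.
Qed.

Lemma hn_derive f : hardy_away f -> hardy_away (cderive f).
Proof.
move=> hf; split; first exact: analytic_cderive hf.1.
move=> d d0; have [M M0 HM] := hn_bound hf (divr_gt0 d0 (ltr0n _ 2)).
exists (16 * M / d ^+ 2) => x dx; have x0 := lt_le_trans d0 dx.
apply: (le_trans (en_derive hf.1 x0 (M := M) _)) => [t xt|].
  by apply: HM; apply: le_trans xt; lra.
rewrite lee_fin ler_wpM2l ?mulr_ge0// lef_pV2 ?posrE ?exprn_gt0//.
by rewrite ler_pXn2r// nnegrE ltW.
Qed.

(* Choosing the length x in the one-dimensional Sobolev inequality. *)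
Lemma hn_pointwise f x y (M : R) : hardy_away f -> 0 < x ->
  (forall t, x / 2 <= t -> (en f t <= M%:E)%E) ->
  sqmod (line f x y) <= 34 * M / x.
Proof.
move=> hf x0 HM; have h1 := sobolev y hf.1 x0 x0.
have xx : x / 2 <= x by lra.
have h2 := en_trunc y (y + x) hf.1 x0 (HM _ xx).
have h3 := en_trunc y (y + x) (hn_derive hf).1 x0 (en_derive hf.1 x0 HM).
rewrite ler_pdivlMr// mulrC; apply: (le_trans h1).
have x2 : 0 < 2 * x ^+ 2 by rewrite mulr_gt0// exprn_gt0.
have h4 : 2 * x ^+ 2 * rint (fun t => sqmod (line (cderive f) x t)) y (y + x) <=
   2 * x ^+ 2 * (16 * M / x ^+ 2) by rewrite ler_pM2l.
have h5 : 2 * x ^+ 2 * (16 * M / x ^+ 2) = 32 * M by field; rewrite gt_eqF.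
lra.
Qed.

Lemma hn_sup f d : hardy_away f -> 0 < d -> exists2 K : R, 0 <= K &
  forall x y, d <= x -> sqmod (line f x y) <= K.
Proof.
move=> hf d0; have [M M0 HM] := hn_bound hf (divr_gt0 d0 (ltr0n _ 2)).
exists (34 * M / d); first by rewrite divr_ge0 ?mulr_ge0// ltW.
move=> x y dx; have x0 := lt_le_trans d0 dx.
apply: (le_trans (hn_pointwise y hf x0 (M := M) _)) => [t xt|].
  by apply: HM; apply: le_trans xt; lra.
by rewrite ler_wpM2l ?mulr_ge0// lef_pV2.
Qed.

Lemma hnD f g : hardy_away f -> hardy_away g -> hardy_away (fun z => f z + g z).
Proof.
move=> [fa fb] [ga gb]; split; first exact: analyticD.
move=> d d0; have [M HM] := fb _ d0; have [N HN] := gb _ d0.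
exists (2 * M + 2 * N) => x dx; have x0 := lt_le_trans d0 dx.
apply: (le_trans (energyD_le _ _ (line_cmeas fa x0) (line_cmeas ga x0))) => //.
rewrite [leRHS](_ : _ = 2%:E * M%:E + 2%:E * N%:E)%E; last by rewrite -!EFinM.
by apply: leeD; apply: lee_wpmul2l => //; [exact: HM|exact: HN].
Qed.

Lemma hnZ f (c : C) : hardy_away f -> hardy_away (fun z => c * f z).
Proof.
move=> [fa fb]; split; first exact: analyticZ.
move=> d d0; have [M HM] := fb _ d0; exists (sqmod c * M) => x dx.
have x0 := lt_le_trans d0 dx.
rewrite /en (_ : line _ x = fun y => c * line f x y)// energyZ//; last exact: line_cmeas.
by rewrite EFinM; apply: lee_wpmul2l; [rewrite lee_fin sqmod_ge0|exact: HM].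
Qed.

Lemma en_shift f (a x : R) : en (fun z => f (z + Complex a 0)) x = en f (x + a).
Proof.
rewrite /en; congr energy; apply/funext => y; rewrite /line; congr f.
by apply: complex_ext => /=; ring.
Qed.

Lemma hn_shift f (a : R) : 0 <= a -> hardy_away f -> hardy_away (fun z => f (z + Complex a 0)).
Proof.
move=> a0 [fa fb]; split; first exact: analytic_shift.
move=> d d0; have [M HM] := fb _ d0; exists M => x dx; rewrite en_shift HM//.
by rewrite (le_trans dx)// lerDl.
Qed.

Lemma enM f g x (K : R) : analytic_rhp f -> analytic_rhp g -> 0 < x ->
  (forall y, sqmod (line g x y) <= K) ->
  (en (fun z => (f z * g z)%R) x <= K%:E * en f x)%E.
Proof.
move=> fa ga x0 HK; have K0 : 0 <= K by apply: le_trans (HK 0); exact: sqmod_ge0.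
have m1 := cmeas_esqmod (line_cmeas fa x0).
rewrite /en /energy -ge0_integralZl_EFin//; last by move=> y _; rewrite lee_fin sqmod_ge0.
have m2 := cmeas_esqmod (line_cmeas (analyticM fa ga) x0).
have m3 := measurable_funeM K%:E m1.
apply: (ge0_le_integral leb measurableT _ m2 m3) => y _.
  by rewrite lee_fin; exact: sqmod_ge0.
rewrite -EFinM lee_fin /line sqmodM [leLHS]mulrC.
by apply: ler_wpM2r; [exact: sqmod_ge0|exact: HK].
Qed.

(** Square-integrability on lines of one factor combines with boundedness of the other on
    half-planes away from the axis. *)
Lemma hnM f g : hardy_away f -> hardy_away g -> hardy_away (fun z => f z * g z).
Proof.
move=> hf hg; split; first exact: analyticM hf.1 hg.1.
move=> d d0; have [M M0 HM] := hn_bound hf d0; have [K K0 HK] := hn_sup hg d0.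
exists (K * M) => x dx; have x0 := lt_le_trans d0 dx.
apply: (le_trans (enM hf.1 hg.1 x0 (fun y => HK x y dx))).
by rewrite EFinM; apply: lee_wpmul2l; [rewrite lee_fin|exact: HM].
Qed.

End HardyCalculus.

#[local] Opaque cderive.

(** * Taylor formula and Littlewood-Paley inequality *)

Section LittlewoodPaley.
Variable R : realType.
Local Notation leb := (@lebesgue_measure R).
Local Notation RT := (measurableTypeR R).
Local Notation C := (R[i]).
Implicit Types (f g : C -> C) (a b x y t : R).

Lemma eq_ler x y : x = y -> x <= y.
Proof. by move=> ->. Qed.

Let ictn_sq f a b y : analytic_rhp f -> 0 < a ->
  ictn (fun s => sqmod (line f s y)) a b.
Proof.
move=> fa a0 s /andP[as_ _]; have [h1 h2] := line_ctn_x y fa (lt_le_trans a0 as_).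
by apply: continuousD; apply: continuousM.
Qed.

Let rint_mono f a b c d y : analytic_rhp f -> 0 < c -> c <= a -> a <= b -> b <= d ->
  rint (fun s => sqmod (line f s y)) a b <= rint (fun s => sqmod (line f s y)) c d.
Proof.
move=> fa c0 ca ab bd; have a0 := lt_le_trans c0 ca.
rewrite (rint_split (a := c) (b := d) (c := a)) ?(le_trans ab)//; last exact: ictn_sq.
rewrite (rint_split (a := a) (b := d) (c := b))//; last exact: ictn_sq.
have p1 : 0 <= rint (fun s => sqmod (line f s y)) c a.
  by apply: Rintegral_ge0 => s _; exact: sqmod_ge0.
have p2 : 0 <= rint (fun s => sqmod (line f s y)) b d.
  by apply: Rintegral_ge0 => s _; exact: sqmod_ge0.
lra.
Qed.

Lemma sqmodN (z : C) : sqmod (- z) = sqmod z.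
Proof. by rewrite /sqmod !reimE !sqrrN. Qed.

Let incr_sym f c d y s t : analytic_rhp f -> 0 < c -> c <= s <= d -> c <= t <= d ->
  sqmod (line f s y - line f t y) <=
  `|s - t| * rint (fun u => sqmod (line (cderive f) u y)) c d.
Proof.
move=> fa c0; wlog ts : s t / t <= s.
  move=> H h1 h2; have [ts|/ltW st] := leP t s; first exact: H.
  by rewrite -sqmodN opprB distrC; exact: H.
move=> /andP[cs sd] /andP[ct td]; rewrite ger0_norm ?subr_ge0//.
apply: (le_trans (increment_x y fa (lt_le_trans c0 ct) ts)).
apply: ler_wpM2l; first by rewrite subr_ge0.
exact: rint_mono (analytic_cderive fa) c0 ct ts sd.
Qed.

(** Subtracting the linear term z f'(t + i y) leaves a function whose derivative is itself an
    increment of f'. Two applications of [increment_x] and one trivial integration give a factor |a|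
    each. *)
Lemma taylor_x f t a y : analytic_rhp f -> `|a| < t ->
  sqmod (line f (t + a) y - line f t y - Complex a 0 * line (cderive f) t y) <=
  `|a| ^+ 3 * rint (fun s => sqmod (line (cderive (cderive f)) s y)) (t - `|a|) (t + `|a|).
Proof.
move=> fa at_; have fa' := analytic_cderive fa.
have c0 : 0 < t - `|a| by rewrite subr_gt0.
have a0 := normr_ge0 a.
have tJ : t - `|a| <= t <= t + `|a| by apply/andP; split; lra.
have aJ : t - `|a| <= t + a <= t + `|a|.
  by have := ler_norm a; have := ler_norm (- a); rewrite normrN => ? ?; apply/andP; split; lra.
set K := rint _ _ _.
have K0 : 0 <= K by apply: Rintegral_ge0 => s _; exact: sqmod_ge0.
pose c := line (cderive f) t y.
pose F (z : C) := f z - z * c.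
have dF z : 0 < complex.Re z -> has_cderiv F z (cderive f z - c).
  move=> z0; move/analytic_has_cderiv : fa => fd.
  have h1 := has_cderivM (has_cderiv_id z) (has_cderiv_cst c z).
  have h2 : has_cderiv (fun w => w * c) z c by move: h1; rewrite mul1r mulr0 addr0.
  exact: has_cderivB (fd _ z0) h2.
have Fa : analytic_rhp F by move=> z z0; have [] := has_cderiv_derivable (dF _ z0).
have FE s : 0 < s -> line (cderive F) s y = line (cderive f) s y - c.
  by move=> s0; rewrite /line; apply: cderiveP; exact: dF.
have -> : line f (t + a) y - line f t y - Complex a 0 * line (cderive f) t y =
    line F (t + a) y - line F t y.
  rewrite -/c /line /F (_ : Complex (t + a) y = Complex t y + Complex a 0); first by ring.
  by apply: complex_ext => /=; ring.
have inc s : t - `|a| <= s <= t + `|a| -> sqmod (line (cderive F) s y) <= `|a| * K.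
  move=> sJ; rewrite FE; last by case/andP : sJ => + _; lra.
  apply: (le_trans (incr_sym y fa' c0 sJ tJ)); rewrite -/K.
  apply: ler_wpM2r => //; rewrite ler_norml; move/andP: sJ => [h1 h2].
  by apply/andP; split; lra.
apply: le_trans (_ : `|a| * (`|a| * K * `|a|) <= _); last first.
  by rewrite !exprS expr0 mulr1; apply: eq_ler; ring.
have main p q : t - `|a| <= p -> p <= q -> q <= t + `|a| -> q - p = `|a| ->
    sqmod (line F q y - line F p y) <= `|a| * (`|a| * K * `|a|).
  move=> h1 pq h2 E; have p0 := lt_le_trans c0 h1.
  apply: (le_trans (increment_x y Fa p0 pq)); rewrite E; apply: ler_wpM2l => //.
  have := rint_bound (f := fun s => sqmod (line (cderive F) s y)) (k := `|a| * K) pq.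
  rewrite E => /(_ (ictn_sq (analytic_cderive Fa) p0)) H.
  apply: le_trans (ler_norm _) (H _) => s /andP[ps sq].
  rewrite ger0_norm ?sqmod_ge0//; apply: inc.
  by rewrite (le_trans h1 ps) (le_trans sq h2).
case/andP: aJ => aJ1 aJ2; have [ap|an] := leP 0 a.
  apply: main => //; rewrite ?ger0_norm//; lra.
rewrite -sqmodN opprB; apply: main => //; rewrite ?ltr0_norm//; lra.
Qed.

(** [taylor_x] integrated over the line: |a|^3 times an interval of length 2 |a|. In norm the
    remainder is thus of order |a|^2. *)
Lemma en_taylor f t a (M : R) : hardy_away f -> `|a| < t / 2 ->
  (forall s, t / 2 <= s -> (en (cderive (cderive f)) s <= M%:E)%E) ->
  (energy leb setT (fun y : RT => (line f (t + a) y - line f t y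
      - Complex a 0 * line (cderive f) t y)%R) <= (2 * a ^+ 4 * M)%:E)%E.
Proof.
move=> hf at2 HM.
have t0 : 0 < t by have := normr_ge0 a; lra.
have tp : 0 < t - `|a| by lra.
have at_ : `|a| < t by lra.
have hf' := hn_derive hf; have hf'' := hn_derive hf'.
have ta : 0 < t + a by have := ler_norm (- a); rewrite normrN; lra.
have m1 : cmeas setT (fun y : RT => line f (t + a) y - line f t y
      - Complex a 0 * line (cderive f) t y).
  have s1 := hn_sqint hf ta; have s2 := hn_sqint hf t0; have s3 := hn_sqint hf' t0.
  exact: (sqintB measurableT (sqintB measurableT s1 s2) (sqintZ measurableT (Complex a 0) s3)).1.
have mh := measurable_hseg (t + `|a|) hf''.1 tp.
have a3 : 0 <= `|a| ^+ 3 by rewrite exprn_ge0.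
apply: (@le_trans _ _ (\int[leb]_y ((`|a| ^+ 3)%:E *
    hseg (cderive (cderive f)) (t - `|a|) (t + `|a|) y))%E).
  apply: (ge0_le_integral leb measurableT _ (cmeas_esqmod m1) (measurable_funeM _ mh)) => y _.
    by rewrite lee_fin sqmod_ge0.
  rewrite (hsegE _ _ hf''.1 tp) -EFinM lee_fin; exact: taylor_x hf.1 at_.
rewrite ge0_integralZl_EFin//; last first.
  by move=> y _; apply: integral_ge0 => s _; rewrite lee_fin sqmod_ge0.
rewrite (hseg_integral _ hf''.1 tp).
have mab : (`[t - `|a|, t + `|a|]%classic : set RT) `<=` `]0%R, +oo[%classic.
  by move=> s/=; rewrite !in_itv/= andbT => /andP[h1 _]; exact: lt_le_trans h1.
have : (\int[leb]_(x in `[(t - `|a|)%R, (t + `|a|)%R]) en (cderive (cderive f)) x <=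
    \int[leb]_(x in `[(t - `|a|)%R, (t + `|a|)%R]) M%:E)%E.
  have m2 := measurable_funS (measurable_itv _) mab (measurable_en hf''.1).
  apply: (ge0_le_integral leb _ _ m2 (measurable_cst _)).
  - exact: measurable_itv.
  - by move=> s _; exact: en_ge0.
  - by move=> s /=; rewrite in_itv/= => /andP[h1 _]; apply: HM; lra.
rewrite integral_cst//= lebesgue_measure_itv/= lte_fin.
have E4 : 2 * a ^+ 4 * M = `|a| ^+ 3 * (2 * `|a| * M).
  have : `|a| ^+ 4 = a ^+ 4 by rewrite -normrX ger0_norm// (exprM a 2 2) sqr_ge0.
  by move=> <-; rewrite !exprS expr0; ring.
rewrite E4 (EFinM (`|a| ^+ 3)) => h; apply: lee_wpmul2l; first by rewrite lee_fin.
apply: (le_trans h); case: ifPn => h2.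
  rewrite -EFinB -EFinM lee_fin; apply: eq_ler; ring.
rewrite mule0 lee_fin; apply: mulr_ge0; first by rewrite mulr_ge0.
rewrite -lee_fin; apply: le_trans (HM t _); [exact: en_ge0|lra].
Qed.

Lemma B_derive_l f g t x : hardy_away f -> hardy_away g -> 0 < t -> 0 < x ->
  is_derive t 1 (fun s => B f g s x) (B (cderive f) g t x).
Proof.
move=> hf hg t0 x0; have hf' := hn_derive hf; have hf'' := hn_derive hf'.
have [M M0 HM] := hn_bound hf'' (divr_gt0 t0 (ltr0n _ 2)).
have sg := hn_sqint hg x0.
apply/is_deriveP => e e0.
pose N := 2 * M * B g g x x.
have bg0 : 0 <= B g g x x by exact: ip_ge0.
have N0 : 0 <= N by rewrite mulr_ge0// mulr_ge0.
(* The Cauchy-Schwarz inequality bounds the error by sqrt N |a|^2, so |a| (sqrt N + 1) < e suffices;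
   t / 2 keeps the Taylor segment away from the axis. *)
exists (Num.min (t / 2) (e / (Num.sqrt N + 1))).
  by rewrite lt_min !divr_gt0// ltr_wpDl ?sqrtr_ge0.
move=> a; rewrite lt_min => /andP[at2 ae].
have ta : 0 < t + a by have := ler_norm (- a); rewrite normrN; lra.
pose q (y : RT) := line f (t + a) y - line f t y - Complex a 0 * line (cderive f) t y.
have s1 := hn_sqint hf ta; have s2 := hn_sqint hf t0; have s3 := hn_sqint hf' t0.
have s12 := sqintB measurableT s1 s2.
have s4 := sqintZ measurableT (Complex a 0) s3.
have sq : sqint leb setT q := sqintB measurableT s12 s4.
have -> : B f g (t + a) x - B f g t x - B (cderive f) g t x * a = ip leb setT q (line g x : RT -> C).
  have e1 := ipBl measurableT s12 s4 sg.
  have e2 := ipBl measurableT s1 s2 sg.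
  have e3 := ipZl measurableT a s3 sg.
  by rewrite /q e1 e2 e3 /B [a * _]mulrC.
apply: (le_trans (ip_CS_sqrt measurableT sq sg)).
have qM : ip leb setT q q <= 2 * a ^+ 4 * M.
  by rewrite -lee_fin -energyE//; exact: en_taylor.
have a4 : a ^+ 4 = (`|a| ^+ 2) ^+ 2 by rewrite -exprM -normrX ger0_norm// (exprM a 2 2) sqr_ge0.
rewrite -sqrtrM ?ip_ge0//.
have : ip leb setT q q * ip leb setT (line g x) (line g x) <= N * (`|a| ^+ 2) ^+ 2.
  rewrite /N -a4 [leRHS](_ : _ = 2 * a ^+ 4 * M * B g g x x); last by ring.
  by apply: ler_wpM2r => //; exact: ip_ge0.
have a20 : 0 <= N * (`|a| ^+ 2) ^+ 2 by rewrite mulr_ge0// sqr_ge0.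
rewrite -(ler_sqrt _ a20) => /le_trans; apply.
rewrite sqrtrM// sqrtr_sqr ger0_norm ?exprn_ge0// expr2 mulrA.
apply: ler_wpM2r; first exact: normr_ge0.
have sN := sqrtr_ge0 N; move: ae; rewrite ltr_pdivlMr; last by lra.
have an := normr_ge0 a; nra.
Qed.

Lemma B_diag f g x y : hardy_away f -> hardy_away g -> 0 < x -> 0 < y ->
  B f g x y = B f g ((x + y) / 2) ((x + y) / 2).
Proof.
move=> hf hg x0 y0.
have h1 : 0 < (x + y) / 2 by rewrite divr_gt0// addr_gt0.
rewrite -(B_shift (x1 := x) (x2 := y) (h := (y - x) / 2))//; try lra.
by congr (B f g _ _); by field.
Qed.

(** Both lines moved by [h] give the same pairing as one line moved by 2 h, so the derivative of one
    variable is taken twice. *)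
Lemma B_derive f g x : hardy_away f -> hardy_away g -> 0 < x ->
  is_derive x 1 (fun s => B f g s s) (2 * B (cderive f) g x x).
Proof.
move=> hf hg x0; apply/is_deriveP => e e0.
have /is_deriveP du := B_derive_l hf hg x0 x0.
have [r r0 H] := du (e / 2) (divr_gt0 e0 (ltr0n _ 2)).
exists (Num.min (r / 2) (x / 2)); first by rewrite lt_min !divr_gt0.
move=> h; rewrite lt_min => /andP[hr hx].
have hh := ler_norm (- h); rewrite normrN in hh.
have x2h : 0 < x + 2 * h by lra.
have xh : 0 < x + h by lra.
have -> : B f g (x + h) (x + h) = B f g (x + 2 * h) x.
  rewrite (B_diag hf hg x2h x0); congr (B f g _ _); by field.
have n2 : `|2 * h| = 2 * `|h| by rewrite normrM ger0_norm.
have := H (2 * h); rewrite n2 => /(_ ltac:(lra)).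
rewrite (_ : B (cderive f) g x x * (2 * h) = 2 * B (cderive f) g x x * h); last by ring.
by move/le_trans; apply; apply: eq_ler; field.
Qed.

End LittlewoodPaley.

(** * Taylor's formula from infinity *)

Section Potential.
Variable R : realType.
Local Notation leb := (@lebesgue_measure R).
Local Notation RT := (measurableTypeR R).
Local Notation C := (R[i]).
Local Notation halfline := (`]0%R, +oo[%classic : set RT).
Implicit Types (f g : C -> C) (x s : R).

Lemma B_sym f g x s : B f g x s = B g f s x.
Proof. exact: ipC. Qed.

Lemma ictn_B f g a b : hardy_away f -> hardy_away g -> 0 < a -> ictn (fun s => B f g s s) a b.
Proof.
move=> hf hg a0 s /andP[as_ _].
exact: is_derive_ctn (B_derive hf hg (lt_le_trans a0 as_)).
Qed.

Lemma measurable_B f g : hardy_away f -> hardy_away g -> measurable_fun halfline (fun s => B f g s s).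
Proof.
move=> hf hg; apply: open_continuous_measurable_fun; first exact: interval_open.
move=> s; rewrite inE/= in_itv/= andbT => s0.
exact: is_derive_ctn (B_derive hf hg s0).
Qed.

(** A primitive of the integrand is (s - x) u1(s) - u(s). *)
Lemma taylor_rint (u u1 u2 : R -> R) x X : x <= X ->
  (forall s, x <= s <= X -> is_derive s 1 u (u1 s)) ->
  (forall s, x <= s <= X -> is_derive s 1 u1 (u2 s)) -> ictn u2 x X ->
  rint (fun s => (s - x) * u2 s) x X = (X - x) * u1 X - u X + u x.
Proof.
move=> xX d1 d2 c2; pose F s := (s - x) * u1 s - u s.
have dF s : x <= s <= X -> is_derive s 1 F ((s - x) * u2 s).
  move=> sX; have h1 := d1 _ sX; have h2 := d2 _ sX.
  have d3 : is_derive s 1 (fun s => s - x) 1.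
    apply/is_deriveP => e e0; exists 1 => // h _.
    rewrite [X in `|X|](_ : _ = 0); last by ring.
    by rewrite normr0 mulr_ge0// ltW.
  have h3 : is_derive s 1 ((fun s => s - x) * u1 - u)
      ((s - x) *: u2 s + u1 s *: 1 - u1 s) := is_deriveB (is_deriveM d3 h2) h1.
  rewrite (_ : (s - x) * u2 s = (s - x) *: u2 s + u1 s *: 1 - u1 s)//.
  by rewrite /GRing.scale/=; ring.
suff -> : rint (fun s => (s - x) * u2 s) x X = F X - F x by rewrite /F; ring.
apply: (rint_ftc xX) => //; apply: ictnM => //.
by apply: ictnB; [move=> s _; exact: id|exact: ictn_cst].
Qed.

Lemma is_derive_cstM (k : R) (u : R -> R) x d : is_derive x 1 u d ->
  is_derive x 1 (fun s => k * u s) (k * d).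
Proof.
move=> /is_deriveP du; apply/is_deriveP => e e0.
have k1 : 0 < `|k| + 1 by rewrite ltr_wpDl.
have [r r0 H] := du (e / (`|k| + 1)) (divr_gt0 e0 k1).
exists r => // h /H {}H; rewrite -mulrA -!mulrBr normrM.
have n0 := normr_ge0 (u (x + h) - u x - d * h).
apply: le_trans (_ : (`|k| + 1) * `|u (x + h) - u x - d * h| <= _).
  by apply: ler_wpM2r => //; rewrite lerDl.
by rewrite mulrC -ler_pdivlMr// mulrAC.
Qed.

Lemma taylor_B f g x X : hardy_away f -> hardy_away g -> 0 < x -> x <= X ->
  rint (fun s => (s - x) * (4 * B (cderive f) (cderive g) s s)) x X =
  (X - x) * (2 * B (cderive f) g X X) - B f g X X + B f g x x.
Proof.
move=> hf hg x0 xX; have hf' := hn_derive hf; have hg' := hn_derive hg.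
pose u s := B f g s s; pose u1 s := 2 * B (cderive f) g s s.
pose u2 s := 4 * B (cderive f) (cderive g) s s.
apply: (@taylor_rint u u1 u2) => //.
- by move=> s /andP[xs _]; exact: B_derive hf hg (lt_le_trans x0 xs).
- move=> s /andP[xs _]; have s0 := lt_le_trans x0 xs.
  (* [B_derive] differentiates the first argument; by symmetry the second derivative falls on [g],
     which yields B(f', g') instead of B(f'', g). *)
  have e1 : (fun t => B (cderive f) g t t) = (fun t => B g (cderive f) t t).
    by apply/funext => t; exact: B_sym.
  have e2 : u2 s = 2 * (2 * B (cderive g) (cderive f) s s).
    have e3 p q : p = q -> 4 * p = 2 * (2 * q) :> R by move=> ->; ring.
    exact: e3 (B_sym _ _ _ _).
  rewrite e2; apply: is_derive_cstM; rewrite e1; exact: B_derive hg hf' s0.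
by apply: ictnM; [exact: ictn_cst|exact: ictn_B].
Qed.

(** Formally the solution of phi'' = u that vanishes at infinity: the positive part of s - x is the
    kernel of twice iterated integration from infinity. *)
Definition pot (u : R -> \bar R) x : \bar R :=
  \int[leb]_(s in `]0%R, +oo[) ((Num.max 0 (s - x))%:E * u s).

Lemma max0_ge0 x : 0 <= Num.max 0 x.
Proof. by rewrite le_max lexx. Qed.

Lemma measurable_pot_kernel (u : R -> \bar R) x : measurable_fun halfline u ->
  measurable_fun halfline (fun s => (Num.max 0 (s - x))%:E * u s)%E.
Proof.
move=> mu; apply: emeasurable_funM => //; apply/measurable_EFinP.
apply: measurable_maxr; first exact: measurable_cst.
by apply: measurable_funB => //; exact: measurable_cst.
Qed.

Lemma pot_le (u : R -> R) x (J : R) : 0 < x -> (forall s, 0 < s -> 0 <= u s) ->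
  measurable_fun halfline u -> (forall X, ictn u x X) ->
  (forall X, x <= X -> rint (fun s => (s - x) * u s) x X <= J) ->
  (pot (EFin \o u) x <= J%:E)%E.
Proof.
move=> x0 u0 mu cu HJ.
pose w s : \bar R := ((Num.max 0 (s - x))%:E * (u s)%:E)%E.
have mw : measurable_fun halfline w.
  by apply: measurable_pot_kernel; exact/measurable_EFinP.
have w0 s : 0 < s -> (0 <= w s)%E.
  by move=> s0; rewrite mule_ge0// lee_fin ?max0_ge0// u0.
pose S (n : nat) : set RT := `]0%R, (n%:R : R)]%classic.
have mS n : measurable (S n) by exact: measurable_itv.
have SE : \bigcup_n S n = halfline.
  apply/seteqP; split=> s.
    by move=> [n _]; rewrite /S/= !in_itv/= andbT => /andP[].
  rewrite /= in_itv/= andbT => s0; exists (Num.bound s) => //.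
  by rewrite /S/= in_itv/= s0 ltW//; apply: archi_boundP; exact: ltW.
have ndS : nondecreasing_seq S.
  move=> p q pq; rewrite subsetEset => s; rewrite /S/= !in_itv/= => /andP[-> h].
  by rewrite (le_trans h)// ler_nat.
have mw' : measurable_fun (\bigcup_n S n) w by rewrite SE.
have cS := ge0_nondecreasing_set_cvg_integral (mu := leb) (F := S) (f := w) ndS mS.
rewrite /pot -SE.
have {}cS : ((\int[leb]_(s in S n) w s)%E @[n --> \oo] --> (\int[leb]_(s in \bigcup_i S i) w s)%E).
  apply: cS => n.
    by apply: measurable_funS mw' => //; [exact: bigcup_measurable|exact: bigcup_sup].
  by move=> s; rewrite /S/= in_itv/= => /andP[s0 _]; exact: w0.
rewrite -(cvg_lim _ cS)//; apply: lime_le; first by apply/cvg_ex; eexists; exact: cS.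
apply: nearW => n.
pose X := Num.max x n%:R; have xX : x <= X by rewrite le_max lexx.
have nX : n%:R <= X by rewrite le_max lexx orbT.
have cw : ictn (fun s => (s - x) * u s) x X.
  apply: ictnM; last exact: cu.
  by apply: ictnB; [move=> s _; exact: id|exact: ictn_cst].
apply: (@le_trans _ _ (\int[leb]_(s in `]0%R, X]) w s)%E).
  have mJ : measurable (`]0%R, X]%classic : set RT) by exact: measurable_itv.
  have mwJ : measurable_fun (`]0%R, X]%classic : set RT) w.
    apply: measurable_funS mw; first exact: measurable_itv.
    by move=> s /=; rewrite !in_itv/= andbT => /andP[].
  apply: (ge0_subset_integral leb (mS n) mJ mwJ).
  - by move=> s /=; rewrite in_itv/= => /andP[s0 _]; exact: w0.
  - by move=> s; rewrite /S/= !in_itv/= => /andP[-> h]; exact: le_trans h nX.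
have XE : (`]0%R, X]%classic : set RT) = `]0%R, x[ `|` `[x, X].
  by rewrite -itv_bndbnd_setU // ?bnd_simp.
have mw1 : measurable_fun (`]0%R, x[ `|` `[x, X] : set RT) w.
  rewrite -XE; apply: measurable_funS mw; first exact: measurable_itv.
  by move=> s /=; rewrite !in_itv/= andbT => /andP[].
have w01 s : (`]0%R, x[ `|` `[x, X] : set RT) s -> (0 <= w s)%E.
  by rewrite -XE/= in_itv/= => /andP[s0 _]; exact: w0.
have dx : [disjoint (`]0%R, x[%classic : set RT) & `[x, X]%classic].
  by apply/disj_setPS => s []; rewrite /= !in_itv/= => /andP[_ h1] /andP[h2 _]; lra.
rewrite XE (ge0_integral_setU leb (measurable_itv _) (measurable_itv _) mw1 w01 dx).
rewrite [X in (X + _)%E](_ : _ = 0)%E ?add0e; last first.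
  apply: integral0_eq => s; rewrite /= in_itv/= => /andP[_ sx].
  by rewrite /w max_l ?mul0e// subr_le0 ltW.
apply: le_trans (_ : ((rint (fun s => (s - x) * u s) x X)%:E <= _)%E); last first.
  by rewrite lee_fin; exact: HJ.
rewrite /rint /Rintegral fineK; last first.
  by apply: integrable_fin_num => //; exact: ictn_integrable.
rewrite le_eqVlt; apply/orP; left; apply/eqP; apply: eq_integral => s; rewrite inE/= in_itv/= => /andP[xs _].
by rewrite /w max_r ?subr_ge0.
Qed.

Lemma pot_lower (u : R -> R) x X : 0 < x -> x <= X -> (forall s, 0 < s -> 0 <= u s) ->
  measurable_fun halfline u -> ictn u x X ->
  ((rint (fun s => (s - x) * u s) x X)%:E <= pot (EFin \o u) x)%E.
Proof.
move=> x0 xX u0 mu cu.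
have cw : ictn (fun s => (s - x) * u s) x X.
  by apply: ictnM => //; apply: ictnB; [move=> s _; exact: id|exact: ictn_cst].
rewrite /rint /Rintegral fineK; last first.
  by apply: integrable_fin_num => //; exact: ictn_integrable.
pose w s : \bar R := ((Num.max 0 (s - x))%:E * (u s)%:E)%E.
have mw : measurable_fun halfline w.
  by apply: measurable_pot_kernel; exact/measurable_EFinP.
apply: (@le_trans _ _ (\int[leb]_(s in `[x, X]) w s)%E).
  rewrite le_eqVlt; apply/orP; left; apply/eqP; apply: eq_integral => s.
  by rewrite inE/= in_itv/= => /andP[xs _]; rewrite /w max_r ?subr_ge0.
apply: (ge0_subset_integral leb (measurable_itv _) (measurable_itv _) mw) => s.
  rewrite /= in_itv/= andbT => s0.
  by rewrite mule_ge0// lee_fin ?max0_ge0// u0.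
by rewrite /= !in_itv/= andbT => /andP[xs _]; exact: lt_le_trans xs.
Qed.

Lemma is_derive_nonincreasing (u : R -> R) x d : is_derive x 1 u d ->
  (forall y, x <= y -> u y <= u x) -> d <= 0.
Proof.
move=> /is_deriveP du ni; rewrite leNgt; apply/negP => d0.
have [r r0 H] := du (d / 2) (divr_gt0 d0 (ltr0n _ 2)).
have r2 : 0 < r / 2 by rewrite divr_gt0.
have := H (r / 2); rewrite gtr0_norm// => /(_ ltac:(lra)) h1.
have h2 := ni (x + r / 2) ltac:(lra).
have := ler_norm (- (u (x + r / 2) - u x - d * (r / 2))); rewrite normrN => h3.
have : 0 < d * r by exact: mulr_gt0.
have e1 : d / 2 * (r / 2) = d * r / 4 by field.
have e2 : d * (r / 2) = d * r / 2 by field.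
rewrite e1 e2 in h1 h3; lra.
Qed.

(** In [taylor_B] with g = f both terms at [X] have the good sign: B(f, f) >= 0, and its derivative
    is nonpositive since energies do not increase. Hence no decay at infinity enters. *)
Lemma littlewood_paley f x : hardy_away f -> 0 < x ->
  (pot (fun s => 4%:E * en (cderive f) s) x <= en f x)%E.
Proof.
move=> hf x0; have hf' := hn_derive hf.
pose u s := 4 * B (cderive f) (cderive f) s s.
have -> : pot (fun s => 4%:E * en (cderive f) s)%E x = pot (EFin \o u) x.
  apply: eq_integral => s; rewrite inE/= in_itv/= andbT => s0.
  by rewrite (enE hf' s0) /u.
rewrite (enE hf x0); apply: pot_le => //.
- by move=> s _; rewrite mulr_ge0//; exact: ip_ge0.
- by apply: measurable_funM; [exact: measurable_cst|exact: measurable_B].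
- by move=> X; apply: ictnM; [exact: ictn_cst|exact: ictn_B].
move=> X xX; have X0 := lt_le_trans x0 xX.
rewrite (taylor_B hf hf x0 xX).
have h1 : 2 * B (cderive f) f X X <= 0.
  apply: (is_derive_nonincreasing (B_derive hf hf X0)) => y Xy.
  by rewrite -lee_fin -!enE//; [exact: en_nonincreasing|exact: lt_le_trans Xy].
have h2 : 0 <= B f f X X by exact: ip_ge0.
have : (X - x) * (2 * B (cderive f) f X X) <= 0.
  by rewrite mulr_ge0_le0// subr_ge0.
lra.
Qed.

(** For two different functions the terms at [X] have no sign, so they are required to be small at
    some arbitrarily chosen [X]; one [X] for each [e] is enough, since the integral up to [X] is at
    most the potential. *)
Lemma B_pot f g x : hardy_away f -> hardy_away g -> 0 < x ->
  (forall e : R, 0 < e -> exists2 X, x <= X &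
    `|B f g X X| <= e /\ `|X * B (cderive f) g X X| <= e) ->
  (`|B f g x x|%:E <= pot (fun s => (4 * `|B (cderive f) (cderive g) s s|)%:E) x)%E.
Proof.
move=> hf hg x0 H; have hf' := hn_derive hf; have hg' := hn_derive hg.
pose u s := 4 * `|B (cderive f) (cderive g) s s|.
have cN (v : R -> R) a b : ictn v a b -> ictn (fun s => `|v s|) a b.
  move=> cv s sab; apply: (@continuous_comp _ _ _ v (fun z : R => `|z|)); first exact: cv.
  exact: norm_continuous.
apply/lee_addgt0Pr => e e0.
have [X xX [h1 h2]] := H (e / 3) (divr_gt0 e0 (ltr0n _ 3)).
have cB : ictn (fun s => B (cderive f) (cderive g) s s) x X by exact: ictn_B.
have cu : ictn u x X by apply: ictnM; [exact: ictn_cst|exact: cN].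
have mu : measurable_fun halfline u.
  apply: measurable_funM; first exact: measurable_cst.
  by apply: measurableT_comp => //; exact: measurable_B.
have u0 s : 0 < s -> 0 <= u s by rewrite mulr_ge0.
have := pot_lower x0 xX u0 mu cu.
have cx : ictn (fun s => s - x) x X.
  by apply: ictnB; [move=> s _; exact: id|exact: ictn_cst].
have cv : ictn (fun s => (s - x) * (4 * B (cderive f) (cderive g) s s)) x X.
  by apply: ictnM => //; apply: ictnM => //; exact: ictn_cst.
have h3 : `|rint (fun s => (s - x) * (4 * B (cderive f) (cderive g) s s)) x X| <=
    rint (fun s => (s - x) * u s) x X.
  have bd s : x <= s <= X -> `|(s - x) * (4 * B (cderive f) (cderive g) s s)| <= (s - x) * u s.
    by move=> /andP[xs _]; rewrite 2!normrM (ger0_norm (ler0n _ 4)) ger0_norm// subr_ge0.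
  apply: le_trans (le_normr_Rintegral _ (ictn_integrable cv)) _ => //.
  apply: rint_le => //; first exact: cN.
  exact: ictnM.
rewrite (taylor_B hf hg x0 xX) in h3.
move=> h4; rewrite addeC; apply: le_trans (leeD (lexx _) h4).
rewrite -EFinD lee_fin.
have h5 : `|(X - x) * (2 * B (cderive f) g X X)| <= 2 * (e / 3).
  rewrite normrM ger0_norm ?subr_ge0// (normrM 2) ger0_norm// mulrCA.
  rewrite normrM ger0_norm in h2; last exact: le_trans (ltW x0) xX.
  have n0 := normr_ge0 (B (cderive f) g X X).
  apply: ler_wpM2l => //; apply: le_trans h2; apply: ler_wpM2r => //.
  by rewrite gerBl ltW.
move: h1 h3 h5; set p := B f g X X; set q := _ * (2 * _); set r := rint _ _ _.
set z := B f g x x => h1 h3 h5.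
rewrite (_ : z = (q - p + z) - q + p); last by ring.
apply: le_trans (ler_normD _ _) _; have := ler_normB (q - p + z) q; lra.
Qed.

(** The Taylor identities live on x > 0, but an atom of the weight evaluates the potential at 0. The
    kernels at 1/(n+1) increase to the kernel at 0, so bounds pass to the limit. *)
Lemma pot_zero (u : R -> \bar R) (J : \bar R) : measurable_fun halfline u ->
  (forall s, 0 < s -> u s \is a fin_num) -> (forall s, 0 < s -> (0 <= u s)%E) ->
  (forall x, 0 < x -> (pot u x <= J)%E) -> (pot u 0 <= J)%E.
Proof.
move=> mu ufin u0 HJ; pose d (n : nat) : R := n.+1%:R^-1.
have d0 n : 0 < d n by rewrite invr_gt0 ltr0n.
have k0 n s : 0 < s -> (0 <= (Num.max 0 (s - d n))%:E * u s)%E.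
  by move=> s0; rewrite mule_ge0 ?u0// lee_fin max0_ge0.
have := @cvg_monotone_convergence _ RT R leb halfline (measurable_itv _)
  (fun n s => (Num.max 0 (s - d n))%:E * u s)%E (fun n => measurable_pot_kernel (d n) mu).
have k0' n s : halfline s -> (0 <= (Num.max 0 (s - d n))%:E * u s)%E.
  by rewrite /= in_itv/= andbT; exact: k0.
move=> /(_ k0') H.
have {}H : pot u (d n) @[n --> \oo] -->
    (\int[leb]_(s in halfline) limn (fun n => (Num.max 0 (s - d n))%:E * u s))%E.
  apply: H => s; rewrite /= in_itv/= andbT => s0 p q pq.
  apply: lee_wpmul2r; first exact: u0.
  rewrite lee_fin; have : d q <= d p.
    by rewrite /d lef_pV2 ?posrE ?ltr0Sn// ler_nat.
  by move=> h; rewrite ge_max max0_ge0/= le_max lerB ?orbT.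
have -> : pot u 0 = (\int[leb]_(s in halfline) limn (fun n => (Num.max 0 (s - d n))%:E * u s))%E.
  apply: eq_integral => s; rewrite inE/= in_itv/= andbT => s0.
  have dl : d n @[n --> \oo] --> (0 : R) by exact: cvg_harmonic.
  have c1 : (Num.max 0 (s - d n)) @[n --> \oo] --> Num.max 0 (s - 0).
    rewrite subr0 max_r ?ltW//.
    have : (s - d n) @[n --> \oo] --> s - 0 by apply: cvgB => //; exact: cvg_cst.
    rewrite subr0 => c2; apply: cvg_trans c2; apply: near_eq_cvg.
    near=> n; rewrite max_r// subr_ge0 ltW//.
    by near: n; apply: (cvgr_lt 0 dl).
  apply/esym/cvg_lim => //; rewrite subr0.
  have c3 : ((Num.max 0 (s - d n))%:E @[n --> \oo] --> (Num.max 0 (s - 0))%:E)%E.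
    by apply: cvg_EFin; [exact: nearW|exact: c1].
  rewrite subr0 in c3; exact: cvgeZr (ufin _ s0) c3.
rewrite -(cvg_lim _ H)//; apply: lime_le; first by apply/cvg_ex; eexists; exact: H.
by apply: nearW => n; exact: HJ.
Unshelve. all: by end_near. Qed.

End Potential.

(** * Doubling weights *)

Section Weights.
Variable R : realType.
Local Notation leb := (@lebesgue_measure R).
Local Notation RT := (measurableTypeR R).
Local Notation halfline := (`]0%R, +oo[%classic : set RT).
Local Notation nneg := (`[0%R, +oo[%classic : set RT).

Lemma weight_lty (m : {measure set RT -> \bar R}) (t : R) : zen_weight m ->
  (m `[0%R, t[%classic < +oo)%E.
Proof.
case=> _ _ [Ht _]; have [t0|t0] := ltP 0 t; first by have /andP[] := Ht _ t0.
by rewrite set_itv_ge ?measure0 ?ltry// bnd_simp -leNgt.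
Qed.

Lemma weight_sigma_finite (m : {measure set RT -> \bar R}) : zen_weight m ->
  sigma_finite setT m.
Proof.
move=> hm; exists (fun n : nat => `]-oo, n%:R[%classic : set RT).
  apply/seteqP; split => // x _; exists (Num.bound x).+1 => //.
  rewrite /= in_itv/=; have [x0|x0] := leP 0 x; last first.
    by apply: lt_le_trans x0 _; rewrite ler0n.
  by apply: lt_trans (archi_boundP x0) _; rewrite ltr_nat.
move=> n; split; first exact: measurable_itv.
have E : (`]-oo, n%:R[%classic : set RT) = `]-oo, 0%R[ `|` `[0%R, n%:R[.
  by rewrite -itv_bndbnd_setU // ?bnd_simp.
rewrite E; apply: (le_lt_trans (measureU2 m (measurable_itv _) (measurable_itv _))).
case: (hm) => m0 _ _.
by rewrite [X in (X + _)%E](_ : _ = 0%E)// add0e; exact: weight_lty.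
Qed.

(* An alias of m carrying the sigma-finite structure that Fubini requires. *)
Definition sigma_finite_copy (m : {measure set RT -> \bar R})
  (sm : sigma_finite setT m) : set RT -> \bar R := m.

HB.instance Definition _ m sm := Measure.on (@sigma_finite_copy m sm).
HB.instance Definition _ m sm :=
  Measure_isSigmaFinite.Build _ RT R (@sigma_finite_copy m sm) sm.

(** The conclusion is an equality of bundled measures, so the general case follows from the
    sigma-finite one by substitution. *)
Lemma sigma_finite_packed (m : {measure set RT -> \bar R}) : sigma_finite setT m ->
  exists m' : {sigma_finite_measure set RT -> \bar R},
    m = (m' : {measure set RT -> \bar R}).
Proof.
move=> sm; exists (sigma_finite_copy sm : {sigma_finite_measure set RT -> \bar R}).
by case: m sm => m [].
Qed.

Lemma doubling_constant (m : {measure set RT -> \bar R}) : doubling m ->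
  exists2 D : R, 0 < D & forall s, 0 < s ->
    (m `[0%R, s[%classic <= D%:E * m `[0%R, (s / 2)%R[%classic)%E.
Proof.
move=> [Hm]; set S := ereal_sup _ => HS.
have SM : exists M : R, (S <= M%:E)%E.
  by case: S HS => [r _|//|_]; [exists r|exists 0; rewrite leNye].
(* The maximum with 1 makes the constant positive without discussing the sign of [M]. *)
have [M HM] := SM; exists (Num.max 1 M); first by rewrite lt_max ltr01.
move=> s s0; have s20 : 0 < s / 2 by rewrite divr_gt0.
have [p1 q1] := andP (Hm _ s0); have [p2 q2] := andP (Hm _ s20).
have f1 : m `[0%R, s[%classic \is a fin_num by rewrite ge0_fin_numE// ltW.
have f2 : m `[0%R, (s / 2)%R[%classic \is a fin_num by rewrite ge0_fin_numE// ltW.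
rewrite -(fineK f1) -(fineK f2) -EFinM lee_fin.
have w0 : 0 < fine (m `[0%R, (s / 2)%R[%classic) by rewrite fine_gt0// p2.
rewrite -ler_pdivrMr//; apply: le_trans (_ : M <= _); last by rewrite le_max lexx orbT.
rewrite -lee_fin; apply: le_trans HM; apply: ereal_sup_ubound.
by exists (s / 2) => //; rewrite (_ : 2 * (s / 2) = s) //; field.
Qed.

Section SigmaFinite.
Variable m : {sigma_finite_measure set RT -> \bar R}.
Hypothesis hm : zen_weight m.

(** The factor that appears at [s] when potentials are integrated against the weight and the order
    of integration is exchanged. *)
Definition weight_moment (s : R) : \bar R := (\int[m]_(x in nneg) (Num.max 0 (s - x))%:E)%E.
Definition weight_below (s : R) : \bar R := m `[0%R, s[%classic.

Let kernel_measurable : measurable_fun setT (fun p : plane R => Num.max 0 (p.2 - p.1)).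
Proof.
apply: measurable_maxr; first exact: measurable_cst.
by apply: measurable_funB; [exact: measurable_snd|exact: measurable_fst].
Qed.

Lemma measurable_mom : measurable_fun setT weight_moment.
Proof.
apply: (@measurable_strip_outer R m nneg (fun p => (Num.max 0 (p.2 - p.1))%:E)) => //.
  by apply: measurable_funTS; apply/measurable_EFinP; exact: kernel_measurable.
by move=> p _; rewrite lee_fin max0_ge0.
Qed.

Lemma wtE s : weight_below s = (\int[m]_(x in nneg) (\1_(`]-oo, s[) x)%:E)%E.
Proof.
rewrite integral_indic//=; congr (m _); apply/seteqP; split=> x; rewrite /= !in_itv/=.
  by case/andP => -> ->.
by case=> -> /andP[->].
Qed.

Lemma measurable_wt : measurable_fun setT weight_below.
Proof.
have := @measurable_strip_outer R m nneg (fun p => (\1_(`]-oo, p.2[) p.1)%:E).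
have -> : (fun y => \int[m]_(x in nneg) (\1_(`]-oo, (x, y).2[) (x, y).1)%:E)%E = weight_below.
  by apply/funext => s; rewrite wtE.
apply => //.
  apply: measurable_funTS; apply/measurable_EFinP.
  have -> : (fun p : plane R => \1_(`]-oo, p.2[) p.1) = \1_[set p : plane R | p.1 < p.2] :> (plane R -> R).
    by apply/funext => p; rewrite !indicE; congr (_ _ _); apply/idP/idP; rewrite !inE/= in_itv/=.
  apply: measurable_indic.
  have := @measurable_fun_ltr _ _ _ setT _ _ (@measurable_fst _ _ RT RT) (@measurable_snd _ _ RT RT).
  move=> /(_ measurableT [set true] ltac:(by [])); rewrite setTI; congr (measurable _).
Qed.

Lemma mom_le s : 0 < s -> (weight_moment s <= s%:E * weight_below s)%E.
Proof.
move=> s0; have mi : measurable_fun nneg (fun x : RT => (\1_(`]-oo, s[) x)%:E : \bar R).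
  by apply/measurable_EFinP; exact: measurable_indic.
rewrite wtE -ge0_integralZl_EFin ?(ltW s0)//.
have mk : measurable_fun nneg (fun x : RT => (Num.max 0 (s - x))%:E).
  apply/measurable_EFinP; apply: measurable_maxr; first exact: measurable_cst.
  by apply: measurable_funB => //; exact: measurable_cst.
apply: (ge0_le_integral m (measurable_itv _) _ mk (measurable_funeM _ mi)) => x.
  by rewrite lee_fin max0_ge0.
rewrite /= in_itv/= andbT => x0; rewrite -EFinM lee_fin indicE.
have [xs|xs] := ltP x s.
  by rewrite mem_set/= ?in_itv//= mulr1 ge_max ltW//= gerBl.
by rewrite max_l ?subr_le0// mulr_ge0// ltW.
Qed.

(** On [0, s/2) the kernel s - x is at least s/2. Doubling will replace m[0, s/2) by m[0, s), up to
    a constant. *)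
Lemma mom_ge s : 0 < s -> ((s / 2)%:E * weight_below (s / 2) <= weight_moment s)%E.
Proof.
move=> s0; have s20 : 0 < s / 2 by rewrite divr_gt0.
have mi : measurable_fun nneg (fun x : RT => (\1_(`]-oo, (s / 2)%R[) x)%:E : \bar R).
  by apply/measurable_EFinP; exact: measurable_indic.
rewrite wtE -ge0_integralZl_EFin ?(ltW s20)//.
have mk : measurable_fun nneg (fun x : RT => (Num.max 0 (s - x))%:E).
  apply/measurable_EFinP; apply: measurable_maxr; first exact: measurable_cst.
  by apply: measurable_funB => //; exact: measurable_cst.
apply: (ge0_le_integral m (measurable_itv _) _ (measurable_funeM _ mi) mk) => x.
  by rewrite -EFinM lee_fin indicE mulr_ge0// ltW.
rewrite /= in_itv/= andbT => x0; rewrite -EFinM lee_fin indicE.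
have [xs|xs] := ltP x (s / 2).
  by rewrite mem_set/= ?in_itv//= mulr1 le_max; apply/orP; right; lra.
by rewrite memNset ?mulr0 ?max0_ge0//= in_itv/=; apply/negP; rewrite -leNgt.
Qed.

Lemma pot_integral (u : R -> \bar R) : measurable_fun halfline u ->
  (forall s, 0 < s -> (0 <= u s)%E) ->
  measurable_fun nneg (pot u) /\
  (\int[m]_(x in nneg) pot u x = \int[leb]_(s in halfline) (weight_moment s * u s))%E.
Proof.
move=> mu u0; pose v := u \_ halfline.
have v0 s : (0 <= v s)%E.
  by apply: erestrict_ge0 => t; rewrite /= in_itv/= andbT; exact: u0.
have mv : measurable_fun setT v by exact/(measurable_restrictT _ _).1.
pose F (p : plane R) : \bar R := ((Num.max 0 (p.2 - p.1))%:E * v p.2)%E.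
have mF : measurable_fun (nneg `*` setT) F.
  apply: measurable_funTS; apply: emeasurable_funM.
    by apply/measurable_EFinP; exact: kernel_measurable.
  exact: measurableT_comp mv (@measurable_snd _ _ RT RT).
have F0 (p : plane R) : nneg p.1 -> (0 <= F p)%E.
  by move=> _; rewrite mule_ge0// lee_fin max0_ge0.
have pE x : pot u x = (\int[leb]_s F (x, s))%E.
  rewrite /pot integral_mkcond; apply: eq_integral => s _; rewrite /F /v !patchE/=.
  by case: ifPn => //; rewrite mule0.
split.
  rewrite (_ : pot u = fun x => \int[leb]_s F (x, s))%E; last exact/funext.
  exact: (@measurable_strip_inner R nneg F (measurable_itv _) mF F0).
rewrite (eq_integral (fun x => \int[leb]_s F (x, s))%E) => [|x _]; last exact: pE.
rewrite (@tonelli_strip_swap R m nneg F (measurable_itv _) mF F0).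
rewrite [RHS]integral_mkcond; apply: eq_integral => s _.
rewrite /F/= patchE; have [sh|sh] := boolP (s \in halfline); last first.
  by rewrite /v patchE (negPf sh); apply: integral0_eq => x _; rewrite mule0.
rewrite /v patchE sh; have s0 : 0 < s by move: sh; rewrite inE/= in_itv/= andbT.
rewrite /weight_moment ge0_integralZr//; last exact: u0.
- apply/measurable_EFinP; apply: measurable_maxr; first exact: measurable_cst.
  by apply: measurable_funB => //; exact: measurable_cst.
- by move=> x _; rewrite lee_fin max0_ge0.
Qed.

Lemma measurable_momM (u : R -> \bar R) : measurable_fun halfline u ->
  measurable_fun halfline (fun s => weight_moment s * u s)%E.
Proof. by move=> mu; apply: emeasurable_funM => //; exact: measurable_funTS measurable_mom. Qed.

Lemma measurable_wtM (u : R -> \bar R) : measurable_fun halfline u ->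
  measurable_fun halfline (fun s => s%:E * weight_below s * u s)%E.
Proof.
move=> mu; apply: emeasurable_funM => //; apply: emeasurable_funM.
  exact/measurable_EFinP.
exact: measurable_funTS measurable_wt.
Qed.

Lemma pot_integral_le (u : R -> \bar R) : measurable_fun halfline u ->
  (forall s, 0 < s -> (0 <= u s)%E) ->
  (\int[m]_(x in nneg) pot u x <= \int[leb]_(s in halfline) (s%:E * weight_below s * u s))%E.
Proof.
move=> mu u0; rewrite (pot_integral mu u0).2.
have h : forall s, halfline s -> (0 <= u s)%E /\ 0 < s.
  by move=> s; rewrite /= in_itv/= andbT => s0; rewrite u0.
apply: (ge0_le_integral leb (measurable_itv _) _ (measurable_momM mu) (measurable_wtM mu)) => s /h[us s0].
  by apply: mule_ge0 => //; apply: integral_ge0 => x _; rewrite lee_fin max0_ge0.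
by apply: lee_wpmul2r => //; exact: mom_le.
Qed.

Lemma pot_integral_ge : exists2 D : R, 0 < D &
  forall u : R -> \bar R, measurable_fun halfline u -> (forall s, 0 < s -> (0 <= u s)%E) ->
  (\int[leb]_(s in halfline) (s%:E * weight_below s * u s) <= D%:E * \int[m]_(x in nneg) pot u x)%E.
Proof.
have [D D0 HD] : exists2 D : R, 0 < D & forall s, 0 < s ->
    (m `[0%R, s[%classic <= D%:E * m `[0%R, (s / 2)%R[%classic)%E.
  by apply: doubling_constant; case: hm.
exists (2 * D); first by rewrite mulr_gt0.
move=> u mu u0; rewrite (pot_integral mu u0).2.
have h : forall s, halfline s -> (0 <= u s)%E /\ 0 < s.
  by move=> s; rewrite /= in_itv/= andbT => s0; rewrite u0.
have mom0 s : (0 <= weight_moment s)%E by apply: integral_ge0 => x _; rewrite lee_fin max0_ge0.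
rewrite -ge0_integralZl_EFin//; first last.
- by rewrite mulr_ge0// ltW.
- exact: measurable_momM.
- by move=> s /h[us _]; exact: mule_ge0.
apply: (ge0_le_integral leb (measurable_itv _) _ (measurable_wtM mu) (measurable_funeM _ (measurable_momM mu))) => s /h[us s0].
  by rewrite !mule_ge0// lee_fin ltW.
rewrite muleA; apply: lee_wpmul2r => //.
apply: le_trans (_ : ((2 * D)%:E * ((s / 2)%:E * weight_below (s / 2)) <= _)%E); last first.
  by apply: lee_wpmul2l; [rewrite lee_fin mulr_ge0// ltW|exact: mom_ge].
rewrite muleA -EFinM (_ : 2 * D * (s / 2) = s * D); last by field.
rewrite EFinM -muleA; apply: lee_wpmul2l; first by rewrite lee_fin ltW.
exact: HD.
Qed.

(** The identities from Cauchy's theorem hold for positive abscissas only; the axis enters through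
    the mass of 0 and is treated with boundary values. *)
Lemma nneg_split (v : R -> \bar R) : measurable_fun nneg v ->
  (forall x, 0 <= x -> (0 <= v x)%E) ->
  (\int[m]_(x in nneg) v x = v 0%R * m [set 0%R] + \int[m]_(x in halfline) v x)%E.
Proof.
move=> mv v0; have E : nneg = [set 0%R] `|` halfline.
  apply/seteqP; split => x; rewrite /= !in_itv/= !andbT.
    by rewrite le_eqVlt => /predU1P[<-|]; [left|right].
  by case=> [->|/ltW].
have d0 : [disjoint ([set 0%R] : set RT) & halfline].
  by apply/disj_setPS => s [/= ->]; rewrite in_itv/= ltxx.
rewrite {1}E (ge0_integral_setU m (measurable_set1 _) (measurable_itv _) _ _ d0).
- congr (_ + _)%E; rewrite (eq_integral (cst (v 0))) => [|x]; last by rewrite inE => ->.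
  by rewrite integral_cst.
- by rewrite -E.
- by rewrite -E => x; rewrite /= in_itv/= andbT; exact: v0.
Qed.

End SigmaFinite.
End Weights.

(** * Zen functions and their boundary values *)

Section ZenHardy.
Variable R : realType.
Local Notation leb := (@lebesgue_measure R).
Local Notation RT := (measurableTypeR R).
Local Notation C := (R[i]).
Local Notation halfline := (`]0%R, +oo[%classic : set RT).
Local Notation nneg := (`[0%R, +oo[%classic : set RT).
Implicit Types (f g : C -> C) (x y h : R).

Lemma analytic_cmeas_shift f (e : R) : analytic_rhp f -> 0 < e ->
  cmeas (@crhp R) (fun p : plane R => f (cplx p + Complex e 0)).
Proof.
move=> fa e0; have [m1 m2] := analytic_cmeas fa.
pose phi (p : plane R) : plane R := (p.1 + e, p.2).
have mphi : measurable_fun (@crhp R) phi.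
  apply: measurable_funTS; apply/measurable_fun_pairP; split.
    by apply: measurable_funD; [exact: measurable_fst|exact: measurable_cst].
  exact: measurable_snd.
have im : phi @` (@crhp R) `<=` @rhp R.
  by move=> _ [p p0 <-]; rewrite /rhp/=; apply: ltr_wpDl.
have E (p : plane R) : cplx (phi p) = cplx p + Complex e 0.
  by apply: complex_ext; rewrite /= ?addr0.
split.
  have := measurable_comp (@measurable_rhp R) im m1 mphi.
  by apply: eq_measurable_fun => p _ /=; rewrite E.
have := measurable_comp (@measurable_rhp R) im m2 mphi.
by apply: eq_measurable_fun => p _ /=; rewrite E.
Qed.

(** The sum of the energies at x - h and x + h, averaged over h in [0, Q), is at most 2 J / Q. One
    and the same [h] must serve both sides, as [en_midpoint] needs symmetric lines; the added 1
    makes the contradiction strict. *)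
Lemma slab_average f (P Q J x : R) : analytic_rhp f -> 0 < P -> P < x - Q -> 0 < Q ->
  (\int[leb]_(t in `](x - Q)%R, (x + Q)%R[) en f t <= J%:E)%E -> 
  exists2 h : R, 0 <= h < Q & (en f (x - h) <= (2 * J / Q + 1)%:E)%E /\
    (en f (x + h) <= (2 * J / Q + 1)%:E)%E.
Proof.
move=> fa P0 PQ Q0 HJ.
pose S : set RT := `](x - Q)%R, (x + Q)%R[%classic.
have mS : measurable S by exact: measurable_itv.
have SH : S `<=` halfline.
  by move=> t; rewrite /S/= !in_itv/= andbT => /andP[h1 _]; apply: lt_trans h1; exact: lt_trans PQ.
pose v := en f \_ S.
have v0 t : (0 <= v t)%E by apply: erestrict_ge0 => s _; exact: en_ge0.
have mv : measurable_fun setT v.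
  by apply/(measurable_restrictT _ _).1 => //; exact: measurable_funS SH (measurable_en fa).
have J0 : 0 <= J.
  by rewrite -lee_fin; apply: le_trans HJ; apply: integral_ge0 => t _; exact: en_ge0.
have Iv : (\int[leb]_t v t <= J%:E)%E by rewrite -integral_mkcond.
have mh : measurable_fun setT (fun h : RT => v (x - h)).
  by apply: measurableT_comp mv _; apply: measurable_funB => //; exact: measurable_cst.
have mh' : measurable_fun setT (fun h : RT => v (x + h)).
  by apply: measurableT_comp mv _; apply: measurable_funD => //; exact: measurable_cst.
have I2 : (\int[leb]_h (v (x - h)%R + v (x + h)%R) <= (2 * J)%:E)%E.
  rewrite ge0_integralD// leb_reflect// leb_translate//.
  by rewrite mulrDl mul1r EFinD leeD.
pose L := 2 * J / Q + 1.
apply: contrapT => H.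
have H' h : (`[0%R, Q[%classic : set RT) h -> (L%:E <= v (x - h)%R + v (x + h)%R)%E.
  rewrite /= in_itv/= => hQ; have /andP[h0 hQ'] := hQ.
  have e1 : v (x - h) = en f (x - h).
    by rewrite /v patchE mem_set// /S/= in_itv/=; apply/andP; split; lra.
  have e2 : v (x + h) = en f (x + h).
    by rewrite /v patchE mem_set// /S/= in_itv/=; apply/andP; split; lra.
  rewrite e1 e2 leNgt; apply/negP => lt1; apply: H; exists h => //; split.
    apply/ltW/(le_lt_trans _ lt1); rewrite leeDl//; exact: en_ge0.
  apply/ltW/(le_lt_trans _ lt1); rewrite leeDr//; exact: en_ge0.
have : ((L * Q)%:E <= (2 * J)%:E)%E.
  apply: le_trans I2; apply: (@le_trans _ _ (\int[leb]_(h in `[0%R, Q[) (v (x - h)%R + v (x + h)%R))%E).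
    rewrite [leLHS](_ : _ = \int[leb]_(h in `[0%R, Q[) L%:E)%E; last first.
      by rewrite integral_cst//= lebesgue_measure_itv/= lte_fin Q0 -EFinB subr0 -EFinM.
    apply: (ge0_le_integral leb (measurable_itv _) _ (measurable_cst _)).
    - by move=> h _; rewrite lee_fin addr_ge0// divr_ge0 ?mulr_ge0// ltW.
    - by apply: measurable_funTS; exact: emeasurable_funD.
    - exact: H'.
  apply: (ge0_subset_integral leb (measurable_itv _) measurableT) => //.
    exact: emeasurable_funD.
  by move=> h _; exact: adde_ge0.
rewrite lee_fin /L mulrDl mul1r divfK ?gt_eqF//; lra.
Qed.

Variable m : {sigma_finite_measure set RT -> \bar R}.
Hypothesis hm : zen_weight m.
Local Notation nu := (m \x leb)%E.

Lemma zen_shift_integral f (e : R) : analytic_rhp f -> 0 < e ->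
  (\int[nu]_(p in @crhp R) (sqmod (f (cplx p + Complex e 0)))%:E =
   \int[m]_(x in nneg) en f (x + e)%R)%E.
Proof.
move=> fa e0; have mF := cmeas_esqmod (analytic_cmeas_shift fa e0).
rewrite crhpE in mF *.
have F0 (p : plane R) : nneg p.1 -> (0 <= (sqmod (f (cplx p + Complex e 0)))%:E)%E.
  by move=> _; rewrite lee_fin; exact: sqmod_ge0.
rewrite (@tonelli_strip R m nneg _ (measurable_itv _) mF F0).
by apply: eq_integral => x _; rewrite -en_shift.
Qed.

Lemma measurable_en_shift f (e : R) : analytic_rhp f -> 0 < e ->
  measurable_fun nneg (fun x => en f (x + e)).
Proof.
move=> fa e0; apply: (measurable_comp (measurable_itv _) _ (measurable_en fa)).
  by move=> _ [x + <-]; rewrite /= !in_itv/= !andbT => x0; rewrite ltr_wpDl.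
by apply: measurable_funD => //; exact: measurable_cst.
Qed.

(** The Zen bound is integrated over the shifts y in [a, b] and Tonelli is applied. If x lies in
    [0, d) and t in ]a + d, b[, then t - x is one of these shifts, so each such x sees the whole
    window; dividing by m[0, d) > 0 leaves its energy. *)
Lemma zen_window f : zen m f -> forall d : R, 0 < d -> exists2 K : R, 0 <= K &
  forall a b, 0 < a -> a <= b -> (\int[leb]_(t in `](a + d)%R, b[) en f t <= (K * (b - a))%:E)%E.
Proof.
move=> [fa]; set S := ereal_sup _ => HS d d0.
have [M M0 HM] : exists2 M : R, 0 <= M &
    forall e, 0 < e -> (\int[m]_(x in nneg) en f (x + e)%R <= M%:E)%E.
  have SE e : 0 < e -> (\int[m]_(x in nneg) en f (x + e)%R <= S)%E.
    move=> e0; rewrite -zen_shift_integral//; apply: ereal_sup_ubound.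
    by exists e.
  have S0 : (0 <= S)%E.
    by apply: le_trans (SE _ (ltr01)); apply: integral_ge0 => x _; exact: en_ge0.
  exists (fine S); first exact: fine_ge0.
  by move=> e e0; rewrite fineK ?ge0_fin_numE//; exact: SE.
have wd : (0 < weight_below m d < +oo)%E by case: (hm) => _ _ [Hd _]; exact: Hd.
have /andP[wd0 wdoo] := wd.
have wf : weight_below m d \is a fin_num by rewrite ge0_fin_numE// ltW.
have w0 : 0 < fine (weight_below m d) by rewrite fine_gt0.
exists (M / fine (weight_below m d)); first by rewrite divr_ge0// ltW.
move=> a b a0 ab.
pose S' : set RT := `](a + d)%R, b[%classic.
have mS : measurable S' by exact: measurable_itv.
have SH : S' `<=` halfline.
  by move=> t; rewrite /S'/= !in_itv/= andbT => /andP[h1 _]; lra.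
pose v := en f \_ S'.
have v0 t : (0 <= v t)%E by apply: erestrict_ge0 => s _; exact: en_ge0.
have mv : measurable_fun setT v.
  by apply/(measurable_restrictT _ _).1 => //; exact: measurable_funS SH (measurable_en fa).
pose A : set RT := `[0%R, d[%classic.
have mA : measurable A by exact: measurable_itv.
pose F (p : plane R) := v (p.1 + p.2).
have mF : measurable_fun (A `*` setT) F.
  apply: measurable_funTS; apply: measurableT_comp mv _.
  by apply: measurable_funD; [exact: measurable_fst|exact: measurable_snd].
have F0 (p : plane R) : A p.1 -> (0 <= F p)%E by move=> _; exact: v0.
have swap := @tonelli_strip_swap R m A F mA mF F0.
have lhs : (\int[m]_(x in A) \int[leb]_y F (x, y) = (\int[leb]_t v t) * weight_below m d)%E.
  rewrite (eq_integral (cst (\int[leb]_t v t)%E)) => [|x _]; last exact: leb_translate.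
  by rewrite integral_cst.
have mG := @measurable_strip_outer R m A F mA mF F0.
have G0 y : (0 <= \int[m]_(x in A) F (x, y))%E.
  by apply: integral_ge0 => x _; exact: v0.
have rhs : (\int[leb]_y \int[m]_(x in A) F (x, y) <= (M * (b - a))%:E)%E.
  apply: (@le_trans _ _ (\int[leb]_y ((cst M%:E \_ (`[a, b]%classic : set RT)) y))%E); last first.
    rewrite -integral_mkcond integral_cst//= lebesgue_measure_itv/=; case: ifPn => h.
      by rewrite -EFinB -EFinM.
    by rewrite mule0 lee_fin mulr_ge0// subr_ge0.
  apply: (ge0_le_integral leb measurableT _ mG) => //.
    by apply/(measurable_restrictT _ _).1 => //; exact: measurable_itv.
  move=> y _; rewrite patchE; case: ifPn => [|ny].
    rewrite inE/= in_itv/= => /andP[ay yb]; have y0 := lt_le_trans a0 ay.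
    apply: le_trans (HM _ y0); apply: (@le_trans _ _ (\int[m]_(x in A) en f (x + y)%R)%E).
      have mvy : measurable_fun setT (fun x : RT => v (x + y)).
        apply: (measurableT_comp mv).
        by apply: measurable_funD; [exact: measurable_id|exact: measurable_cst].
      have AN : A `<=` nneg by move=> x; rewrite /A/= !in_itv/= andbT => /andP[].
      apply: (ge0_le_integral m mA _ _ (measurable_funS (measurable_itv _) AN (measurable_en_shift fa y0))).
      - by move=> x _; exact: v0.
      - exact: measurable_funTS mvy.
      - move=> x _; rewrite /F /v patchE/=; case: ifPn => // _; exact: en_ge0.
    apply: (ge0_subset_integral m mA (measurable_itv _) (measurable_en_shift fa y0)).
      by move=> x _; exact: en_ge0.
    by move=> x; rewrite /A/= !in_itv/= andbT => /andP[].
  rewrite le_eqVlt; apply/orP; left; apply/eqP; apply: integral0_eq => x.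
  rewrite /A/= in_itv/= => /andP[x0 xd]; rewrite /F /v patchE memNset//.
  rewrite /S'/= in_itv/= => /andP[h1 h2]; move/negP: ny; apply.
  by rewrite inE/= in_itv/=; apply/andP; split; lra.
rewrite [leLHS](_ : _ = \int[leb]_t v t)%E; last by rewrite [LHS]integral_mkcond.
rewrite mulrAC EFinM lee_pdivlMr// fineK//.
by rewrite -lhs swap.
Qed.

(** From averages to every line: windows have bounded energy, so two symmetric lines near x are
    good, and midpoint convexity bounds the line x itself. The bound depends on [d] only, since
    windows of equal length have the same bound. *)
Lemma zen_hn f : zen m f -> hardy_away f.
Proof.
move=> zf; have fa := zf.1; split => // d d0.
have sf : slab f.
  split=> // a b a0; have [K K0 HK] := zen_window zf (divr_gt0 a0 (ltr0n _ 4)).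
  have [ab|ba] := leP a b; last first.
    by rewrite set_itv_ge ?integral_set0 ?ltry// bnd_simp -ltNge.
  have := HK (a / 4) (b + 1) (divr_gt0 a0 (ltr0n _ 4)) ltac:(lra).
  move=> h; apply: le_lt_trans (le_trans _ h) (ltry _).
  apply: (ge0_subset_integral leb (measurable_itv _) (measurable_itv _)).
  - apply: measurable_funS (measurable_en fa); first exact: measurable_itv.
    by move=> t; rewrite /= !in_itv/= andbT => /andP[h1 _]; lra.
  - by move=> t _; exact: en_ge0.
  - by move=> t; rewrite /= !in_itv/= => /andP[h1 h2]; apply/andP; split; lra.
(* For x >= 4 Q the window ]x - Q, x + Q[ is obtained from a = x - 2 Q and b = x + Q, whose
   difference is the 3 Q in [J]. *)
pose Q := d / 4; have Q0 : 0 < Q by rewrite divr_gt0.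
have [K K0 HK] := zen_window zf Q0.
pose J := K * (3 * Q); exists (2 * J / Q + 1) => x dx.
have dQ : d = 4 * Q by rewrite /Q; field.
have w : (\int[leb]_(t in `](x - Q)%R, (x + Q)%R[) en f t <= J%:E)%E.
  have := HK (x - 2 * Q) (x + Q) ltac:(lra) ltac:(lra).
  rewrite (_ : x - 2 * Q + Q = x - Q); last by ring.
  by rewrite (_ : x + Q - (x - 2 * Q) = 3 * Q)//; ring.
have [h /andP[h0 hQ] [h1 h2]] := slab_average fa Q0 (x := x) (Q := Q) ltac:(lra) Q0 w.
have := en_midpoint sf h0 (x := x) ltac:(lra) h1 h2.
by rewrite (_ : (_ + _) / 2 = 2 * J / Q + 1); last by field; rewrite gt_eqF.
Qed.

End ZenHardy.

(** * Poisson averages and the Hardy-Littlewood maximal function *)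

Section Maximal.
Variable R : realType.
Local Notation leb := (@lebesgue_measure R).
Local Notation RT := (measurableTypeR R).
Local Notation C := (R[i]).
Implicit Types (f g : C -> C) (x y : R).

Let pk_den x y0 y : 0 < x -> 0 < x ^+ 2 + (y - y0) ^+ 2.
Proof. by move=> x0; rewrite ltr_wpDr ?sqr_ge0// exprn_gt0. Qed.

Definition poisson_weight (x y0 y : R) : R := x / (x ^+ 2 + (y - y0) ^+ 2).

Lemma pk_ge0 x y0 y : 0 < x -> 0 <= poisson_weight x y0 y.
Proof. by move=> x0; rewrite divr_ge0 ?ltW// pk_den. Qed.

Lemma pk_measurable x y0 : 0 < x -> measurable_fun setT (poisson_weight x y0 : RT -> R).
Proof.
move=> x0; apply: continuous_measurable_fun => y.
have cB : {for y, continuous (fun t : R => t - y0)}.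
  by apply: continuousB; [exact: id|exact: cst_continuous].
have cq : {for y, continuous (fun t : R => (t - y0) ^+ 2)}.
  have -> : (fun t : R => (t - y0) ^+ 2) = (fun t => t - y0) * (fun t => t - y0).
    by apply/funext => t; rewrite expr2.
  exact: continuousM.
have cd : {for y, continuous (fun t : R => x ^+ 2 + (t - y0) ^+ 2)}.
  by apply: continuousD; first exact: cst_continuous.
have cv : {for y, continuous (fun t : R => (x ^+ 2 + (t - y0) ^+ 2)^-1)}.
  by apply: continuousV => //; rewrite gt_eqF// pk_den.
have ck : {for y, continuous (fun t : R => x / (x ^+ 2 + (t - y0) ^+ 2))}.
  by apply: continuousM => //; exact: cst_continuous.
exact: ck.
Qed.

Lemma sqmodV (z : C) : z != 0 -> sqmod z^-1 = (sqmod z)^-1.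
Proof.
move=> z0; have s0 : sqmod z != 0.
  by rewrite sqmodE expf_neq0// gt_eqF// normc_gt0.
apply: (mulfI s0); rewrite -sqmodM mulfV// mulfV//.
by rewrite /sqmod /= expr1n expr0n addr0.
Qed.

(* The weight 1/(z + x0 - i y0) localises f near x0 + i y0; the monotonicity of
   the vertical energies then plays the role of the Poisson formula. The constant is
   136 = 34 * 4: 34 is the Sobolev constant, and the weight is 1/(2 x0) at the
   point itself. *)
Lemma poisson_bound f x0 y0 (d : R) : hardy_away f -> 0 < d -> 2 * d <= x0 ->
  ((sqmod (line f x0 y0))%:E <=
   136%:E * \int[leb]_y (poisson_weight x0 y0 y * sqmod (line f d y))%:E)%E.
Proof.
move=> hf d0 dx; have x00 : 0 < x0 by lra.
pose q : C := Complex x0 (- y0).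
pose k (z : C) : C := (z + q)^-1.
have nz (z : C) : 0 < complex.Re z -> z + q != 0.
  move=> z0; apply/eqP => /(congr1 (@complex.Re R)); rewrite cReD/=; lra.
have ka : analytic_rhp k.
  move=> z z0; suff : has_cderiv k z (- (z + q) ^- 2 * (1 + 0)).
    by move=> /has_cderiv_derivable[].
  apply: (has_cderiv_comp (f := fun w => w^-1)); last exact: has_cderivV (nz _ z0).
  exact: has_cderivD (has_cderiv_id z) (has_cderiv_cst q z).
have kE t y : 0 < t -> sqmod (line k t y) = ((t + x0) ^+ 2 + (y - y0) ^+ 2)^-1.
  by move=> t0; rewrite /line /k sqmodV ?nz// /sqmod !reimE.
have kle t y : 0 < t -> sqmod (line k t y) <= (x0 ^+ 2 + (y - y0) ^+ 2)^-1.
  move=> t0; rewrite kE// lef_pV2 ?posrE ?pk_den//; last by rewrite addr_gt0.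
  by rewrite lerD2r ler_pXn2r// ?nnegrE; lra.
have kle' t y : 0 < t -> sqmod (line k t y) <= (x0 ^+ 2)^-1.
  move=> t0; apply: (le_trans (kle _ _ t0)).
  by rewrite lef_pV2 ?posrE ?pk_den ?exprn_gt0// lerDl sqr_ge0.
pose g (z : C) := f z * k z.
have hg : hardy_away g.
  split; first exact: analyticM hf.1 ka.
  move=> e e0; have [M HM] := hf.2 _ e0; exists ((x0 ^+ 2)^-1 * M) => t et.
  have t0 := lt_le_trans e0 et.
  apply: (le_trans (enM hf.1 ka t0 (fun y => kle' t y t0))).
  rewrite EFinM; apply: lee_wpmul2l; last exact: HM.
  by rewrite lee_fin invr_ge0 sqr_ge0.
pose M := B g g d d.
have M0 : 0 <= M by exact: ip_ge0.
have HM t : x0 / 2 <= t -> (en g t <= M%:E)%E.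
  by move=> xt; rewrite -enE//; apply: en_nonincreasing => //; lra.
have := hn_pointwise y0 hg x00 HM.
have -> : sqmod (line g x0 y0) = sqmod (line f x0 y0) / (4 * x0 ^+ 2).
  by rewrite /line sqmodM -/(line k x0 y0) kE// subrr expr0n/= addr0 -mulr2n exprMn_n -mulr_natl.
rewrite ler_pdivrMr ?mulr_gt0 ?exprn_gt0// => h1.
have {}h1 : sqmod (line f x0 y0) <= 136 * (x0 * M).
  by apply: (le_trans h1); apply: eq_ler; field; rewrite gt_eqF.
rewrite -lee_fin in h1; apply: (le_trans h1).
rewrite (EFinM 136); apply: lee_wpmul2l; first by rewrite lee_fin.
rewrite EFinM -(enE hg d0).
have mg := cmeas_esqmod (line_cmeas hg.1 d0).
rewrite /en /energy -ge0_integralZl_EFin ?(ltW x00)//; last first.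
  by move=> y _; rewrite lee_fin; exact: sqmod_ge0.
have mr : measurable_fun setT (fun y : RT => (poisson_weight x0 y0 y * sqmod (line f d y))%:E).
  apply/measurable_EFinP; apply: measurable_funM; first exact: pk_measurable.
  exact: cmeas_sqmod (line_cmeas hf.1 d0).
apply: (ge0_le_integral leb measurableT _ (measurable_funeM _ mg) mr) => y _.
  by rewrite -EFinM lee_fin mulr_ge0// ?(ltW x00)//; exact: sqmod_ge0.
rewrite -EFinM lee_fin {1}/line sqmodM -/(line f d y) -/(line k d y) /poisson_weight.
rewrite -mulrA; apply: ler_wpM2l; first exact: ltW.
by rewrite mulrC; apply: ler_wpM2r; [exact: sqmod_ge0|exact: kle].
Qed.

(** The least j with |y - y0| < 2^j x. If it is positive, minimality gives |y - y0| >= 2^(j-1) x, so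
    the kernel is at most 1 / (4^(j-1) x). *)
Lemma pk_dyadic x y0 y : 0 < x -> exists j : nat, `|y - y0| < 2 ^+ j * x /\
  poisson_weight x y0 y <= 4 * (4 ^+ j)^-1 / x.
Proof.
move=> x0; have u0 := normr_ge0 (y - y0).
have E : exists j : nat, `|y - y0| < 2 ^+ j * x.
  exists (Num.bound (`|y - y0| / x)).
  rewrite -ltr_pdivrMr//; apply: lt_le_trans (archi_boundP (divr_ge0 u0 (ltW x0))) _.
  rewrite -natrX ler_nat; apply: ltnW; exact: ltn_expl.
have [j Hj jmin] := ex_minnP E; exists j; split=> //.
rewrite /poisson_weight; case: j Hj jmin => [|j] Hj jmin.
  rewrite expr0 invr1 mulr1 ler_pdivrMr ?pk_den// mulrAC ler_pdivlMr// -expr2.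
  have := sqr_ge0 (y - y0); have := sqr_ge0 x; lra.
have h : 2 ^+ j * x <= `|y - y0|.
  by rewrite leNgt; apply/negP => /jmin; rewrite ltnn.
have p2 : 0 < (2 : R) ^+ j by rewrite exprn_gt0.
have h2 : (2 ^+ j * x) ^+ 2 <= (y - y0) ^+ 2.
  by rewrite -[leRHS]real_normK ?num_real// ler_pXn2r// nnegrE// mulr_ge0 ?ltW.
have e4 : (4 : R) ^+ j.+1 = 4 * (2 ^+ j) ^+ 2.
  by rewrite exprS -exprM mulnC exprM; congr (_ * _ ^+ _); rewrite expr2; ring.
rewrite e4; move: (2 ^+ j : R) p2 h2 => P p2 h2.
rewrite ler_pdivrMr ?pk_den// (_ : 4 * _ / x = (P ^+ 2 * x)^-1); last first.
  by field; rewrite !gt_eqF.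
rewrite mulrC ler_pdivlMr ?mulr_gt0 ?exprn_gt0//.
have e5 : x * (P ^+ 2 * x) = (P * x) ^+ 2 by ring.
rewrite e5; have := sqr_ge0 x; lra.
Qed.

Lemma HL_ball (w : R -> R) y0 (r c : R) : 0 < r -> (forall y, 0 <= w y) ->
  (HL_maximal w y0 <= c%:E)%E ->
  (\int[leb]_(y in ball y0 r) (w y)%:E <= (2 * r * c)%:E)%E.
Proof.
move=> r0 w0 H.
have h : (iavg w (ball y0 r) <= c%:E)%E.
  apply: le_trans H; apply: ereal_sup_ubound; exists r => //.
  by rewrite /= in_itv/= andbT.
have {}h : ((leb (ball y0 r))^-1 * \int[leb]_(y in ball y0 r) (w y)%:E <= c%:E)%E.
  rewrite [leLHS](_ : _ = iavg w (ball y0 r))//; congr (_ * _)%E.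
  by apply: eq_integral => y _; rewrite gee0_abs// lee_fin.
move: h; rewrite lebesgue_measure_ball ?(ltW r0)//.
have r2 : 0 < r *+ 2 by rewrite mulrn_wgt0.
rewrite inver gt_eqF// => h.
have -> : (2 * r * c = r *+ 2 * c) by rewrite mulr_natl.
rewrite EFinM -[leLHS]mul1e -(_ : ((r *+ 2)%:E * (r *+ 2)^-1%:E = 1)%E); last first.
  by rewrite -EFinM mulfV// gt_eqF.
by rewrite -muleA; apply: lee_wpmul2l => //; rewrite lee_fin ltW.
Qed.

(** The kernel is dominated by a sum of multiples of indicators of dyadic balls. The jth ball
    contributes 4 / (4^j x) times 2 (2^j x) c, that is 8 c / 2^j, and these add up to 16 c. *)
Lemma pk_HL (w : R -> R) x y0 (c : R) : 0 < x -> (forall y, 0 <= w y) ->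
  measurable_fun setT w -> (HL_maximal w y0 <= c%:E)%E ->
  (\int[leb]_y (poisson_weight x y0 y * w y)%:E <= (16 * c)%:E)%E.
Proof.
move=> x0 w0 mw H.
pose a (j : nat) : R := 4 * (4 ^+ j)^-1 / x.
have a0 j : 0 <= a j by rewrite divr_ge0 ?ltW// mulr_ge0// invr_ge0 exprn_ge0.
pose bl (j : nat) : set RT := ball y0 (2 ^+ j * x).
have mb j : measurable (bl j) by exact: measurable_ball.
pose F (j : nat) (y : RT) : \bar R := ((a j)%:E * ((EFin \o w) \_ (bl j)) y)%E.
have mw' : measurable_fun setT (EFin \o w) by exact/measurable_EFinP.
have mF j : measurable_fun setT (F j).
  apply: measurable_funeM; apply/(measurable_restrictT _ _).1 => //.
  exact: measurable_funTS.
have r0 j y : (0 <= ((EFin \o w) \_ (bl j)) y)%E.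
  by apply: erestrict_ge0 => t _; rewrite lee_fin.
have F0 j (y : RT) : setT y -> (0 <= F j y)%E by move=> _; rewrite mule_ge0// lee_fin.
apply: (@le_trans _ _ (\int[leb]_y (\sum_(j <oo) F j y))%E).
  have m1 : measurable_fun setT (fun y : RT => (poisson_weight x y0 y * w y)%:E).
    by apply/measurable_EFinP; apply: measurable_funM => //; exact: pk_measurable.
  have m2 : measurable_fun setT (fun y : RT => \sum_(j <oo) F j y)%E.
    by apply: ge0_emeasurable_sum => [j y yT _|j _]; [exact: F0|exact: mF].
  apply: (ge0_le_integral leb measurableT _ m1 m2) => y _.
    by rewrite lee_fin mulr_ge0 ?pk_ge0.
  have [j [j1 j2]] := pk_dyadic y0 y x0.
  apply: (@le_trans _ _ (F j y)).
    rewrite /F patchE mem_set /=; last by rewrite /bl /ball/= distrC.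
    by rewrite -EFinM lee_fin ler_wpM2r.
  apply: le_trans (nneseries_lim_ge j.+1 _); last by move=> i _ _; exact: F0.
  rewrite big_mkord big_ord_recr/= leeDr//; apply: sume_ge0 => i _; exact: F0.
rewrite integral_nneseries//.
have := @cvg_geometric_eseries_half R (16 * c) 0; rewrite expr0 divr1 => /cvg_lim <- //.
apply: lee_nneseries => j _; first by move=> _; apply: integral_ge0 => y _; exact: F0.
rewrite /F ge0_integralZl_EFin//; last first.
  by apply/(measurable_restrictT _ _).1 => //; exact: measurable_funTS.
rewrite -integral_mkcond.
have p2 : 0 < (2 : R) ^+ j by rewrite exprn_gt0.
have b0 : 0 < 2 ^+ j * x by rewrite mulr_gt0.
apply: (@le_trans _ _ ((a j)%:E * (2 * (2 ^+ j * x) * c)%:E)%E).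
  by apply: lee_wpmul2l; [rewrite lee_fin|exact: HL_ball].
rewrite -EFinM lee_fin; apply: eq_ler; rewrite /a addn1 natrX exprS.
have -> : (4 : R) ^+ j = (2 ^+ j) ^+ 2 by rewrite -exprM mulnC exprM; congr (_ ^+ _); rewrite expr2; ring.
by move: (2 ^+ j : R) p2 => P p2; field; rewrite !gt_eqF.
Qed.

End Maximal.

(** * Weak-type bound and radial limits *)

Section Fatou.
Variable R : realType.
Local Notation leb := (@lebesgue_measure R).
Local Notation RT := (measurableTypeR R).
Local Notation C := (R[i]).
Implicit Types (f g u : C -> C) (x y : R).

Definition recip_succ (n : nat) : R := n.+1%:R^-1.

Let sq_ctn f x y : analytic_rhp f -> 0 < x ->
  {for y, continuous (fun t => sqmod (line f x t))}.
Proof.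
move=> fa x0; have [h1 h2] := line_ctn_y y fa x0.
by apply: continuousD; apply: continuousM.
Qed.

Let open_gt (w : R -> R) (c y : R) : {for y, continuous w} -> c < w y ->
  nbhs y [set t | c < w t].
Proof. by move=> cw cy; exact: (cvgr_gt _ cw). Qed.

Definition radial_maximal_set u (c : R) : set R := [set y | exists2 x, 0 < x & c < sqmod (line u x y)].

(** [poisson_bound] at abscissa x uses data on a line d with 2 d <= x. The restriction on x lets the
    single line d = 1/(n+1) serve all points of the nth set. *)
Let vmaxn u (c : R) (n : nat) : set R :=
  [set y | exists2 x, 2 * recip_succ n <= x & c < sqmod (line u x y)].

Let dn_gt0 n : 0 < recip_succ n. Proof. by rewrite invr_gt0 ltr0n. Qed.


Let vmaxn_open u c n : analytic_rhp u -> open (vmaxn u c n).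
Proof.
move=> ua; rewrite openE => y [x nx cx]; have x0 : 0 < x by have := dn_gt0 n; lra.
have h1 : nbhs y [set t | c < sqmod (line u x t)] := open_gt (@sq_ctn u x y ua x0) cx.
by rewrite /interior/=; apply: filterS h1 => t h; exists x.
Qed.

Let dn_small e : 0 < e -> exists N, forall n, (N <= n)%N -> recip_succ n < e.
Proof.
move=> e0; exists (Num.bound e^-1) => n Nn.
rewrite /recip_succ invf_plt ?posrE ?ltr0n//.
apply: lt_le_trans (archi_boundP _) _; first by rewrite invr_ge0 ltW.
by rewrite ler_nat; apply: leqW.
Qed.

Let vmaxE u c : radial_maximal_set u c = \bigcup_n vmaxn u c n.
Proof.
apply/seteqP; split=> y.
  move=> [x x0 cx]; have [N HN] := dn_small (divr_gt0 x0 (ltr0n _ 2)).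
  by exists N => //; exists x => //; have := HN _ (leqnn N); lra.
by move=> [n _ [x nx cx]]; exists x => //; have := dn_gt0 n; lra.
Qed.

Lemma weak_type u (M c : R) : hardy_away u -> (forall x, 0 < x -> (en u x <= M%:E)%E) -> 0 < c ->
  open (radial_maximal_set u c) /\ (leb (radial_maximal_set u c) <= (3 * (136 * 16) * M / c)%:E)%E.
Proof.
move=> hu HM c0.
have op : open (radial_maximal_set u c) by rewrite vmaxE; apply: bigcup_open => n _; exact: vmaxn_open hu.1.
split=> //; pose c' := c / (136 * 16).
have c'0 : 0 < c' by rewrite divr_gt0.
have Vn n : (leb (vmaxn u c n) <= (3 * (136 * 16) * M / c)%:E)%E.
  pose d : R := recip_succ n; have d0 : 0 < d := dn_gt0 n.
  pose w (y : R) := sqmod (line u d y).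
  have su := hn_sqint hu d0.
  have lw : locally_integrable setT w.
    apply: open_integrable_locally; first exact: openT.
    exact: (sqint_sqmod su).
  have mH : measurable [set y : RT | (HL_maximal w y > c'%:E)%E].
    rewrite -[X in measurable X]setTI; apply: emeasurable_fun_o_infty => //.
    exact: measurable_HL_maximal.
  apply: (@le_trans _ _ (leb [set y : RT | (HL_maximal w y > c'%:E)%E])).
    have mV : measurable (vmaxn u c n : set RT).
      by apply: open_measurable; exact: vmaxn_open hu.1.
    apply: le_measure; [by rewrite inE|by rewrite inE|].
    move=> y [x nx cx]; rewrite /= ltNge; apply/negP => Hy.
    have x0 : 0 < x by have := dn_gt0 n; lra.
    have h1 := poisson_bound y hu d0 nx.
    have h2 := pk_HL x0 (fun t => sqmod_ge0 _) (cmeas_sqmod su.1) Hy.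
    have : ((sqmod (line u x y))%:E <= 136%:E * (16 * c')%:E)%E.
      by apply: (le_trans h1); apply: lee_wpmul2l.
    rewrite -EFinM lee_fin => h3; move: cx; rewrite ltNge => /negP; apply.
    by apply: (le_trans h3); apply: eq_ler; rewrite /c'; field.
  apply: (le_trans (maximal_inequality lw c'0)).
  apply: (@le_trans _ _ ((3 / c')%:E * M%:E)%E).
    apply: lee_wpmul2l; first by rewrite lee_fin divr_ge0// ltW.
    apply: le_trans (HM _ d0); rewrite /en /energy.
    rewrite le_eqVlt; apply/orP; left; apply/eqP; apply: eq_integral => y _.
    by rewrite gee0_abs// lee_fin; exact: sqmod_ge0.
  rewrite -EFinM lee_fin; apply: eq_ler; rewrite /c'; field.
  by rewrite gt_eqF.
have nd : nondecreasing_seq (vmaxn u c).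
  move=> p q pq; rewrite subsetEset => y [x px cx]; exists x => //.
  apply: le_trans px; rewrite ler_wpM2l// /recip_succ lef_pV2 ?posrE ?ltr0Sn//.
  by rewrite ler_nat ltnS.
have mV n : measurable (vmaxn u c n : set RT).
  by apply: open_measurable; exact: vmaxn_open hu.1.
have := nondecreasing_cvg_mu (mu := leb) mV (bigcup_measurable (fun n _ => mV n)) nd.
rewrite -vmaxE => cV; rewrite -(cvg_lim _ cV)//.
apply: lime_le; first by apply/cvg_ex; eexists; exact: cV.
by apply: nearW => n; exact: Vn.
Qed.

Lemma en_diff f x x' : hardy_away f -> 0 < x -> 0 < x' ->
  (energy leb setT (fun y : RT => (line f x y - line f x' y)%R) =
   (B f f x x + B f f x' x' - 2 * B f f ((x + x') / 2) ((x + x') / 2))%:E)%E.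
Proof.
move=> hf x0 x'0; have s1 := hn_sqint hf x0; have s2 := hn_sqint hf x'0.
have s := sqintB measurableT s1 s2.
rewrite energyE//; congr (_%:E).
have e1 := ipBl measurableT s1 s2 s; have e2 := ipBr measurableT s1 s2 s1.
have e3 := ipBr measurableT s1 s2 s2.
have e : ip leb setT (fun y : RT => line f x y - line f x' y)
    (fun y => line f x y - line f x' y) =
    B f f x x - B f f x x' - (B f f x' x - B f f x' x') by rewrite e1 e2 e3.
by rewrite e (B_sym f f x' x) (B_diag hf hf x0 x'0); ring.
Qed.

Definition hardy_bounded f (S : R) := hardy_away f /\ forall x, 0 < x -> (en f x <= S%:E)%E.

(** By [en_diff] the squared distance of two lines is the sum of their energies minus twice the
    energy halfway. Energies increase to their supremum towards the axis, so left of a line [d]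
    within e/2 of it this is at most e. *)
Lemma hbd_cauchy f S : hardy_bounded f S -> forall e : R, 0 < e -> exists2 d : R, 0 < d &
  forall x x', 0 < x -> x <= d -> 0 < x' -> x' <= d ->
  (energy leb setT (fun y : RT => (line f x y - line f x' y)%R) <= e%:E)%E.
Proof.
move=> [hf HS] e e0; pose A : set R := [set B f f x x | x in [set x | 0 < x]].
have hsA : has_sup A.
  split; first by exists (B f f 1 1); exists 1 => //=.
  by exists S => _ [x /= x0 <-]; rewrite -lee_fin -enE//; exact: HS.
have [_ [d /= d0 <-] hd] := sup_adherent (divr_gt0 e0 (ltr0n _ 2)) hsA.
have ub x : 0 < x -> B f f x x <= sup A.
  by move=> x0; apply: ub_le_sup; [exact: hsA.2|exists x].
exists d => // x x' x0 xd x'0 x'd; rewrite en_diff// lee_fin.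
have h : B f f d d <= B f f ((x + x') / 2) ((x + x') / 2).
  rewrite -lee_fin -!enE//; last by lra.
  by apply: en_nonincreasing => //; lra.
have := ub _ x0; have := ub _ x'0; lra.
Qed.

(** Cauchy's criterion with countably many thresholds: the complement is assembled from the open
    sets [osc] by countable operations, hence measurable, and no limit needs to be named. *)
Definition radially_cauchy f y := forall k : nat, exists n : nat, forall x x',
  0 < x < recip_succ n -> 0 < x' < recip_succ n ->
  sqmod (line f x y - line f x' y) <= recip_succ k.

Let osc f (k n : nat) : set R := [set y | exists x x',
  [/\ 0 < x < recip_succ n, 0 < x' < recip_succ n &
      recip_succ k < sqmod (line f x y - line f x' y)]].

Let osc_open f k n : analytic_rhp f -> open (osc f k n).
Proof.
move=> fa; rewrite openE => y [x [x' [xn x'n h]]].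
have x0 : 0 < x by case/andP: xn. have x'0 : 0 < x' by case/andP: x'n.
have [p1 p2] := line_ctn_y y fa x0; have [q1 q2] := line_ctn_y y fa x'0.
have c : {for y, continuous (fun t => sqmod (line f x t - line f x' t))}.
  have c1 : {for y, continuous (fun t => complex.Re (line f x t) - complex.Re (line f x' t))}.
    exact: continuousB.
  have c2 : {for y, continuous (fun t => complex.Im (line f x t) - complex.Im (line f x' t))}.
    exact: continuousB.
  have -> : (fun t => sqmod (line f x t - line f x' t)) = (fun t =>
     (complex.Re (line f x t) - complex.Re (line f x' t)) *
     (complex.Re (line f x t) - complex.Re (line f x' t)) +
     (complex.Im (line f x t) - complex.Im (line f x' t)) *
     (complex.Im (line f x t) - complex.Im (line f x' t))).
    by apply/funext => t; rewrite sqmodE_mul !reimE.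
  by apply: continuousD; apply: continuousM.
have h1 : nbhs y [set t | recip_succ k < sqmod (line f x t - line f x' t)] := open_gt c h.
by rewrite /interior/=; apply: filterS h1 => t ht; exists x, x'.
Qed.

Let bcauE f : [set y | radially_cauchy f y] = \bigcap_k \bigcup_n ~` osc f k n.
Proof.
apply/seteqP; split=> y.
  move=> H k _; have [n Hn] := H k; exists n => // -[x [x' [xn x'n]]].
  by rewrite ltNge Hn.
move=> H k; have [n _ Hn] := H k I; exists n => x x' xn x'n.
by rewrite leNgt; apply/negP => h; apply: Hn; exists x, x'.
Qed.

Lemma measurable_bcau f : analytic_rhp f -> measurable ([set y | radially_cauchy f y] : set RT).
Proof.
move=> fa; rewrite bcauE; apply: bigcap_measurable => [|k _]; first by exists 0%N.
apply: bigcup_measurable => n _.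
by apply: measurableC; apply: open_measurable; exact: osc_open.
Qed.

Lemma bcau_limit f y : radially_cauchy f y -> forall e : R, 0 < e -> exists2 d : R, 0 < d &
  forall x, 0 < x < d -> normc (line f x y - boundary_value f y) <= e.
Proof.
move=> H.
have H' e : 0 < e -> exists n : nat, forall x x',
    0 < x < recip_succ n -> 0 < x' < recip_succ n -> normc (line f x y - line f x' y) <= e.
  move=> e0; have e20 : 0 < e ^+ 2 by rewrite exprn_gt0.
  have [k Hk] := dn_small e20; have [n Hn] := H k; exists n => x x' xn x'n.
  have := le_trans (Hn x x' xn x'n) (ltW (Hk _ (leqnn k))).
  by rewrite sqmodE ler_pXn2r// nnegrE ?normc_ge0// ltW.
(* The index is shifted by one because the criterion asks for points strictly below 1/(n+1). *)
pose v (n : nat) : C := line f (recip_succ n.+1) y.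
have vn (n p : nat) : (n <= p)%N -> 0 < recip_succ p.+1 < recip_succ n.
  move=> np; rewrite dn_gt0 /recip_succ/= ltf_pV2 ?posrE ?ltr0Sn// ltr_nat.
  by rewrite !ltnS.
have [l Hl] : exists l : C, forall e : R, 0 < e -> exists N, forall n, (N <= n)%N ->
    normc (v n - l) <= e.
  apply: complex_cauchy_limit => e e0; have [N HN] := H' e e0; exists N => n p Nn Np.
  exact: (HN _ _ (vn _ _ Nn) (vn _ _ Np)).
have lim : forall e : R, 0 < e -> exists2 d : R, 0 < d &
    forall x, 0 < x < d -> normc (f (Complex x y) - l) <= e.
  move=> e e0; have e20 : 0 < e / 2 by rewrite divr_gt0.
  have [n Hn] := H' _ e20; have [N HN] := Hl _ e20.
  exists (recip_succ n) => // x xn.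
  have h1 := Hn x _ xn (vn _ _ (leq_maxl n N)); have h2 := HN _ (leq_maxr n N).
  rewrite -/(line f x y) (_ : line f x y - l = (line f x y - v (maxn n N)) + (v (maxn n N) - l)).
    by apply: le_trans (le_normcD _ _) _; rewrite [leRHS](splitr e); exact: lerD.
  by ring.
by rewrite (boundary_valueP lim).
Qed.

(* Where the radial limit does not exist, lim returns a fixed junk point. *)
Lemma boundary_value_junk : exists p : C, forall f y, ~ radially_cauchy f y -> boundary_value f y = p.
Proof.
eexists => f y H; rewrite /boundary_value dvgP; first reflexivity.
rewrite cvg_ex => -[l /cvg_ray Hl]; apply: H => k.
have k0 : 0 < recip_succ k := dn_gt0 k.
have s0 : 0 < Num.sqrt (recip_succ k) / 2 by rewrite divr_gt0// sqrtr_gt0.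
have [d d0 Hd] := Hl _ s0; have [N HN] := dn_small d0; exists N => x x' /andP[x0 xN] /andP[x'0 x'N].
have dN := HN _ (leqnn N).
have h1 := Hd x ltac:(by rewrite x0 (lt_trans xN)).
have h2 := Hd x' ltac:(by rewrite x'0 (lt_trans x'N)).
rewrite sqmodE -[leRHS]sqr_sqrtr ?(ltW k0)//.
rewrite ler_pXn2r// ?nnegrE ?normc_ge0 ?sqrtr_ge0//.
rewrite (_ : line f x y - line f x' y = (line f x y - l) + - (line f x' y - l)); last by ring.
apply: le_trans (le_normcD _ _) _; rewrite normcN.
by rewrite /line; move: h1 h2; set p := normc _; set q := normc _; lra.
Qed.

(** A limit of measurable functions on the set of radial convergence, and one constant off it. So
    [boundary_value f] is measurable even for a function without radial limits, as [ext] demands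
    whatever the weight. *)
Lemma measurable_boundary f : analytic_rhp f -> cmeas setT (boundary_value f : RT -> C).
Proof.
move=> fa; have mb := measurable_bcau fa.
have TE : [set: RT] = [set y | radially_cauchy f y] `|` ~` [set y | radially_cauchy f y] by rewrite setUv.
have [junk Hjunk] := boundary_value_junk.
have lim (p : C -> R) (hp : forall z w, `|p z - p w| <= normc (z - w)) y : radially_cauchy f y ->
    p (line f (recip_succ n) y) @[n --> \oo] --> p (boundary_value f y).
  move=> /bcau_limit H; apply/cvgrPdist_le => e e0; have [d d0 Hd] := H _ e0.
  have [N HN] := dn_small d0; exists N => // n /= Nn.
  rewrite distrC; apply: le_trans (hp _ _) _; apply: Hd.
  by rewrite dn_gt0/= HN.
have hRe (z w : C) : `|complex.Re z - complex.Re w| <= normc (z - w).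
  by rewrite -cReN -cReD; exact: normc_Re.
have hIm (z w : C) : `|complex.Im z - complex.Im w| <= normc (z - w).
  by rewrite -cImN -cImD; exact: normc_Im.
split; rewrite TE; apply/measurable_funU => //; [exact: measurableC| |exact: measurableC|].
- split.
    apply: (measurable_fun_cvg (h := fun n y => complex.Re (line f (recip_succ n) y))).
      by move=> n; apply: measurable_funTS; exact: (line_cmeas fa (dn_gt0 n)).1.
    by move=> y; exact: lim.
  apply: (eq_measurable_fun (fun=> complex.Re junk)); last exact: measurable_cst.
  by move=> y; rewrite inE => /Hjunk ->.
- split.
    apply: (measurable_fun_cvg (h := fun n y => complex.Im (line f (recip_succ n) y))).
      by move=> n; apply: measurable_funTS; exact: (line_cmeas fa (dn_gt0 n)).2.
    by move=> y; exact: lim.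
  apply: (eq_measurable_fun (fun=> complex.Im junk)); last exact: measurable_cst.
  by move=> y; rewrite inE => /Hjunk ->.
Qed.

End Fatou.

Section Triangle.
Context d (T : measurableType d) (R : realType).
Variables (mu : {measure set T -> \bar R}) (D : set T).
Hypothesis mD : measurable D.
Local Notation C := (R[i]).
Implicit Types (p q s : T -> C).

Definition l2norm p : R := Num.sqrt (ip mu D p p).

Lemma nrm_ge0 p : 0 <= l2norm p. Proof. exact: sqrtr_ge0. Qed.

Lemma nrm_sq p : l2norm p ^+ 2 = ip mu D p p.
Proof. by rewrite sqr_sqrtr// ip_ge0. Qed.

Lemma nrm_tri p q : sqint mu D p -> sqint mu D q ->
  l2norm p <= l2norm q + l2norm (fun x => p x - q x).
Proof.
move=> hp hq; have hpq := sqintB mD hp hq.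
have [->|p0] := eqVneq (l2norm p) 0; first by rewrite addr_ge0 ?nrm_ge0.
have pp : 0 < l2norm p by rewrite lt_neqAle eq_sym p0 nrm_ge0.
rewrite -(ler_pM2l pp) -expr2 nrm_sq mulrDr.
have h1 := ip_CS_sqrt mD hp hq; have h2 := ip_CS_sqrt mD hp hpq.
have h3 := ipBr mD hp hq hp.
have h4 := ler_norm (ip mu D p q); have h5 := ler_norm (ip mu D p (fun x => p x - q x)).
rewrite -/(l2norm p) -/(l2norm q) -/(l2norm (fun x => p x - q x)) in h1 h2.
lra.
Qed.

Lemma ip_cont p q s t : sqint mu D p -> sqint mu D q -> sqint mu D s -> sqint mu D t ->
  `|ip mu D p s - ip mu D q t| <=
  l2norm (fun x => p x - q x) * l2norm s + l2norm q * l2norm (fun x => s x - t x).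
Proof.
move=> hp hq hs ht.
have -> : ip mu D p s - ip mu D q t =
    ip mu D (fun x => p x - q x) s + ip mu D q (fun x => s x - t x).
  by rewrite (ipBl mD hp hq hs) (ipBr mD hs ht hq); ring.
apply: (le_trans (ler_normD _ _)); apply: lerD; apply: ip_CS_sqrt => //; exact: sqintB.
Qed.

Lemma nrm_le p (e : R) : sqint mu D p -> 0 <= e ->
  (l2norm p <= e) = (energy mu D p <= (e ^+ 2)%:E)%E.
Proof.
move=> hp e0; rewrite energyE// lee_fin -nrm_sq.
by rewrite ler_pXn2r// nnegrE ?nrm_ge0.
Qed.

Lemma ip_ae p q s (N : set T) : measurable N -> mu N = 0%E ->
  cmeas D p -> cmeas D q -> cmeas D s -> (forall x, D x -> ~ N x -> p x = q x) ->
  ip mu D p s = ip mu D q s.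
Proof.
move=> mN N0 mp mq ms pq; rewrite /ip /Rintegral; congr fine.
apply: ae_eq_integral => //.
- by apply/measurable_EFinP; exact: cmeas_cdot.
- by apply/measurable_EFinP; exact: cmeas_cdot.
exists N; split=> // x /= H; apply: contrapT => Nx; apply: H => Dx.
by rewrite pq.
Qed.

Lemma energy_fatou_ae (F : nat -> T -> C) p (M : \bar R) (N : set T) :
  measurable N -> mu N = 0%E -> (forall n, cmeas D (F n)) -> cmeas D p ->
  (forall x, D x -> ~ N x -> (fun n => (sqmod (F n x))%:E) @ \oo --> (sqmod (p x))%:E) ->
  (exists K, forall n, (K <= n)%N -> (energy mu D (F n) <= M)%E) ->
  (energy mu D p <= M)%E.
Proof.
move=> mN N0 mF mp Fp [K HK].
have mDN : measurable (D `\` N) by exact: measurableD.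
have DN : D `\` N `<=` D by exact: subDsetl.
have cS q : cmeas D q -> cmeas (D `\` N) q.
  by move=> [h1 h2]; split; [exact: measurable_funS h1|exact: measurable_funS h2].
have E q : cmeas D q -> energy mu D q = energy mu (D `\` N) q.
  move=> mq; apply: ge0_negligible_integral => //; first exact: cmeas_esqmod.
  by move=> x _; rewrite lee_fin sqmod_ge0.
rewrite E//; apply: (@energy_fatou _ _ _ mu (D `\` N) mDN F) => //.
- by move=> n; exact: cS.
- exact: cS.
- by move=> x [Dx Nx]; exact: Fp.
- by exists K => n Kn; rewrite -E//; exact: HK.
Qed.

End Triangle.

(** * Almost everywhere and mean convergence to the boundary *)

Section Boundary.
Variable R : realType.
Local Notation leb := (@lebesgue_measure R).
Local Notation RT := (measurableTypeR R).
Local Notation C := (R[i]).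
Implicit Types (f g u : C -> C) (x y : R).
Local Notation rc := (@recip_succ R).

Lemma rcp_gt0 n : 0 < rc n. Proof. by rewrite invr_gt0 ltr0n. Qed.

Lemma rcp_small e : 0 < e -> exists N, forall n, (N <= n)%N -> rc n < e.
Proof.
move=> e0; exists (Num.bound e^-1) => n Nn.
rewrite /recip_succ invf_plt ?posrE ?ltr0n//.
apply: lt_le_trans (archi_boundP _) _; first by rewrite invr_ge0 ltW.
by rewrite ler_nat; apply: leqW.
Qed.

Lemma sqmod_line_small f x y e : analytic_rhp f -> 0 < x -> 0 < e ->
  exists2 d : R, 0 < d & forall s, `|s - x| < d -> sqmod (line f s y - line f x y) <= e.
Proof.
move=> fa x0 e0; have [h1 h2] := line_ctn_x y fa x0.
have e2 : 0 < Num.min 1 (e / 2) by rewrite lt_min ltr01 divr_gt0.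
have [d1 d10 H1] : exists2 d, 0 < d & forall s, `|s - x| < d ->
    `|complex.Re (line f s y) - complex.Re (line f x y)| <= Num.min 1 (e / 2).
  have c : ictn (fun s => complex.Re (line f s y)) x x.
    by move=> s; rewrite -eq_le => /eqP <-.
  by have /ictnP /(_ x) /(_ ltac:(by rewrite lexx)) /(_ _ e2) := c.
have [d2 d20 H2] : exists2 d, 0 < d & forall s, `|s - x| < d ->
    `|complex.Im (line f s y) - complex.Im (line f x y)| <= Num.min 1 (e / 2).
  have c : ictn (fun s => complex.Im (line f s y)) x x.
    by move=> s; rewrite -eq_le => /eqP <-.
  by have /ictnP /(_ x) /(_ ltac:(by rewrite lexx)) /(_ _ e2) := c.
exists (Num.min d1 d2); first by rewrite lt_min d10.
move=> s; rewrite lt_min => /andP[/H1 a1 /H2 a2].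
have sq (t : R) : `|t| <= Num.min 1 (e / 2) -> t ^+ 2 <= e / 2.
  rewrite le_min => /andP[t1 te]; have t0 := normr_ge0 t.
  rewrite -real_normK ?num_real// expr2; nra.
rewrite /sqmod !reimE; have := sq _ a1; have := sq _ a2; lra.
Qed.

(** Maximal function argument: u = f - f(. + dl) has small energy on every line, so its radial
    maximal function is small off a set of small measure, while f(. + dl) is continuous up to the
    axis. The oscillation of f is therefore small off that set, and intersecting such sets leaves
    measure 0. *)
Lemma ae_bcau f S : hardy_bounded f S -> leb (~` [set y : RT | radially_cauchy f y]) = 0%E.
Proof.
move=> hS; have [hf HS] := hS; have fa := hf.1.
pose W (k : nat) : set RT := [set y | forall n : nat, exists x x',
  [/\ 0 < x < rc n, 0 < x' < rc n & rc k < sqmod (line f x y - line f x' y)]].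
suff Wk k : exists A : set RT, [/\ measurable A, leb A = 0%E & W k `<=` A].
  have mb : measurable (~` [set y : RT | radially_cauchy f y]).
    by apply: measurableC; exact: measurable_bcau.
  apply/(negligibleP leb mb).
  have nW : leb.-negligible (\bigcup_k W k).
    by apply: negligible_bigcup => k; have [A [mA A0 WA]] := Wk k; exists A.
  apply: negligibleS nW.
  move=> y /= ny; have [k Hk] : exists k, W k y.
    apply: contrapT => H; apply: ny => k; apply: contrapT => H'; apply: H; exists k => n.
    apply: contrapT => H2; apply: H'; exists n => x x' xn x'n.
    by rewrite leNgt; apply/negP => lt1; apply: H2; exists x, x'.
  by exists k.
(* The increments of [u] and of the shifted function are each at most 4 c in squared modulus, hence
   their sum at most 16 c = [rc k]. *)
pose c : R := rc k / 16; have c0 : 0 < c by rewrite divr_gt0// rcp_gt0.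
pose KK : R := 3 * (136 * 16); have KK0 : 0 < KK by rewrite !mulr_gt0.
have V e : 0 < e -> exists A : set RT, [/\ measurable A, (leb A <= e%:E)%E & W k `<=` A].
  move=> e0; have eta0 : 0 < e * c / KK by rewrite divr_gt0// mulr_gt0.
  have [d d0 Hd] := hbd_cauchy hS eta0.
  pose dl := d / 2; have dl0 : 0 < dl by rewrite divr_gt0.
  pose u (z : C) := f z + - 1 * f (z + Complex dl 0).
  have hu : hardy_away u := hnD hf (hnZ (- 1) (hn_shift (ltW dl0) hf)).
  have uE x y : line u x y = line f x y - line f (x + dl) y.
    rewrite /u /line mulN1r; congr (_ - f _); apply: complex_ext => /=; ring.
  have Hu x : 0 < x -> (en u x <= (e * c / KK)%:E)%E.
    (* The Cauchy property concerns lines near the axis only; for larger x the monotonicity of the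
       energy of [u] takes over. *)
    move=> x0; pose x1 := Num.min x dl.
    have x10 : 0 < x1 by rewrite lt_min x0.
    have x1d : x1 <= dl by rewrite ge_min lexx orbT.
    apply: (le_trans (en_nonincreasing hu x10 _)); first by rewrite ge_min lexx.
    have dd : d = dl + dl by rewrite /dl; field.
    have := Hd x1 (x1 + dl) x10 ltac:(lra) ltac:(lra) ltac:(lra).
    by rewrite /en (_ : line u x1 = fun y => line f x1 y - line f (x1 + dl) y)//; exact/funext.
  have [op Hop] := weak_type hu Hu c0.
  exists (radial_maximal_set u c); split; first exact: open_measurable.
    apply: (le_trans Hop); rewrite lee_fin -/KK; apply: eq_ler; field.
    by rewrite !gt_eqF.
  move=> y Wy; apply: contrapT => ny.
  have uc x : 0 < x -> sqmod (line u x y) <= c.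
    by move=> x0; rewrite leNgt; apply/negP => lt1; apply: ny; exists x.
  have [r r0 Hr] := sqmod_line_small y fa dl0 c0.
  have [n Hn] := rcp_small r0.
  have [x [x' [/andP[x0 xn] /andP[x'0 x'n]]]] := Wy n.
  rewrite ltNge => /negP; apply.
  have nr := Hn _ (leqnn n).
  have a1 : sqmod (line f (x + dl) y - line f dl y) <= c.
    by apply: Hr; rewrite addrK gtr0_norm// (lt_trans xn).
  have a2 : sqmod (line f (x' + dl) y - line f dl y) <= c.
    by apply: Hr; rewrite addrK gtr0_norm// (lt_trans x'n).
  have a3 := uc _ x0; have a4 := uc _ x'0.
  have b1 := sqmodD_le (line f (x + dl) y - line f dl y) (- (line f (x' + dl) y - line f dl y)).
  have b2 := sqmodD_le (line u x y) (- line u x' y).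
  rewrite sqmodN in b1; rewrite sqmodN in b2.
  have b3 := sqmodD_le (line u x y + - line u x' y)
    ((line f (x + dl) y - line f dl y) + - (line f (x' + dl) y - line f dl y)).
  have E : line u x y + - line u x' y +
    ((line f (x + dl) y - line f dl y) + - (line f (x' + dl) y - line f dl y)) =
    line f x y - line f x' y by rewrite !uE; ring.
  rewrite E in b3; have ck : rc k = 16 * c by rewrite /c; field.
  lra.
have [A HA] := boolp.choice (fun n => V (rc n) (rcp_gt0 n)).
exists (\bigcap_n A n); split.
- by apply: bigcap_measurable => [|n _]; [exists 0%N|have [] := HA n].
- apply/eqP; rewrite eq_le measure_ge0 andbT; apply/lee_addgt0Pr => e e0; rewrite add0e.
  have [n Hn] := rcp_small e0; have [mA lA _] := HA n.
  apply: (@le_trans _ _ (leb (A n))).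
    apply: le_measure; rewrite ?inE//; last exact: bigcap_inf.
    by apply: bigcap_measurable => [|j _]; [exists 0%N|have [] := HA j].
  by apply: (le_trans lA); rewrite lee_fin ltW// Hn.
- by move=> y Wy n _; have [_ _] := HA n; apply.
Qed.

Lemma cvg_sqmod (v : nat -> C) (l : C) :
  (forall e : R, 0 < e -> exists N, forall n, (N <= n)%N -> normc (v n - l) <= e) ->
  (fun n => (sqmod (v n))%:E) @ \oo --> (sqmod l)%:E.
Proof.
move=> H; apply: cvg_EFin; first exact: nearW.
have cn : normc (v n) @[n --> \oo] --> normc l.
  apply/cvgrPdist_le => e e0; have [N HN] := H _ e0; exists N => // n /= Nn.
  have h1 := HN _ Nn; rewrite ler_norml.
  have a1 := le_normcD (v n - l) l; have a2 := le_normcD (v n) (- (v n - l)).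
  rewrite normcN in a2; rewrite subrK in a1.
  rewrite (_ : v n + - (v n - l) = l) in a2; last by ring.
  by apply/andP; split; lra.
have -> : fine \o (fun n => (sqmod (v n))%:E) = (fun n => normc (v n)) \* (fun n => normc (v n)).
  by apply/funext => n /=; rewrite sqmodE expr2.
by rewrite sqmodE expr2; exact: (cvgM cn cn).
Qed.

Lemma bcau_rcp f y : radially_cauchy f y -> forall e : R, 0 < e -> exists N, forall n, (N <= n)%N ->
  normc (line f (rc n) y - boundary_value f y) <= e.
Proof.
move=> /bcau_limit H e e0; have [d d0 Hd] := H _ e0; have [N HN] := rcp_small d0.
by exists N => n Nn; apply: Hd; rewrite rcp_gt0 HN.
Qed.

Let mnb f : analytic_rhp f -> measurable (~` [set y : RT | radially_cauchy f y]).
Proof. by move=> fa; apply: measurableC; exact: measurable_bcau. Qed.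

Lemma boundary_energy f S : hardy_bounded f S ->
  sqint leb setT (boundary_value f : RT -> C) /\
  (energy leb setT (boundary_value f : RT -> C) <= S%:E)%E.
Proof.
move=> hS; have fa := hS.1.1; have mb := measurable_boundary fa.
suff h : (energy leb setT (boundary_value f : RT -> C) <= S%:E)%E.
  by split=> //; split=> //; exact: le_lt_trans h (ltry _).
apply: (@energy_fatou_ae _ RT R leb setT measurableT (fun n => line f (rc n))
  (boundary_value f) _ _ (mnb fa) (ae_bcau hS)) => //.
- by move=> n; exact: line_cmeas fa (rcp_gt0 n).
- by move=> y _ /contrapT by_; apply: cvg_sqmod; exact: bcau_rcp.
- by exists 0%N => n _; exact: hS.2 (rcp_gt0 n).
Qed.

(** Fatou's lemma lets the second line of [hbd_cauchy] tend to the axis. *)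
Lemma boundary_L2 f S : hardy_bounded f S -> forall e : R, 0 < e -> exists2 d : R, 0 < d &
  forall x, 0 < x -> x <= d ->
  (energy leb setT (fun y : RT => (line f x y - boundary_value f y)%R) <= e%:E)%E.
Proof.
move=> hS e e0; have hf := hS.1; have fa := hf.1.
have [d d0 Hd] := hbd_cauchy hS e0; exists d => // x x0 xd.
have sb := (boundary_energy hS).1; have sx := hn_sqint hf x0.
have [N HN] := rcp_small d0.
apply: (@energy_fatou_ae _ RT R leb setT measurableT
  (fun n y => line f x y - line f (rc n) y) (fun y => line f x y - boundary_value f y)
  _ _ (mnb fa) (ae_bcau hS)).
- by move=> n; exact: (sqintB measurableT sx (hn_sqint hf (rcp_gt0 n))).1.
- exact: (sqintB measurableT sx sb).1.
- move=> y _ /contrapT by_; apply: cvg_sqmod => e' e'0.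
  have [K HK] := bcau_rcp by_ e'0; exists K => n Kn.
  rewrite (_ : _ - _ = - (line f (rc n) y - boundary_value f y)); last by ring.
  by rewrite normcN; exact: HK.
- by exists N => n Nn; apply: Hd => //; [exact: rcp_gt0|apply/ltW/HN].
Qed.

Lemma boundary_nrm f S : hardy_bounded f S -> forall e : R, 0 < e -> exists2 d : R, 0 < d &
  forall x, 0 < x -> x <= d ->
  l2norm leb setT (fun y : RT => line f x y - boundary_value f y) <= e.
Proof.
move=> hS e e0; have [d d0 Hd] := boundary_L2 hS (exprn_gt0 2 e0).
exists d => // x x0 xd; rewrite nrm_le ?Hd// ?(ltW e0)//.
by apply: sqintB => //; [exact: hn_sqint hS.1 x0|exact: (boundary_energy hS).1].
Qed.

(** Lines closer to the axis carry at least as much energy, and they converge in norm to the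
    boundary values. *)
Lemma en_le_boundary f S x : hardy_bounded f S -> 0 < x ->
  (en f x <= energy leb setT (boundary_value f : RT -> C))%E.
Proof.
move=> hS x0; have hf := hS.1; have [sb _] := boundary_energy hS.
have sx := hn_sqint hf x0.
have h : l2norm leb setT (line f x : RT -> C) <= l2norm leb setT (boundary_value f : RT -> C).
  apply/ler_addgt0Pr => e e0; have [d d0 Hd] := boundary_nrm hS e0.
  pose t := Num.min x d; have t0 : 0 < t by rewrite lt_min x0.
  have tx : t <= x by rewrite ge_min lexx.
  have td : t <= d by rewrite ge_min lexx orbT.
  have st := hn_sqint hf t0.
  apply: (@le_trans _ _ (l2norm leb setT (line f t : RT -> C))).
    rewrite nrm_le ?nrm_ge0// nrm_sq -energyE//; exact: en_nonincreasing.
  apply: (le_trans (nrm_tri measurableT st sb)); rewrite lerD2l; exact: Hd.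
by rewrite /en [leRHS]energyE// -nrm_sq -nrm_le ?nrm_ge0.
Qed.

End Boundary.

(** * The Zen space in terms of line energies *)

Section Zen.
Variable R : realType.
Local Notation leb := (@lebesgue_measure R).
Local Notation RT := (measurableTypeR R).
Local Notation C := (R[i]).
Local Notation halfline := (`]0%R, +oo[%classic : set RT).
Local Notation nneg := (`[0%R, +oo[%classic : set RT).
Implicit Types (f g : C -> C) (x y : R).
Variable m : {sigma_finite_measure set RT -> \bar R}.
Hypothesis hm : zen_weight m.
Local Notation nu := (m \x leb)%E.
Local Notation m0 := (m [set 0%R]).
Local Notation bv := (@boundary_value R).

Lemma atom_lty : (m0 < +oo)%E.
Proof.
apply: le_lt_trans (weight_lty 1 hm).
by apply: le_measure; rewrite ?inE// => x /= ->; rewrite in_itv/= lexx ltr01.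
Qed.

Lemma atom_fin : m0 \is a fin_num.
Proof. by rewrite ge0_fin_numE//; exact: atom_lty. Qed.

(** The supremum over shifts split into what the weight sees inside and on the axis: an atom at 0
    forces membership in the Hardy space, its absence imposes nothing there. *)
Definition zen_conditions f := [/\ hardy_away f, (\int[m]_(x in halfline) en f x < +oo)%E &
  m0 != 0%E -> exists S, hardy_bounded f S].

Lemma split_shift f (e : R) : analytic_rhp f -> 0 < e ->
  (\int[m]_(x in nneg) en f (x + e)%R =
   en f e * m0 + \int[m]_(x in halfline) en f (x + e)%R)%E.
Proof.
move=> fa e0; rewrite (@nneg_split R m (fun x => en f (x + e))) ?add0r//.
  exact: measurable_en_shift.
by move=> x _; exact: en_ge0.
Qed.

(** Energies are nonincreasing, so the shifted integrals over positive abscissas increase to the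
    unshifted one, and monotone convergence applies. At the atom the shifted integral contains m{0}
    times the energy of the line e, which bounds all energies when m{0} > 0. *)
Lemma zenP f : zen m f <-> zen_conditions f.
Proof.
have HN : halfline `<=` nneg by move=> x; rewrite /= !in_itv/= !andbT; exact: ltW.
split.
- move=> zf; have hf := zen_hn hm zf; have fa := zf.1.
  have [M M0 HM] : exists2 M : R, 0 <= M &
      forall e, 0 < e -> (\int[m]_(x in nneg) en f (x + e)%R <= M%:E)%E.
    case: zf => _; set S := ereal_sup _ => HS.
    have SE e : 0 < e -> (\int[m]_(x in nneg) en f (x + e)%R <= S)%E.
      move=> e0; rewrite -zen_shift_integral//; apply: ereal_sup_ubound.
      by exists e.
    have S0 : (0 <= S)%E.
      by apply: le_trans (SE _ (ltr01)); apply: integral_ge0 => x _; exact: en_ge0.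
    exists (fine S); first exact: fine_ge0.
    by move=> e e0; rewrite fineK ?ge0_fin_numE//; exact: SE.
  have ie e : 0 < e -> (0 <= \int[m]_(x in halfline) en f (x + e)%R)%E.
    by move=> e0; apply: integral_ge0 => x _; exact: en_ge0.
  have ib e : 0 < e -> (0 <= en f e * m0)%E.
    by move=> e0; apply: mule_ge0 => //; exact: en_ge0.
  split=> //.
    have mF n : measurable_fun halfline (fun x => en f (x + @recip_succ R n)).
      exact: measurable_funS (measurable_itv _) HN (measurable_en_shift fa (rcp_gt0 R n)).
    have F0 n x : halfline x -> (0 <= en f (x + @recip_succ R n))%E by move=> _; exact: en_ge0.
    have Fnd x : halfline x -> nondecreasing_seq (fun n => en f (x + @recip_succ R n)).
      rewrite /= in_itv/= andbT => x0 p q pq; apply: en_nonincreasing => //.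
        by rewrite addr_gt0// rcp_gt0.
      by rewrite lerD2l /recip_succ lef_pV2 ?posrE ?ltr0Sn// ler_nat ltnS.
    have Flim x : halfline x -> en f (x + @recip_succ R n) @[n --> \oo] --> en f x.
      rewrite /= in_itv/= andbT => x0.
      have rl : (x + @recip_succ R n) @[n --> \oo] --> x.
        rewrite -[X in _ --> X]addr0; apply: cvgD; first exact: cvg_cst.
        exact: cvg_harmonic.
      have xr n : 0 < x + @recip_succ R n by apply: addr_gt0 => //; exact: rcp_gt0.
      have cB := is_derive_ctn (B_derive hf hf x0).
      rewrite enE//; apply: cvg_EFin.
        by apply: nearW => n; rewrite (enE hf (xr n)).
      have -> : fine \o (fun n => en f (x + @recip_succ R n)) =
          (fun s => B f f s s) \o (fun n => x + @recip_succ R n).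
        by apply/funext => n /=; rewrite (enE hf (xr n)).
      exact: cvg_comp rl cB.
    have cI := cvg_monotone_convergence (mu := m) (measurable_itv _) mF F0 Fnd.
    have E : (\int[m]_(x in halfline) en f x =
        \int[m]_(x in halfline) limn (fun n => en f (x + @recip_succ R n)%R))%E.
      by apply: eq_integral => x; rewrite inE => hx; apply/esym/cvg_lim => //; exact: Flim.
    apply: (@le_lt_trans _ _ M%:E); last exact: ltry.
    rewrite E -(cvg_lim _ cI)//; apply: lime_le; first by apply/cvg_ex; eexists; exact: cI.
    apply: nearW => n; apply: le_trans (HM _ (rcp_gt0 R n)).
    by rewrite split_shift ?rcp_gt0// leeDr// ib// rcp_gt0.
  move=> m00; have m0p : 0 < fine m0.
    by rewrite fine_gt0// atom_lty andbT lt0e m00/=.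
  exists (M / fine m0); split=> // x x0.
  rewrite EFinM lee_pdivlMr// fineK ?atom_fin//.
  by apply: le_trans (HM _ x0); rewrite split_shift// leeDl// ie.
- move=> [hf If Hb]; split; first exact: hf.1.
  have [b b0 Hb'] : exists2 b : R, 0 <= b & forall e, 0 < e -> (en f e * m0 <= b%:E)%E.
    have [->|/Hb[S [_ HS]]] := eqVneq m0 0%E.
      by exists 0 => // e _; rewrite mule0.
    have S0 : 0 <= S by rewrite -lee_fin; apply: le_trans (HS 1 ltr01); exact: en_ge0.
    exists (S * fine m0); first by rewrite mulr_ge0// fine_ge0.
    by move=> e e0; rewrite EFinM fineK ?atom_fin//; apply: lee_wpmul2r => //; exact: HS.
  apply: (@le_lt_trans _ _ (b%:E + \int[m]_(x in halfline) en f x)%E); last first.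
    by rewrite lte_add_pinfty// ltry.
  apply: ge_ereal_sup => _ [e /= e0 <-].
  rewrite zen_shift_integral ?split_shift//; try exact: hf.1.
  apply: leeD; first exact: Hb'.
  have me := measurable_funS (measurable_itv _) HN (measurable_en_shift hf.1 e0).
  apply: (ge0_le_integral m (measurable_itv _) _ me (measurable_en hf.1)).
    by move=> x _; exact: en_ge0.
  move=> x; rewrite /= in_itv/= andbT => x0; apply: en_nonincreasing => //.
  by rewrite lerDl ltW.
Qed.

Lemma hbdD f g S S' : hardy_bounded f S -> hardy_bounded g S' ->
  hardy_bounded (fun z => f z + g z) (2 * S + 2 * S').
Proof.
move=> [hf HS] [hg HS']; split; first exact: hnD.
move=> x x0; apply: (le_trans (energyD_le leb measurableT (line_cmeas hf.1 x0) (line_cmeas hg.1 x0))).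
rewrite [leRHS](_ : _ = 2%:E * S%:E + 2%:E * S'%:E)%E; last by rewrite -!EFinM.
by apply: leeD; apply: lee_wpmul2l => //; [exact: HS|exact: HS'].
Qed.

Lemma hbdZ f (c : C) S : hardy_bounded f S -> hardy_bounded (fun z => c * f z) (sqmod c * S).
Proof.
move=> [hf HS]; split; first exact: hnZ.
move=> x x0; rewrite /en (_ : line _ x = fun y => c * line f x y)//.
rewrite (energyZ leb measurableT c (line_cmeas hf.1 x0)) EFinM.
by apply: lee_wpmul2l; [rewrite lee_fin sqmod_ge0|exact: HS].
Qed.

Lemma zenD f g : zen m f -> zen m g -> zen m (fun z => f z + g z).
Proof.
move=> /zenP[hf If Bf] /zenP[hg Ig Bg]; apply/zenP; split; first exact: hnD.
- have m1 := measurable_en hf.1; have m2 := measurable_en hg.1.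
  have m3 := measurable_en (analyticD hf.1 hg.1).
  apply: (@le_lt_trans _ _ (\int[m]_(x in halfline) (2%:E * en f x + 2%:E * en g x))%E).
    apply: (ge0_le_integral m (measurable_itv _) _ m3).
    - by move=> x _; exact: en_ge0.
    - by apply: emeasurable_funD; exact: measurable_funeM.
    move=> x; rewrite /= in_itv/= andbT => x0.
    exact: (energyD_le leb measurableT (line_cmeas hf.1 x0) (line_cmeas hg.1 x0)).
  rewrite ge0_integralD//; first last.
  - exact: measurable_funeM.
  - by move=> x _; rewrite mule_ge0// en_ge0.
  - exact: measurable_funeM.
  - by move=> x _; rewrite mule_ge0// en_ge0.
  rewrite !ge0_integralZl_EFin//; try by move=> x _; exact: en_ge0.
  by rewrite lte_add_pinfty// lte_mul_pinfty.
- move=> m00; have [S hS] := Bf m00; have [S' hS'] := Bg m00.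
  by exists (2 * S + 2 * S'); exact: hbdD.
Qed.

Lemma zenZ f (c : C) : zen m f -> zen m (fun z => c * f z).
Proof.
move=> /zenP[hf If Bf]; apply/zenP; split; first exact: hnZ.
- have m1 := measurable_en hf.1.
  have -> : (\int[m]_(x in halfline) en (fun z => (c * f z)%R) x =
      \int[m]_(x in halfline) ((sqmod c)%:E * en f x))%E.
    apply: eq_integral => x; rewrite inE/= in_itv/= andbT => x0.
    exact: (energyZ leb measurableT c (line_cmeas hf.1 x0)).
  rewrite ge0_integralZl_EFin ?sqmod_ge0//; last by move=> x _; exact: en_ge0.
  by rewrite lte_mul_pinfty// lee_fin sqmod_ge0.
- by move=> m00; have [S hS] := Bf m00; exists (sqmod c * S); exact: hbdZ.
Qed.

Lemma ext_cmeas f : analytic_rhp f -> cmeas (@crhp R) (ext f).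
Proof.
move=> fa; have [m1 m2] := analytic_cmeas fa; have [b1 b2] := measurable_boundary fa.
have mR := @measurable_rhp R.
have m0' : measurable (([set 0%R] : set RT) `*` [set: RT]) by exact: measurableX.
have E : @crhp R = @rhp R `|` ([set 0%R] `*` setT).
  apply/seteqP; split=> -[x y]; rewrite /crhp /rhp/=.
    by rewrite le_eqVlt => /predU1P[<-|]; [right|left].
  by case=> [/ltW|[->]].
have e1 (p : plane R) : rhp p -> ext f p = f (cplx p).
  by rewrite /rhp/ext/= => ->.
have e2 (p : plane R) : ([set 0%R] `*` setT) p -> ext f p = bv f p.2.
  by rewrite /ext/= => -[-> _]; rewrite ltxx.
split; rewrite E; apply/measurable_funU => //; split.
- by apply: eq_measurable_fun m1 => p; rewrite inE => /e1 ->.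
- apply: (eq_measurable_fun (fun p : plane R => complex.Re (bv f p.2))).
    by move=> p; rewrite inE => /e2 ->.
  by apply: measurable_funTS; exact: measurableT_comp b1 (@measurable_snd _ _ RT RT).
- by apply: eq_measurable_fun m2 => p; rewrite inE => /e1 ->.
- apply: (eq_measurable_fun (fun p : plane R => complex.Im (bv f p.2))).
    by move=> p; rewrite inE => /e2 ->.
  by apply: measurable_funTS; exact: measurableT_comp b2 (@measurable_snd _ _ RT RT).
Qed.

Lemma strip_split (F : plane R -> \bar R) : measurable_fun (@crhp R) F ->
  (forall p, @crhp R p -> (0 <= F p)%E) ->
  (\int[nu]_(p in @crhp R) F p = (\int[leb]_y F (0%R, y)) * m0 +
    \int[m]_(x in halfline) \int[leb]_y F (x, y))%E.
Proof.
move=> mF F0; rewrite crhpE in mF *.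
have F0' (p : plane R) : nneg p.1 -> (0 <= F p)%E.
  by rewrite /= in_itv/= andbT => p0; exact: F0.
rewrite (@tonelli_strip R m nneg F (measurable_itv _) mF F0').
rewrite (@nneg_split R m (fun x => \int[leb]_y F (x, y))%E)//.
  exact: (@measurable_strip_inner R nneg F (measurable_itv _) mF F0').
by move=> x x0; apply: integral_ge0 => y _; exact: F0.
Qed.

Lemma sqnormE f : analytic_rhp f ->
  (sqnorm m (ext f) = energy leb setT (bv f : RT -> C) * m0 +
    \int[m]_(x in halfline) en f x)%E.
Proof.
move=> fa; rewrite /sqnorm strip_split; first last.
- by move=> p _; rewrite lee_fin sqmod_ge0.
- exact: cmeas_esqmod (ext_cmeas fa).
congr (_ * _ + _)%E.
  by apply: eq_integral => y _; rewrite /ext/= ltxx.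
apply: eq_integral => x; rewrite inE/= in_itv/= andbT => x0.
by apply: eq_integral => y _; rewrite /ext/= x0.
Qed.

Lemma sqnorm_lty f : zen m f -> (sqnorm m (ext f) < +oo)%E.
Proof.
move=> /zenP[hf If Bf]; rewrite sqnormE; last exact: hf.1.
apply: lte_add_pinfty => //; have [->|/Bf[S hS]] := eqVneq m0 0%E.
  by rewrite mule0 ltry.
have [_ h] := boundary_energy hS.
apply: (@le_lt_trans _ _ (S%:E * m0)%E); first exact: lee_wpmul2r.
by rewrite -(fineK atom_fin) -EFinM ltry.
Qed.

Lemma ext_sqint f : zen m f -> sqint nu (@crhp R) (ext f).
Proof. by move=> zf; split; [exact: ext_cmeas zf.1|exact: sqnorm_lty]. Qed.

(** Boundary values are compatible with linear combinations only where the radial limits exist. The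
    exceptional set is null: it lies over the axis, and if the axis has mass then almost every
    radial limit exists. *)
Definition divergence_set f : set (plane R) := [set 0%R] `*` ~` [set y | radially_cauchy f y].

Lemma measurable_bad f : analytic_rhp f -> measurable (divergence_set f).
Proof. by move=> fa; apply: measurableX => //; apply: measurableC; exact: measurable_bcau. Qed.

Lemma bad_null f : zen m f -> nu (divergence_set f) = 0%E.
Proof.
move=> zf; have fa := zf.1; have /zenP[_ _ Bf] := zf.
have mb : measurable (~` [set y : RT | radially_cauchy f y]).
  by apply: measurableC; exact: measurable_bcau.
have -> : (nu (divergence_set f) = m0 * leb (~` [set y : RT | radially_cauchy f y]))%E.
  exact: (product_measure1E m leb (measurable_set1 _) mb).
have [->|/Bf[S hS]] := eqVneq m0 0%E; first by rewrite mul0e.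
by rewrite (ae_bcau hS) mule0.
Qed.

Lemma boundary_valueZ f (c : C) y : radially_cauchy f y -> bv (fun z => c * f z) y = c * bv f y.
Proof.
move=> /bcau_limit Hf; apply: boundary_valueP => e e0.
have c1 : 0 < normc c + 1 by rewrite ltr_wpDl ?normc_ge0.
have [d d0 Hd] := Hf _ (divr_gt0 e0 c1); exists d => // x xd.
rewrite -mulrBr normcM; have := Hd _ xd; rewrite /line ler_pdivlMr//.
by have := normc_ge0 (f (Complex x y) - bv f y); nra.
Qed.

Lemma bad_bcau f (p : plane R) : @crhp R p -> ~ divergence_set f p -> 0 < p.1 \/ p.1 = 0 /\ radially_cauchy f p.2.
Proof.
case: p => x y; rewrite /crhp/divergence_set/= le_eqVlt => /predU1P[<- H|]; last by left.
by right; split=> //; apply: contrapT => H'; apply: H.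
Qed.

Lemma extZ f (c : C) (p : plane R) : @crhp R p -> ~ divergence_set f p ->
  ext (fun z => c * f z) p = c * ext f p.
Proof.
move=> Dp nf; rewrite /ext; case: (bad_bcau Dp nf) => [->//|[p0 bf]].
by rewrite p0 ltxx boundary_valueZ.
Qed.

End Zen.

(** * Completeness and orthogonal projection *)

Section Completeness.
Variable R : realType.
Local Notation leb := (@lebesgue_measure R).
Local Notation RT := (measurableTypeR R).
Local Notation C := (R[i]).
Local Notation halfline := (`]0%R, +oo[%classic : set RT).
Local Notation nneg := (`[0%R, +oo[%classic : set RT).
Implicit Types (f g u v : C -> C) (x y : R).
Variable m : {sigma_finite_measure set RT -> \bar R}.
Hypothesis hm : zen_weight m.
Local Notation nu := (m \x leb)%E.
Local Notation m0 := (m [set 0%R]).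
Local Notation bv := (@boundary_value R).

Lemma boundary_part_le f : zen m f ->
  (energy leb setT (bv f : RT -> C) * m0 <= sqnorm m (ext f))%E /\
  (\int[m]_(x in halfline) en f x <= sqnorm m (ext f))%E.
Proof.
move=> zf; rewrite (sqnormE m zf.1); split.
  by rewrite leeDl//; apply: integral_ge0 => x _; exact: en_ge0.
by rewrite leeDr// mule_ge0// energy_ge0.
Qed.

Lemma en_atom f t : zen m f -> 0 < t ->
  (en f t * m0 <= energy leb setT (bv f : RT -> C) * m0)%E.
Proof.
move=> zf t0; have /(zenP hm)[_ _ Hb] := zf.
have [->|/Hb[S hS]] := eqVneq m0 0%E; first by rewrite !mule0.
by apply: lee_wpmul2r => //; exact: en_le_boundary hS t0.
Qed.

(** Every line left of [t], the axis included, carries at least the energy of the line [t]. This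
    makes point evaluations bounded on the Zen space. *)
Lemma en_sqnorm f t : zen m f -> 0 < t -> (en f t * weight_below m t <= sqnorm m (ext f))%E.
Proof.
move=> zf t0; have hf := zen_hn hm zf.
have mI : measurable (`]0%R, t[%classic : set RT) by exact: measurable_itv.
have wE : (weight_below m t = m0 + m `]0%R, t[%classic)%E.
  rewrite /weight_below -measureU//.
    congr (m _); apply/seteqP; split=> x; rewrite /= !in_itv/=.
      by case/andP; rewrite le_eqVlt => /predU1P[<-|h1 h2]; [left|right; rewrite h1].
    by case=> [->|/andP[/ltW-> ->]]//; rewrite lexx.
  by apply/seteqP; split=> // x [/= ->]; rewrite in_itv/= ltxx.
rewrite wE ge0_muleDr// (sqnormE m zf.1); apply: leeD; first exact: en_atom.
have IH : (`]0%R, t[%classic : set RT) `<=` halfline.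
  by move=> x; rewrite /= !in_itv/= andbT => /andP[].
have me := measurable_en zf.1.
apply: (@le_trans _ _ (\int[m]_(x in `]0%R, t[) en f x)%E); last first.
  by apply: (ge0_subset_integral m mI (measurable_itv _) me) => // x _; exact: en_ge0.
rewrite -integral_cst//.
apply: (ge0_le_integral m mI _ (measurable_cst _) (measurable_funS (measurable_itv _) IH me)).
  by move=> x _; exact: en_ge0.
move=> x; rewrite /= in_itv/= => /andP[x0 xt].
by apply: en_nonincreasing => //; exact: ltW.
Qed.

Lemma wt_pos t : 0 < t -> 0 < fine (weight_below m t) /\ weight_below m t \is a fin_num.
Proof.
move=> t0; case: (hm) => _ _ [/(_ _ t0) /andP[h1 h2] _].
have wf : weight_below m t \is a fin_num by rewrite ge0_fin_numE// ltW.
by split=> //; rewrite fine_gt0// h1.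
Qed.

Lemma en_bound f t d (L : R) : zen m f -> 0 < d -> d <= t ->
  (sqnorm m (ext f) <= L%:E)%E -> (en f t <= (L / fine (weight_below m d))%:E)%E.
Proof.
move=> zf d0 dt HL; have [w0 wf] := wt_pos d0; have hf := zen_hn hm zf.
apply: (le_trans (en_nonincreasing hf d0 dt)).
rewrite EFinM lee_pdivlMr// fineK//; apply: le_trans HL; exact: en_sqnorm.
Qed.

Lemma zen_pointwise f x y d (L : R) : zen m f -> 0 < d -> d <= x ->
  (sqnorm m (ext f) <= L%:E)%E ->
  sqmod (line f x y) <= 34 * (L / fine (weight_below m (d / 2))) / d.
Proof.
move=> zf d0 dx HL; have x0 := lt_le_trans d0 dx; have hf := zen_hn hm zf.
have d20 : 0 < d / 2 by rewrite divr_gt0.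
have [w0 _] := wt_pos d20.
have L0 : 0 <= L by rewrite -lee_fin; apply: le_trans HL; exact: energy_ge0.
apply: (le_trans (hn_pointwise y hf x0 (M := L / fine (weight_below m (d / 2))) _)) => [t xt|].
  by apply: (en_bound zf d20 _ HL); lra.
rewrite ler_wpM2l//; last by rewrite lef_pV2.
by rewrite mulr_ge0// divr_ge0// ltW.
Qed.

(** Analyticity comes from Weierstrass' theorem, the locally uniform bound being [zen_pointwise].
    Fatou's lemma is applied to the interior and to the lines approaching the axis separately, each
    part being at most L; hence 2 L. *)
Lemma zen_limit (F : nat -> C -> C) u (L : R) : (forall n, zen m (F n)) ->
  (forall z : C, 0 < complex.Re z -> forall e : R, 0 < e -> exists N, forall n, (N <= n)%N ->
    normc (F n z - u z) <= e) ->
  (forall n, (sqnorm m (ext (F n)) <= L%:E)%E) ->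
  zen m u /\ (sqnorm m (ext u) <= (2 * L)%:E)%E.
Proof.
move=> zF Fu FL.
have L0 : 0 <= L by rewrite -lee_fin; apply: le_trans (FL 0%N); exact: energy_ge0.
have ua : analytic_rhp u.
  move=> z z0; pose d := complex.Re z / 2; have d0 : 0 < d by rewrite divr_gt0.
  pose K := 34 * (L / fine (weight_below m (d / 2))) / d.
  have [w0 _] := wt_pos (divr_gt0 d0 (ltr0n _ 2)).
  have K0 : 0 <= K by rewrite divr_ge0 ?(ltW d0)// mulr_ge0// divr_ge0// ltW.
  have inD (h : C) : normc h < d -> d <= complex.Re (z + h).
    move=> hd; rewrite cReD; have := normc_Re h; rewrite ler_norml => /andP[h1 _].
    have : complex.Re z = d + d by rewrite /d; field.
    by move=> ->; lra.
  have [c /has_cderiv_derivable[]//] : exists c, has_cderiv u z c.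
  apply: (@weierstrass R F u z d (Num.sqrt K) d0).
  - move=> n; apply: analytic_holo_disc; first exact: (zF n).1.
    by rewrite /d; lra.
  - move=> n h hd; have := zen_pointwise (complex.Im (z + h)) (zF n) d0 (inD _ hd) (FL n).
    rewrite /line -/K sqmodE (_ : Complex _ _ = z + h); last by apply: complex_ext.
    by rewrite -[X in _ <= X -> _]sqr_sqrtr// ler_pXn2r// nnegrE ?normc_ge0 ?sqrtr_ge0.
  - move=> h hd; apply: Fu; exact: lt_le_trans d0 (inD _ hd).
have lim x y : 0 < x -> (fun n => (sqmod (line (F n) x y))%:E) @ \oo --> (sqmod (line u x y))%:E.
  by move=> x0; apply: cvg_sqmod => e e0; exact: Fu.
have enu x : 0 < x -> forall M : \bar R, (forall n, en (F n) x <= M)%E -> (en u x <= M)%E.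
  move=> x0 M HM; apply: (@energy_fatou _ RT R leb setT measurableT (fun n => line (F n) x)).
  - by move=> n; exact: line_cmeas (zF n).1 x0.
  - exact: line_cmeas.
  - by move=> y _; exact: lim.
  - by exists 0%N => n _; exact: HM.
have hu : hardy_away u.
  split=> // d d0; exists (L / fine (weight_below m d)) => x dx.
  by apply: enu => [|n]; [exact: lt_le_trans dx|exact: en_bound (zF n) d0 dx (FL n)].
have rhp_int f : analytic_rhp f ->
    (energy nu (@rhp R) (fun p => f (cplx p)) = \int[m]_(x in halfline) en f x)%E.
  move=> fa; rewrite /energy; have mf := cmeas_esqmod (analytic_cmeas fa).
  rewrite rhpE in mf *.
  have F0 (p : plane R) : halfline p.1 -> (0 <= (sqmod (f (cplx p)))%:E)%E.
    by move=> _; rewrite lee_fin; exact: sqmod_ge0.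
  by rewrite (@tonelli_strip R m halfline _ (measurable_itv _) mf F0).
have Iu : (\int[m]_(x in halfline) en u x <= L%:E)%E.
  rewrite -rhp_int//; apply: (@energy_fatou _ _ R nu (@rhp R) (@measurable_rhp R)
    (fun n p => F n (cplx p))).
  - by move=> n; exact: analytic_cmeas (zF n).1.
  - exact: analytic_cmeas.
  - by move=> [x y]; exact: lim.
  - exists 0%N => n _; rewrite (rhp_int _ (zF n).1).
    exact: le_trans (boundary_part_le (zF n)).2 (FL n).
have hb : m0 != 0%E -> hardy_bounded u (L / fine m0).
  move=> m00; have m0p : 0 < fine m0.
    by rewrite fine_gt0// (atom_lty hm) andbT lt0e m00/=.
  split=> // x x0; apply: enu => // n.
  rewrite EFinM lee_pdivlMr// fineK ?(atom_fin hm)//.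
  apply: le_trans (FL n); apply: le_trans (boundary_part_le (zF n)).1.
  exact: en_atom.
have zu : zen m u.
  apply/(zenP hm); split=> //; first exact: le_lt_trans Iu (ltry _).
  by move=> /hb; exists (L / fine m0).
split=> //; rewrite (sqnormE m ua) mulr_natl mulr2n EFinD; apply: leeD => //.
have [e0|m00] := eqVneq m0 0%E; first by rewrite e0 mule0 lee_fin.
have m0p : 0 < fine m0.
  by rewrite fine_gt0// (atom_lty hm) andbT lt0e m00/=.
have := (boundary_energy (hb m00)).2.
by rewrite EFinM lee_pdivlMr// fineK ?(atom_fin hm).
Qed.

Local Notation E := (@crhp R).
Local Notation mE := (@measurable_crhp R).
Local Notation ipn := (ip nu E).

Let bad2 f g : set (plane R) := divergence_set f `|` divergence_set g.
Let mbad2 f g : zen m f -> zen m g -> measurable (bad2 f g).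
Proof. by move=> zf zg; apply: measurableU; apply: measurable_bad; [exact: zf.1|exact: zg.1]. Qed.
Let nbad2 f g : zen m f -> zen m g -> nu (bad2 f g) = 0%E.
Proof.
move=> zf zg; apply/eqP; rewrite eq_le measure_ge0 andbT.
apply: (le_trans (measureU2 nu (measurable_bad zf.1) (measurable_bad zg.1))).
apply: (@le_trans _ _ (0 + 0)%E); last by rewrite adde0.
apply: leeD; rewrite le_eqVlt; apply/orP; left; apply/eqP; exact: (bad_null hm).
Qed.

Let ext_comb f g (c : C) (p : plane R) : zen m f -> zen m g -> E p -> ~ bad2 f g p ->
  ext (fun z => f z + c * g z) p = ext f p + c * ext g p.
Proof.
move=> zf zg Ep; rewrite /bad2 => /not_orP[nf ng]; rewrite /ext.
case: (bad_bcau Ep nf) => [->//|[p0 bf]]; case: (bad_bcau Ep ng) => [->//|[_ bg]].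
rewrite p0 ltxx; apply: boundary_valueP => e e0.
have [d d0 Hd] := bcau_limit bf (divr_gt0 e0 (ltr0n _ 2)).
have c1 : 0 < normc c + 1 by rewrite ltr_wpDl ?normc_ge0.
have [d' d'0 Hd'] := bcau_limit bg (divr_gt0 (divr_gt0 e0 (ltr0n _ 2)) c1).
exists (Num.min d d'); first by rewrite lt_min d0.
move=> x /andP[x0]; rewrite lt_min => /andP[xd xd'].
have h1 := Hd x ltac:(by rewrite x0); have h2 := Hd' x ltac:(by rewrite x0).
rewrite (_ : _ - _ = (line f x p.2 - bv f p.2) + c * (line g x p.2 - bv g p.2)); last first.
  by rewrite /line; ring.
apply: (le_trans (le_normcD _ _)); rewrite [leRHS](splitr e); apply: lerD => //.
rewrite normcM; move: h2; rewrite ler_pdivlMr//.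
have := normc_ge0 (line g x p.2 - bv g p.2); nra.
Qed.

Lemma zen_comb f g (c : C) : zen m f -> zen m g -> zen m (fun z => f z + c * g z).
Proof. by move=> zf zg; apply: zenD => //; exact: zenZ. Qed.

Lemma ip_comb f g (c : C) (w : plane R -> C) : zen m f -> zen m g -> cmeas E w ->
  ipn (ext (fun z => f z + c * g z)) w = ipn (fun p => ext f p + c * ext g p) w.
Proof.
move=> zf zg mw; have zfg := zen_comb c zf zg.
apply: (ip_ae (mE) (mbad2 zf zg) (nbad2 zf zg)) => //; first exact: ext_cmeas zfg.1.
  by apply: cmeasD; [exact: ext_cmeas zf.1|apply: cmeasZ; exact: ext_cmeas zg.1].
by move=> p Ep np; exact: ext_comb.
Qed.

End Completeness.

Section Projection.
Variable R : realType.
Local Notation leb := (@lebesgue_measure R).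
Local Notation RT := (measurableTypeR R).
Local Notation C := (R[i]).
Implicit Types (f g u v k : C -> C) (x y s : R).
Variable m : {sigma_finite_measure set RT -> \bar R}.
Hypothesis hm : zen_weight m.
Local Notation nu := (m \x leb)%E.
Local Notation E := (@crhp R).
Local Notation mE := (@measurable_crhp R).
Local Notation ipn := (ip nu E).
Local Notation rc := (@recip_succ R).
Variable w : plane R -> C.
Hypothesis hw : sqint nu E w.

Let comb g s k : C -> C := fun z => g z + Complex s 0 * k z.
Let zcomb g s k : zen m g -> zen m k -> zen m (comb g s k).
Proof. exact: zen_comb. Qed.
Let S g : zen m g -> sqint nu E (ext g). Proof. exact: ext_sqint. Qed.
Let dist g : R := ipn (fun p => w p - ext g p) (fun p => w p - ext g p).

Let ipcomb g s k t : zen m g -> zen m k -> sqint nu E t ->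
  ipn (ext (comb g s k)) t = ipn (ext g) t + s * ipn (ext k) t.
Proof.
move=> zg zk ht; rewrite (ip_comb hm (Complex s 0) zg zk ht.1).
have hz := sqintZ mE (Complex s 0) (S zk).
by rewrite (ipDl mE (S zg) hz ht) (ipZl mE s (S zk) ht).
Qed.

Let dist_expand g : zen m g ->
  dist g = ipn w w - 2 * ipn w (ext g) + ipn (ext g) (ext g).
Proof.
move=> zg; have sg := S zg; have sd := sqintB mE hw sg.
rewrite /dist (ipBl mE hw sg sd) (ipBr mE hw sg hw) (ipBr mE hw sg sg).
by rewrite (ipC nu E (ext g) w); ring.
Qed.

Let dist_comb g s k : zen m g -> zen m k ->
  dist (comb g s k) = dist g - 2 * s * (ipn w (ext k) - ipn (ext g) (ext k)) +
    s ^+ 2 * ipn (ext k) (ext k).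
Proof.
move=> zg zk; have zgk := zcomb s zg zk; have sg := S zg.
have sk := S zk; have sc := S zgk.
rewrite !dist_expand// (ipcomb s zg zk sc) (ipC nu E w) (ipcomb s zg zk hw).
rewrite (ipC nu E (ext g) (ext (comb g s k))) (ipC nu E (ext k) (ext (comb g s k))).
rewrite (ipcomb s zg zk sg) (ipcomb s zg zk sk).
rewrite (ipC nu E (ext k) (ext g)) (ipC nu E (ext g) w) (ipC nu E (ext k) w).
move: (ipn w w) (ipn w (ext g)) (ipn w (ext k)) (ipn (ext g) (ext g)) => a1 a2 a3 a4.
by move: (ipn (ext g) (ext k)) (ipn (ext k) (ext k)) => a5 a6; ring.
Qed.

(** Any Zen function k is reached from g along the direction k - g, so [dist_comb] also computes
    distances to k. *)
Let comb1 g k : comb g 1 (comb k (-1) g) = k.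
Proof.
apply/funext => z; rewrite /comb; apply: complex_ext; rewrite !reimE/=; ring.
Qed.

Let dist_ge0 g : 0 <= dist g. Proof. exact: ip_ge0. Qed.

(** A minimizing sequence for the distance to [w] is Cauchy in norm, hence pointwise by bounded
    point evaluations; the pointwise limit is again a Zen function and is close in norm to the
    sequence. Orthogonality is obtained for each member up to an error and then for the limit. *)
Lemma zen_projection : (exists f, zen m f) ->
  exists2 v, zen m v & forall g, zen m g -> ipn w (ext g) = ipn (ext v) (ext g).
Proof.
move=> [f0 zf0].
pose A : set R := [set dist g | g in [set g | zen m g]].
have hA : has_inf A.
  split; first by exists (dist f0); exists f0.
  by exists 0 => _ [g _ <-]; exact: dist_ge0.
pose d := inf A.
have dle g : zen m g -> d <= dist g.
  by move=> zg; apply: ge_inf; [exact: hA.2|exists g].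
have [F HF] : exists F : nat -> C -> C, forall n, zen m (F n) /\ dist (F n) <= d + rc n.
  have H n : exists g, zen m g /\ dist g <= d + rc n.
    have [_ [g zg <-] h] := inf_adherent (rcp_gt0 R n) hA.
    by exists g; split=> //; exact: ltW.
  by have [F HF] := boolp.choice H; exists F.
have zF n : zen m (F n) := (HF n).1.
(* Parallelogram identity: the squared norm of F p - F n is twice the sum of the two distances minus
   four times the distance of the midpoint, which is at least d. *)
have par n p : (n <= p)%N -> (sqnorm m (ext (comb (F p) (-1) (F n))) <= (4 * rc n)%:E)%E.
  move=> np; pose k := comb (F p) (-1) (F n).
  have zk : zen m k by exact: zcomb.
  have h1 := dist_comb 1 (zF n) zk; rewrite comb1 in h1.
  have h2 := dist_comb (1 / 2) (zF n) zk.
  have h3 := dle _ (zcomb (1 / 2) (zF n) zk).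
  have h4 := (HF n).2; have h5 := (HF p).2.
  have h6 : rc p <= rc n by rewrite /recip_succ lef_pV2 ?posrE ?ltr0Sn// ler_nat ltnS.
  have -> : (sqnorm m (ext k) = (ipn (ext k) (ext k))%:E)%E by rewrite -energyE//; exact: S.
  rewrite lee_fin; have : (1 / 2 : R) ^+ 2 = 1 / 4 by field.
  move=> h7; rewrite h7 in h2; rewrite expr1n in h1; clearbody d.
  move: (dist (F n)) (dist (F p)) (dist (comb (F n) (1 / 2) k)) h1 h2 h3 h4 h5.
  move: (ipn w (ext k) - _) (ipn (ext k) (ext k)) (rc n) (rc p) h6 => I1 I2 r r2.
  by move=> h6 x1 x2 x3 h1 h2 h3 h4 h5; lra.
have cauchy (z : C) : 0 < complex.Re z -> forall e : R, 0 < e -> exists N, forall n p,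
    (N <= n)%N -> (N <= p)%N -> normc (F n z - F p z) <= e.
  move=> z0 e e0; have [w0 _] := wt_pos hm (divr_gt0 z0 (ltr0n _ 2)).
  set W := fine _ in w0.
  (* 136 = 34 * 4: the constant of [zen_pointwise] times the 4 of [par]. *)
  pose a := (e / 2) ^+ 2 * complex.Re z * W / 136.
  have a0 : 0 < a by rewrite divr_gt0// !mulr_gt0// exprn_gt0// divr_gt0.
  have [N HN] := rcp_small a0; exists N.
  have H n : (N <= n)%N -> normc (F n z - F N z) <= e / 2.
    move=> Nn; have zk : zen m (comb (F n) (-1) (F N)) by exact: zcomb.
    have := zen_pointwise hm (complex.Im z) zk z0 (lexx _) (par _ _ Nn).
    rewrite /line (_ : Complex _ _ = z); last by case: (z).
    rewrite (_ : comb (F n) (-1) (F N) z = F n z - F N z); last first.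
      by rewrite /comb; apply: complex_ext; rewrite !reimE/=; ring.
    rewrite -/W sqmodE => h.
    have : normc (F n z - F N z) ^+ 2 <= (e / 2) ^+ 2.
      apply: (le_trans h); rewrite ler_pdivrMr// mulrA ler_pdivrMr//.
      have := HN _ (leqnn N); rewrite /a ltr_pdivlMr//; lra.
    by rewrite ler_pXn2r// nnegrE ?normc_ge0// divr_ge0// ltW.
  move=> n p Nn Np.
  rewrite (_ : F n z - F p z = (F n z - F N z) + - (F p z - F N z)); last by ring.
  apply: (le_trans (le_normcD _ _)); rewrite normcN [leRHS](splitr e).
  by apply: lerD; exact: H.
have [v Hv] : exists v : C -> C, forall z, 0 < complex.Re z -> forall e : R, 0 < e ->
    exists N, forall n, (N <= n)%N -> normc (F n z - v z) <= e.
  have H (z : C) : exists l : C, 0 < complex.Re z -> forall e : R, 0 < e ->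
      exists N, forall n, (N <= n)%N -> normc (F n z - l) <= e.
    have [z0|z0] := ltP 0 (complex.Re z); last by exists 0.
    by have [l Hl] := complex_cauchy_limit (cauchy z z0); exists l.
  by have [v Hv] := boolp.choice H; exists v.
have lim n : zen m (comb v (-1) (F n)) /\
    (sqnorm m (ext (comb v (-1) (F n))) <= (2 * (4 * rc n))%:E)%E.
  apply: (zen_limit hm (F := fun p => comb (F (n + p)%N) (-1) (F n))).
  - by move=> p; exact: zcomb.
  - move=> z z0 e e0; have [N HN] := Hv z z0 e e0; exists N => p Np.
    rewrite (_ : comb _ _ _ z - _ = F (n + p)%N z - v z); last by rewrite /comb; ring.
    by apply: HN; exact: leq_trans Np (leq_addl _ _).
  - by move=> p; apply: par; exact: leq_addr.
have zv : zen m v.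
  have := zcomb 1 (zF 0%N) (lim 0%N).1; rewrite comb1; exact.
exists v => // g zg; have sg := S zg.
pose Ng := ipn (ext g) (ext g); have Ng0 : 0 <= Ng by exact: ip_ge0.
pose X := ipn w (ext g) - ipn (ext v) (ext g).
(* 18 = 2 * 1 + 2 * 8: from X = a - b, with [a] the defect of orthogonality at [F n] and [b] the
   effect of replacing [F n] by [v]. *)
have X2 n : X ^+ 2 <= 18 * rc n * Ng.
  pose a := ipn w (ext g) - ipn (ext (F n)) (ext g).
  (* Moving [F n] along [g] cannot bring the distance below d; the discriminant of this quadratic
     condition bounds the first variation. *)
  have ha : a ^+ 2 <= (dist (F n) - d) * Ng.
    apply: quad_discr => //; first by rewrite subr_ge0 dle.
    move=> t; have := dle _ (zcomb (- t) (zF n) zg).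
    rewrite (dist_comb (- t) (zF n) zg) -/Ng -/a sqrrN; lra.
  have ha' : a ^+ 2 <= rc n * Ng.
    apply: (le_trans ha); apply: ler_wpM2r => //; have := (HF n).2; lra.
  pose b := ipn (ext (comb v (-1) (F n))) (ext g).
  have zu := (lim n).1; have su := S zu.
  have hb : b ^+ 2 <= 8 * rc n * Ng.
    apply: (le_trans (ip_CS mE su sg)); apply: ler_wpM2r => //.
    rewrite -lee_fin -energyE//; apply: (le_trans (lim n).2).
    by rewrite lee_fin; apply: eq_ler; ring.
  have Xab : X = a - b by rewrite /X /a /b (ipcomb (-1) zv (zF n) sg); ring.
  rewrite Xab; have : 0 <= (a + b) ^+ 2 by exact: sqr_ge0.
  have e1 : (a - b) ^+ 2 = 2 * a ^+ 2 + 2 * b ^+ 2 - (a + b) ^+ 2 by ring.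
  rewrite e1; clearbody Ng a b; move: (rc n) ha' hb => r ha' hb; lra.
apply/eqP; rewrite -subr_eq0 -/X -sqrf_eq0 eq_le sqr_ge0 andbT.
rewrite leNgt; apply/negP => X0.
have N1 : 0 < 18 * Ng + 1 by rewrite ltr_wpDl// mulr_ge0.
have [n Hn] := rcp_small (divr_gt0 X0 N1).
have := Hn _ (leqnn n); rewrite ltr_pdivlMr// => h1.
have := X2 n; have := rcp_gt0 R n; move: (rc n) h1 => r h1 r0 h2; nra.
Qed.

End Projection.

(** * The Hankel form *)

Section Density.
Import HBNNSimple.
Context d (T : measurableType d) (R : realType).
Variables (mu lam : {measure set T -> \bar R}) (D : set T) (g : T -> \bar R).
Hypotheses (mD : measurable D) (mg : measurable_fun D g)
  (g0 : forall x, D x -> (0 <= g x)%E) (gfin : forall x, D x -> g x \is a fin_num)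
  (muE : forall A, measurable A -> mu A = (\int[lam]_(x in A `&` D) g x)%E).

Let density_nnsfun (h : {nnsfun T >-> R}) :
  (\int[mu]_(x in D) (h x)%:E = \int[lam]_(x in D) ((h x)%:E * g x))%E.
Proof.
have i0 r x : (0 <= (r * \1_(h @^-1` [set r]) x)%:E)%E by rewrite EFinM nnfun_muleindic_ge0.
have mi r : measurable_fun D (fun x => (r * \1_(h @^-1` [set r]) x)%:E).
  exact/measurable_EFinP/measurableT_comp.
under [LHS]eq_integral do rewrite fimfunE -fsumEFin//.
rewrite [LHS]ge0_integral_fsum//.
have -> : (\int[lam]_(x in D) ((h x)%:E * g x) = \int[lam]_(x in D)
    \sum_(r \in range h) ((r * \1_(h @^-1` [set r]) x)%:E * g x))%E.
  apply: eq_integral => x xD.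
  by rewrite fimfunE -fsumEFin// ge0_mule_fsuml.
rewrite [RHS]ge0_integral_fsum//; first last.
- by move=> r x Dx; rewrite mule_ge0// g0.
- by move=> r; exact: emeasurable_funM.
apply: eq_fsbigr => r; rewrite inE => -[t _ rE].
have r0 : 0 <= r by rewrite -rE.
have mA : measurable (h @^-1` [set r]) by exact: measurable_sfunP.
rewrite integralZl_indic_nnsfun//= integral_indic//.
have -> : (\int[lam]_(x in D) ((r * \1_(h @^-1` [set r]) x)%:E * g x) =
    \int[lam]_(x in D) (r%:E * (g \_ (h @^-1` [set r])) x))%E.
  apply: eq_integral => x _; rewrite EFinM -muleA patchE indicE.
  by case: ifPn => _; rewrite ?mul1e ?mul0e.
rewrite ge0_integralZl_EFin//.
- rewrite -integral_mkcondr; congr (_ * _)%E; rewrite muE; last exact: measurableI.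
  by rewrite -setIA setIid setIC.
- by move=> x Dx; rewrite patchE; case: ifPn => // _; exact: g0.
- by apply/measurable_restrict => //; apply: measurable_funS mg.
Qed.

(** [muE] gives the density on sets only; simple functions and monotone convergence extend it to
    integrands. Finiteness of [g] lets the limit pass through the product. *)
Lemma density_integral (h : T -> \bar R) : measurable_fun D h ->
  (forall x, D x -> (0 <= h x)%E) ->
  (\int[mu]_(x in D) h x = \int[lam]_(x in D) (h x * g x))%E.
Proof.
move=> mh h0; pose h_ := nnsfun_approx mD mh.
have ch x : D x -> (h_ n x)%:E @[n --> \oo] --> h x by move=> Dx; exact: cvg_nnsfun_approx.
have nd x : nondecreasing_seq (fun n => (h_ n x)%:E).
  by move=> a b ab; rewrite lee_fin; exact/lefP/nd_nnsfun_approx.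
have mh_ n : measurable_fun D (EFin \o h_ n).
  exact/measurable_EFinP/measurable_funTS.
have hn0 n x : D x -> (0 <= (EFin \o h_ n) x)%E by move=> _; rewrite lee_fin.
have c1 := cvg_monotone_convergence (mu := mu) mD mh_
  hn0 (fun x _ => nd x).
have c2 := @cvg_monotone_convergence _ _ _ lam D mD (fun n x => (h_ n x)%:E * g x)%E
  (fun n => emeasurable_funM (mh_ n) mg).
have {}c2 : (\int[lam]_(x in D) ((h_ n x)%:E * g x))%E @[n --> \oo] -->
    (\int[lam]_(x in D) limn (fun n => (h_ n x)%:E * g x))%E.
  apply: c2; first by move=> n x Dx; rewrite mule_ge0 ?g0// lee_fin.
  move=> x Dx a b ab; apply: lee_wpmul2r; [exact: g0|exact: nd].
have e1 : (\int[mu]_(x in D) limn (EFin \o h_^~ x) = \int[mu]_(x in D) h x)%E.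
  by apply: eq_integral => x; rewrite inE => Dx; apply/cvg_lim => //; exact: ch.
have e2 : (\int[lam]_(x in D) limn (fun n => (h_ n x)%:E * g x) =
    \int[lam]_(x in D) (h x * g x))%E.
  apply: eq_integral => x; rewrite inE => Dx; apply/cvg_lim => //.
  by apply: cvgeZr; [exact: gfin|exact: ch].
rewrite -e1 -e2 -(cvg_lim _ c1)// -(cvg_lim _ c2)//.
by congr (limn _); apply/funext => n; exact: density_nnsfun.
Qed.

End Density.

Section CarlesonEnergy.
Variable R : realType.
Local Notation leb := (@lebesgue_measure R).
Local Notation RT := (measurableTypeR R).
Local Notation C := (R[i]).
Local Notation halfline := (`]0%R, +oo[%classic : set RT).
Local Notation nneg := (`[0%R, +oo[%classic : set RT).
Implicit Types (f g : C -> C) (x y s : R).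
Variable m : {sigma_finite_measure set RT -> \bar R}.
Hypothesis hm : zen_weight m.
Variables (b : C -> C) (mu : {measure set (plane R) -> \bar R}).
Hypotheses (hb : hardy_away b) (hmu : has_hankel_density m b mu) (hcarl : carleson m mu).
Local Notation m0 := (m [set 0%R]).

Lemma hankel_density_integral f : analytic_rhp f ->
  (\int[mu]_(p in @rhp R) (sqmod (f (cplx p)))%:E =
   \int[leb]_(s in halfline) (s%:E * weight_below m s * en (fun z => (f z * cderive b z)%R) s))%E.
Proof.
move=> fa; have ba := analytic_cderive hb.1.
pose g (p : plane R) : \bar R := ((sqmod (cderive b (cplx p)) * p.1)%:E * weight_below m p.1)%E.
have mfst : measurable_fun setT (fun p : plane R => p.1) by exact: measurable_fst.
have mg : measurable_fun (@rhp R) g.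
  apply: emeasurable_funM.
    apply/measurable_EFinP; apply: measurable_funM.
      exact: cmeas_sqmod (analytic_cmeas ba).
    exact: measurable_funTS mfst.
  apply: measurable_funTS; exact: measurableT_comp (measurable_wt m) mfst.
have w0 s : (0 <= weight_below m s)%E by [].
have g0 (p : plane R) : rhp p -> (0 <= g p)%E.
  rewrite /rhp/= => p0; apply: mule_ge0 => //.
  by rewrite lee_fin mulr_ge0 ?sqmod_ge0// ltW.
have gfin (p : plane R) : rhp p -> g p \is a fin_num.
  by rewrite /rhp/= => p0; rewrite fin_numM// (wt_pos hm p0).2.
have mf := cmeas_esqmod (analytic_cmeas fa).
rewrite (@density_integral _ _ R mu (leb \x leb)%E (@rhp R) g (@measurable_rhp R) mg g0 gfin hmu _ mf); last first.
  by move=> p _; rewrite lee_fin sqmod_ge0.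
have mF : measurable_fun (halfline `*` setT) (fun p : plane R => (sqmod (f (cplx p)))%:E * g p)%E.
  by rewrite -rhpE; exact: emeasurable_funM.
have F0 (p : plane R) : halfline p.1 -> (0 <= (sqmod (f (cplx p)))%:E * g p)%E.
  by rewrite /= in_itv/= andbT => p0; rewrite mule_ge0 ?g0// lee_fin sqmod_ge0.
rewrite rhpE (@tonelli_strip R leb halfline _ (measurable_itv _) mF F0).
apply: eq_integral => s; rewrite inE/= in_itv/= andbT => s0.
have mc := cmeas_esqmod (line_cmeas (analyticM fa ba) s0).
rewrite /en /energy -ge0_integralZl//; first last.
- by rewrite mule_ge0// lee_fin ltW.
- by move=> y _; rewrite lee_fin sqmod_ge0.
apply: eq_integral => y _; rewrite /g/=.
rewrite (_ : line (fun z => f z * cderive b z) s y = f (cplx (s, y)) * cderive b (cplx (s, y)))//.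
rewrite sqmodM; move: (sqmod _) (sqmod _) => p q.
rewrite [RHS]muleAC muleA -!EFinM; congr (_%:E * _)%E; ring.
Qed.

(** The two energies that the product rule produces for a factor f: that of f', governed by the
    Littlewood-Paley inequality, and that of f b', governed by the Carleson condition. *)
Definition gradient_density f s : \bar R := (en (cderive f) s + en (fun z => (f z * cderive b z)%R) s)%E.

(** [pot_integral_ge] turns s m[0, s) into potentials of 4 times the energy of f', which
    [littlewood_paley] bounds by the energy of f on each line. At the atom [pot_zero] and the
    boundary energy take its place. *)
Lemma square_function_bound : exists2 K : R, 0 < K & forall f, zen m f ->
  (\int[leb]_(s in halfline) (s%:E * weight_below m s * en (cderive f) s) <= K%:E * sqnorm m (ext f))%E.
Proof.
have [D D0 HD] := pot_integral_ge hm; exists D => // f zf.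
have hf := zen_hn hm zf; have hf' := hn_derive hf; have me := measurable_en hf'.1.
pose u s : \bar R := (4%:E * en (cderive f) s)%E.
have mu' : measurable_fun halfline u by exact: measurable_funeM.
have u0 s : 0 < s -> (0 <= u s)%E by move=> _; rewrite mule_ge0// en_ge0.
have ufin s : 0 < s -> u s \is a fin_num by move=> s0; rewrite /u enE.
have w0 s : (0 <= weight_below m s)%E by [].
apply: (@le_trans _ _ (\int[leb]_(s in halfline) (s%:E * weight_below m s * u s))%E).
  apply: (ge0_le_integral leb (measurable_itv _) _ (measurable_wtM m me) (measurable_wtM m mu')) => s.
    by rewrite /= in_itv/= andbT => s0; rewrite !mule_ge0 ?en_ge0// lee_fin ltW.
  rewrite /= in_itv/= andbT => s0; apply: lee_wpmul2l.
    by rewrite mule_ge0// lee_fin ltW.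
  by rewrite /u -[leLHS]mul1e; apply: lee_wpmul2r; [exact: en_ge0|rewrite lee_fin ler1n].
apply: (le_trans (HD u mu' u0)); apply: lee_wpmul2l; first by rewrite lee_fin ltW.
have [mp _] := pot_integral m mu' u0.
have p0 x : (0 <= pot u x)%E.
  apply: integral_ge0 => s; rewrite /= in_itv/= andbT => s0.
  by rewrite mule_ge0 ?u0// lee_fin max0_ge0.
rewrite (nneg_split m mp) ?(sqnormE m zf.1)//; apply: leeD.
  have /(zenP hm)[_ _ Hb] := zf.
  have [->|/Hb[S hS]] := eqVneq m0 0%E; first by rewrite !mule0.
  apply: lee_wpmul2r => //; apply: pot_zero => // x x0.
  by apply: (le_trans (littlewood_paley hf x0)); exact: en_le_boundary hS x0.
have HN : halfline `<=` nneg by move=> x; rewrite /= !in_itv/= !andbT; exact: ltW.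
apply: (ge0_le_integral m (measurable_itv _) _ (measurable_funS (measurable_itv _) HN mp) (measurable_en hf.1)).
  by move=> x _; exact: p0.
by move=> x; rewrite /= in_itv/= andbT => x0; exact: littlewood_paley.
Qed.

Lemma dens_bound : exists2 K : R, 0 < K & forall f, zen m f ->
  (\int[leb]_(s in halfline) (s%:E * weight_below m s * gradient_density f s) <= K%:E * sqnorm m (ext f))%E.
Proof.
have [K K0 HK] := square_function_bound; have [L L0 HL] := hcarl.
exists (K + L); first exact: addr_gt0.
move=> f zf; have hf := zen_hn hm zf; have hf' := hn_derive hf.
have hfb := hnM hf (hn_derive hb).
have m1 := measurable_wtM m (measurable_en hf'.1).
have m2 := measurable_wtM m (measurable_en hfb.1).
have w0 s : halfline s -> (0 <= s%:E * weight_below m s)%E.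
  by rewrite /= in_itv/= andbT => s0; rewrite mule_ge0// lee_fin ltW.
rewrite (_ : (\int[leb]_(s in halfline) (s%:E * weight_below m s * gradient_density f s) =
  \int[leb]_(s in halfline) (s%:E * weight_below m s * en (cderive f) s +
    s%:E * weight_below m s * en (fun z => (f z * cderive b z)%R) s))%E); last first.
  by apply: eq_integral => s _; rewrite /gradient_density ge0_muleDr ?en_ge0.
rewrite ge0_integralD//; first last.
- by move=> s /w0 h; rewrite mule_ge0 ?en_ge0.
- by move=> s /w0 h; rewrite mule_ge0 ?en_ge0.
rewrite EFinD ge0_muleDl ?lee_fin ?(ltW K0) ?(ltW L0)//; apply: leeD; first exact: HK.
by rewrite -hankel_density_integral ?HL//; exact: hf.1.
Qed.

End CarlesonEnergy.

(** * The pairing of a product with the symbol *)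

Section MainEstimate.
Variable R : realType.
Local Notation leb := (@lebesgue_measure R).
Local Notation RT := (measurableTypeR R).
Local Notation C := (R[i]).
Local Notation halfline := (`]0%R, +oo[%classic : set RT).
Local Notation nneg := (`[0%R, +oo[%classic : set RT).
Local Notation bv := (@boundary_value R).
Implicit Types (f g p q r : C -> C) (x y s t : R).

Lemma ip_amgm (p q : RT -> C) t : sqint leb setT p -> sqint leb setT q -> 0 < t ->
  2 * `|ip leb setT p q| <= t * ip leb setT p p + t^-1 * ip leb setT q q.
Proof.
move=> hp hq t0; have P0 : 0 <= ip leb setT p p by exact: ip_ge0.
have Q0 : 0 <= ip leb setT q q by exact: ip_ge0.
have q1 := ip_quad measurableT t^-1 hp hq; have q2 := ip_quad measurableT (- t^-1) hp hq.
have g1 := ip_ge0 leb setT (fun x => p x + Complex t^-1 0 * q x).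
have g2 := ip_ge0 leb setT (fun x => p x + Complex (- t^-1) 0 * q x).
rewrite q1 in g1; rewrite q2 in g2.
move: (ip leb setT p p) (ip leb setT q q) (ip leb setT p q) P0 Q0 g1 g2 => a c b a0 c0 g1 g2.
have ti : t * t^-1 = 1 by rewrite mulfV// gt_eqF.
have h1 : 0 <= t * (a + 2 * t^-1 * b + t^-1 ^+ 2 * c) by rewrite mulr_ge0// ltW.
have h2 : 0 <= t * (a + 2 * - t^-1 * b + (- t^-1) ^+ 2 * c) by rewrite mulr_ge0// ltW.
have e1 : t * (a + 2 * t^-1 * b + t^-1 ^+ 2 * c) = t * a + 2 * b + t^-1 * c.
  by field; rewrite gt_eqF.
have e2 : t * (a + 2 * - t^-1 * b + (- t^-1) ^+ 2 * c) = t * a - 2 * b + t^-1 * c.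
  by field; rewrite gt_eqF.
rewrite e1 in h1; rewrite e2 in h2.
move: (t * a) (t^-1 * c) h1 h2 => ta tc h1 h2.
by case: (ger0P b) => b0; lra.
Qed.

(** The factor q crosses the pairing as its conjugate, which has the same modulus: p is then
    measured alone and r together with q, as the Carleson condition requires. *)
Lemma B_mul_amgm p q r s t : hardy_away p -> hardy_away q -> hardy_away r -> 0 < s -> 0 < t ->
  2 * `|B (fun z => p z * q z) r s s| <=
  t * B p p s s + t^-1 * B (fun z => q z * r z) (fun z => q z * r z) s s.
Proof.
move=> hp hq hr s0 t0; have sp := hn_sqint hp s0; have sqr := hn_sqint (hnM hq hr) s0.
pose c (y : RT) : C := conjc (line q s y) * line r s y.
have scE y : sqmod (c y) = sqmod (line (fun z => q z * r z) s y).
  by rewrite /c /line !sqmodM /sqmod !reimE sqrrN.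
have sc : sqint leb setT c.
  split; first by apply: cmeasM; [apply: cmeasJ; exact: line_cmeas hq.1 s0|exact: line_cmeas hr.1 s0].
  rewrite (_ : energy leb setT c = en (fun z => q z * r z) s); first exact: sqr.2.
  by apply: eq_integral => y _; rewrite scE.
have e1 : B (fun z => p z * q z) r s s = ip leb setT (line p s : RT -> C) c.
  by apply: eq_Rintegral => y _; rewrite /c /line /cdot !reimE; ring.
have e2 : B (fun z => q z * r z) (fun z => q z * r z) s s = ip leb setT c c.
  by apply: eq_Rintegral => y _; rewrite !cdotzz scE.
by rewrite e1 e2; exact: ip_amgm.
Qed.

Let young_sum (z a a' t t' x1 x2 y1 y2 : R) : z <= a + a' -> 2 * a <= t * x1 + t' * y2 ->
  2 * a' <= t' * y1 + t * x2 -> 2 * z <= t * (x1 + x2) + t' * (y1 + y2).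
Proof. by rewrite !mulrDr; lra. Qed.

Lemma B_product_bound f g p s t : hardy_away f -> hardy_away g -> hardy_away p -> 0 < s -> 0 < t ->
  2 * `|B (cderive (fun z => f z * g z)) p s s| <=
  t * (B (cderive f) (cderive f) s s + B (fun z => f z * p z) (fun z => f z * p z) s s) +
  t^-1 * (B (cderive g) (cderive g) s s + B (fun z => g z * p z) (fun z => g z * p z) s s).
Proof.
move=> hf hg hp s0 t0; have hf' := hn_derive hf; have hg' := hn_derive hg.
have h1 := B_mul_amgm hf' hg hp s0 t0.
have ti0 : 0 < t^-1 by rewrite invr_gt0.
(* The second term of the product rule is used with 1/t, so that all energies of f carry t and all
   those of g carry 1/t. *)
have h2 := B_mul_amgm hg' hf hp s0 ti0; rewrite invrK in h2.
have s1 := hn_sqint (hnM hf' hg) s0; have s2 := hn_sqint (hnM hg' hf) s0.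
have sp := hn_sqint hp s0.
have E : B (cderive (fun z => f z * g z)) p s s =
    B (fun z => cderive f z * g z) p s s + B (fun z => cderive g z * f z) p s s.
  rewrite -(ipDl measurableT s1 s2 sp); apply: eq_Rintegral => y _.
  rewrite {1}/line cderiveM//; [|exact: hf.1|exact: hg.1].
  by rewrite /line [X in _ + X]mulrC.
have h3 := le_trans (eq_ler (congr1 (fun r : R => `|r|) E)) (ler_normD _ _).
exact: young_sum h3 h1 h2.
Qed.

(** |g|^2 = O(1/x) uniformly on lines, so the energy of f g is O(1/X) and that of its derivative
    O(1/X^3); against the bounded energy of b, Cauchy-Schwarz makes both terms O(X^(-1/2)). *)
Lemma product_decay f g b Sb x : hardy_away f -> hardy_away g -> hardy_bounded b Sb -> 0 < x ->
  forall e : R, 0 < e -> exists2 X, x <= X &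
    `|B (fun z => f z * g z) b X X| <= e /\
    `|X * B (cderive (fun z => f z * g z)) b X X| <= e.
Proof.
move=> hf hg [hb HS] x0 e e0; pose F z := f z * g z; have hF : hardy_away F := hnM hf hg.
have [M M0 HM] := hn_bound hf (divr_gt0 x0 (ltr0n _ 2)).
have [N N0 HN] := hn_bound hg (divr_gt0 x0 (ltr0n _ 2)).
have S0 : 0 <= Sb by rewrite -lee_fin; apply: le_trans (HS 1 ltr01); exact: en_ge0.
pose A := 34 * N * M; have A0 : 0 <= A by rewrite !mulr_ge0.
have enF t : x <= t -> (en F t <= (A / t)%:E)%E.
  move=> xt; have t0 := lt_le_trans x0 xt.
  have Hg y : sqmod (line g t y) <= 34 * N / t.
    by apply: (hn_pointwise y hg t0) => s ts; apply: HN; lra.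
  apply: (le_trans (enM hf.1 hg.1 t0 Hg)).
  apply: (@le_trans _ _ ((34 * N / t)%:E * M%:E)%E).
    apply: lee_wpmul2l; last by apply: HM; lra.
    by rewrite lee_fin divr_ge0 ?mulr_ge0// ltW.
  by rewrite -EFinM lee_fin; apply: eq_ler; rewrite /A; field; rewrite gt_eqF.
pose Q := 32 * A * Sb + 1; have Q0 : 0 < Q by rewrite ltr_wpDl// !mulr_ge0.
(* The derivative at [X] is estimated by lines down to X / 2, which must stay right of x; there A /
   t <= 2 A / X, which explains the 32 = 16 * 2 in [Q]. *)
pose X := Num.max (2 * x) (Q / e ^+ 2).
have xX : 2 * x <= X by rewrite le_max lexx.
have QX : Q / e ^+ 2 <= X by rewrite le_max lexx orbT.
have X0 : 0 < X by lra.
have QX' : Q / X <= e ^+ 2.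
  by move: QX; rewrite ler_pdivrMr ?exprn_gt0// mulrC => h; rewrite ler_pdivrMr.
have sb := hn_sqint hb X0; have hF' := hn_derive hF.
have bS : B b b X X <= Sb by rewrite -lee_fin -enE//; exact: HS.
have bb0 : 0 <= B b b X X by exact: ip_ge0.
have F1 : B F F X X <= A / X by rewrite -lee_fin -enE//; apply: enF; lra.
have F2 : B (cderive F) (cderive F) X X <= 32 * A / X / X ^+ 2.
  rewrite -lee_fin -enE//; apply: (le_trans (en_derive hF.1 X0 (M := 2 * A / X) _)).
    move=> t Xt; have t0 : 0 < t by lra.
    apply: (le_trans (enF t ltac:(lra))); rewrite lee_fin.
    rewrite ler_pdivrMr// mulrAC ler_pdivlMr//; have := A0; nra.
  by rewrite lee_fin; apply: eq_ler; field; rewrite gt_eqF.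
have fin (z : R) : z ^+ 2 <= Q / X -> `|z| <= e.
  move=> h; rewrite -(ler_pXn2r (n := 2))// ?nnegrE ?normr_ge0// ?(ltW e0)//.
  by rewrite real_normK ?num_real//; exact: le_trans QX'.
have AS : A * Sb <= Q by have : 0 <= A * Sb by [exact: mulr_ge0]; rewrite /Q -mulrA; lra.
have AS' : 32 * A * Sb <= Q by rewrite /Q; lra.
exists X; first by lra.
split; apply: fin.
  apply: (le_trans (ip_CS measurableT (hn_sqint hF X0) sb)).
  apply: (@le_trans _ _ (A / X * Sb)).
    by apply: ler_pM => //; exact: ip_ge0.
  by rewrite mulrAC ler_wpM2r// invr_ge0 ltW.
rewrite exprMn; apply: (@le_trans _ _ (X ^+ 2 * (32 * A / X / X ^+ 2 * Sb))).
  apply: ler_wpM2l; first exact: sqr_ge0.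
  apply: (le_trans (ip_CS measurableT (hn_sqint hF' X0) sb)).
  by apply: ler_pM => //; exact: ip_ge0.
rewrite (_ : X ^+ 2 * _ = 32 * A * Sb / X); last by field; rewrite gt_eqF.
by rewrite ler_wpM2r// invr_ge0 ltW.
Qed.

(** The absolute value of the second derivative of the pairing of f g with p; its potential
    dominates the pairing once the terms at infinity vanish. *)
Definition mixed_gradient f g p s : \bar R :=
  (4 * `|B (cderive (fun z => f z * g z)) (cderive p) s s|)%:E.

Lemma measurable_gap f g p : hardy_away f -> hardy_away g -> hardy_away p -> measurable_fun halfline (mixed_gradient f g p).
Proof.
move=> hf hg hp; apply/measurable_EFinP; apply: measurable_funM; first exact: measurable_cst.
apply: measurableT_comp => //; apply: measurable_B; last exact: hn_derive.
by apply: hn_derive; exact: hnM.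
Qed.

Let fin_le (z X Y a c : R) (P Q : \bar R) : P = X%:E -> Q = Y%:E ->
  z <= a * X + c * Y -> (z%:E <= a%:E * P + c%:E * Q)%E.
Proof. by move=> -> -> h; rewrite -!EFinM lee_fin. Qed.

Let double_le (z X Y t t' : R) : 2 * z <= t * X + t' * Y ->
  4 * z <= 2 * t * X + 2 * t' * Y.
Proof. by rewrite -!mulrA; lra. Qed.

Lemma gap_le f g p s t : hardy_away f -> hardy_away g -> hardy_away p -> 0 < s -> 0 < t ->
  (mixed_gradient f g p s <= (2 * t)%:E * gradient_density p f s + (2 * t^-1)%:E * gradient_density p g s)%E.
Proof.
move=> hf hg hp s0 t0; have hp' := hn_derive hp.
have h := double_le (B_product_bound hf hg hp' s0 t0).
have d1 := f_equal2 adde (enE (hn_derive hf) s0) (enE (hnM hf hp') s0).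
have d2 := f_equal2 adde (enE (hn_derive hg) s0) (enE (hnM hg hp') s0).
exact: fin_le d1 d2 h.
Qed.

Lemma B_gap f g b Sb x : hardy_away f -> hardy_away g -> hardy_bounded b Sb -> 0 < x ->
  (`|B (fun z => (f z * g z)%R) b x x|%:E <= pot (mixed_gradient f g b) x)%E.
Proof.
move=> hf hg hb x0; apply: B_pot => //; [exact: hnM|exact: hb.1|].
exact: product_decay hb x0.
Qed.

Lemma pot_antitone (u : R -> \bar R) x : measurable_fun halfline u ->
  (forall s, 0 < s -> (0 <= u s)%E) -> 0 < x -> (pot u x <= pot u 0)%E.
Proof.
move=> mu u0 x0.
apply: (ge0_le_integral leb (measurable_itv _) _ (measurable_pot_kernel x mu) (measurable_pot_kernel 0 mu)) => s;
  rewrite /= in_itv/= andbT => s0.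
  by rewrite mule_ge0 ?u0// lee_fin max0_ge0.
apply: lee_wpmul2r; first exact: u0.
by rewrite lee_fin subr0 ge_max max0_ge0/= le_max; apply/orP; right; lra.
Qed.

End MainEstimate.

(** * Slices of the Hankel form and the boundary line *)

Section HankelForm.
Variable R : realType.
Local Notation leb := (@lebesgue_measure R).
Local Notation RT := (measurableTypeR R).
Local Notation C := (R[i]).
Local Notation halfline := (`]0%R, +oo[%classic : set RT).
Local Notation nneg := (`[0%R, +oo[%classic : set RT).
Local Notation bv := (@boundary_value R).
Implicit Types (f g : C -> C) (x y s t : R).
Variable m : {sigma_finite_measure set RT -> \bar R}.
Hypothesis hm : zen_weight m.
Local Notation nu := (m \x leb)%E.
Local Notation E := (@crhp R).
Local Notation mE := (@measurable_crhp R).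
Local Notation ipn := (ip nu E).
Local Notation m0 := (m [set 0%R]).

(** The absolute value is placed outside the inner integrals: Cauchy's theorem speaks of integrals
    over entire lines, so the cancellation along each line has to be kept. *)
Lemma ip_slices (p q : plane R -> C) : sqint nu E p -> sqint nu E q ->
  (`|ipn p q|%:E <= `|\int[leb]_y (cdot (p (0%R, y)) (q (0%R, y)))%:E| * m0 +
    \int[m]_(x in halfline) `|\int[leb]_y (cdot (p (x, y)) (q (x, y)))%:E|)%E.
Proof.
move=> hp hq; pose phi (z : plane R) : \bar R := (cdot (p z) (q z))%:E.
have iphi : nu.-integrable E phi by exact: (sqint_cdot mE hp hq).
pose psi := phi \_ E.
have ipsi : nu.-integrable setT psi by exact: (integrable_mkcond _ mE).1.
have iF := integrable_fubini_F ipsi.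
have mF := measurable_int m iF.
pose F := fubini_F leb psi.
have FE x : 0 <= x -> F x = (\int[leb]_y phi (x, y))%E.
  move=> x0; apply: eq_integral => y _; rewrite /psi patchE mem_set//.
have FN x : x < 0 -> F x = 0%E.
  move=> x0; apply: integral0_eq => y _; rewrite /psi patchE memNset//.
  by rewrite /crhp/=; apply/negP; rewrite -ltNge.
have -> : (`|ipn p q|%:E = `|\int[m]_x F x|)%E.
  rewrite (integral12_prod_meas1 ipsi) -integral_mkcond.
  rewrite -(fineK (integrable_fin_num mE iphi)); congr (_%:E).
apply: (le_trans (le_abse_integral m measurableT mF)).
have -> : (\int[m]_x `|fubini_F leb psi x| = \int[m]_(x in nneg) `|F x|)%E.
  rewrite [RHS]integral_mkcond; apply: eq_integral => x _; rewrite patchE.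
  case: ifPn => //; rewrite notin_setE/= in_itv/= andbT => /negP; rewrite -ltNge.
  by move=> /FN; rewrite /F => ->; rewrite abse0.
have mA : measurable_fun nneg (fun x => `|F x|)%E.
  by apply: measurable_funTS; exact: measurableT_comp.
rewrite (nneg_split m mA) ?FE//; apply: leeD => //.
rewrite le_eqVlt; apply/orP; left; apply/eqP; apply: eq_integral => x.
by rewrite inE/= in_itv/= andbT => x0; rewrite FE// ltW.
Qed.

Lemma boundary_shift g (e : R) y : analytic_rhp g -> 0 < e ->
  bv (fun z => g (z + Complex e 0)%R) y = line g e y.
Proof.
move=> ga e0; apply: boundary_valueP => r r0.
have [d d0 Hd] := sqmod_line_small y ga e0 (exprn_gt0 2 r0).
exists d => // x /andP[x0 xd].
have -> : g (Complex x y + Complex e 0) = line g (x + e) y.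
  by rewrite /line; congr g; apply: complex_ext => /=; ring.
have := Hd (x + e); rewrite addrK gtr0_norm// => /(_ xd).
by rewrite sqmodE ler_pXn2r// nnegrE ?normc_ge0// ltW.
Qed.

Lemma zen_shift g (e : R) : zen m g -> 0 < e ->
  zen m (fun z => g (z + Complex e 0)%R) /\
  (sqnorm m (ext (fun z => g (z + Complex e 0)%R)) <= sqnorm m (ext g))%E.
Proof.
move=> zg e0; have hg := zen_hn hm zg; have hge := hn_shift (ltW e0) hg.
have HN : halfline `<=` nneg by move=> x; rewrite /= !in_itv/= !andbT; exact: ltW.
have I : (\int[m]_(x in halfline) en (fun z => g (z + Complex e 0)%R) x <=
    \int[m]_(x in halfline) en g x)%E.
  apply: (ge0_le_integral m (measurable_itv _) _ (measurable_en hge.1) (measurable_en hg.1)).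
    by move=> x _; exact: en_ge0.
  move=> x; rewrite /= in_itv/= andbT => x0; rewrite en_shift.
  by apply: en_nonincreasing => //; rewrite lerDl ltW.
have /(zenP hm)[_ Ig Hb] := zg.
split.
  apply/(zenP hm); split=> //; first exact: le_lt_trans Ig.
  move=> /Hb[S [_ HS]]; exists S; split=> // x x0; rewrite en_shift.
  by apply: HS; rewrite addr_gt0.
rewrite (sqnormE m hge.1) (sqnormE m zg.1); apply: leeD => //.
rewrite (_ : energy leb setT _ = en g e); first exact: en_atom.
by apply: eq_integral => y _; rewrite (boundary_shift y zg.1 e0).
Qed.

Variables (b : C -> C) (Sb : R) (mu : {measure set (plane R) -> \bar R}).
Hypotheses (hb : hardy_bounded b Sb) (hmu : has_hankel_density m b mu) (hcarl : carleson m mu).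

Let N f := ipn (ext f) (ext f).
Let NE f : zen m f -> sqnorm m (ext f) = (N f)%:E.
Proof. by move=> zf; rewrite /N -energyE//; exact: ext_sqint. Qed.
Let N0 f : 0 <= N f. Proof. exact: ip_ge0. Qed.

Lemma gap_pot_integral : exists2 K : R, 0 < K & forall f g t, zen m f -> zen m g -> 0 < t ->
  (\int[m]_(x in nneg) pot (mixed_gradient f g b) x <= (K * (t * N f + t^-1 * N g))%:E)%E.
Proof.
have [K K0 HK] := dens_bound hm hb.1 hmu hcarl.
exists (2 * K); first exact: mulr_gt0.
move=> f g t zf zg t0; have hf := zen_hn hm zf; have hg := zen_hn hm zg.
have mgap := measurable_gap hf hg hb.1.
have gap0 s : 0 < s -> (0 <= mixed_gradient f g b s)%E by move=> _; rewrite lee_fin mulr_ge0.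
apply: (le_trans (pot_integral_le m mgap gap0)).
have md h : hardy_away h -> measurable_fun halfline (gradient_density b h).
  move=> hh; apply: emeasurable_funD; apply: measurable_en.
    exact: (hn_derive hh).1.
  exact: (hnM hh (hn_derive hb.1)).1.
have t20 : 0 <= 2 * t by rewrite mulr_ge0// ltW.
have ti20 : 0 <= 2 * t^-1 by rewrite mulr_ge0// invr_ge0 ltW.
have d0 h s : (0 <= gradient_density b h s)%E by rewrite adde_ge0// en_ge0.
have w0 s : halfline s -> (0 <= s%:E * weight_below m s)%E.
  by rewrite /= in_itv/= andbT => s0; rewrite mule_ge0// lee_fin ltW.
have m1 := measurable_wtM m (md _ hf); have m2 := measurable_wtM m (md _ hg).
apply: (@le_trans _ _ (\int[leb]_(s in halfline) ((2 * t)%:E * (s%:E * weight_below m s * gradient_density b f s) +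
    (2 * t^-1)%:E * (s%:E * weight_below m s * gradient_density b g s)))%E).
  apply: (ge0_le_integral leb (measurable_itv _) _ (measurable_wtM m mgap)).
  - move=> s hs; rewrite mule_ge0 ?w0// gap0//; move: hs; by rewrite /= in_itv/= andbT.
  - by apply: emeasurable_funD; exact: measurable_funeM.
  move=> s hs; have s0 : 0 < s by move: hs; rewrite /= in_itv/= andbT.
  apply: le_trans (lee_wpmul2l (w0 _ hs) (gap_le hf hg hb.1 s0 t0)) _.
  rewrite ge0_muleDr ?mule_ge0// ?lee_fin//.
  by rewrite [in leLHS]muleCA [X in (_ + X <= _)%E]muleCA.
rewrite ge0_integralD//; first last.
- exact: measurable_funeM.
- by move=> s hs; rewrite mule_ge0 ?lee_fin// mule_ge0 ?w0.
- exact: measurable_funeM.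
- by move=> s hs; rewrite mule_ge0 ?lee_fin// mule_ge0 ?w0.
rewrite !ge0_integralZl_EFin//; try by move=> s hs; rewrite mule_ge0 ?w0.
rewrite [leRHS](_ : _ = (2 * t)%:E * (K * N f)%:E + (2 * t^-1)%:E * (K * N g)%:E)%E; last first.
  by rewrite -!EFinM; congr (_%:E); ring.
have HKf := HK _ zf; have HKg := HK _ zg.
rewrite (NE zf) -EFinM in HKf; rewrite (NE zg) -EFinM in HKg.
by apply: leeD; apply: lee_wpmul2l => //; rewrite lee_fin.
Qed.

Let dist_est (a a' n k e r : R) : 0 <= n -> 0 <= k -> k * (n + 1) <= e ->
  `|a - a'| <= n * k -> `|a'| <= r -> `|a| <= r + e.
Proof.
move=> n0 k0 ke h h'; have := ler_normD (a - a') a'; rewrite subrK.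
have : n * k <= e by nra.
lra.
Qed.

Let dist_est' (a a' k u v d r : R) : 0 <= k -> k * (u + v + 1) = d ->
  `|a' - a| <= k * u + v * k -> `|a'| <= r -> `|a| <= r + d.
Proof.
move=> k0 kd h h'; have := ler_normB a' (a' - a); rewrite opprB addrC subrK.
have : k * u + v * k <= d by rewrite -kd !mulrDr mulr1 [v * k]mulrC lerDl.
lra.
Qed.

(* On the boundary line the product f g need not be square-integrable, so g is
   first moved inside the half-plane, where it is bounded. *)
Lemma slice0_bound f g (r : R) : m0 != 0%E -> zen m f -> zen m g ->
  sqint leb setT (fun y : RT => bv b y * conjc (bv f y)) ->
  (forall e, 0 < e -> (\int[m]_(x in nneg)
     pot (mixed_gradient f (fun z => g (z + Complex e 0)%R) b) x <= r%:E)%E) ->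
  `|ip leb setT (fun y : RT => bv b y * conjc (bv f y)) (bv g)| * fine m0 <= r.
Proof.
move=> m00 zf zg sw Hr.
have hf := zen_hn hm zf; have hg := zen_hn hm zg.
have /(zenP hm)[_ _ /(_ m00)[Sf hSf]] := zf.
have /(zenP hm)[_ _ /(_ m00)[Sg hSg]] := zg.
have m0p : 0 < fine m0.
  by rewrite fine_gt0// (atom_lty hm) andbT lt0e m00/=.
rewrite -ler_pdivlMr//.
have sbb := (boundary_energy hb).1; have sbg := (boundary_energy hSg).1.
pose w0 (y : RT) : C := bv b y * conjc (bv f y).
(* It suffices to test with the lines of g inside the half-plane, since they converge in norm to its
   boundary values and [w0] is square-integrable. *)
suff He e : 0 < e -> `|ip leb setT w0 (line g e : RT -> C)| <= r / fine m0.
  apply/ler_addgt0Pr => e e0.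
  have n1 : 0 < l2norm leb setT w0 + 1 by rewrite ltr_wpDl ?nrm_ge0.
  have [d d0 Hd] := boundary_nrm hSg (divr_gt0 e0 n1).
  have sl := hn_sqint hg d0.
  have sw' : sqint leb setT w0 := sw.
  have h0 := ipBr measurableT sbg sl sw'.
  have h1 := ip_CS_sqrt measurableT sw' (sqintB measurableT sbg sl); rewrite h0 in h1.
  rewrite -/(l2norm leb setT w0) -/(l2norm leb setT (fun x : RT => bv g x - line g d x)) in h1.
  have z1 : l2norm leb setT (fun x : RT => bv g x - line g d x) =
      l2norm leb setT (fun x : RT => line g d x - bv g x).
    by congr Num.sqrt; apply: eq_Rintegral => y _; rewrite !cdotzz -sqmodN opprB.
  rewrite z1 in h1.
  have h2 := Hd d d0 (lexx _); rewrite ler_pdivlMr// in h2.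
  have h3 := He _ d0; have n0 := nrm_ge0 leb setT w0.
  have n2 := nrm_ge0 leb setT (fun x : RT => line g d x - bv g x).
  exact: dist_est n0 n2 h2 h1 h3.
move=> e0; pose g' (z : C) := g (z + Complex e 0).
have hg' : hardy_away g' := hn_shift (ltW e0) hg.
have [Kg Kg0 HKg] := hn_sup hg e0.
have g'E x y : line g' x y = line g (x + e) y.
  by rewrite /line /g'; congr g; apply: complex_ext => /=; ring.
have Kg' x y : 0 < x -> sqmod (line g' x y) <= Kg.
  by move=> x0; rewrite g'E; apply: HKg; rewrite lerDr ltW.
pose F (z : C) := f z * g' z; have hF : hardy_away F := hnM hf hg'.
have hSF : hardy_bounded F (Kg * Sf).
  split=> // x x0; apply: (le_trans (enM hf.1 hg'.1 x0 (fun y => Kg' x y x0))).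
  by rewrite EFinM; apply: lee_wpmul2l; [rewrite lee_fin|exact: hSf.2].
have bvF y : radially_cauchy f y -> bv F y = bv f y * line g e y.
  move=> bf; apply: boundary_valueP => d d0.
  have k1 : 0 < Num.sqrt Kg + 1 by rewrite ltr_wpDl ?sqrtr_ge0.
  have k2 : 0 < normc (bv f y) + 1 by rewrite ltr_wpDl ?normc_ge0.
  have d20 : 0 < d / 2 by rewrite divr_gt0.
  have [d1 d10 H1] := bcau_limit bf (divr_gt0 d20 k1).
  have [d2 d20' H2] := sqmod_line_small y hg.1 e0 (exprn_gt0 2 (divr_gt0 d20 k2)).
  exists (Num.min d1 d2); first by rewrite lt_min d10.
  move=> x /andP[x0]; rewrite lt_min => /andP[xd1 xd2].
  have a1 := H1 x ltac:(by rewrite x0).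
  have a2 : normc (line g' x y - line g e y) <= d / 2 / (normc (bv f y) + 1).
    have := H2 (x + e); rewrite addrK gtr0_norm// => /(_ xd2); rewrite g'E sqmodE.
    rewrite ler_pXn2r// ?nnegrE ?normc_ge0//.
    exact: divr_ge0 (ltW d20) (ltW k2).
  have a3 : normc (line g' x y) <= Num.sqrt Kg.
    have := Kg' x y x0; rewrite sqmodE -[X in _ <= X -> _](sqr_sqrtr Kg0).
    by rewrite ler_pXn2r// nnegrE ?normc_ge0 ?sqrtr_ge0.
  rewrite (_ : F _ - _ = (line f x y - bv f y) * line g' x y +
    bv f y * (line g' x y - line g e y)); last by rewrite /F /line; ring.
  apply: (le_trans (le_normcD _ _)); rewrite !normcM [leRHS](splitr d).
  rewrite ler_pdivlMr// in a1; rewrite ler_pdivlMr// in a2.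
  move: (normc_ge0 (line f x y - bv f y)) (normc_ge0 (line g' x y)) a1 a2 a3.
  move: (normc_ge0 (line g' x y - line g e y)) (normc_ge0 (bv f y)).
  move: (normc (line f x y - bv f y)) (normc (line g' x y)) => u1 u2.
  move: (normc (line g' x y - line g e y)) (normc (bv f y)) => u3 u4.
  by move=> u30 u40 u10 u20 a1 a2 a3; apply: lerD; nra.
have sF := (boundary_energy hSF).1.
have mbad : measurable (~` [set y : RT | radially_cauchy f y]).
  by apply: measurableC; apply: measurable_bcau; exact: hf.1.
have <- : ip leb setT (bv F : RT -> C) (bv b) = ip leb setT w0 (line g e : RT -> C).
  have sfe : cmeas setT (fun y : RT => bv f y * line g e y).
    by apply: cmeasM; [exact: measurable_boundary hf.1|exact: line_cmeas hg.1 e0].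
  rewrite (ip_ae measurableT mbad (ae_bcau hSf) sF.1 sfe sbb.1); last first.
    by move=> y _ /contrapT; exact: bvF.
  by apply: eq_Rintegral => y _; rewrite /w0 /cdot !reimE; ring.
(* The pairing at x is at most the potential at x, hence at most the potential at 0; that value
   times the mass of the atom is one summand of the integral bounded by r. *)
have HB x : 0 < x -> `|B F b x x| <= r / fine m0.
  move=> x0; rewrite ler_pdivlMr// -lee_fin EFinM fineK ?(atom_fin hm)//.
  have mgap := measurable_gap hf hg' hb.1.
  have gap0 s : 0 < s -> (0 <= mixed_gradient f g' b s)%E by move=> _; rewrite lee_fin mulr_ge0.
  apply: le_trans (Hr _ e0).
  have mp := (pot_integral m mgap gap0).1.
  have p0 x' : (0 <= pot (mixed_gradient f g' b) x')%E.
    apply: integral_ge0 => s; rewrite /= in_itv/= andbT => s0.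
    by rewrite mule_ge0 ?gap0// lee_fin max0_ge0.
  rewrite (nneg_split m mp (fun x' _ => p0 x')).
  apply: (@le_trans _ _ (pot (mixed_gradient f g' b) 0%R * m0)%E).
    apply: lee_wpmul2r => //; apply: (le_trans (B_gap hf hg' hb x0)).
    exact: pot_antitone.
  by rewrite leeDl//; apply: integral_ge0 => x' _; exact: p0.
apply/ler_addgt0Pr => d d0.
have S0 : 0 <= Sb by rewrite -lee_fin; apply: le_trans (hb.2 1 ltr01); exact: en_ge0.
pose q := Num.sqrt Sb + l2norm leb setT (bv F : RT -> C) + 1.
have q0 : 0 < q by rewrite ltr_wpDl// addr_ge0 ?sqrtr_ge0 ?nrm_ge0.
have dq := divr_gt0 d0 q0.
have [d1 d10 H1] := boundary_nrm hSF dq; have [d2 d20 H2] := boundary_nrm hb dq.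
pose x := Num.min d1 d2; have x0 : 0 < x by rewrite lt_min d10.
have a1 := H1 x x0 ltac:(by rewrite ge_min lexx).
have a2 := H2 x x0 ltac:(by rewrite ge_min lexx orbT).
have sx := hn_sqint hF x0; have sbx := hn_sqint hb.1 x0.
have a3 : l2norm leb setT (line b x : RT -> C) <= Num.sqrt Sb.
  by rewrite nrm_le ?sqrtr_ge0// sqr_sqrtr//; exact: hb.2.
have h1 := ip_cont measurableT sx sF sbx sbb.
have h2 := HB x x0; rewrite /B in h2.
have n1 := nrm_ge0 leb setT (fun y : RT => line F x y - bv F y).
have n3 := nrm_ge0 leb setT (line b x : RT -> C).
have n4 := nrm_ge0 leb setT (bv F : RT -> C).
have h6 := ler_pM n1 n3 a1 a3; have h7 := ler_wpM2l n4 a2.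
have e1 : d / q * (Num.sqrt Sb + l2norm leb setT (bv F : RT -> C) + 1) = d.
  by rewrite -/q divfK// gt_eqF.
exact: dist_est' (divr_ge0 (ltW d0) (ltW q0)) e1 (le_trans h1 (lerD h6 h7)) h2.
Qed.

End HankelForm.

(** * Boundedness of the Hankel form and of the operator *)

Section HankelBound.
Variable R : realType.
Local Notation leb := (@lebesgue_measure R).
Local Notation RT := (measurableTypeR R).
Local Notation C := (R[i]).
Local Notation halfline := (`]0%R, +oo[%classic : set RT).
Local Notation nneg := (`[0%R, +oo[%classic : set RT).
Local Notation bv := (@boundary_value R).
Implicit Types (f g : C -> C) (x y s t : R).
Variable m : {sigma_finite_measure set RT -> \bar R}.
Hypothesis hm : zen_weight m.
Local Notation nu := (m \x leb)%E.
Local Notation E := (@crhp R).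
Local Notation mE := (@measurable_crhp R).
Local Notation ipn := (ip nu E).
Local Notation m0 := (m [set 0%R]).
Variables (b : C -> C) (Sb : R) (mu : {measure set (plane R) -> \bar R}).
Hypotheses (hb : hardy_bounded b Sb) (hmu : has_hankel_density m b mu) (hcarl : carleson m mu).

Let N f := ipn (ext f) (ext f).

Let lt_first (a c r : \bar R) : (0 < c)%E -> (0 <= r)%E -> (a * c + r < +oo)%E ->
  (a < +oo)%E.
Proof.
move=> c0 r0; case: a => [a _|+|_]; [exact: ltry| |by rewrite ltNye].
by rewrite gt0_mulye// addye ?ltxx// -ltNye; exact: lt_le_trans r0.
Qed.

(** A positive atom makes the axis a set of positive weight, so square-integrability over the closed
    half-plane descends to the boundary line. *)
Let slice_sqint f : zen m f -> m0 != 0%E ->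
  sqint nu E (fun p => ext b p * conjc (ext f p)) ->
  sqint leb setT (fun y : RT => bv b y * conjc (bv f y)).
Proof.
move=> zf m00 [mw Ew].
have mw0 : cmeas setT (fun y : RT => bv b y * conjc (bv f y)).
  apply: cmeasM; first exact: measurable_boundary hb.1.1.
  by apply: cmeasJ; exact: measurable_boundary zf.1.
split=> //.
have F0 (p : plane R) : E p -> (0 <= (sqmod (ext b p * conjc (ext f p)))%:E)%E.
  by move=> _; rewrite lee_fin sqmod_ge0.
have := strip_split m (cmeas_esqmod mw) F0 => h; have := Ew; rewrite /energy h.
rewrite [X in (X * _ + _ < _)%E -> _](_ : _ =
    energy leb setT (fun y : RT => bv b y * conjc (bv f y))); last first.
  by apply: eq_integral => y _; rewrite /ext/= ltxx.
apply: lt_first; first by rewrite lt0e m00/=.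
by apply: integral_ge0 => x xh; apply: integral_ge0 => y _; rewrite lee_fin sqmod_ge0.
Qed.

(** The axis and the interior are each bounded by the full weighted integral of the potential, which
    explains the 2 in 2 K. *)
Lemma hankel_form_bound : exists2 K : R, 0 < K & forall f g t, zen m f -> zen m g ->
  sqint nu E (fun p => ext b p * conjc (ext f p)) -> 0 < t ->
  `|ipn (fun p => ext b p * conjc (ext f p)) (ext g)| <= K * (t * N f + t^-1 * N g).
Proof.
have [K K0 HK] := gap_pot_integral hm hb hmu hcarl.
exists (2 * K); first exact: mulr_gt0.
move=> f g t zf zg sw t0; have hf := zen_hn hm zf; have hg := zen_hn hm zg.
have sg := ext_sqint hm zg.
pose r := K * (t * N f + t^-1 * N g).
rewrite -lee_fin; apply: (le_trans (ip_slices sw sg)).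
rewrite [leRHS](_ : _ = r%:E + r%:E)%E; last by rewrite -EFinD /r; congr (_%:E); ring.
apply: leeD.
  have [->|m00] := eqVneq m0 0%E.
    rewrite mule0 lee_fin; apply: mulr_ge0; first exact: ltW.
    apply: addr_ge0; apply: mulr_ge0; rewrite ?invr_ge0 ?(ltW t0)//; exact: ip_ge0.
  have sw0 := slice_sqint zf m00 sw.
  have /(zenP hm)[_ _ /(_ m00)[Sg hSg]] := zg.
  have sbg := (boundary_energy hSg).1.
  have Hr e : 0 < e -> (\int[m]_(x in nneg)
      pot (mixed_gradient f (fun z => g (z + Complex e 0)%R) b) x <= r%:E)%E.
    move=> e0; have [zge Nge] := zen_shift hm zg e0.
    apply: (le_trans (HK f _ t zf zge t0)); rewrite lee_fin /r.
    apply: ler_wpM2l; first exact: ltW.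
    apply: lerD => //; apply: ler_wpM2l; first by rewrite invr_ge0 ltW.
    have sge := ext_sqint hm zge.
    by rewrite -lee_fin /N -!energyE.
  have := slice0_bound hm hb m00 zf zg sw0 Hr.
  rewrite -lee_fin EFinM fineK ?(atom_fin hm)// => h.
  apply: le_trans h; rewrite le_eqVlt; apply/orP; left; apply/eqP; congr (_ * _)%E.
  rewrite /ip /Rintegral -abse_EFin fineK; last first.
    by apply: integrable_fin_num => //; exact: (sqint_cdot measurableT sw0 sbg).
  by congr abse; apply: eq_integral => y _; rewrite /ext/= ltxx.
have mgap := measurable_gap hf hg hb.1.
have gap0 s : 0 < s -> (0 <= mixed_gradient f g b s)%E by move=> _; rewrite lee_fin mulr_ge0.
have mp := (pot_integral m mgap gap0).1.
have p0 x : (0 <= pot (mixed_gradient f g b) x)%E.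
  apply: integral_ge0 => s; rewrite /= in_itv/= andbT => s0.
  by rewrite mule_ge0 ?gap0// lee_fin max0_ge0.
apply: le_trans (HK f g t zf zg t0).
have HN : halfline `<=` nneg by move=> x; rewrite /= !in_itv/= !andbT; exact: ltW.
apply: (@le_trans _ _ (\int[m]_(x in halfline) pot (mixed_gradient f g b) x)%E); last first.
  by apply: (ge0_subset_integral m (measurable_itv _) (measurable_itv _) mp) => // x _; exact: p0.
pose F (z : C) := f z * g z; have hF : hardy_away F := hnM hf hg.
rewrite (_ : (\int[m]_(x in halfline) `|_|)%E = (\int[m]_(x in halfline) `|B F b x x|%:E)%E); last first.
  apply: eq_integral => x; rewrite inE/= in_itv/= andbT => x0.
  have sF := hn_sqint hF x0; have sb := hn_sqint hb.1 x0.
  rewrite /B /ip /Rintegral -abse_EFin fineK; last first.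
    by apply: integrable_fin_num => //; exact: (sqint_cdot measurableT sF sb).
  congr abse; apply: eq_integral => y _; rewrite /ext/= x0; congr (_%:E).
  by rewrite /line /F /cplx/= /cdot !reimE; ring.
have mB : measurable_fun halfline (fun x => `|B F b x x|%:E).
  by apply/measurable_EFinP; apply: measurableT_comp => //; exact: measurable_B hF hb.1.
apply: (ge0_le_integral m (measurable_itv _) _ mB (measurable_funS (measurable_itv _) HN mp)).
  by move=> x _; rewrite lee_fin.
by move=> x; rewrite /= in_itv/= andbT => x0; exact: B_gap hf hg hb x0.
Qed.

(** Everything is conjugated: projecting conj(b) f onto the conjugates of Zen functions is
    projecting b conj(f) onto the Zen space and conjugating the result. *)
Lemma sqint_conj_symbol f : L2 m (conj_symbol_mul b f) ->
  sqint nu E (fun p => ext b p * conjc (ext f p)).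
Proof.
move=> [m1 m2 El]; have e (p : plane R) :
    ext b p * conjc (ext f p) = conjc (conj_symbol_mul b f p).
  by rewrite /conj_symbol_mul; apply: complex_ext; rewrite !reimE; ring.
split.
  split; first by apply: eq_measurable_fun m1 => p _; rewrite e cReJ.
  apply: (eq_measurable_fun (fun p => - complex.Im (conj_symbol_mul b f p))).
    by move=> p _; rewrite e cImJ.
  by apply: measurableT_comp m2.
rewrite (_ : energy nu E _ = sqnorm m (conj_symbol_mul b f))//.
by apply: eq_integral => p _; rewrite e /sqmod cReJ cImJ sqrrN.
Qed.

Lemma projection_orthogonal f v : zen m f -> zen m v ->
  sqint nu E (fun p => ext b p * conjc (ext f p)) ->
  (forall g, zen m g ->
    ipn (fun p => ext b p * conjc (ext f p)) (ext g) = ipn (ext v) (ext g)) ->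
  is_orth_proj m (@conj_zen R m) (conj_symbol_mul b f) (fun p => conjc (ext v p)).
Proof.
move=> zf zv sw Hv; split; first by exists v.
move=> _ [g zg ->].
pose w (p : plane R) : C := ext b p * conjc (ext f p).
have sv := ext_sqint hm zv; have sg := ext_sqint hm zg.
have orth k : zen m k -> ipn (fun p => w p - ext v p) (ext k) = 0.
  move=> zk; have sk := ext_sqint hm zk.
  by rewrite (ipBl mE sw sv sk) Hv// subrr.
rewrite /inner; congr Complex.
  rewrite -(orth g zg); apply: eq_Rintegral => p _.
  by rewrite /cdot /w /conj_symbol_mul !reimE; ring.
(* The real pairing with -i g is the imaginary part of the inner product, so real orthogonality to
   -i g completes the complex one. *)
pose c : C := Complex 0 (-1); have zcg := zenZ hm c zg.
rewrite -(orth _ zcg) ipC.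
rewrite (ip_ae mE (measurable_bad zg.1) (bad_null hm zg) (ext_cmeas zcg.1)
   (q := fun p => c * ext g p) (cmeasZ c sg.1) (sqintB mE sw sv).1); last first.
  by move=> p Ep np; exact: extZ.
apply: eq_Rintegral => p _.
by rewrite /cdot /w /c /conj_symbol_mul !reimE/=; ring.
Qed.

Lemma little_hankel_bounded_sigma_finite : little_hankel_bounded m b.
Proof.
have [K K0 HK] := hankel_form_bound; exists (2 * K); first exact: mulr_gt0.
move=> f zf lf; have sw := sqint_conj_symbol lf.
have [v zv Hv] := zen_projection hm sw (ex_intro _ f zf).
exists (fun p => conjc (ext v p)); first exact: projection_orthogonal.
have sv := ext_sqint hm zv; have sf := ext_sqint hm zf.
have Nf0 : 0 <= N f by exact: ip_ge0.
have Nv0 : 0 <= N v by exact: ip_ge0.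
have key : N v <= (2 * K) ^+ 2 * N f.
  have K20 : 0 < 2 * K by rewrite mulr_gt0.
  (* The form is tested on the projection itself, where it equals [N v]. With t = 2 K the term in
     [N v] on the right has coefficient 1/2 and is absorbed, leaving N v <= 4 K^2 N f. *)
  have := HK f v _ zf zv sw K20; rewrite (Hv v zv) -/(N v) ger0_norm//.
  rewrite (_ : K * (2 * K * N f + (2 * K)^-1 * N v) = 2 * K ^+ 2 * N f + N v / 2).
    by rewrite exprMn; lra.
  by field; rewrite gt_eqF.
have e1 : sqnorm m (fun p => conjc (ext v p)) = (N v)%:E.
  rewrite -energyE//; apply: eq_integral => p _.
  by rewrite /sqmod cReJ cImJ sqrrN.
have e2 : sqnorm m (ext f) = (N f)%:E by rewrite -energyE.
rewrite /L2norm e1 e2 !poweR_EFin -EFinM lee_fin !powR12_sqrt//.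
rewrite -[X in X * _]ger0_norm; last by rewrite mulr_ge0// ltW.
by rewrite -sqrtr_sqr -sqrtrM ?sqr_ge0// ler_sqrt// mulr_ge0// sqr_ge0.
Qed.

End HankelBound.

Lemma hardy2_hbd (R : realType) (b : R[i] -> R[i]) : hardy2 b -> exists S : R, hardy_bounded b S.
Proof.
move=> [ba]; set S := ereal_sup _ => HS.
have Sx x : 0 < x -> (en b x <= S)%E by move=> x0; apply: ereal_sup_ubound; exists x.
have S0 : (0 <= S)%E by apply: le_trans (Sx 1 ltr01); exact: en_ge0.
have Sf : S = (fine S)%:E by rewrite fineK// ge0_fin_numE.
have H x : 0 < x -> (en b x <= (fine S)%:E)%E by rewrite -Sf; exact: Sx.
exists (fine S); split=> //; split=> // d d0.
by exists (fine S) => x dx; apply: H; exact: lt_le_trans dx.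
Qed.

Theorem theorem2p5 (R : realType)
    (m : {measure set (measurableTypeR R) -> \bar R}) (hm : zen_weight m)
    (b : R[i] -> R[i]) (hb : hardy2 b)
    (mu : {measure set (plane R) -> \bar R}) (hmu : has_hankel_density m b mu)
    (hcarl : carleson m mu) :
  little_hankel_bounded m b.
Proof.
have [m' mm'] := sigma_finite_packed (weight_sigma_finite hm); subst m.
have [S hS] := hardy2_hbd hb.
exact (little_hankel_bounded_sigma_finite hm hS hmu hcarl).
Qed.
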